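(* Let $(\mathbb{S}^2,g_0)$ be the standard round sphere and let $D$ be the Dirac operator associated with its spin structure. Let $u\in H^1(\mathbb{S}^2)$ with $\bar u=0$ and let $\psi\in H^{1/2}(\Sigma\mathbb{S}^2)\setminus\{0\}$. If $\rho>0$, $\mu>0$ and $\rho+\mu\le4\pi$, then $$\frac{\rho}{2}\log\int_{\mathbb{S}^2}e^{2u}\,dv+\mu\log\int_{\mathbb{S}^2}e^{u}|\psi|^2\,dv\le\frac12\int_{\mathbb{S}^2}|\nabla u|^2\,dv+\int_{\mathbb{S}^2}\langle|D|\psi,\psi\rangle\,dv+C_{\rho,\mu},$$ where $$C_{\rho,\mu}=\frac{\rho}{2}\log4\pi+\mu\log2\mu-\mu .$$
   Context: $dv$ is the volume form of $g_0$ (total area $4\pi$) and $\bar u=\frac1{4\pi}\int_{\mathbb{S}^2}u\,dv$. $\Sigma\mathbb{S}^2$ is the spinor bundle of $\mathbb{S}^2$ and $D\psi=\sum_{\alpha}e_\alpha\cdot\nabla_{e_\alpha}\psi$ (with $X\cdot Y+Y\cdot X=-2g_0(X,Y)$); $|D|=(D^2)^{1/2}$ is defined by spectral calculus. $H^{1/2}(\Sigma\mathbb{S}^2)$ is the domain in $L^2$ of $|D|^{1/2}$, and $\int_{\mathbb{S}^2}\langle|D|\psi,\psi\rangle\,dv:=\||D|^{1/2}\psi\|_{L^2}^2$ is the associated closed quadratic form. *)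

(* Defs.v *)
From HB Require Import structures.
From mathcomp Require Import all_boot all_order all_algebra.
From mathcomp Require Import finmap.
From mathcomp Require Import all_classical all_reals all_analysis.
From mathcomp Require Import measurable_realfun.
From mathcomp.analysis.showcase Require Import summability.
From mathcomp.real_closed Require Import complex.
From mathcomp Require Import ring lra.

Set Implicit Arguments.
Unset Strict Implicit.
Unset Printing Implicit Defensive.

Import Order.TTheory GRing.Theory Num.Theory.
Import numFieldNormedType.Exports.

Local Open Scope classical_set_scope.
Local Open Scope ring_scope.
Local Open Scope complex_scope.

(* Borel sigma-algebra of R^n, generated by the coordinates. *)
Section measurable_rV.
Context (R : realType) (n : nat).

Let coord (i : 'I_n) (x : 'rV[R]_n) : R := x 0 i.

Let rV_set0 : g_sigma_preimage coord set0.
Proof. exact: sigma_algebra0. Qed.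

Let rV_setC A : g_sigma_preimage coord A -> g_sigma_preimage coord (~` A).
Proof. exact: sigma_algebraC. Qed.

Let rV_bigcup (F : _^nat) : (forall i, g_sigma_preimage coord (F i)) ->
  g_sigma_preimage coord (\bigcup_i (F i)).
Proof. exact: sigma_algebra_bigcup. Qed.

HB.instance Definition _ := @isMeasurable.Build default_measure_display
  'rV[R]_n (g_sigma_preimage coord) rV_set0 rV_setC rV_bigcup.

Lemma measurable_fun_rV d (T : measurableType d) (f : T -> 'rV[R]_n) :
  (forall i, measurable_fun [set: T] (fun t => f t 0 i)) ->
  measurable_fun [set: T] f.
Proof.
move=> mf; apply: (@measurability _ _ _ _ _ _
  (\big[setU/set0]_(i < n) preimage_set_system setT (coord i) measurable)) => //.
move=> _ [A + <-]; rewrite -bigcup_seq => -[i _ [B mB <-]].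
by rewrite !setTI; have := mf i measurableT _ mB; rewrite setTI.
Qed.

End measurable_rV.

Section defs.
Context {R : realType}.

Local Notation E := 'rV[R]_3.
Local Notation spinor := 'cV[R[i]]_2.
Local Notation Re := complex.Re.
Local Notation Im := complex.Im.

(* Functions and spinors on S^2 are represented by
   maps defined on all of R^3; only their values on S^2 matter. *)

Definition dot (v w : E) : R := \sum_k v 0 k * w 0 k.

Definition sphere : set E := [set x | dot x x = 1].

Definition tangent (x X : E) : Prop := dot x X = 0.

Definition tangent_frame (x e1 e2 : E) : Prop :=
  [/\ tangent x e1, tangent x e2, dot e1 e1 = 1, dot e2 e2 = 1 & dot e1 e2 = 0].

(* Cylindrical coordinates (z, phi): there g_0 is
   dz^2 / (1 - z^2) + (1 - z^2) dphi^2, of determinant 1, so that dv = dz dphi.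
   The image of chart_dom is S^2 minus a half meridian. *)
Definition chart (p : R * R) : E :=
  \row_(k < 3) [:: Num.sqrt (1 - p.1 ^+ 2) * cos p.2;
                   Num.sqrt (1 - p.1 ^+ 2) * sin p.2;
                   p.1]`_k.

Definition chart_dom : set (R * R) := `]-1, 1[ `*` `]0, 2 * pi[.

Lemma measurable_chart_dom : measurable chart_dom.
Proof. by apply: measurableX; exact: measurable_itv. Qed.

Lemma measurable_chart : measurable_fun [set: R * R] chart.
Proof.
have mc (f : R -> R) : continuous f -> measurable_fun [set: R] f.
  exact: continuous_measurable_fun.
have msq : measurable_fun [set: R * R] (fun p : R * R => Num.sqrt (1 - p.1 ^+ 2)).
  apply: (measurableT_comp (mc _ (@sqrt_continuous R))).
  apply: measurable_funB => //; exact: measurable_funX.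
apply: measurable_fun_rV => -[[|[|[|//]]] i3].
- rewrite (_ : (fun _ => _) =
    (fun p => Num.sqrt (1 - p.1 ^+ 2) * cos p.2)); last first.
    by apply/funext => p; rewrite mxE.
  apply: measurable_funM => //.
  exact: (measurableT_comp (mc _ (@continuous_cos R))).
- rewrite (_ : (fun _ => _) =
    (fun p => Num.sqrt (1 - p.1 ^+ 2) * sin p.2)); last first.
    by apply/funext => p; rewrite mxE.
  apply: measurable_funM => //.
  exact: (measurableT_comp (mc _ (@continuous_sin R))).
- rewrite (_ : (fun _ => _) = fst) //.
  by apply/funext => p; rewrite mxE.
Qed.

Definition sphere_measure : set E -> \bar R :=
  pushforward (mrestr (@lebesgue_measure R \x @lebesgue_measure R)%E
                      measurable_chart_dom) chart.

Let sphere_measure0 : sphere_measure set0 = 0%E.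
Proof. by rewrite /sphere_measure /pushforward preimage_set0 measure0. Qed.

Let sphere_measure_ge0 A : (0 <= sphere_measure A)%E.
Proof. by apply: measure_ge0; exact: measurable_chart. Qed.

Let sphere_measure_sigma_additive : semi_sigma_additive sphere_measure.
Proof. by apply: measure_semi_sigma_additive; exact: measurable_chart. Qed.

HB.instance Definition _ := isMeasure.Build _ _ _ sphere_measure
  sphere_measure0 sphere_measure_ge0 sphere_measure_sigma_additive.

Lemma sphere_chart (p : R * R) : chart_dom p -> sphere (chart p).
Proof.
move=> [/= + _]; rewrite in_itv/= => /andP[p1 p2].
have p3 : 0 <= 1 - p.1 ^+ 2 by nra.
rewrite /sphere /dot /= !big_ord_recl big_ord0 !mxE/= addr0.
rewrite -!expr2 !exprMn sqr_sqrtr//.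
by have := cos2Dsin2 p.2; nra.
Qed.

Lemma sphere_area : sphere_measure [set: E] = (4 * pi)%:E.
Proof.
rewrite /sphere_measure /pushforward /mrestr preimage_setT setTI.
transitivity ((@lebesgue_measure R) `](-1)%R, 1%R[ *
    (@lebesgue_measure R) `]0%R, (2 * pi)%R[)%E.
  by apply: product_measure1E; exact: measurable_itv.
rewrite !lebesgue_measure_itv/= !lte_fin -!EFinD.
have pi0 := pi_gt0 R.
rewrite !ifT; [|by rewrite mulr_gt0|lra].
by rewrite -EFinM; congr (_%:E); lra.
Qed.

(* Since S^2 is a closed submanifold of R^3, the smooth
   functions on S^2 are the restrictions of the smooth functions on R^3, and
   their differential along S^2 is the restriction of 'D_X to tangent X. *)

Fixpoint differentiable_n (n : nat) (f : E -> R) : Prop :=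
  if n is n'.+1 then (forall x, differentiable f x) /\
                     (forall v, differentiable_n n' (fun x => 'D_v f x))
  else True.

Definition smooth (f : E -> R) : Prop := forall n, differentiable_n n f.

Definition smooth_spinor (Psi : E -> spinor) : Prop :=
  forall k, smooth (fun x => Re (Psi x k 0)) /\ smooth (fun x => Im (Psi x k 0)).

Definition gradient (f : E -> R) (df : E -> E) : Prop :=
  forall x, sphere x -> tangent x (df x) /\
    (forall X, tangent x X -> dot (df x) X = 'D_X f x).

(* The spinor bundle of S^2 is realized as the restriction to S^2 of the
   trivial spinor bundle R^3 x C^2. A tangent vector X acts by
   i (X_1 sigma_1 + X_2 sigma_2 + X_3 sigma_3), with sigma_k the Pauli
   matrices. *)

Definition pauli (k : 'I_3) : 'M[R[i]]_2 :=
  [:: \matrix_(a, b) (a != b)%:R;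
      \matrix_(a, b) ((a != b)%:R * (-1) ^+ b * 'i);
      \matrix_(a, b) ((a == b)%:R * (-1) ^+ b)]`_k.

Definition clifford (X : E) : 'M[R[i]]_2 :=
  \sum_k ('i * (X 0 k)%:C) *: pauli k.

Definition Dspinor (X : E) (Psi : E -> spinor) (x : E) : spinor :=
  \col_k ('D_X (fun y => Re (Psi y k 0)) x +i* 'D_X (fun y => Im (Psi y k 0)) x).

(* The spin connection at x, by the spinorial Gauss formula with unit normal
   field x and second fundamental form - g_0. Its compatibility with the
   Levi-Civita connection is clifford_connection below; the connection form is
   skew-Hermitian and traceless, so that the metric is parallel and there is no
   twist by a line bundle. *)
Definition nabla (X : E) (Psi : E -> spinor) (x : E) : spinor :=
  Dspinor X Psi x + (2^-1)%:C *: (clifford X *m clifford x *m Psi x).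

Definition dirac_smooth (Psi Phi : E -> spinor) : Prop :=
  forall x e1 e2, sphere x -> tangent_frame x e1 e2 ->
    Phi x = clifford e1 *m nabla e1 Psi x + clifford e2 *m nabla e2 Psi x.

Definition normsq (s : spinor) : R := \sum_k (Re (s k 0) ^+ 2 + Im (s k 0) ^+ 2).

Definition hdot (s t : spinor) : R[i] := \sum_k s k 0 * (t k 0)^*.

Definition L2fun (u : E -> R) : Prop :=
  measurable_fun [set: E] u /\ (\int[sphere_measure]_x (u x ^+ 2)%:E < +oo)%E.

Definition L2field (V : E -> E) : Prop :=
  measurable_fun [set: E] V /\
  (\int[sphere_measure]_x (dot (V x) (V x))%:E < +oo)%E.

Definition L2spinor (psi : E -> spinor) : Prop :=
  (forall k, measurable_fun [set: E] (fun x => Re (psi x k 0)) /\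
             measurable_fun [set: E] (fun x => Im (psi x k 0))) /\
  (\int[sphere_measure]_x (normsq (psi x))%:E < +oo)%E.

Definition inner (psi phi : E -> spinor) : R[i] :=
  (\int[sphere_measure]_x Re (hdot (psi x) (phi x))) +i*
  (\int[sphere_measure]_x Im (hdot (psi x) (phi x))).

(* u lies in the completion of the smooth functions for the H^1 norm, and du
   is its weak gradient. *)
Definition weak_gradient (u : E -> R) (du : E -> E) : Prop :=
  [/\ L2fun u, L2field du &
    exists (f : nat -> E -> R) (df : nat -> E -> E),
    [/\ forall n, [/\ smooth (f n), gradient (f n) (df n) & L2field (df n)],
        (\int[sphere_measure]_x ((f n x - u x) ^+ 2)%:E)%E @[n --> \oo] --> 0%E &
        (\int[sphere_measure]_x (dot (df n x - du x) (df n x - du x))%:E)%E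
          @[n --> \oo] --> 0%E]].

Definition H1 (u : E -> R) : Prop := exists du, weak_gradient u du.

Definition grad (u : E -> R) : E -> E :=
  xget (fun=> 0) [set du | weak_gradient u du].

Definition dirichlet (u : E -> R) : R :=
  \int[sphere_measure]_x dot (grad u x) (grad u x).

Definition mean (u : E -> R) : R :=
  (4 * pi)^-1 * \int[sphere_measure]_x u x.

(* The graph of the self-adjoint Dirac operator: the closure of the Dirac
   operator on smooth spinors (which is essentially self-adjoint). *)
Definition dirac (psi phi : E -> spinor) : Prop :=
  [/\ L2spinor psi, L2spinor phi &
    exists Psi Phi : nat -> E -> spinor,
    [/\ forall n, [/\ smooth_spinor (Psi n), dirac_smooth (Psi n) (Phi n) &
                      L2spinor (Phi n)],
        (\int[sphere_measure]_x (normsq (Psi n x - psi x))%:E)%E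
          @[n --> \oo] --> 0%E &
        (\int[sphere_measure]_x (normsq (Phi n x - phi x))%:E)%E
          @[n --> \oo] --> 0%E]].

Definition eigenspinor (l : R) (phi : E -> spinor) : Prop :=
  dirac phi (fun x => l%:C *: phi x).

Definition spectral_projection (l : R) (psi pi_l : E -> spinor) : Prop :=
  eigenspinor l pi_l /\
  forall phi, eigenspinor l phi -> inner (fun x => psi x - pi_l x) phi = 0.

(* phi = h(D) psi. As S^2 is compact, D has pure point spectrum, so that
   h(D) psi is the L^2-sum over l of h(l) P_l psi, and psi is in the domain
   of h(D) when this family is summable in L^2; P_l psi = 0 unless l is an
   eigenvalue. *)
Definition dirac_calculus (h : R -> R) (psi phi : E -> spinor) : Prop :=
  [/\ L2spinor psi, L2spinor phi &
    exists P : R -> E -> spinor,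
    (forall l, spectral_projection l psi (P l)) /\
    (\int[sphere_measure]_x
       (normsq (\sum_(l <- A) (h l)%:C *: P l x - phi x))%:E)%E
      @[A --> (totally : set_system {fset R})] --> 0%E].

(* |D|^(1/2), where |D| = (D^2)^(1/2) *)
Definition sqrt_abs_dirac : (E -> spinor) -> (E -> spinor) -> Prop :=
  dirac_calculus (fun l => Num.sqrt (Num.sqrt (l ^+ 2))).

Definition H12 (psi : E -> spinor) : Prop := exists phi, sqrt_abs_dirac psi phi.

Definition dirac_energy (psi : E -> spinor) : R :=
  \int[sphere_measure]_x
    normsq (xget (fun=> 0) [set phi | sqrt_abs_dirac psi phi] x).

Let clifford_ij (X : E) (a b : 'I_2) : clifford X a b =
  let x := X 0 0 in let y := X 0 1 in let z := X 0 2 in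
  if a == 0 then if b == 0 then 0 +i* z else y +i* x
  else if b == 0 then (- y) +i* x else 0 +i* (- z).
Proof.
rewrite /clifford !big_ord_recl big_ord0 !mxE /pauli/=.
rewrite (_ : lift ord0 ord0 = 1 :> 'I_3); last exact/val_inj.
rewrite (_ : ord0 = 0 :> 'I_3) //.
rewrite (_ : lift ord0 (lift ord0 ord0) = 2 :> 'I_3); last exact/val_inj.
by case: a => [[|[|//]] a2]; case: b => [[|[|//]] b2];
  apply/eqP; rewrite eq_complex/=; apply/andP; split; apply/eqP; rewrite /=; ring.
Qed.

Lemma clifford_relation (X Y : E) :
  clifford X *m clifford Y + clifford Y *m clifford X =
  ((- 2 * dot X Y)%:C)%:M.
Proof.
apply/matrixP => a b; rewrite !mxE !big_ord_recl !big_ord0 !clifford_ij /dot.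
rewrite !big_ord_recl big_ord0.
rewrite (_ : lift ord0 ord0 = 1 :> 'I_3); last exact/val_inj.
rewrite (_ : ord0 = 0 :> 'I_3) //.
rewrite (_ : lift ord0 (lift ord0 ord0) = 2 :> 'I_3); last exact/val_inj.
case: a => [[|[|//]] a2]; case: b => [[|[|//]] b2];
  apply/eqP; rewrite eq_complex/=; apply/andP; split; apply/eqP; rewrite /=; ring.
Qed.

(* The commutator of the connection form of nabla with Clifford
   multiplication by a tangent vector Y is the normal component of the flat
   derivative of Y, up to sign: hence
   nabla_X (Y . psi) = (nabla_X Y) . psi + Y . nabla_X psi. *)
Lemma clifford_connection (x X Y : E) :
  sphere x -> tangent x X -> tangent x Y ->
  (2^-1)%:C *: (clifford X *m clifford x *m clifford Y) -
  (2^-1)%:C *: (clifford Y *m clifford X *m clifford x) =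
  (dot X Y)%:C *: clifford x.
Proof.
rewrite /sphere/= /tangent => x1 xX xY.
have relY : clifford x *m clifford Y = - (clifford Y *m clifford x).
  apply/eqP; rewrite -addr_eq0 clifford_relation xY mulr0.
  by apply/eqP/matrixP => a b; rewrite !mxE mul0rn.
rewrite -mulmxA relY mulmxN scalerN mulmxA -opprD -scalerDr -mulmxDl.
rewrite clifford_relation mul_scalar_mx scalerA -scaleNr; congr (_ *: _).
by rewrite -rmorphM -rmorphN/=; congr (_%:C); lra.
Qed.

End defs.

(* Main.v *)
(* The two exponential integrals are bounded separately, and the bounds are combined by
   means of [ln x <= x - 1].

   The integral of [e^(2u)] is controlled by Onofri's inequality. In stereographic
   coordinates, a Knothe rearrangement of a large square transports [e^v] times the area
   density to the area density; integrating the divergence of this map against the square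
   root of the transported density leaves the Dirichlet energy of [v].

   The integral of [w |psi|^2] is at most [pi^(-1/2) ||w||_2 <|D| psi, psi>]. Testing
   [psi] against [w psi] reduces this to [<psi, eta>^2 <= <|D| psi, psi> <theta, eta>] with
   [eta = |D| theta] polynomial, which is Cauchy-Schwarz, and to the lower bound
   [pi^(1/2) ||theta||_4^2 <= <theta, |D| theta>]. A polynomial spinor is on the sphere a sum
   of monogenic spinors [A_i] and Clifford multiples [x B_i] of monogenic spinors, so that
   the components [f] of [theta] and of [x theta] extend to harmonic polynomials, and
   [2 <theta, |D| theta>] is the sum of the fluxes [int f (f / 2 + d_r f)]. Such a flux
   dominates [pi^(1/2) ||f||_4^2]: an inversion turns this into the sharp trace inequality
   on a half space, again proved by transport along a Knothe rearrangement. *)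
From HB Require Import structures.
From mathcomp Require Import all_boot all_order all_algebra finmap.
From mathcomp Require Import all_classical all_reals all_analysis.
From mathcomp Require Import measurable_realfun ring lra zify.
From mathcomp.analysis.showcase Require Import summability.
From mathcomp.real_closed Require Import complex.
Require Import Defs.
Set Implicit Arguments.
Unset Strict Implicit.
Unset Printing Implicit Defensive.
Import Order.TTheory GRing.Theory Num.Theory.
Import numFieldNormedType.Exports.
Local Open Scope classical_set_scope.
Local Open Scope ring_scope.

(** * Iterated integrals of continuous functions *)

(** The bounds on both integrals have to be sharp, so boundary terms are computed exactly or shown
    to vanish in a limit. A Knothe map serves as well as an optimal one: it is triangular, so its
    Jacobian and its divergence involve only the diagonal derivatives, each of them a derivative in
    one variable, and it preserves the faces of a box.

    Onofri's inequality on a large square needs a function that is small near the boundary, hence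
    one that vanishes at the pole of the projection. A point of a surface has zero capacity, so a
    logarithmic cutoff arranges this at no cost in the limit.

    The operator [|D|] multiplies a monogenic spinor of degree [i] by [i + 1], while the flux of a
    harmonic polynomial of degree [i] is [i + 1/2] times its squared norm. Clifford multiplication
    by [x] is an isometry on the sphere that raises the degree by one, and [i + 1] is the average of
    [i + 1/2] and [i + 3/2]: hence the pair [theta], [x theta] and the factor 2.

    A general [psi] enters only through its pairings with eigenspinors; it is never approximated.
    The test spinor is, first by polynomials and then by bounded measurable spinors. *)

Section continuity.
Context {R : realType} {T : topologicalType}.
Implicit Types (f g : T -> R).

Lemma continuous_cst (c : R) : continuous (fun _ : T => c).
Proof. by move=> x; exact: cvg_cst. Qed.
Lemma continuous_add f g : continuous f -> continuous g ->
  continuous (fun x => f x + g x).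
Proof. by move=> cf cg x; apply: cvgD; [exact: cf|exact: cg]. Qed.
Lemma continuous_opp f : continuous f -> continuous (fun x => - f x).
Proof. by move=> cf x; apply: cvgN; exact: cf. Qed.
Lemma continuous_mul f g : continuous f -> continuous g ->
  continuous (fun x => f x * g x).
Proof. by move=> cf cg x; apply: cvgM; [exact: cf|exact: cg]. Qed.
Lemma continuous_exp f n : continuous f -> continuous (fun x => f x ^+ n).
Proof.
move=> cf; elim: n => [|n ih]; first exact: continuous_cst.
rewrite (_ : (fun _ => _) = (fun x => f x * f x ^+ n)); first exact: continuous_mul.
by apply/funext => x; rewrite exprS.
Qed.
Lemma continuous_inv f : continuous f -> (forall x, f x != 0) ->
  continuous (fun x => (f x)^-1).
Proof. by move=> cf f0 x; apply: cvgV => //; exact: cf. Qed.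
Lemma continuous_comp1 (h : R -> R) f : continuous h -> continuous f ->
  continuous (fun x => h (f x)).
Proof. by move=> ch cf x; apply: (continuous_comp (cf x)); exact: ch. Qed.
Lemma continuous_maxr f g : continuous f -> continuous g ->
  continuous (fun x => Num.max (f x) (g x)).
Proof. by move=> cf cg x; exact: (continuous_max (cf x) (cg x)). Qed.
Lemma continuous_minr f g : continuous f -> continuous g ->
  continuous (fun x => Num.min (f x) (g x)).
Proof. by move=> cf cg x; exact: (continuous_min (cf x) (cg x)). Qed.
Lemma continuous_pair_mk (U V : topologicalType) (f : T -> U) (g : T -> V) :
  continuous f -> continuous g -> continuous (fun x => (f x, g x)).
Proof. by move=> cf cg x; apply: cvg_pair; [exact: cf|exact: cg]. Qed.
Lemma continuous_comp_top (U V : topologicalType) (h : U -> V) (f : T -> U) :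
  continuous h -> continuous f -> continuous (fun x => h (f x)).
Proof. by move=> ch cf x; apply: (continuous_comp (cf x)); exact: ch. Qed.
End continuity.

Lemma continuous_fst (T U : topologicalType) : continuous (@fst T U).
Proof. by move=> x; exact: cvg_fst. Qed.
Lemma continuous_snd (T U : topologicalType) : continuous (@snd T U).
Proof. by move=> x; exact: cvg_snd. Qed.
Lemma continuous_idfun (T : topologicalType) : continuous (fun x : T => x).
Proof. by move=> x. Qed.

Section itg.
Context {R : realType}.
Notation mu := (@lebesgue_measure R).
Implicit Types (a b c : R) (f g : R -> R).

(** Real-valued, and 0 when [b < a] because the interval is then empty. Integrands below are mostly
    continuous on the whole line, which makes integrability automatic; this is why maps and
    densities are later clamped or truncated instead of being restricted to a box. *)
Definition itg a b f : R := \int[mu]_(x in `[a, b]) f x.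

Lemma continuous_integrable a b f : continuous f ->
  mu.-integrable `[a, b] (EFin \o f).
Proof.
move=> cf; apply: continuous_compact_integrable; first exact: segment_compact.
exact: continuous_subspaceT.
Qed.

Lemma eq_itg a b f g : (forall x, a <= x <= b -> f x = g x) ->
  itg a b f = itg a b g.
Proof. by move=> fg; apply: eq_Rintegral => x; rewrite inE/= in_itv/= => /fg. Qed.

Lemma itgD a b f g : continuous f -> continuous g ->
  itg a b (fun x => f x + g x) = itg a b f + itg a b g.
Proof. by move=> cf cg; apply: RintegralD => //; exact: continuous_integrable. Qed.

Lemma itgB a b f g : continuous f -> continuous g ->
  itg a b (fun x => f x - g x) = itg a b f - itg a b g.
Proof. by move=> cf cg; apply: RintegralB => //; exact: continuous_integrable. Qed.

Lemma itgZ a b (k : R) f : continuous f ->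
  itg a b (fun x => k * f x) = k * itg a b f.
Proof. by move=> cf; apply: RintegralZl => //; exact: continuous_integrable. Qed.

Lemma itg_cst a b (k : R) : a <= b -> itg a b (fun=> k) = k * (b - a).
Proof.
move=> ab; rewrite /itg Rintegral_cst//.
rewrite [X in fine X](@lebesgue_measure_itv R `[a, b])/= lte_fin; case: ltP => [//|ba].
by rewrite (_ : b = a) ?subrr//; apply/eqP; rewrite eq_le ab ba.
Qed.

Lemma itg_le a b f g : continuous f -> continuous g ->
  (forall x, a <= x <= b -> f x <= g x) -> itg a b f <= itg a b g.
Proof.
by move=> cf cg fg; apply: le_Rintegral => //; exact: continuous_integrable.
Qed.

Lemma itg_ge0 a b f : (forall x, a <= x <= b -> 0 <= f x) -> 0 <= itg a b f.
Proof. by move=> f0; apply: Rintegral_ge0 => x/=; rewrite in_itv/= => /f0. Qed.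

Lemma itg_normr a b f : continuous f ->
  `|itg a b f| <= itg a b (fun x => `|f x|).
Proof. by move=> cf; apply: le_normr_Rintegral => //; exact: continuous_integrable. Qed.

Lemma itg_bound a b f (M : R) : a <= b -> continuous f ->
  (forall x, a <= x <= b -> `|f x| <= M) -> `|itg a b f| <= M * (b - a).
Proof.
move=> ab cf fM; rewrite -itg_cst//; apply: (le_trans (itg_normr _ _ cf)).
apply: itg_le => //; last exact: continuous_cst.
by apply: continuous_comp1 => //; exact: norm_continuous.
Qed.

Lemma itg_FTC a b f F : a <= b -> continuous f -> continuous F ->
  (forall x, a < x < b -> is_derive x 1 F (f x)) -> itg a b f = F b - F a.
Proof.
rewrite le_eqVlt => /predU1P[<- _ _ _|ab cf cF dF].
  by rewrite /itg set_itv1 Rintegral_set1 subrr.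
rewrite /itg /Rintegral (@continuous_FTC2 _ f F)//.
- exact: continuous_subspaceT.
- split.
  + by move=> x; rewrite in_itv/= => xab; have [] := dF x xab.
  + by apply: cvg_at_right_filter; exact: cF.
  + by apply: cvg_at_left_filter; exact: cF.
- by move=> x; rewrite in_itv/= derive1E => xab; have [_ ->] := dF x xab.
Qed.

Lemma itg1 a f : itg a a f = 0.
Proof. by rewrite /itg set_itv1 Rintegral_set1. Qed.

Lemma itg_derive a f x : continuous f -> a < x ->
  is_derive x 1 (fun y => itg a y f) (f x).
Proof.
move=> cf ax.
have [] := @continuous_FTC1_closed R f a x (x + 1).
- by rewrite ltrDl.
- exact: continuous_integrable.
- exact: ax.
- exact: cf.
by move=> dF; rewrite derive1E => F'; split.
Qed.

Lemma is_derive_continuous (F f : R -> R) : (forall x : R, is_derive x 1 F (f x)) ->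
  continuous F.
Proof.
move=> dF x; apply: differentiable_continuous.
by apply/derivable1_diffP; have [] := dF x.
Qed.

(* Glue the one-sided primitives [itg c _ f] with c -> -oo. *)
Lemma primitive_ex f : continuous f -> exists P : R -> R, forall x : R, is_derive x 1 P (f x).
Proof.
move=> cf.
have split1 a b c : a < b -> b <= c -> itg a c f = itg a b f + itg b c f.
  move=> ab bc.
  have dF (x : R) : a < x -> is_derive x 1 (fun y => itg a y f) (f x).
    exact: itg_derive.
  pose F x := itg a (Num.max b x) f.
  have -> : itg b c f = F c - F b.
    apply: itg_FTC => //.
    - move=> x; apply: (@continuous_comp _ _ _ (fun x => Num.max b x) (fun y => itg a y f)).
        by apply: continuous_maxr; [exact: continuous_cst|exact: continuous_idfun].
      apply: differentiable_continuous; apply/derivable1_diffP.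
      by case: (dF (Num.max b x)) => //; rewrite lt_max ab.
    - move=> x /andP[bx xc]; have := dF _ (lt_trans ab bx).
      apply: near_eq_is_derive.
      near=> y; rewrite /F (max_idPr _)//.
      by near: y; exact: lt_le_nbhsr.
  by rewrite /F (max_idPl (lexx b)) (max_idPr bc) addrC subrK.
exists (fun x => itg (Num.min x 0 - 1) x f - itg (Num.min x 0 - 1) 0 f) => x.
pose a := Num.min x 0 - 2.
have : is_derive x 1 (fun y => itg a y f - itg a 0 f) (f x).
  rewrite -[f x]subr0; apply: is_deriveB.
  by apply: itg_derive => //; rewrite /a ltrBlDr; case: (leP x 0); lra.
apply: near_eq_is_derive.
near=> y.
have xy : x - 1 < y by near: y; apply: lt_nbhsr; rewrite ltrBlDr ltrDl.
have ay : a < Num.min y 0 - 1.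
  rewrite /a; case: (leP x 0) => x0; case: (leP y 0) => y0; lra.
rewrite (split1 a (Num.min y 0 - 1) y)//; last first.
  by case: (leP y 0); lra.
rewrite (split1 a (Num.min y 0 - 1) 0)//; last first.
  by case: (leP y 0); lra.
ring.
Unshelve. all: by end_near. Qed.

End itg.

(** * Integrals depending on a parameter, and Fubini on rectangles *)

Section itg_param.
Context {R : realType}.
Notation mu := (@lebesgue_measure R).

Lemma itg_primitive (f P : R -> R) (a b : R) : continuous f -> a <= b ->
  (forall x : R, is_derive x 1 P (f x)) -> itg a b f = P b - P a.
Proof.
move=> cf ab dP; apply: itg_FTC => //; exact: is_derive_continuous dP.
Qed.

Lemma itg_split (f : R -> R) (a b c : R) : continuous f -> a <= b -> b <= c ->
  itg a c f = itg a b f + itg b c f.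
Proof.
move=> cf ab bc; have [P dP] := primitive_ex cf.
rewrite !(itg_primitive cf _ dP)//; first by ring.
exact: le_trans bc.
Qed.

Lemma continuous_section (T : topologicalType) (t : T) (f : T * R -> R) :
  continuous f -> continuous (fun x => f (t, x)).
Proof.
move=> cf; apply: (continuous_comp_top cf).
by apply: continuous_pair_mk; [move=> x; exact: cvg_cst|exact: continuous_idfun].
Qed.

(** The parameter ranges over an arbitrary topological space, so sequences do not suffice:
    compactness of [[a, b]] turns joint continuity at each [(t0, x)] into a neighbourhood of [t0]
    that works for all [x] at once. *)
Lemma itg_continuous (T : topologicalType) (f : T * R -> R) (a b : R) :
  continuous f -> continuous (fun t => itg a b (fun x => f (t, x))).
Proof.
move=> cf; case: (leP a b) => [ab|ba]; last first.
  rewrite (_ : (fun _ => _) = fun=> 0); first exact: continuous_cst.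
  by apply/funext => t; rewrite /itg set_itv_ge ?Rintegral_set0// bnd_simp -ltNge.
have cs t : continuous (fun x => f (t, x)) by apply: continuous_section.
move=> t0; apply/cvgrPdist_le => e e0.
(* The 1 keeps the denominator positive when [a = b]. *)
pose e' := e / (b - a + 1).
have d0 : 0 < b - a + 1 by lra.
have e'0 : 0 < e' by exact: divr_gt0.
have /compact_near_coveringP nc := @segment_compact R a b.
have H x : `[a, b]%classic x ->
    \forall x' \near x & t \near nbhs t0, `|f (t0, x') - f (t, x')| <= e'.
  move=> _.
  have /cvgrPdist_le /(_ (e' / 2)) c1 := cf (t0, x).
  have /cvgrPdist_le /(_ (e' / 2)) c2 := cs t0 x.
  have h0 : 0 < e' / 2 by lra.
  have [[A B]/= [nA nB] AB] := c1 h0.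
  exists (B `&` [set y | `|f (t0, x) - f (t0, y)| <= e' / 2], A).
    by split => //=; apply: filterI => //; exact: c2.
  move=> [y t]/= [[By hy] At].
  have := AB (t, y) (conj At By) => /= hty.
  rewrite (_ : _ - _ = (f (t0, x) - f (t, y)) - (f (t0, x) - f (t0, y))); last by ring.
  by rewrite (le_trans (ler_normB _ _))//; lra.
have UK := nc T (nbhs t0) (fun t x => `|f (t0, x) - f (t, x)| <= e') (nbhs_filter t0) H.
apply: filterS UK => t UK.
rewrite -itgB//.
apply: (@le_trans _ _ (e' * (b - a))).
  apply: itg_bound => //; exact: continuous_add (cs _) (continuous_opp (cs _)).
rewrite /e' -mulrA ler_piMr//; first lra.
by rewrite mulrC ler_pdivrMr// mul1r; lra.
Qed.

Definition rnd (n : nat) (x : R) : R := (Num.floor (n.+1%:R * x))%:~R / n.+1%:R.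

Lemma rnd_cvg (x : R) : rnd n x @[n --> \oo] --> x.
Proof.
apply/cvgrPdist_le => e e0; near=> n.
have n0 : 0 < n.+1%:R :> R by [].
have /andP[h1 h2] : (Num.floor (n.+1%:R * x))%:~R <= n.+1%:R * x < (Num.floor (n.+1%:R * x) + 1)%:~R.
  exact: floor_itv.
apply: (@le_trans _ _ (n.+1%:R^-1)); last first.
  near: n; by have := near_infty_natSinv_lt (PosNum e0); apply: filterS => m /ltW.
rewrite /rnd ler_norml; move: h2; rewrite intrD => h2.
rewrite -(ler_pM2l n0) -[in X in _ && X](ler_pM2l n0).
rewrite !mulrBr mulrN mulfV ?gt_eqF// (mulrCA n.+1%:R) mulfV ?gt_eqF// mulr1; lra.
Unshelve. all: by end_near. Qed.

Lemma cvg_pair_nbhs (T : Type) (F : set_system T) (FF : Filter F)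
    (U V : topologicalType) (f : T -> U) (g : T -> V) (u : U) (v : V) :
  f @ F --> u -> g @ F --> v -> (f x, g x) @[x --> F] --> (u, v).
Proof. by move=> fu gv; apply: cvg_pair; [exact: fu|exact: gv]. Qed.

(** With arguments rounded by [rnd], the function is constant on countably many measurable cells; by
    continuity the rounded functions converge pointwise to the original one. *)
Lemma measurable_continuous3 d (T : measurableType d) (f : R * R * R -> R)
    (x y z : T -> R) : continuous f ->
  measurable_fun [set: T] x -> measurable_fun [set: T] y -> measurable_fun [set: T] z ->
  measurable_fun [set: T] (fun t => f (x t, y t, z t)).
Proof.
move=> cf mx my mz.
apply: (@measurable_fun_cvg _ _ _ _ (fun n t => f (rnd n (x t), rnd n (y t), rnd n (z t)))) => //.
  move=> n _ B mB; rewrite setTI.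
  pose A (i : int) (w : T -> R) := w @^-1` [set s | Num.floor (n.+1%:R * s) = i].
  have mA i w : measurable_fun [set: T] w -> measurable (A i w).
    move=> mw; rewrite -[A i w]setTI; apply: mw => //.
    rewrite (_ : [set s | _] = `[(i%:~R / n.+1%:R), ((i + 1)%:~R / n.+1%:R)[%classic)//.
    apply/seteqP; split => s /=; rewrite in_itv/= ler_pdivrMr// ltr_pdivlMr// mulrC.
      by move=> <-; exact: floor_itv.
    by move=> h; apply/eqP; rewrite floor_eq.
  pose g (k : int * int * int) := f (k.1.1%:~R / n.+1%:R, k.1.2%:~R / n.+1%:R, k.2%:~R / n.+1%:R).
  rewrite (_ : _ @^-1` B = \bigcup_(k : int * int * int)
     (if `[< B (g k) >] then A k.1.1 x `&` A k.1.2 y `&` A k.2 z else set0)).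
    apply: countable_bigcupT_measurable; first exact: countableP.
    by move=> k; case: ifP => // _; do 2 (apply: measurableI; last exact: mA); exact: mA.
  apply/seteqP; split => t /=.
    move=> Bt; exists (Num.floor (n.+1%:R * x t), Num.floor (n.+1%:R * y t), Num.floor (n.+1%:R * z t)) => //=.
    by rewrite ifT//; exact/asboolP.
  move=> [[[i j] k] _ /=]; case: ifP => // /asboolP Bg [[h1 h2] h3].
  by move: Bg; rewrite /g /rnd /= -h1 -h2 -h3.
move=> t _.
have h : (rnd n (x t), rnd n (y t), rnd n (z t)) @[n --> \oo] --> (x t, y t, z t).
  have h1 : (rnd n (x t), rnd n (y t)) @[n --> \oo] --> (x t, y t).
    exact: (cvg_pair_nbhs _ (@rnd_cvg (x t)) (@rnd_cvg (y t))).
  exact: (cvg_pair_nbhs _ h1 (@rnd_cvg (z t))).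
exact: cvg_comp h (cf _).
Qed.

Lemma measurable_continuous2 d (T : measurableType d) (f : R * R -> R)
    (x y : T -> R) : continuous f ->
  measurable_fun [set: T] x -> measurable_fun [set: T] y ->
  measurable_fun [set: T] (fun t => f (x t, y t)).
Proof.
move=> cf mx my.
apply: (@measurable_continuous3 _ _ (fun p => f p.1) x y (fun=> 0)) => //.
exact: (continuous_comp_top cf (@continuous_fst _ _)).
Qed.

(** [f] is extended by 0 outside the rectangle, which makes it integrable on the plane. Fubini there
    gives both orders, and the inner integrals are the [itg] ones over the rectangle and 0 off
    it. *)
Lemma itg_fubini_bounded (f : R * R -> R) (a b c d M : R) :
  measurable_fun [set: R * R] f ->
  (forall x y, a <= x <= b -> c <= y <= d -> `|f (x, y)| <= M) ->
  itg a b (fun x => itg c d (fun y => f (x, y))) =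
  itg c d (fun y => itg a b (fun x => f (x, y))).
Proof.
move=> mf fM.
pose D : set (R * R) := `[a, b] `*` `[c, d].
have mD : measurable D by exact: measurableX.
pose g := (EFin \o f) \_ D.
have ig : (mu \x mu)%E.-integrable setT g.
  rewrite /g -integrable_mkcond//; apply: measurable_bounded_integrable => //.
  - rewrite [X in (X < _)%E]product_measure1E//.
    rewrite [X in (X * _)%E](@lebesgue_measure_itv R `[a, b])/=.
    rewrite [X in (_ * X)%E](@lebesgue_measure_itv R `[c, d])/=.
    by do 2 case: ifP => _; rewrite -EFinM ?ltry.
  - exact: measurable_funS mf.
  - exists M; split; first exact: num_real.
    move=> N MN [x y]/= [/=]; rewrite !in_itv/= => h1 h2.
    exact: le_trans (fM _ _ h1 h2) (ltW MN).
have FU := Fubini ig.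
have inner (u v : R) (h k : R -> R) N : measurable_fun [set: R] h -> (forall x, u <= x <= v -> `|h x| <= N) ->
    (\int[mu]_(y in `[u, v]) (h y)%:E)%E = (itg u v h)%:E.
  move=> mh hN; rewrite /itg /Rintegral fineK//.
  apply: integrable_fin_num => //; apply: measurable_bounded_integrable => //.
  - rewrite [X in (X < _)%E](@lebesgue_measure_itv R `[u, v])/=.
    by case: ifP => _; rewrite ?ltry.
  - exact: measurable_funS mh.
  - exists N; split; first exact: num_real.
    move=> N' MN x /=; rewrite in_itv/= => h1.
    exact: le_trans (hN _ h1) (ltW MN).
have mfx x : measurable_fun [set: R] (fun y => f (x, y)).
  exact: measurableT_comp.
have mfy y : measurable_fun [set: R] (fun x => f (x, y)).
  exact: measurableT_comp.
have E1 : (\int[mu]_x \int[mu]_y g (x, y) =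
    \int[mu]_(x in `[a, b]) (itg c d (fun y => f (x, y)))%:E)%E.
  rewrite [RHS]integral_mkcond; apply: eq_integral => x _; rewrite /patch; case: ifPn => xab.
    rewrite -(inner c d _ (cst 0) M)//; last first.
      by move=> y ycd; apply: fM => //; move: xab; rewrite inE/= in_itv.
    rewrite [RHS]integral_mkcond; apply: eq_integral => y _.
    rewrite /g /patch/=; congr (if _ then _ else _).
    apply/idP/idP; rewrite !inE/=; first by case.
    by split=> //=; rewrite inE in xab.
  rewrite integral0_eq// => y _; rewrite /g /patch ifN//.
  by apply: contra xab; rewrite !inE => -[].
have E2 : (\int[mu]_y \int[mu]_x g (x, y) =
    \int[mu]_(y in `[c, d]) (itg a b (fun x => f (x, y)))%:E)%E.
  rewrite [RHS]integral_mkcond; apply: eq_integral => y _; rewrite /patch; case: ifPn => ycd.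
    rewrite -(inner a b _ (cst 0) M)//; last first.
      by move=> x xab; apply: fM => //; move: ycd; rewrite inE/= in_itv.
    rewrite [RHS]integral_mkcond; apply: eq_integral => x _.
    rewrite /g /patch/=; congr (if _ then _ else _).
    apply/idP/idP; rewrite !inE/=; first by case.
    by split=> //=; rewrite inE in ycd.
  rewrite integral0_eq// => x _; rewrite /g /patch ifN//.
  by apply: contra ycd; rewrite !inE => -[].
by rewrite [LHS]/itg [RHS]/itg /Rintegral -E1 -E2 FU.
Qed.

Lemma continuous_bounded_box (f : R * R -> R) (a b c d : R) : continuous f ->
  exists M, forall x y, a <= x <= b -> c <= y <= d -> `|f (x, y)| <= M.
Proof.
move=> cf; have cB : compact (`[a, b] `*` `[c, d] : set (R * R)).
  by apply: compact_setX; exact: segment_compact.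
have /compact_bounded [M [Mr HM]] : compact (f @` (`[a, b] `*` `[c, d])).
  by apply: continuous_compact => //; exact: continuous_subspaceT.
exists (M + 1) => x y xab ycd; apply: (HM (M + 1)); first by rewrite ltrDl.
by exists (x, y) => //=; rewrite !in_itv.
Qed.

Lemma itg_fubini (f : R * R -> R) (a b c d : R) : continuous f ->
  itg a b (fun x => itg c d (fun y => f (x, y))) =
  itg c d (fun y => itg a b (fun x => f (x, y))).
Proof.
move=> cf; have [M fM] := continuous_bounded_box a b c d cf.
apply: (@itg_fubini_bounded _ _ _ _ _ M) => //.
rewrite (_ : f = fun p => f (p.1, p.2)); last by apply/funext => -[].
exact: measurable_continuous2.
Qed.

End itg_param.

(** * The Knothe rearrangement *)

Section substitution.
Context {R : realType}.

(** Both sides are increments of [P \o T] for a primitive [P] of [h]. Differentiability of [T] is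
    asked only in the open interval, which is what the transport maps offer. *)
Lemma itg_substitution (h T T' : R -> R) (a b : R) : a <= b -> T a <= T b ->
  continuous h -> continuous T -> continuous (fun x => h (T x) * T' x) ->
  (forall x : R, a < x < b -> is_derive x 1 T (T' x)) ->
  itg a b (fun x => h (T x) * T' x) = itg (T a) (T b) h.
Proof.
move=> ab Tab ch cT chT dT; have [P dP] := primitive_ex ch.
rewrite (itg_primitive ch Tab dP).
apply: (@itg_FTC _ _ _ _ (P \o T)) => //.
- by move=> x; apply: (continuous_comp (cT x)); exact: (is_derive_continuous dP).
- move=> x xab; have := dT x xab => dTx.
  have := dP (T x) => dPx.
  exact: is_derive1_comp.
Qed.

Lemma itg_gt0 (f : R -> R) (a b : R) : a < b -> continuous f ->
  (forall x, 0 < f x) -> 0 < itg a b f.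
Proof.
move=> ab cf f0.
have [c cab fc] := @EVT_min R f a b (ltW ab) (continuous_subspaceT cf).
apply: (@lt_le_trans _ _ (itg a b (fun=> f c))).
  by rewrite itg_cst ?ltW// mulr_gt0// subr_gt0.
by apply: itg_le => //; exact: continuous_cst.
Qed.

(** Moves the variable endpoint into the integrand, so that joint continuity in parameter and
    endpoint follows from continuity of an integral over the fixed interval [[0, 1]]. *)
Lemma itg_scaled (f : R -> R) (a x : R) : continuous f -> a <= x ->
  itg a x f = itg 0 1 (fun s => f (a + (x - a) * s) * (x - a)).
Proof.
move=> cf ax; have cT : continuous (fun s : R => a + (x - a) * s).
  apply: continuous_add; first exact: continuous_cst.
  by apply: continuous_mul; [exact: continuous_cst|exact: continuous_idfun].
have -> : itg 0 1 (fun s => f (a + (x - a) * s) * (x - a)) =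
    itg (a + (x - a) * 0) (a + (x - a) * 1) f.
  apply: (@itg_substitution f (fun s => a + (x - a) * s) (fun=> x - a)) => //.
  - by rewrite mulr0 mulr1; lra.
  - apply: continuous_mul; last exact: continuous_cst.
    exact: continuous_comp1.
  - by move=> s _; apply: is_derive_eq; rewrite /GRing.scale/=; ring.
by rewrite mulr0 addr0 mulr1 addrC subrK.
Qed.
End substitution.

(** * Monotone transport on an interval, with a parameter *)

Section transport.
Context {R : realType} {P : topologicalType}.
Variables (a b : P * R -> R) (lo hi : R).
Hypotheses (lohi : lo < hi) (ca : continuous a) (cb : continuous b).
Hypotheses (a0 : forall p, 0 < a p) (b0 : forall p, 0 < b p).
Hypothesis mass : forall p,
  itg lo hi (fun x => a (p, x)) = itg lo hi (fun x => b (p, x)).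

(** Clamping extends the cumulative functions, and with them the transport map, continuously and by
    constants beyond [[lo, hi]]. *)
Let clamp (x : R) := Num.max lo (Num.min x hi).
Let cumul (f : P * R -> R) p x := itg lo x (fun s => f (p, s)).
Let inv p v := xget lo [set y | lo <= y <= hi /\ cumul b p y = v].

Let csec (f : P * R -> R) p : continuous f -> continuous (fun x => f (p, x)).
Proof. by move=> cf; exact: continuous_section. Qed.

Let clamp_itv x : lo <= clamp x <= hi.
Proof. by rewrite /clamp le_max lexx/= ge_max ltW//= ge_min lexx orbT. Qed.

Let clamp_id x : lo <= x <= hi -> clamp x = x.
Proof. by move=> /andP[lx xh]; rewrite /clamp (min_idPl xh) (max_idPr lx). Qed.

Let clamp_continuous : continuous clamp.
Proof.
apply: continuous_maxr; first exact: continuous_cst.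
by apply: continuous_minr; [exact: continuous_idfun|exact: continuous_cst].
Qed.

Let cumul_lt (f : P * R -> R) p x y : continuous f -> (forall p, 0 < f p) -> lo <= x -> x < y ->
  cumul f p x < cumul f p y.
Proof.
move=> cf f0 lx xy; rewrite /cumul.
have -> : itg lo y (fun s => f (p, s)) = itg lo x (fun s => f (p, s)) + itg x y (fun s => f (p, s)).
  by apply: itg_split => //; [exact: csec|exact: ltW].
by rewrite ltrDl itg_gt0//; exact: csec.
Qed.

Let cumul_clamp_continuous (f : P * R -> R) : continuous f ->
  continuous (fun q : P * R => cumul f q.1 (clamp q.2)).
Proof.
move=> cf.
rewrite (_ : (fun _ => _) = fun q : P * R => itg 0 1
   (fun s => f (q.1, lo + (clamp q.2 - lo) * s) * (clamp q.2 - lo))); last first.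
  apply/funext => q; rewrite /cumul itg_scaled//; first exact: csec.
  by case/andP: (clamp_itv q.2).
have c1 : continuous (fun r : (P * R) * R => clamp r.1.2).
  apply: (continuous_comp_top clamp_continuous).
  exact: (continuous_comp_top (@continuous_snd _ _) (@continuous_fst _ _)).
have c2 : continuous (fun r : (P * R) * R => clamp r.1.2 - lo).
  by apply: continuous_add => //; exact: continuous_cst.
apply: (@itg_continuous _ _ (fun r : (P * R) * R =>
   f (r.1.1, lo + (clamp r.1.2 - lo) * r.2) * (clamp r.1.2 - lo))).
apply: continuous_mul => //; apply: (continuous_comp_top cf).
apply: continuous_pair_mk.
  exact: (continuous_comp_top (@continuous_fst _ _) (@continuous_fst _ _)).
apply: continuous_add; first exact: continuous_cst.
by apply: continuous_mul => //; exact: continuous_snd.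
Qed.

Let cumul_derive (f : P * R -> R) p (x : R) : continuous f -> lo < x ->
  is_derive x 1 (cumul f p) (f (p, x)).
Proof. by move=> cf lx; apply: itg_derive => //; exact: csec. Qed.

Let cumul_sub (f : P * R -> R) p : continuous f ->
  {within `[lo, hi], continuous (cumul f p)}.
Proof.
move=> cf.
apply: (@subspace_eq_continuous _ _ _ (cumul f p \o clamp)).
  by move=> x; rewrite inE/= in_itv/= => xlh; rewrite /= clamp_id.
apply: continuous_subspaceT => x.
pose k x := (p, x : R).
have ck : continuous k.
  by apply: continuous_pair_mk; [move=> z; exact: cvg_cst|exact: continuous_idfun].
exact: (continuous_comp_top (cumul_clamp_continuous cf) ck).
Qed.

Let invP p x : lo <= x <= hi ->
  lo <= inv p (cumul a p x) <= hi /\ cumul b p (inv p (cumul a p x)) = cumul a p x.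
Proof.
move=> xlh.
have [y /[!in_itv]/= ylh yE] : exists2 y, y \in `[lo, hi] & cumul b p y = cumul a p x.
  apply: IVT; [exact: ltW|exact: cumul_sub|].
  have b1 : cumul b p lo = 0 by rewrite /cumul itg1.
  have b2 : cumul b p hi = cumul a p hi by rewrite /cumul mass.
  have ge0 : 0 <= cumul a p x by apply: itg_ge0 => z _; exact: ltW.
  have leh : cumul a p x <= cumul a p hi.
    move/andP : xlh => [lx]; rewrite le_eqVlt => /predU1P[->//|xh].
    by apply: ltW; exact: cumul_lt.
  rewrite b1 b2 ge_min ge0/= le_max leh orbT//.
by have := @xgetPex _ lo [set y | lo <= y <= hi /\ cumul b p y = cumul a p x];
  apply; exists y.
Qed.

Let inv_uniq p y : lo <= y <= hi -> inv p (cumul b p y) = y.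
Proof.
move=> ylh; apply: xget_unique => [//|z /= [zlh zE]].
case: (ltgtP z y) => // zy.
- by have /andP[lz _] := zlh; have := @cumul_lt b p z y cb b0 lz zy; rewrite zE ltxx.
- by have /andP[ly _] := ylh; have := @cumul_lt b p y z cb b0 ly zy; rewrite zE ltxx.
Qed.

(** [T (p, _)] is the cumulative function of [a] followed by the inverse of that of [b]; its
    derivative is the quotient of the densities by the inverse function rule. *)
Lemma transport_ex : exists T : P * R -> R, [/\ continuous T,
  forall q, lo <= T q <= hi, forall p, T (p, lo) = lo, forall p, T (p, hi) = hi &
  forall p (x : R), lo < x < hi ->
    is_derive x 1 (fun y => T (p, y)) (a (p, x) / b (p, T (p, x)))].
Proof.
pose T q := inv q.1 (cumul a q.1 (clamp q.2)).
have TP p x : lo <= T (p, x) <= hi /\ cumul b p (T (p, x)) = cumul a p (clamp x).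
  exact: invP.
exists T; split.
(* Joint continuity of [T] is read off the order: for [y] in [[lo, hi]], [y < T q] says that the
   cumulative function of [b] at [y] lies below that of [a] at [q], an open condition on [q] since
   both are jointly continuous. *)
- have near_lt (q : P * R) y : lo <= y -> y < T q -> \forall q' \near q, y < T q'.
    move=> ly yT.
    have h : cumul b q.1 (clamp y) < cumul a q.1 (clamp q.2).
      have [/andP[_ Th] <-] := TP q.1 q.2; rewrite clamp_id -?surjective_pairing.
        exact: cumul_lt.
      by rewrite ly (le_trans (ltW yT))//; case: q yT Th.
    have c1 : continuous (fun q : P * R => cumul a q.1 (clamp q.2) - cumul b q.1 (clamp y)).
      apply: continuous_add; first exact: cumul_clamp_continuous.
      apply: continuous_opp.
      apply: (@continuous_comp_top _ _ _ (fun q : P * R => cumul b q.1 (clamp q.2)) (fun q : P * R => (q.1, y))).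
        exact: cumul_clamp_continuous.
      by apply: continuous_pair_mk; [exact: continuous_fst|exact: continuous_cst].
    have := @cvgr_gt _ _ _ _ _ _ (c1 q) 0; rewrite subr_gt0 => /(_ (nbhs_filter q) h).
    apply: filterS => q' /=; rewrite subr_gt0.
    have [/andP[lT Th] <-] := TP q'.1 q'.2; rewrite -surjective_pairing => h'.
    rewrite ltNge; apply/negP => Ty; move: h'; rewrite ltNge => /negP; apply.
    have yh : y <= hi.
      by have [/andP[_ +] _] := TP q.1 q.2; rewrite -surjective_pairing => /(le_trans (ltW yT)).
    rewrite clamp_id ?ly//; move: Ty; rewrite le_eqVlt => /predU1P[->//|Ty].
    by apply/ltW/cumul_lt => //; rewrite (surjective_pairing q').
  have near_gt (q : P * R) y : y <= hi -> T q < y -> \forall q' \near q, T q' < y.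
    move=> yh Ty.
    have lyT : lo <= T q by have [/andP[]] := TP q.1 q.2; rewrite -surjective_pairing.
    have ly := le_trans lyT (ltW Ty).
    have h : cumul a q.1 (clamp q.2) < cumul b q.1 (clamp y).
      have [_ <-] := TP q.1 q.2; rewrite clamp_id ?ly// -?surjective_pairing.
      exact: cumul_lt.
    have c1 : continuous (fun q : P * R => cumul b q.1 (clamp y) - cumul a q.1 (clamp q.2)).
      apply: continuous_add; last by apply: continuous_opp; exact: cumul_clamp_continuous.
      apply: (@continuous_comp_top _ _ _ (fun q : P * R => cumul b q.1 (clamp q.2)) (fun q : P * R => (q.1, y))).
        exact: cumul_clamp_continuous.
      by apply: continuous_pair_mk; [exact: continuous_fst|exact: continuous_cst].
    have := @cvgr_gt _ _ _ _ _ _ (c1 q) 0; rewrite subr_gt0 => /(_ (nbhs_filter q) h).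
    apply: filterS => q' /=; rewrite subr_gt0.
    have [/andP[lT Th] <-] := TP q'.1 q'.2; rewrite -surjective_pairing => h'.
    rewrite ltNge; apply/negP => Ty'; move: h'; rewrite ltNge => /negP; apply.
    rewrite clamp_id ?ly//; move: Ty'; rewrite le_eqVlt => /predU1P[->//|Ty'].
    by apply/ltW/cumul_lt.
  move=> q; apply/cvgrPdist_le => e e0.
  have [/andP[lT Th] _] := TP q.1 q.2; move: lT Th; rewrite -surjective_pairing => lT Th.
  have n1 : \forall q' \near q, T q - e <= T q'.
    have [ly|yl] := leP lo (T q - e).
      have := near_lt q _ ly; rewrite ltrBlDr ltrDl => /(_ e0).
      by apply: filterS => q' /ltW.
    apply: (@filterE _ _ (nbhs_filter q)) => q'; rewrite (le_trans (ltW yl))//.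
    by have [/andP[]] := TP q'.1 q'.2; rewrite -surjective_pairing.
  have n2 : \forall q' \near q, T q' <= T q + e.
    have [ly|yl] := leP (T q + e) hi.
      have := near_gt q _ ly; rewrite ltrDl => /(_ e0).
      by apply: filterS => q' /ltW.
    apply: (@filterE _ _ (nbhs_filter q)) => q'; rewrite (le_trans _ (ltW yl))//.
    by have [/andP[]] := TP q'.1 q'.2; rewrite -surjective_pairing.
  by apply: (@filterS2 _ _ (nbhs_filter q) _ _ _ _ n1 n2) => q' h1 h2; rewrite ler_norml; lra.
- by move=> [p x]; have [] := TP p x.
- move=> p; rewrite /T/= clamp_id ?lexx ?ltW//.
  rewrite (_ : cumul a p lo = cumul b p lo); last by rewrite /cumul !itg1.
  by rewrite inv_uniq// lexx ltW.
- move=> p; rewrite /T/= clamp_id ?lexx ?ltW//.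
  have E : cumul a p hi = cumul b p hi by exact: mass.
  by rewrite E inv_uniq// lexx ltW.
move=> p x /andP[lx xh].
have xlh : lo <= x <= hi by rewrite !ltW.
have [/andP[lT Th] TE] := TP p x; rewrite clamp_id// in TE.
(* Interior points go to interior points, where the cumulative function of [b] is differentiable. *)
have lT' : lo < T (p, x).
  rewrite lt_neqAle lT andbT; apply/eqP => E.
  have := @cumul_lt a p lo x ca a0 (lexx lo) lx.
  by rewrite -TE -E /cumul !itg1 ltxx.
have Th' : T (p, x) < hi.
  rewrite lt_neqAle Th andbT; apply/eqP => E.
  have := @cumul_lt a p x hi ca a0 (ltW lx) xh.
  by rewrite -TE E /cumul mass ltxx.
have dA : is_derive x 1 (cumul a p) (a (p, x)) by exact: cumul_derive.
have dB : is_derive (T (p, x)) 1 (cumul b p) (b (p, T (p, x))) by exact: cumul_derive.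
have near_in : \forall y \near T (p, x), lo < y < hi.
  near=> y; apply/andP; split; near: y; [exact: lt_nbhsr|exact: lt_nbhsl].
have dI : is_derive (cumul b p (T (p, x))) 1 (inv p) (b (p, T (p, x)))^-1.
  apply: (@is_derive_inverse _ (cumul b p)) => //; last by rewrite gt_eqF.
  - by apply: filterS near_in => y /andP[ly yh]; rewrite inv_uniq// !ltW.
  - apply: filterS near_in => y /andP[ly yh].
    apply: differentiable_continuous; apply/derivable1_diffP.
    by have [] := @cumul_derive b p y cb ly.
rewrite TE in dI.
have := is_derive1_comp dI dA; rewrite mulrC; apply: near_eq_is_derive.
near=> y; rewrite /T/= clamp_id//; apply/andP; split; apply: ltW; near: y.
  exact: lt_nbhsr.
exact: lt_nbhsl.
Unshelve. all: by end_near. Qed.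

End transport.

(** Proves continuity by following the shape of the function, with atoms taken from the continuity
    hypotheses in the context; the nonvanishing of an inverted function is left as a goal. *)
Ltac cts1 :=
  lazymatch goal with
  |- forall y, @continuous_at _ _ y ?F => first
  [ match goal with H : forall x, @continuous_at _ _ x ?f |- _ => constr_eq f F; exact H end
  | lazymatch F with
  | (fun z => z) => exact: continuous_idfun
  | @fst _ _ => exact: continuous_fst
  | @snd _ _ => exact: continuous_snd
  | (fun z => @fst _ _ z) => exact: continuous_fst
  | (fun z => @snd _ _ z) => exact: continuous_snd
  | (fun z => @Algebra.add _ (@?f z) (@?g z)) => apply: (@continuous_add _ _ f g)
  | (fun z => @Algebra.opp _ (@?f z)) => apply: (@continuous_opp _ _ f)
  | (fun z => @GRing.mul _ (@?f z) (@?g z)) => apply: (@continuous_mul _ _ f g)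
  | (fun z => @GRing.exp _ (@?f z) _) => apply: (@continuous_exp _ _ f)
  | (fun z => @GRing.inv _ (@?f z)) => apply: (@continuous_inv _ _ f)
  | (fun z => Order.max (@?f z) (@?g z)) => apply: (@continuous_maxr _ _ f g)
  | (fun z => Order.min (@?f z) (@?g z)) => apply: (@continuous_minr _ _ f g)
  | (fun z => (@?f z, @?g z)) => apply: (@continuous_pair_mk _ _ _ f g)
  | (fun z => fst (@?g z)) => apply: (@continuous_comp_top _ _ _ (@fst _ _) g (@continuous_fst _ _))
  | (fun z => snd (@?g z)) => apply: (@continuous_comp_top _ _ _ (@snd _ _) g (@continuous_snd _ _))
  | (fun z => expR (@?g z)) => apply: (@continuous_comp_top _ _ _ expR g (@continuous_expR _))
  | (fun z => ?f (@?g z)) => match goal with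
     H : forall x, @continuous_at _ _ x ?f' |- _ => constr_eq f f';
        apply: (@continuous_comp_top _ _ _ f g H) end
    end
  | exact: continuous_cst | exact: cst_continuous ]
  end.
Ltac cts := repeat cts1.

(** * Triangular maps in two and three variables *)

Section knothe.
Context {R : realType}.

Lemma mulVrAC (f g h : R) : f / g * h = h / g * f.
Proof. by ring. Qed.

Lemma ratio_cancel (f u c b : R) : u != 0 -> b != 0 ->
  c * f = u * (c * b * (f / u / b)).
Proof. by move=> u0 b0; field; rewrite ?u0 ?b0. Qed.

Lemma ratio_chain (f g u v d e : R) : u != 0 -> v != 0 ->
  f / u = d * (g / v) -> u = e * v -> f = e * d * g.
Proof.
move=> u0 v0 E1 E2; rewrite -[LHS](mulfVK u0) E1 [in X in _ * X]E2.
by field.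
Qed.

Lemma continuous_itg_fiber (T : topologicalType) (F : T * R -> R) lo hi :
  continuous F -> continuous (fun p => itg lo hi (fun x => F (p, x))).
Proof. exact: itg_continuous. Qed.

(* One level of the Knothe rearrangement: over each [p], [T (p, _)] transports
   the conditional density of [F] at [p] to that of [G] at [S p]. *)
Lemma fiber_transport (P : topologicalType) (S : P -> P) (F G : P * R -> R)
    (lo hi : R) : lo < hi -> continuous S -> continuous F -> continuous G ->
  (forall q, 0 < F q) -> (forall q, 0 < G q) ->
  let F1 p := itg lo hi (fun x => F (p, x)) in
  let G1 p := itg lo hi (fun x => G (p, x)) in
  exists T d : P * R -> R, [/\ continuous T /\ continuous d,
    (forall q, lo <= T q <= hi) /\ (forall p, T (p, lo) = lo /\ T (p, hi) = hi),
    (forall q, 0 < d q) /\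
    (forall p (x : R), lo < x < hi -> is_derive x 1 (fun y => T (p, y)) (d (p, x))),
    forall p x, F (p, x) / F1 p = d (p, x) * (G (S p, T (p, x)) / G1 (S p)) &
    forall phi : P * R -> R, continuous phi -> forall p,
      itg lo hi (fun x => phi (S p, T (p, x)) * F (p, x)) =
      F1 p / G1 (S p) * itg lo hi (fun y => phi (S p, y) * G (S p, y))].
Proof.
move=> lohi cS cF cG F0 G0 F1 G1.
have cF1 : continuous F1 by exact: continuous_itg_fiber.
have cG1 : continuous G1 by exact: continuous_itg_fiber.
have F10 p : 0 < F1 p by exact: (itg_gt0 lohi (@continuous_section R _ p F cF) (fun z => F0 (p, z))).
have G10 p : 0 < G1 p by exact: (itg_gt0 lohi (@continuous_section R _ p G cG) (fun z => G0 (p, z))).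
(* Dividing by the fibre masses makes both sides probability densities, so the masses agree whatever
   the marginals are. *)
pose a (q : P * R) := F q / F1 q.1.
pose b (q : P * R) := G (S q.1, q.2) / G1 (S q.1).
have ca : continuous a.
  by rewrite /a; cts => q; rewrite gt_eqF.
have cb : continuous b.
  by rewrite /b; cts => q; rewrite gt_eqF.
have a0 q : 0 < a q by exact: divr_gt0.
have b0 q : 0 < b q by exact: divr_gt0.
have cFp p : continuous (fun x => F (p, x)) by exact: (@continuous_section R _ p F cF).
have cGp p : continuous (fun x => G (p, x)) by exact: (@continuous_section R _ p G cG).
have mass p : itg lo hi (fun x => a (p, x)) = itg lo hi (fun x => b (p, x)).
  transitivity (1 : R).
    rewrite -(mulVf (lt0r_neq0 (F10 p))) -itgZ//.
    by apply: eq_itg => x _; rewrite mulrC.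
  rewrite -(mulVf (lt0r_neq0 (G10 (S p)))) -itgZ//.
  by apply: eq_itg => x _; rewrite mulrC.
have [T [cT Trange Tlo Thi dT]] := transport_ex lohi ca cb a0 b0 mass.
pose d (q : P * R) := a q / b (q.1, T q).
have cd : continuous d.
  by rewrite /d; cts => q; rewrite gt_eqF.
have dE p x : F (p, x) / F1 p = d (p, x) * (G (S p, T (p, x)) / G1 (S p)).
  have E := lt0r_neq0 (b0 (p, T (p, x))).
  by rewrite -[G _ / _]/(b (p, T (p, x))) /d /= mulfVK.
exists T, d; split => //.
- split=> [q|p x xlh]; first exact: divr_gt0.
  exact: dT.
- move=> phi cphi p.
  pose h y := phi (S p, y) * b (p, y).
  have ch : continuous h by rewrite /h; cts.
  have cTp : continuous (fun x => T (p, x)) by exact: (@continuous_section R _ p T cT).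
  have := @itg_substitution _ h (fun x => T (p, x)) (fun x => d (p, x)) lo hi
    (ltW lohi) _ ch cTp _ _.
  rewrite Tlo Thi => /(_ (ltW lohi)) sub.
  transitivity (F1 p * itg lo hi (fun x => h (T (p, x)) * d (p, x))).
    rewrite -itgZ; last by rewrite /h/=; cts.
    apply: eq_itg => x _.
    exact: (ratio_cancel (F (p, x)) (phi (S p, T (p, x))) (lt0r_neq0 (F10 p))
      (lt0r_neq0 (b0 (p, T (p, x))))).
  rewrite sub; last by cts.
  rewrite -mulrA; congr (_ * _); rewrite -itgZ; last by cts.
  by apply: eq_itg => y _; rewrite /h /b/= mulrA mulrC.
Qed.

(** The marginals in [x] are transported first; then, over each [x], the conditional density at [x]
    is sent to the one at [T1 x]. The map being triangular, its Jacobian is [d1 * d2], and no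
    derivative of [T2] in [x] is ever taken. *)
Lemma knothe2 (F G : R * R -> R) (l1 h1 l2 h2 : R) : l1 < h1 -> l2 < h2 ->
  continuous F -> continuous G -> (forall q, 0 < F q) -> (forall q, 0 < G q) ->
  itg l1 h1 (fun x => itg l2 h2 (fun y => F (x, y))) =
  itg l1 h1 (fun x => itg l2 h2 (fun y => G (x, y))) ->
  exists (T1 d1 : R -> R) (T2 d2 : R * R -> R),
  [/\ [/\ continuous T1, continuous d1, continuous T2 & continuous d2],
      (forall x, l1 <= T1 x <= h1) /\ (forall q, l2 <= T2 q <= h2),
      [/\ T1 l1 = l1, T1 h1 = h1, (forall x, T2 (x, l2) = l2) &
          (forall x, T2 (x, h2) = h2)],
      [/\ forall x, 0 < d1 x, forall q, 0 < d2 q,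
          forall x : R, l1 < x < h1 -> is_derive x 1 T1 (d1 x) &
          forall x (y : R), l2 < y < h2 -> is_derive y 1 (fun y => T2 (x, y)) (d2 (x, y))] &
      (forall x y, F (x, y) = d1 x * d2 (x, y) * G (T1 x, T2 (x, y))) /\
      (forall phi : R * R -> R, continuous phi ->
        itg l1 h1 (fun x => itg l2 h2 (fun y => phi (T1 x, T2 (x, y)) * F (x, y))) =
        itg l1 h1 (fun x => itg l2 h2 (fun y => phi (x, y) * G (x, y))))].
Proof.
move=> lh1 lh2 cF cG F0 G0 mass.
pose F1 x := itg l2 h2 (fun y => F (x, y)).
pose G1 x := itg l2 h2 (fun y => G (x, y)).
have cF1 : continuous F1 by exact: continuous_itg_fiber.
have cG1 : continuous G1 by exact: continuous_itg_fiber.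
have F10 p : 0 < F1 p by exact: (itg_gt0 lh2 (@continuous_section R _ p F cF) (fun z => F0 (p, z))).
have G10 p : 0 < G1 p by exact: (itg_gt0 lh2 (@continuous_section R _ p G cG) (fun z => G0 (p, z))).
have cF1' : continuous (fun q : R * R => F1 q.2).
  exact: (continuous_comp_top cF1 (@continuous_snd R R)).
have cG1' : continuous (fun q : R * R => G1 q.2).
  exact: (continuous_comp_top cG1 (@continuous_snd R R)).
(* The marginals carry no parameter: a dummy one is used, and the maps are read off at its value
   0. *)
have [T [d [[cT cd] [Tr Te] [d0 dT] TE Tphi]]] := fiber_transport (S := fun x : R => x)
  lh1 (@continuous_idfun _) cF1' cG1' (fun q => F10 q.2) (fun q => G10 q.2).
pose T1 x := T (0, x); pose d1 x := d (0, x).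
have cT1 : continuous T1 by exact: (@continuous_section R _ 0 T cT).
have cd1 : continuous d1 by exact: (@continuous_section R _ 0 d cd).
have m0 : 0 < itg l1 h1 G1 by exact: itg_gt0.
have T1E x : F1 x = d1 x * G1 (T1 x).
  have := TE 0 x; rewrite /= -[itg l1 h1 F1]/(itg l1 h1 F1) mass -/G1 mulrA.
  by move/(congr1 (fun z => z * itg l1 h1 G1)); rewrite !mulfVK ?gt_eqF.
have T1phi (phi : R -> R) : continuous phi ->
    itg l1 h1 (fun x => phi (T1 x) * F1 x) = itg l1 h1 (fun x => phi x * G1 x).
  move=> cphi; have cphi' : continuous (fun q : R * R => phi q.2) by cts.
  have /= -> := Tphi _ cphi' 0.
  by rewrite -[itg l1 h1 F1]/(itg l1 h1 F1) mass mulfV ?mul1r ?gt_eqF.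
have [T2 [d2 [[cT2 cd2] [T2r T2e] [d20 dT2] T2E T2phi]]] :=
  fiber_transport lh2 cT1 cF cG F0 G0.
exists T1, d1, T2, d2; split.
- by split; [exact: cT1|exact: cd1|exact: cT2|exact: cd2].
- by split => [x|]; [exact: Tr|exact: T2r].
- by split; [have [] := Te 0|have [] := Te 0|move=> x; have [] := T2e x|move=> x; have [] := T2e x].
- by split; [move=> x; exact: d0|exact: d20|exact: dT|exact: dT2].
- split=> [x y|phi cphi].
    exact: (ratio_chain (lt0r_neq0 (F10 x)) (lt0r_neq0 (G10 (T1 x))) (T2E x y) (T1E x)).
  pose Phi x := itg l2 h2 (fun y => phi (x, y) * G (x, y)).
  have cPhi : continuous Phi.
    by apply: (@continuous_itg_fiber _ (fun q => phi q * G q)); cts.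
  transitivity (itg l1 h1 (fun x => (Phi (T1 x) / G1 (T1 x)) * F1 x)).
    apply: eq_itg => x _; rewrite T2phi// -/(F1 x) -/(G1 (T1 x)) -/(Phi (T1 x)).
    exact: mulVrAC.
  have := T1phi (fun x => Phi x / G1 x).
  rewrite /= => ->; last by cts => x; rewrite gt_eqF.
  by apply: eq_itg => x _; exact: (mulfVK (lt0r_neq0 (G10 x))).
Qed.

(** The planar map between the marginals in the first two variables serves as the base map [S], and
    the third coordinate is transported fibrewise over it. *)
Lemma knothe3 (F G : (R * R) * R -> R) (l1 h1 l2 h2 l3 h3 : R) :
  l1 < h1 -> l2 < h2 -> l3 < h3 ->
  continuous F -> continuous G -> (forall q, 0 < F q) -> (forall q, 0 < G q) ->
  itg l1 h1 (fun x => itg l2 h2 (fun y => itg l3 h3 (fun z => F (x, y, z)))) =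
  itg l1 h1 (fun x => itg l2 h2 (fun y => itg l3 h3 (fun z => G (x, y, z)))) ->
  exists (T1 d1 : R -> R) (T2 d2 : R * R -> R) (T3 d3 : R * R * R -> R),
  [/\ [/\ continuous T1 /\ continuous d1, continuous T2 /\ continuous d2 &
          continuous T3 /\ continuous d3],
      [/\ forall x, l1 <= T1 x <= h1, forall q, l2 <= T2 q <= h2 &
          forall q, l3 <= T3 q <= h3],
      [/\ T1 l1 = l1 /\ T1 h1 = h1, forall x, T2 (x, l2) = l2 /\ T2 (x, h2) = h2 &
          forall p, T3 (p, l3) = l3 /\ T3 (p, h3) = h3],
      [/\ [/\ forall x, 0 < d1 x, forall q, 0 < d2 q & forall q, 0 < d3 q],
          forall x : R, l1 < x < h1 -> is_derive x 1 T1 (d1 x),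
          forall x (y : R), l2 < y < h2 -> is_derive y 1 (fun y => T2 (x, y)) (d2 (x, y)) &
          forall p (z : R), l3 < z < h3 -> is_derive z 1 (fun z => T3 (p, z)) (d3 (p, z))] &
      (forall x y z, F (x, y, z) =
         d1 x * d2 (x, y) * d3 (x, y, z) * G (T1 x, T2 (x, y), T3 (x, y, z))) /\
      (forall phi : R * R * R -> R, continuous phi ->
        itg l1 h1 (fun x => itg l2 h2 (fun y => itg l3 h3 (fun z =>
          phi (T1 x, T2 (x, y), T3 (x, y, z)) * F (x, y, z)))) =
        itg l1 h1 (fun x => itg l2 h2 (fun y => itg l3 h3 (fun z =>
          phi (x, y, z) * G (x, y, z)))))].
Proof.
move=> lh1 lh2 lh3 cF cG F0 G0 mass.
pose F1 p := itg l3 h3 (fun z => F (p, z)).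
pose G1 p := itg l3 h3 (fun z => G (p, z)).
have cF1 : continuous F1 by exact: continuous_itg_fiber.
have cG1 : continuous G1 by exact: continuous_itg_fiber.
have F10 p : 0 < F1 p by exact: (itg_gt0 lh3 (@continuous_section R _ p F cF) (fun z => F0 (p, z))).
have G10 p : 0 < G1 p by exact: (itg_gt0 lh3 (@continuous_section R _ p G cG) (fun z => G0 (p, z))).
have [T1 [d1 [T2 [d2 [[cT1 cd1 cT2 cd2] [r1 r2] [e1 e1' e2 e2'] [d10 d20 dT1 dT2] [T12E T12phi]]]]]] :=
  knothe2 lh1 lh2 cF1 cG1 F10 G10 mass.
pose S p := (T1 p.1, T2 p).
have cS : continuous S by rewrite /S; cts.
have [T3 [d3 [[cT3 cd3] [T3r T3e] [d30 dT3] T3E T3phi]]] :=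
  fiber_transport lh3 cS cF cG F0 G0.
exists T1, d1, T2, d2, T3, d3; split.
- by split; split; [exact: cT1|exact: cd1|exact: cT2|exact: cd2|exact: cT3|exact: cd3].
- by split; [exact: r1|exact: r2|exact: T3r].
- by split; [split; [exact: e1|exact: e1']|move=> x; split; [exact: e2|exact: e2']|exact: T3e].
- by split; [split; [exact: d10|exact: d20|exact: d30]|exact: dT1|exact: dT2|exact: dT3].
split=> [x y z|phi cphi].
  exact: (ratio_chain (lt0r_neq0 (F10 (x, y))) (lt0r_neq0 (G10 (S (x, y))))
    (T3E (x, y) z) (T12E x y)).
pose Phi p := itg l3 h3 (fun z => phi (p, z) * G (p, z)).
have cPhi : continuous Phi.
  by apply: (@continuous_itg_fiber _ (fun q => phi q * G q)); cts.
transitivity (itg l1 h1 (fun x => itg l2 h2 (fun y =>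
   (Phi (T1 x, T2 (x, y)) / G1 (T1 x, T2 (x, y))) * F1 (x, y)))).
  apply: eq_itg => x _; apply: eq_itg => y _.
  have -> := T3phi phi cphi (x, y).
  rewrite -/(F1 (x, y)) -/(G1 (S (x, y))) -/(Phi (S (x, y))).
  exact: mulVrAC.
have := T12phi (fun p => Phi p / G1 p).
rewrite /= => ->; last by cts => x; rewrite gt_eqF.
by apply: eq_itg => x _; apply: eq_itg => y _; exact: (mulfVK (lt0r_neq0 (G10 (x, y)))).
Qed.

End knothe.

(** * Integrals over boxes and the divergence theorem *)

Section box_integrals.
Context {R : realType}.
Implicit Types (f g : R * R -> R) (F G : R * R * R -> R).

Definition itg2 (a b c d : R) f := itg a b (fun x => itg c d (fun y => f (x, y))).
Definition itg3 (a b c d e k : R) F :=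
  itg a b (fun x => itg c d (fun y => itg e k (fun z => F (x, y, z)))).

Lemma continuous_inner f c d : continuous f ->
  continuous (fun x => itg c d (fun y => f (x, y))).
Proof. exact: itg_continuous. Qed.

Lemma continuous_inner3 F e k : continuous F ->
  continuous (fun p : R * R => itg e k (fun z => F (p, z))).
Proof. exact: itg_continuous. Qed.

Lemma continuous_slice f (x : R) : continuous f -> continuous (fun y => f (x, y)).
Proof. by move=> cf; cts. Qed.

Lemma continuous_slice3 F (p : R * R) : continuous F -> continuous (fun z => F (p, z)).
Proof. by move=> cf; cts. Qed.

Lemma itg2D a b c d f g : continuous f -> continuous g ->
  itg2 a b c d (fun p => f p + g p) = itg2 a b c d f + itg2 a b c d g.
Proof.
move=> cf cg; rewrite /itg2 -itgD; [|exact: continuous_inner|exact: continuous_inner].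
apply: eq_itg => x _; apply: itgD; exact: continuous_slice.
Qed.

Lemma itg2Z a b c d (k : R) f : continuous f ->
  itg2 a b c d (fun p => k * f p) = k * itg2 a b c d f.
Proof.
move=> cf; rewrite /itg2 -itgZ; last exact: continuous_inner.
apply: eq_itg => x _; apply: itgZ; exact: continuous_slice.
Qed.

Lemma eq_itg2 a b c d f g : (forall x y, a <= x <= b -> c <= y <= d -> f (x, y) = g (x, y)) ->
  itg2 a b c d f = itg2 a b c d g.
Proof. by move=> fg; apply: eq_itg => x xab; apply: eq_itg => y ycd; exact: fg. Qed.

Lemma itg2_le a b c d f g : continuous f -> continuous g ->
  (forall x y, a <= x <= b -> c <= y <= d -> f (x, y) <= g (x, y)) ->
  itg2 a b c d f <= itg2 a b c d g.
Proof.
move=> cf cg fg; apply: itg_le; [exact: continuous_inner|exact: continuous_inner|].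
move=> x xab; apply: itg_le; [exact: continuous_slice|exact: continuous_slice|].
by move=> y ycd; exact: fg.
Qed.

Lemma itg2_ge0 a b c d f : (forall x y, a <= x <= b -> c <= y <= d -> 0 <= f (x, y)) ->
  0 <= itg2 a b c d f.
Proof. by move=> f0; apply: itg_ge0 => x xab; apply: itg_ge0 => y ycd; exact: f0. Qed.

Lemma itg2_gt0 a b c d f : a < b -> c < d -> continuous f -> (forall p, 0 < f p) ->
  0 < itg2 a b c d f.
Proof.
move=> ab cd cf f0; apply: itg_gt0 => //; first exact: continuous_inner.
by move=> x; apply: itg_gt0 => //; exact: continuous_slice.
Qed.

Lemma itg2_cst a b c d (k : R) : a <= b -> c <= d ->
  itg2 a b c d (fun=> k) = k * (d - c) * (b - a).
Proof.
move=> ab cd; rewrite /itg2 -itg_cst//; apply: eq_itg => x _; exact: itg_cst.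
Qed.

Lemma itg2C a b c d f : continuous f ->
  itg2 a b c d f = itg c d (fun y => itg a b (fun x => f (x, y))).
Proof. by move=> cf; exact: itg_fubini. Qed.

Lemma itg3E a b c d e k F :
  itg3 a b c d e k F = itg2 a b c d (fun p => itg e k (fun z => F (p, z))).
Proof. by []. Qed.

Lemma itg3D a b c d e k F G : continuous F -> continuous G ->
  itg3 a b c d e k (fun p => F p + G p) = itg3 a b c d e k F + itg3 a b c d e k G.
Proof.
move=> cF cG; rewrite !itg3E -itg2D; [|exact: continuous_inner3|exact: continuous_inner3].
apply: eq_itg2 => x y _ _; apply: itgD; exact: continuous_slice3.
Qed.

Lemma itg3Z a b c d e k (l : R) F : continuous F ->
  itg3 a b c d e k (fun p => l * F p) = l * itg3 a b c d e k F.
Proof.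
move=> cF; rewrite !itg3E -itg2Z; last exact: continuous_inner3.
apply: eq_itg2 => x y _ _; apply: itgZ; exact: continuous_slice3.
Qed.

Lemma eq_itg3 a b c d e k F G :
  (forall x y z, a <= x <= b -> c <= y <= d -> e <= z <= k -> F (x, y, z) = G (x, y, z)) ->
  itg3 a b c d e k F = itg3 a b c d e k G.
Proof.
move=> FG; rewrite !itg3E; apply: eq_itg2 => x y xab ycd.
by apply: eq_itg => z zek; exact: FG.
Qed.

Lemma itg3_le a b c d e k F G : continuous F -> continuous G ->
  (forall x y z, a <= x <= b -> c <= y <= d -> e <= z <= k -> F (x, y, z) <= G (x, y, z)) ->
  itg3 a b c d e k F <= itg3 a b c d e k G.
Proof.
move=> cF cG FG; rewrite !itg3E.
apply: itg2_le; [exact: continuous_inner3|exact: continuous_inner3|].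
move=> x y xab ycd; apply: itg_le; [exact: continuous_slice3|exact: continuous_slice3|].
by move=> z zek; exact: FG.
Qed.

Lemma itg3_gt0 a b c d e k F : a < b -> c < d -> e < k -> continuous F ->
  (forall p, 0 < F p) -> 0 < itg3 a b c d e k F.
Proof.
move=> ab cd ek cF F0; rewrite itg3E; apply: itg2_gt0 => //; first exact: continuous_inner3.
by move=> p; apply: itg_gt0 => //; exact: continuous_slice3.
Qed.

Lemma itg3_ge0 a b c d e k F :
  (forall x y z, a <= x <= b -> c <= y <= d -> e <= z <= k -> 0 <= F (x, y, z)) ->
  0 <= itg3 a b c d e k F.
Proof.
move=> F0; rewrite itg3E; apply: itg2_ge0 => x y xab ycd; apply: itg_ge0 => z zek.
exact: F0.
Qed.

(** Each component is differentiated in its own variable only, and only inside the rectangle: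
    exactly the regularity of a Knothe map. *)
Lemma divergence2 a b c d (V1 V2 W1 W2 : R * R -> R) : a <= b -> c <= d ->
  continuous V1 -> continuous V2 -> continuous W1 -> continuous W2 ->
  (forall (x y : R), a < x < b -> is_derive x 1 (fun x => V1 (x, y)) (W1 (x, y))) ->
  (forall (x y : R), c < y < d -> is_derive y 1 (fun y => V2 (x, y)) (W2 (x, y))) ->
  itg2 a b c d (fun p => W1 p + W2 p) =
  itg c d (fun y => V1 (b, y) - V1 (a, y)) + itg a b (fun x => V2 (x, d) - V2 (x, c)).
Proof.
move=> ab cd cV1 cV2 cW1 cW2 dV1 dV2; rewrite itg2D; [|exact: cW1|exact: cW2].
have FTC (u v : R) (f f' : R -> R) : u <= v -> continuous f -> continuous f' ->
    (forall x : R, u < x < v -> is_derive x 1 f (f' x)) -> itg u v f' = f v - f u.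
  by move=> uv cf cf' df; apply: itg_FTC.
congr (_ + _).
  rewrite itg2C; last exact: cW1.
  apply: eq_itg => y _.
  by apply: (FTC _ _ (fun x => V1 (x, y))) => //; cts.
apply: eq_itg => x _.
by apply: (FTC _ _ (fun y => V2 (x, y))) => //; cts.
Qed.

Lemma divergence3 a b c d e k (V1 V2 V3 W1 W2 W3 : R * R * R -> R) :
  a <= b -> c <= d -> e <= k ->
  continuous V1 -> continuous V2 -> continuous V3 ->
  continuous W1 -> continuous W2 -> continuous W3 ->
  (forall (x y z : R), a < x < b ->
     is_derive x 1 (fun x => V1 (x, y, z)) (W1 (x, y, z))) ->
  (forall (x y z : R), c < y < d ->
     is_derive y 1 (fun y => V2 (x, y, z)) (W2 (x, y, z))) ->
  (forall (x y z : R), e < z < k -> is_derive z 1 (fun z => V3 (x, y, z)) (W3 (x, y, z))) ->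
  itg3 a b c d e k (fun p => W1 p + W2 p + W3 p) =
  itg2 c d e k (fun q => V1 (b, q.1, q.2) - V1 (a, q.1, q.2)) +
  itg2 a b e k (fun q => V2 (q.1, d, q.2) - V2 (q.1, c, q.2)) +
  itg2 a b c d (fun q => V3 (q, k) - V3 (q, e)).
Proof.
move=> ab cd ek cV1 cV2 cV3 cW1 cW2 cW3 dV1 dV2 dV3.
rewrite itg3D; [|by cts|exact: cW3].
rewrite itg3D; [|exact: cW1|exact: cW2].
have FTC (u v : R) (f f' : R -> R) : u <= v -> continuous f -> continuous f' ->
    (forall x : R, u < x < v -> is_derive x 1 f (f' x)) -> itg u v f' = f v - f u.
  by move=> uv cf cf' df; apply: itg_FTC.
have -> : itg3 a b c d e k W1 =
    itg2 c d e k (fun q => V1 (b, q.1, q.2) - V1 (a, q.1, q.2)).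
  transitivity (itg c d (fun y => itg a b (fun x => itg e k (fun z => W1 (x, y, z))))).
    by rewrite itg3E itg2C; last exact: continuous_inner3.
  apply: eq_itg => y _.
  rewrite (@itg_fubini R (fun q => W1 (q.1, y, q.2))); last by cts.
  apply: eq_itg => z _.
  by apply: (FTC _ _ (fun x => V1 (x, y, z))) => //; cts.
have -> : itg3 a b c d e k W2 =
    itg2 a b e k (fun q => V2 (q.1, d, q.2) - V2 (q.1, c, q.2)).
  apply: eq_itg => x _.
  rewrite (@itg_fubini R (fun q => W2 (x, q.1, q.2))); last by cts.
  apply: eq_itg => z _.
  by apply: (FTC _ _ (fun y => V2 (x, y, z))) => //; cts.
have -> : itg3 a b c d e k W3 = itg2 a b c d (fun q => V3 (q, k) - V3 (q, e)).
  rewrite itg3E; apply: eq_itg2 => x y _ _.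
  by apply: (FTC _ _ (fun z => V3 (x, y, z))) => //; cts.
by [].
Qed.

End box_integrals.

(** * Onofri's inequality on a square *)

Section onofri_box.
Context {R : realType}.

Lemma is_derive_mul (f g : R -> R) (x f' g' : R) :
  is_derive x 1 f f' -> is_derive x 1 g g' ->
  is_derive x 1 (fun x => f x * g x) (f' * g x + f x * g').
Proof.
by move=> df dg; apply: is_derive_eq; rewrite /GRing.scale/= addrC mulrC (mulrC f').
Qed.

Lemma is_derive_expR_comp (f : R -> R) (x d : R) : is_derive x 1 f d ->
  is_derive x 1 (fun x => expR (f x)) (d * expR (f x)).
Proof.
move=> df; have := is_derive1_comp (is_derive_expR (f x)) df.
by rewrite mulrC.
Qed.

Lemma is_derive_half_density (c : R) (v q : R -> R) (x v' q' : R) : q x != 0 ->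
  is_derive x 1 v v' -> is_derive x 1 q q' ->
  is_derive x 1 (fun x => c * expR (v x / 2) / q x)
    (c * expR (v x / 2) / q x * (v' / 2 - q' / q x)).
Proof.
move=> q0 dv dq.
have dvh : is_derive x 1 (fun x => v x / 2) (v' / 2).
  by apply: is_derive_eq; rewrite /GRing.scale/=; field.
have de := is_derive_expR_comp dvh.
apply: is_derive_eq; rewrite /GRing.scale/=; field; exact: q0.
Qed.

(* AM-GM for the two factors of the Jacobian of a triangular map. *)
Lemma jacobian_amgm2 (q F h a b : R) : 0 < q -> 0 < h -> 0 < a -> 0 < b ->
  h ^+ 2 = F -> F = a * b * q ^- 2 -> q * F <= h * (a + b) / 2.
Proof.
move=> q0 h0 a0 b0 hF FE; have F0 : 0 < F by rewrite -hF exprn_gt0.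
have qF0 : 0 <= q * F by rewrite mulr_ge0 ?ltW.
have hab : 0 <= h * (a + b) / 2 by rewrite !mulr_ge0 ?ltW ?addr_gt0.
rewrite -(ler_pXn2r (n := 2))// ?nnegrE//.
have -> : (q * F) ^+ 2 = F * (a * b).
  rewrite expr2 {2}FE; field; by rewrite gt_eqF.
rewrite !exprMn hF exprVn -mulrA ler_pM2l// ler_pdivlMr ?exprn_gt0//.
have := sqr_ge0 (a - b); nra.
Qed.

(** [H] is the half density, with gradient [H * (a / 2 - 2 * x / q)] and its analogue in [y]. Half
    of [H] times the divergence of the map is half the divergence of [H T] minus half the product of
    the gradient of [H] with [T], and this product is split by Young's inequality. The defect is
    half a sum of two squares. *)
Lemma transport_young2 (H F t1 t2 e1 e2 a b x y q : R) : q != 0 -> H ^+ 2 = F ->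
  H * (e1 + e2) / 2 <=
  (H * (a / 2 - 2 * x / q) * t1 + H * e1 + (H * (b / 2 - 2 * y / q) * t2 + H * e2)) * (1 / 2) +
  (1 / 32 * (a ^+ 2 + b ^+ 2) + - (1 / 4) * ((x * a + y * b) / q) +
   1 / 2 * ((x ^+ 2 + y ^+ 2) / q ^+ 2) +
   1 / 2 * (t1 ^+ 2 + t2 ^+ 2) * F).
Proof.
move=> q0 <-.
have s1 : 0 <= ((a - 4 * x / q) / 4 + H * t1) ^+ 2 by exact: sqr_ge0.
have s2 : 0 <= ((b - 4 * y / q) / 4 + H * t2) ^+ 2 by exact: sqr_ge0.
rewrite -subr_ge0; set S := (X in 0 <= X).
have -> : S = 1 / 2 * (((a - 4 * x / q) / 4 + H * t1) ^+ 2 + ((b - 4 * y / q) / 4 + H * t2) ^+ 2).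
  by rewrite /S; field.
by rewrite mulr_ge0// addr_ge0.
Qed.

Definition rho2 (p : R * R) : R := 1 + p.1 ^+ 2 + p.2 ^+ 2.

Lemma rho2_ge1 p : 1 <= rho2 p.
Proof. by rewrite /rho2; nra. Qed.
Lemma rho2_gt0 p : 0 < rho2 p.
Proof. exact: lt_le_trans (rho2_ge1 p). Qed.
Lemma rho2_neq0 p : rho2 p != 0.
Proof. by rewrite gt_eqF// rho2_gt0. Qed.
Lemma continuous_rho2 : continuous rho2.
Proof. by rewrite /rho2; cts. Qed.

Definition square_boundary (r : R) (w : R * R -> R) : R :=
  itg (- r) r (fun y => w (r, y) + w (- r, y)) +
  itg (- r) r (fun x => w (x, r) + w (x, - r)).

(** Divergence theorem for the radial field [p * w / rho2], whose normal component on every side is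
    [r * w / rho2]; the terms in [w] simplify because [rho2 - |p|^2 = 1]. *)
Lemma square_divergence (r : R) (w w1 w2 : R * R -> R) : 0 < r ->
  continuous w -> continuous w1 -> continuous w2 ->
  (forall x y : R, is_derive x 1 (fun x => w (x, y)) (w1 (x, y))) ->
  (forall x y : R, is_derive y 1 (fun y => w (x, y)) (w2 (x, y))) ->
  r * square_boundary r (fun p => w p / rho2 p) =
  itg2 (- r) r (- r) r (fun p => (p.1 * w1 p + p.2 * w2 p) / rho2 p) +
  itg2 (- r) r (- r) r (fun p => 2 * w p / rho2 p ^+ 2).
Proof.
move=> r0 cw cw1 cw2 dw1 dw2.
have crho := continuous_rho2; have rho0 := rho2_neq0.
have rr : - r <= r by lra.
pose W1 p := (p.1 * w1 p + w p) / rho2 p - 2 * p.1 ^+ 2 * w p / rho2 p ^+ 2.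
pose W2 p := (p.2 * w2 p + w p) / rho2 p - 2 * p.2 ^+ 2 * w p / rho2 p ^+ 2.
have cW1 : continuous W1 by rewrite /W1; cts; move=> p; rewrite ?expf_neq0.
have cW2 : continuous W2 by rewrite /W2; cts; move=> p; rewrite ?expf_neq0.
have cV1 : continuous (fun p : R * R => p.1 * w p / rho2 p) by cts.
have cV2 : continuous (fun p : R * R => p.2 * w p / rho2 p) by cts.
have dV1 (x y : R) : - r < x < r ->
    is_derive x 1 (fun x => x * w (x, y) / rho2 (x, y)) (W1 (x, y)).
  move=> _; have dw := dw1 x y.
  have dr : is_derive x 1 (fun x => rho2 (x, y)) (2 * x).
    rewrite /rho2/=; apply: is_derive_eq; rewrite /GRing.scale/=; ring.
  have n0 := rho0 (x, y).
  apply: is_derive_eq; rewrite /GRing.scale/= /W1/=; field; exact: n0.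
have dV2 (x y : R) : - r < y < r ->
    is_derive y 1 (fun y => y * w (x, y) / rho2 (x, y)) (W2 (x, y)).
  move=> _; have dw := dw2 x y.
  have dr : is_derive y 1 (fun y => rho2 (x, y)) (2 * y).
    rewrite /rho2/=; apply: is_derive_eq; rewrite /GRing.scale/=; ring.
  have n0 := rho0 (x, y).
  apply: is_derive_eq; rewrite /GRing.scale/= /W2/=; field; exact: n0.
have := divergence2 rr rr cV1 cV2 cW1 cW2 dV1 dV2; rewrite /=.
rewrite -itg2D; last 2 first.
- by cts; move=> p; rewrite ?expf_neq0.
- by cts; move=> p; rewrite ?expf_neq0.
have -> : itg2 (- r) r (- r) r (fun p => W1 p + W2 p) = itg2 (- r) r (- r) r
    (fun p => (p.1 * w1 p + p.2 * w2 p) / rho2 p + 2 * w p / rho2 p ^+ 2).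
  apply: eq_itg2 => x y _ _; rewrite /W1 /W2/=.
  have := rho0 (x, y); set q := rho2 _ => q0.
  have -> : x ^+ 2 = q - 1 - y ^+ 2 by rewrite /q /rho2/=; ring.
  by field.
move=> ->; rewrite /square_boundary mulrDr -!itgZ; [|by cts|by cts].
by congr (_ + _); apply: eq_itg => x _; ring.
Qed.

Lemma square_boundary_le (r : R) (u w : R * R -> R) : 0 < r -> continuous u -> continuous w ->
  (forall p, r <= `|p.1| \/ r <= `|p.2| -> u p <= w p) ->
  square_boundary r u <= square_boundary r w.
Proof.
move=> r0 cu cw uw.
have nr : r <= `|- r| by rewrite normrN ler_norm.
have rn := ler_norm r.
apply: lerD; apply: itg_le; try by cts.
  by move=> x _; apply: lerD; apply: uw; left.
by move=> x _; apply: lerD; apply: uw; right.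
Qed.

Lemma square_boundaryZ (r a : R) (w : R * R -> R) : continuous w ->
  square_boundary r (fun p => a * w p) = a * square_boundary r w.
Proof.
move=> cw; rewrite /square_boundary mulrDr -!itgZ; [|by cts|by cts].
by congr (_ + _); apply: eq_itg => x _; rewrite mulrDr.
Qed.

(** Boundary terms are compared with multiples of [1 / rho2], so this exact value takes the place of
    asymptotic estimates on the boundary. *)
Lemma square_boundary_inv_rho2 (r : R) : 0 < r ->
  r * square_boundary r (fun p => 1 / rho2 p) =
  2 * itg2 (- r) r (- r) r (fun p => rho2 p ^- 2).
Proof.
move=> r0; have crho := continuous_rho2; have rho0 := rho2_neq0.
have rho20 p : rho2 p ^+ 2 != 0 by rewrite expf_neq0.
have cst2 (c : R) : continuous (fun _ : R * R => c) by cts.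
have d0 (c : R) (x : R) : is_derive x 1 (fun=> c) 0 by exact: is_derive_cst.
rewrite (square_divergence r0 (cst2 1) (cst2 0) (cst2 0) (fun x y => d0 1 x) (fun x y => d0 1 y)).
rewrite -itg2D; [|by cts|by cts].
rewrite -itg2Z; last by cts.
apply: eq_itg2 => x y _ _; have := rho0 (x, y); set q := rho2 _ => q0.
by field.
Qed.

Lemma square_boundary_ratio_le (r a : R) (w : R * R -> R) : 0 < r -> continuous w ->
  (forall p, r <= `|p.1| \/ r <= `|p.2| -> w p <= a * (1 / rho2 p)) ->
  r * square_boundary r w <= a * (2 * itg2 (- r) r (- r) r (fun p => rho2 p ^- 2)).
Proof.
move=> r0 cw wa; have crho := continuous_rho2; have rho0 := rho2_neq0.
have c1 : continuous (fun p => 1 / rho2 p) by cts.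
have c2 : continuous (fun p => a * (1 / rho2 p)) by cts.
rewrite -(square_boundary_inv_rho2 r0) mulrCA -(square_boundaryZ r a c1) ler_pM2l//.
exact: square_boundary_le.
Qed.

Lemma square_boundary_ratio_ge (r a : R) (w : R * R -> R) : 0 < r -> continuous w ->
  (forall p, r <= `|p.1| \/ r <= `|p.2| -> a * (1 / rho2 p) <= w p) ->
  a * (2 * itg2 (- r) r (- r) r (fun p => rho2 p ^- 2)) <= r * square_boundary r w.
Proof.
move=> r0 cw wa; have crho := continuous_rho2; have rho0 := rho2_neq0.
have c1 : continuous (fun p => 1 / rho2 p) by cts.
have c2 : continuous (fun p => a * (1 / rho2 p)) by cts.
rewrite -(square_boundary_inv_rho2 r0) mulrCA -(square_boundaryZ r a c1) ler_pM2l//.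
exact: square_boundary_le.
Qed.

Lemma itg2_inv_rho2 (r : R) : itg2 (- r) r (- r) r (fun p => (rho2 p)^-1) =
  itg2 (- r) r (- r) r (fun p => rho2 p ^- 2) +
  2 * itg2 (- r) r (- r) r (fun p => 1 / 2 * ((p.1 ^+ 2 + p.2 ^+ 2) / rho2 p ^+ 2)).
Proof.
have crho := continuous_rho2; have rho0 := rho2_neq0.
have rho20 p : rho2 p ^+ 2 != 0 by rewrite expf_neq0.
rewrite -itg2Z; last by cts.
rewrite -itg2D; [|by cts|by cts].
apply: eq_itg2 => x y _ _ /=.
have := rho0 (x, y); set q := rho2 _ => q0.
have -> : x ^+ 2 = q - 1 - y ^+ 2 by rewrite /q /rho2/=; ring.
by field.
Qed.

(* Mass transport from [k e^v rho^-2] to [rho^-2], [rho^-2 dx] being the area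
   form of the sphere up to a factor 4. *)
Lemma onofri_square (r e : R) (v v1 v2 : R * R -> R) : 0 < r ->
  continuous v -> continuous v1 -> continuous v2 ->
  (forall x y : R, is_derive x 1 (fun x => v (x, y)) (v1 (x, y))) ->
  (forall x y : R, is_derive y 1 (fun y => v (x, y)) (v2 (x, y))) ->
  (forall p, r <= `|p.1| \/ r <= `|p.2| -> `|v p| <= e) ->
  let m := itg2 (- r) r (- r) r (fun p => rho2 p ^- 2) in
  let Z := itg2 (- r) r (- r) r (fun p => expR (v p) / rho2 p ^+ 2) in
  m <= Num.sqrt (m / Z) * expR (e / 2) * m + e / 2 * m
    + 1 / 32 * itg2 (- r) r (- r) r (fun p => v1 p ^+ 2 + v2 p ^+ 2)
    + 1 / 2 * itg2 (- r) r (- r) r (fun p => v p / rho2 p ^+ 2).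
Proof.
move=> r0 cv cv1 cv2 dv1 dv2 ve; cbv zeta.
set m := itg2 _ _ _ _ (fun p => rho2 p ^- 2).
set Z := itg2 _ _ _ _ (fun p => expR (v p) / rho2 p ^+ 2).
have crho := continuous_rho2; have rho0 := rho2_neq0.
have rho20 p : rho2 p ^+ 2 != 0 by rewrite expf_neq0.
have rr : - r < r by lra.
have rr' := ltW rr.
have cG : continuous (fun p => rho2 p ^- 2) by cts.
have cE : continuous (fun p => expR (v p) / rho2 p ^+ 2) by cts.
have G0 p : 0 < rho2 p ^- 2 by rewrite invr_gt0 exprn_gt0// rho2_gt0.
have E0 p : 0 < expR (v p) / rho2 p ^+ 2 by rewrite mulr_gt0// expR_gt0.
have m0 : 0 < m by exact: itg2_gt0.
have Z0 : 0 < Z by exact: itg2_gt0.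
(* The factor that gives [e^v rho2^-2] the mass of the target density. *)
pose k := m / Z; have k0 : 0 < k by exact: divr_gt0.
pose F p := k * (expR (v p) / rho2 p ^+ 2).
have cF : continuous F by rewrite /F; cts.
have F0 p : 0 < F p by rewrite mulr_gt0.
have mass : itg (- r) r (fun x => itg (- r) r (fun y => F (x, y))) =
    itg (- r) r (fun x => itg (- r) r (fun y => rho2 (x, y) ^- 2)).
  by rewrite -/(itg2 _ _ _ _ F) itg2Z// /k mulfVK// gt_eqF.
have [T1 [d1 [T2 [d2 [[cT1 cd1 cT2 cd2] [T1r T2r] [T1l T1h T2l T2h]
  [d10 d20 dT1 dT2] [FE Fphi]]]]]] := knothe2 rr rr cF cG F0 G0 mass.
pose h p := Num.sqrt k * expR (v p / 2) / rho2 p.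
have ch : continuous h by rewrite /h; cts.
have h0 p : 0 < h p.
  apply: divr_gt0; last exact: rho2_gt0.
  by apply: mulr_gt0; [rewrite sqrtr_gt0|exact: expR_gt0].
have hF p : h p ^+ 2 = F p.
  rewrite /h /F !exprMn sqr_sqrtr ?ltW// exprVn -mulrA; congr (_ * (_ * _)).
  by rewrite -expRM_natl; congr expR; field.
have cT1' : continuous (fun p : R * R => T1 p.1) by cts.
have cd1' : continuous (fun p : R * R => d1 p.1) by cts.
pose h1 p := h p * (v1 p / 2 - 2 * p.1 / rho2 p).
pose h2 p := h p * (v2 p / 2 - 2 * p.2 / rho2 p).
have ch1 : continuous h1 by rewrite /h1; cts.
have ch2 : continuous h2 by rewrite /h2; cts.
have dh1 (x y : R) : is_derive x 1 (fun x => h (x, y)) (h1 (x, y)).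
  have dv := dv1 x y.
  have dr : is_derive x 1 (fun x => rho2 (x, y)) (2 * x).
    rewrite /rho2/=; apply: is_derive_eq; rewrite /GRing.scale/=; ring.
  have n0 := rho0 (x, y).
  exact: (@is_derive_half_density (Num.sqrt k) (fun x => v (x, y)) (fun x => rho2 (x, y)) x _ _ n0 dv dr).
have dh2 (x y : R) : is_derive y 1 (fun y => h (x, y)) (h2 (x, y)).
  have dv := dv2 x y.
  have dr : is_derive y 1 (fun y => rho2 (x, y)) (2 * y).
    rewrite /rho2/=; apply: is_derive_eq; rewrite /GRing.scale/=; ring.
  have n0 := rho0 (x, y).
  exact: (@is_derive_half_density (Num.sqrt k) (fun y => v (x, y)) (fun y => rho2 (x, y)) y _ _ n0 dv dr).
(* Integration by parts of [h div T]: [T] preserves the faces of the square. *)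
pose W1 p := h1 p * T1 p.1 + h p * d1 p.1.
pose W2 p := h2 p * T2 p + h p * d2 p.
have cW1 : continuous W1 by rewrite /W1; cts.
have cW2 : continuous W2 by rewrite /W2; cts.
have cV1 : continuous (fun p : R * R => h p * T1 p.1) by cts.
have cV2 : continuous (fun p : R * R => h p * T2 p) by cts.
have dV1 (x y : R) : - r < x < r -> is_derive x 1 (fun x => h (x, y) * T1 x) (W1 (x, y)).
  move=> xr; have dT := dT1 x xr; have dh := dh1 x y.
  exact: (@is_derive_mul (fun x => h (x, y)) T1 x _ _ dh dT).
have dV2 (x y : R) : - r < y < r -> is_derive y 1 (fun y => h (x, y) * T2 (x, y)) (W2 (x, y)).
  move=> xr; have dT := dT2 x y xr; have dh := dh2 x y.
  exact: (@is_derive_mul (fun y => h (x, y)) (fun y => T2 (x, y)) y _ _ dh dT).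
have IBP : itg2 (- r) r (- r) r (fun p => W1 p + W2 p) = r * square_boundary r h.
  rewrite (divergence2 rr' rr' cV1 cV2 cW1 cW2 dV1 dV2) /square_boundary mulrDr.
  rewrite -!itgZ; [|by cts|by cts]; congr (_ + _); apply: eq_itg => x _.
    by rewrite /= T1l T1h; ring.
  by rewrite /= T2l T2h; ring.
have step1 x y : rho2 (T1 x, T2 (x, y)) * F (x, y) <= h (x, y) * (d1 x + d2 (x, y)) / 2.
  exact: (jacobian_amgm2 (rho2_gt0 _) (h0 _) (d10 _) (d20 _) (hF _) (FE x y)).
pose A p := 1 / 32 * (v1 p ^+ 2 + v2 p ^+ 2) + - (1 / 4) * ((p.1 * v1 p + p.2 * v2 p) / rho2 p).
pose B p := 1 / 2 * ((p.1 ^+ 2 + p.2 ^+ 2) / rho2 p ^+ 2).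
have cA : continuous A by rewrite /A; cts.
have cB : continuous B by rewrite /B; cts.
have step2 x y : h (x, y) * (d1 x + d2 (x, y)) / 2 <=
    (W1 (x, y) + W2 (x, y)) * (1 / 2) + (A (x, y) + B (x, y) +
     1 / 2 * (T1 x ^+ 2 + T2 (x, y) ^+ 2) * F (x, y)).
  exact: (transport_young2 _ _ _ _ _ _ x y (rho0 (x, y)) (hF (x, y))).
have cTF : continuous (fun p : R * R => rho2 (T1 p.1, T2 p) * F p) by cts.
have cT2F : continuous (fun p : R * R => 1 / 2 * (T1 p.1 ^+ 2 + T2 p ^+ 2) * F p) by cts.
have cW : continuous (fun p => (W1 p + W2 p) * (1 / 2)) by cts.
have cAB : continuous (fun p : R * R => A p + B p + 1 / 2 * (T1 p.1 ^+ 2 + T2 p ^+ 2) * F p).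
  exact: continuous_add (continuous_add cA cB) cT2F.
have cR := continuous_add cW cAB.
have := itg2_le cTF cR (fun x y (_ : - r <= x <= r) (_ : - r <= y <= r) =>
  le_trans (step1 x y) (step2 x y)).
(* The transport property, applied here to [rho2] and below to half the squared norm, removes the
   map from the inequality. *)
have -> : itg2 (- r) r (- r) r (fun p : R * R => rho2 (T1 p.1, T2 p) * F p) =
    itg2 (- r) r (- r) r (fun p => (rho2 p)^-1).
  transitivity (itg2 (- r) r (- r) r (fun p => rho2 p * rho2 p ^- 2)).
    exact: (Fphi rho2 crho).
  apply: eq_itg2 => x y _ _ /=.
  by have := rho0 (x, y); set q := rho2 _ => q0; field.
rewrite (itg2D _ _ _ _ cW cAB) (itg2D _ _ _ _ (continuous_add cA cB) cT2F) (itg2D _ _ _ _ cA cB).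
have -> : itg2 (- r) r (- r) r (fun p : R * R => 1 / 2 * (T1 p.1 ^+ 2 + T2 p ^+ 2) * F p)
    = itg2 (- r) r (- r) r B.
  have c1 : continuous (fun p : R * R => 1 / 2 * (p.1 ^+ 2 + p.2 ^+ 2)) by cts.
  transitivity (itg2 (- r) r (- r) r (fun p => 1 / 2 * (p.1 ^+ 2 + p.2 ^+ 2) * rho2 p ^- 2)).
    exact: (Fphi _ c1).
  by apply: eq_itg2 => x y _ _ /=; rewrite /B/= mulrA.
have -> : itg2 (- r) r (- r) r (fun p => (W1 p + W2 p) * (1 / 2)) = 1 / 2 * (r * square_boundary r h).
  by rewrite -IBP -itg2Z; [apply: eq_itg2 => x y _ _; ring|cts].
have cD : continuous (fun p : R * R => v1 p ^+ 2 + v2 p ^+ 2) by cts.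
have cX : continuous (fun p : R * R => (p.1 * v1 p + p.2 * v2 p) / rho2 p) by cts.
have cst2 (c : R) : continuous (fun _ : R * R => c) by cts.
have -> : itg2 (- r) r (- r) r A =
    1 / 32 * itg2 (- r) r (- r) r (fun p => v1 p ^+ 2 + v2 p ^+ 2) +
    - (1 / 4) * itg2 (- r) r (- r) r (fun p => (p.1 * v1 p + p.2 * v2 p) / rho2 p).
  rewrite (itg2D _ _ _ _ (continuous_mul (cst2 (1 / 32)) cD) (continuous_mul (cst2 (- (1 / 4))) cX)).
  by rewrite (itg2Z _ _ _ _ _ cD) (itg2Z _ _ _ _ _ cX).
have SD := square_divergence r0 cv cv1 cv2 dv1 dv2.
have ve1 p : r <= `|p.1| \/ r <= `|p.2| -> v p <= e.
  by move=> /ve; rewrite ler_norml => /andP[].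
have ve2 p : r <= `|p.1| \/ r <= `|p.2| -> - e <= v p.
  by move=> /ve; rewrite ler_norml => /andP[].
have B1 : r * square_boundary r h <= Num.sqrt k * expR (e / 2) * (2 * m).
  apply: (square_boundary_ratio_le r0 ch) => p pr.
  rewrite /h mul1r ler_pM2r ?invr_gt0 ?rho2_gt0// ler_pM2l ?sqrtr_gt0//.
  by rewrite ler_expR ler_pM2r ?invr_gt0//; exact: ve1.
have cvr : continuous (fun p => v p / rho2 p) by cts.
have B2 : - e * (2 * m) <= r * square_boundary r (fun p => v p / rho2 p).
  apply: (square_boundary_ratio_ge r0 cvr) => p pr.
  rewrite mul1r ler_pM2r ?invr_gt0 ?rho2_gt0//; exact: ve2.
(* The integral of [1 / rho2] exceeds [m] by twice that of [B]. The two copies on the right, one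
   from [B] itself and one from the squared norm of the map, cancel this excess. *)
have E2 := itg2_inv_rho2 r; rewrite -/m -/B in E2.
have cV : continuous (fun p => v p / rho2 p ^+ 2) by cts.
have E3 : itg2 (- r) r (- r) r (fun p => 2 * v p / rho2 p ^+ 2) =
    2 * itg2 (- r) r (- r) r (fun p => v p / rho2 p ^+ 2).
  by rewrite -(itg2Z _ _ _ _ _ cV); apply: eq_itg2 => x y _ _; rewrite mulrA.
move: SD B1 B2; rewrite E3 E2 -/k.
set X := itg2 _ _ _ _ (fun p => _ / rho2 p); set V := itg2 _ _ _ _ (fun p => v p / _).
set D := itg2 _ _ _ _ (fun p => v1 p ^+ 2 + _); set IB := itg2 _ _ _ _ _.
set b1 := _ * square_boundary r _; set b2 := _ * square_boundary r h.
set sq := Num.sqrt k * _.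
clearbody X V D IB b1 b2 sq m.
clear -m; lra.
Qed.

End onofri_box.

(** * The sharp trace inequality on a half box *)

Section trace_box.
Context {R : realType}.

Lemma amgm3 (a b c : R) : 0 < a -> 0 < b -> 0 < c -> 27 * (a * b * c) <= (a + b + c) ^+ 3.
Proof.
move=> a0 b0 c0; rewrite -subr_ge0.
have -> : (a + b + c) ^+ 3 - 27 * (a * b * c) =
    (a + b + c) / 2 * ((a - b) ^+ 2 + (b - c) ^+ 2 + (c - a) ^+ 2) +
    3 * (a * (b - c) ^+ 2 + b * (c - a) ^+ 2 + c * (a - b) ^+ 2) by field.
have := sqr_ge0 (a - b); have := sqr_ge0 (b - c); have := sqr_ge0 (c - a).
move=> h1 h2 h3; have abc : 0 <= (a + b + c) / 2 by lra.
apply: addr_ge0; first by rewrite mulr_ge0// !addr_ge0.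
by rewrite mulr_ge0// !addr_ge0// mulr_ge0// ltW.
Qed.

(** The density is [f^6] and the target [q^-3]. In dimension 3 the exponent 6 is the critical
    Sobolev exponent, and 4 is the critical exponent of the trace. *)
Lemma jacobian_amgm3 (q f a b c : R) : 0 < q -> 0 < f -> 0 < a -> 0 < b -> 0 < c ->
  f ^+ 6 = a * b * c * q ^- 3 -> q * f ^+ 6 <= f ^+ 4 * (a + b + c) / 3.
Proof.
move=> q0 f0 a0 b0 c0 FE.
have h1 : 0 <= q * f ^+ 6 by rewrite mulr_ge0 ?exprn_ge0 ?ltW.
have h2 : 0 <= f ^+ 4 * (a + b + c) / 3.
  by rewrite !mulr_ge0 ?exprn_ge0 ?ltW ?addr_gt0.
rewrite -(ler_pXn2r (n := 3))// ?nnegrE//.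
have -> : (q * f ^+ 6) ^+ 3 = f ^+ 12 * (a * b * c).
  have -> : (q * f ^+ 6) ^+ 3 = f ^+ 12 * (f ^+ 6 * q ^+ 3) by ring.
  by rewrite FE mulfVK// expf_neq0// gt_eqF.
have -> : (f ^+ 4 * (a + b + c) / 3) ^+ 3 = f ^+ 12 * ((a + b + c) ^+ 3 / 27) by field.
by rewrite ler_pM2l ?exprn_gt0// ler_pdivlMr// mulrC amgm3.
Qed.

(** [4 f^3 f_i] is the gradient of [f^4]. The defect is [2 / (3 k)] times the sum of the squares of
    [k f_i + f^3 t_i]; the free parameter [k] is optimized in [trace_optimize]. *)
Lemma transport_young3 (k f f1 f2 f3 t1 t2 t3 e1 e2 e3 : R) : 0 < k ->
  f ^+ 4 * (e1 + e2 + e3) / 3 <=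
  (4 * f ^+ 3 * f1 * t1 + f ^+ 4 * e1 + (4 * f ^+ 3 * f2 * t2 + f ^+ 4 * e2) +
   (4 * f ^+ 3 * f3 * t3 + f ^+ 4 * e3)) * (1 / 3) +
  (2 * k / 3 * (f1 ^+ 2 + f2 ^+ 2 + f3 ^+ 2) +
   2 / (3 * k) * (t1 ^+ 2 + t2 ^+ 2 + t3 ^+ 2) * f ^+ 6).
Proof.
move=> k0.
pose s := 2 / (3 * k) * ((k * f1 + f ^+ 3 * t1) ^+ 2 + (k * f2 + f ^+ 3 * t2) ^+ 2 +
  (k * f3 + f ^+ 3 * t3) ^+ 2).
have s0 : 0 <= s.
  apply: mulr_ge0; first by rewrite divr_ge0// mulr_ge0// ltW.
  by apply: addr_ge0; [apply: addr_ge0|]; exact: sqr_ge0.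
rewrite -subr_ge0; set S := (X in 0 <= X).
have -> : S = s by rewrite /S /s; field; rewrite gt_eqF.
exact: s0.
Qed.

Lemma mulf_exprV3 (q : R) : q != 0 -> q * q ^- 3 = q ^- 2.
Proof. by move=> q0; field. Qed.

Lemma face_pair_le (r a b c : R) : 0 <= r -> a <= c -> b <= c ->
  a * r - b * (- r) <= 2 * r * c.
Proof. by move=> r0 ac bc; nra. Qed.

Lemma face_top_le (r a b c : R) : 0 <= r -> a <= c -> a * r - b * 1 + b <= 2 * r * c / 2.
Proof. by move=> r0 ac; nra. Qed.

Lemma far_faces_le (r c : R) : 1 < r -> 0 <= c ->
  2 * r * c * (r - 1) * (r - - r) + 2 * r * c * (r - 1) * (r - - r) +
  2 * r * c / 2 * (r - - r) * (r - - r) <= 12 * r ^+ 3 * c.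
Proof.
move=> r1 c0; rewrite -subr_ge0; set S := (X in 0 <= X).
have -> : S = 8 * r ^+ 2 * c by rewrite /S; field.
by rewrite mulr_ge0// mulr_ge0// sqr_ge0.
Qed.

Lemma sqr_le_add3 (r a b c : R) : r ^+ 2 = a ^+ 2 \/ r ^+ 2 = b ^+ 2 \/ r ^+ 2 = c ^+ 2 ->
  r ^+ 2 <= a ^+ 2 + b ^+ 2 + c ^+ 2.
Proof.
have := sqr_ge0 a; have := sqr_ge0 b; have := sqr_ge0 c.
by move=> h1 h2 h3 [|[]] ->; lra.
Qed.

Lemma pow4_ge0 (C r : R) : 0 < r -> 0 <= C ^+ 2 / r ^+ 4.
Proof. by move=> r0; rewrite divr_ge0 ?sqr_ge0// exprn_ge0// ltW. Qed.

Lemma pow4_le (C r q f : R) : 0 < r -> 0 < q -> f ^+ 2 <= C / q -> r ^+ 2 <= q ->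
  f ^+ 4 <= C ^+ 2 / r ^+ 4.
Proof.
move=> r0 q0 fC rp; have C0 : 0 <= C.
  by have := le_trans (sqr_ge0 _) fC; rewrite pmulr_lge0// invr_gt0.
have fr : f ^+ 2 <= C / r ^+ 2.
  apply: (le_trans fC); apply: ler_wpM2l => //.
  by rewrite lef_pV2// posrE// exprn_gt0.
have -> : f ^+ 4 = (f ^+ 2) ^+ 2 by ring.
have -> : C ^+ 2 / r ^+ 4 = (C / r ^+ 2) ^+ 2 by field; rewrite gt_eqF.
by rewrite ler_pXn2r// nnegrE ?sqr_ge0// divr_ge0// exprn_ge0// ltW.
Qed.

(** The squared norm on the region [z >= 1]; the truncation keeps it at least 1, hence its negative
    powers continuous, on the whole space. The density [rho3^-3] is the sixth power of [1 / |X|],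
    which is up to a factor the Kelvin transform of a constant. *)
Definition rho3 (p : R * R * R) : R := p.1.1 ^+ 2 + p.1.2 ^+ 2 + (Num.max 1 p.2) ^+ 2.

Lemma rho3_ge1 p : 1 <= rho3 p.
Proof.
have : 1 <= Num.max 1 p.2 by rewrite le_max lexx.
by rewrite /rho3; nra.
Qed.
Lemma rho3_gt0 p : 0 < rho3 p.
Proof. exact: lt_le_trans (rho3_ge1 p). Qed.
Lemma rho3_neq0 p : rho3 p != 0.
Proof. by rewrite gt_eqF// rho3_gt0. Qed.
Lemma continuous_rho3 : continuous rho3.
Proof. by rewrite /rho3; cts. Qed.
Lemma rho3_exprV_gt0 n p : 0 < rho3 p ^- n.
Proof. by rewrite invr_gt0 exprn_gt0// rho3_gt0. Qed.
Lemma rho3_expr_neq0 n p : rho3 p ^+ n != 0.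
Proof. by rewrite expf_neq0// rho3_neq0. Qed.
Lemma rho3E (x y z : R) : 1 <= z -> rho3 (x, y, z) = x ^+ 2 + y ^+ 2 + z ^+ 2.
Proof. by move=> z1; rewrite /rho3/= (max_idPr z1). Qed.
Lemma rho3_top (x y r : R) : 1 <= r -> r ^+ 2 <= rho3 (x, y, r).
Proof. by move=> r1; rewrite rho3E//; apply: sqr_le_add3; right; right. Qed.
Lemma rho3_bottom (x y : R) : rho3 (x, y, 1) = rho2 (x, y).
Proof. by rewrite rho3E// /rho2/=; ring. Qed.

Definition half_box (r : R) (F : R * R * R -> R) := itg3 (- r) r (- r) r 1 r F.

Lemma face_bound (a b c d M : R) (w : R * R -> R) : a <= b -> c <= d -> continuous w ->
  (forall x y, a <= x <= b -> c <= y <= d -> w (x, y) <= M) ->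
  itg2 a b c d w <= M * (d - c) * (b - a).
Proof.
move=> ab cd cw wM; rewrite -itg2_cst//; apply: itg2_le => //.
exact: continuous_cst.
Qed.

Lemma is_derive_exp4 (f : R -> R) (x f' : R) : is_derive x 1 f f' ->
  is_derive x 1 (fun x => f x ^+ 4) (4 * f x ^+ 3 * f').
Proof.
move=> df; apply: is_derive_eq; rewrite /GRing.scale/=; ring.
Qed.

(** Transport of [f^6] to [rho3^-3], the divergence of the map being taken against [f^4]. The bottom
    face [z = 1] produces the trace term, and decay makes the other five faces [O(1/r)]. *)
Lemma trace_half_box (r k C : R) (f f1 f2 f3 : R * R * R -> R) : 1 < r -> 0 < k ->
  continuous f -> continuous f1 -> continuous f2 -> continuous f3 ->
  (forall p, 0 < f p) ->
  (forall x y z : R, is_derive x 1 (fun x => f (x, y, z)) (f1 (x, y, z))) ->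
  (forall x y z : R, is_derive y 1 (fun y => f (x, y, z)) (f2 (x, y, z))) ->
  (forall x y z : R, 1 < z -> is_derive z 1 (fun z => f (x, y, z)) (f3 (x, y, z))) ->
  (forall p, f p ^+ 2 <= C / rho3 p) ->
  half_box r (fun p => f p ^+ 6) = half_box r (fun p => rho3 p ^- 3) ->
  itg2 (- r) r (- r) r (fun p => f (p, 1) ^+ 4) + 3 * half_box r (fun p => rho3 p ^- 2) <=
  2 * k * half_box r (fun p => f1 p ^+ 2 + f2 p ^+ 2 + f3 p ^+ 2)
  + 2 / k * half_box r (fun p => rho3 p ^- 2) + 12 * C ^+ 2 / r.
Proof.
move=> r1 k0 cf cf1 cf2 cf3 f0 df1 df2 df3 fC mass.
have crho := continuous_rho3; have rho0 := rho3_neq0.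
have rho20 := rho3_expr_neq0 2.
have rho30 := rho3_expr_neq0 3.
have r0 : 0 < r by exact: lt_trans r1.
have rr : - r < r by rewrite -subr_gt0 opprK addr_gt0.
have rr' := ltW rr; have r1' := ltW r1.
have cF : continuous (fun p => f p ^+ 6) by cts.
have cG : continuous (fun p => rho3 p ^- 3) by cts.
have F0 p : 0 < f p ^+ 6 by exact: exprn_gt0.
have G0 := rho3_exprV_gt0 3.
have [T1 [d1 [T2 [d2 [T3 [d3 [[[cT1 cd1] [cT2 cd2] [cT3 cd3]] [T1r T2r T3r]
  [[T1l T1h] T2e T3e] [[d10 d20 d30] dT1 dT2 dT3] [FE Fphi]]]]]]]] :=
  knothe3 rr rr r1 cF cG F0 G0 mass.
pose W1 p := 4 * f p ^+ 3 * f1 p * T1 p.1.1 + f p ^+ 4 * d1 p.1.1.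
pose W2 p := 4 * f p ^+ 3 * f2 p * T2 p.1 + f p ^+ 4 * d2 p.1.
pose W3 p := 4 * f p ^+ 3 * f3 p * T3 p + f p ^+ 4 * d3 p.
pose V1 p := f p ^+ 4 * T1 p.1.1.
pose V2 p := f p ^+ 4 * T2 p.1.
pose V3 p := f p ^+ 4 * T3 p.
have cT1' : continuous (fun p : R * R * R => T1 p.1.1) by cts.
have cd1' : continuous (fun p : R * R * R => d1 p.1.1) by cts.
have cT2' : continuous (fun p : R * R * R => T2 p.1) by cts.
have cd2' : continuous (fun p : R * R * R => d2 p.1) by cts.
have cf4 : continuous (fun p => f p ^+ 4) by cts.
have cW1 : continuous W1 by rewrite /W1; cts.
have cW2 : continuous W2 by rewrite /W2; cts.
have cW3 : continuous W3 by rewrite /W3; cts.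
have cV1 : continuous V1 by rewrite /V1; cts.
have cV2 : continuous V2 by rewrite /V2; cts.
have cV3 : continuous V3 by rewrite /V3; cts.
have dV1 (x y z : R) : - r < x < r -> is_derive x 1 (fun x => V1 (x, y, z)) (W1 (x, y, z)).
  move=> xr.
  exact: (is_derive_mul (is_derive_exp4 (df1 x y z)) (dT1 x xr)).
have dV2 (x y z : R) : - r < y < r -> is_derive y 1 (fun y => V2 (x, y, z)) (W2 (x, y, z)).
  move=> yr.
  exact: (is_derive_mul (is_derive_exp4 (df2 x y z)) (dT2 x y yr)).
have dV3 (x y z : R) : 1 < z < r -> is_derive z 1 (fun z => V3 (x, y, z)) (W3 (x, y, z)).
  move=> zr; have z1 : 1 < z by case/andP: zr.
  exact: (is_derive_mul (is_derive_exp4 (df3 x y z z1)) (dT3 (x, y) z zr)).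
have IBP := divergence3 rr' rr' r1' cV1 cV2 cV3 cW1 cW2 cW3 dV1 dV2 dV3.
have f4C p : r ^+ 2 <= rho3 p -> f p ^+ 4 <= C ^+ 2 / r ^+ 4.
  exact: (pow4_le r0 (rho3_gt0 p) (fC p)).
have nn : 0 <= C ^+ 2 / r ^+ 4 := pow4_ge0 C r0.
pose M := 2 * r * (C ^+ 2 / r ^+ 4).
have face1 : itg2 (- r) r 1 r (fun q => V1 (r, q.1, q.2) - V1 (- r, q.1, q.2)) <=
    M * (r - 1) * (r - - r).
  apply: face_bound; [exact: rr'|exact: r1'|by cts|].
  move=> y z _ _; rewrite /V1/= T1l T1h.
  have h1 : f (r, y, z) ^+ 4 <= C ^+ 2 / r ^+ 4 by apply: f4C; apply: sqr_le_add3; left.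
  have h2 : f (- r, y, z) ^+ 4 <= C ^+ 2 / r ^+ 4.
    by apply: f4C; apply: sqr_le_add3; left; rewrite /= sqrrN.
  exact: (face_pair_le (ltW r0) h1 h2).
have face2 : itg2 (- r) r 1 r (fun q => V2 (q.1, r, q.2) - V2 (q.1, - r, q.2)) <=
    M * (r - 1) * (r - - r).
  apply: face_bound; [exact: rr'|exact: r1'|by cts|].
  move=> y z _ _; rewrite /V2/=; have [-> ->] := T2e y.
  have h1 : f (y, r, z) ^+ 4 <= C ^+ 2 / r ^+ 4 by apply: f4C; apply: sqr_le_add3; right; left.
  have h2 : f (y, - r, z) ^+ 4 <= C ^+ 2 / r ^+ 4.
    by apply: f4C; apply: sqr_le_add3; right; left; rewrite /= sqrrN.
  exact: (face_pair_le (ltW r0) h1 h2).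
(* On the bottom face the third coordinate of the map is exactly 1, so this face contributes the
   trace integral itself. *)
have face3 : itg2 (- r) r (- r) r (fun q => V3 (q, r) - V3 (q, 1)) <=
    M / 2 * (r - - r) * (r - - r) - itg2 (- r) r (- r) r (fun p => f (p, 1) ^+ 4).
  rewrite lerBrDr -itg2D; [|by cts|by cts].
  apply: face_bound; [exact: rr'|exact: rr'|by cts|].
  move=> x y _ _; rewrite /V3/=; have [-> ->] := T3e (x, y).
  have h1 : f (x, y, r) ^+ 4 <= C ^+ 2 / r ^+ 4.
    exact: (f4C _ (rho3_top x y r1')).
  exact: (face_top_le _ (ltW r0) h1).
have step1 x y z : rho3 (T1 x, T2 (x, y), T3 (x, y, z)) * f (x, y, z) ^+ 6 <=
    f (x, y, z) ^+ 4 * (d1 x + d2 (x, y) + d3 (x, y, z)) / 3.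
  exact: (jacobian_amgm3 (rho3_gt0 _) (f0 _) (d10 _) (d20 _) (d30 _) (FE x y z)).
pose N p := f1 p ^+ 2 + f2 p ^+ 2 + f3 p ^+ 2.
pose tau (p : R * R * R) := p.1.1 ^+ 2 + p.1.2 ^+ 2 + p.2 ^+ 2.
pose L p := 2 / (3 * k) * tau (T1 p.1.1, T2 p.1, T3 p) * f p ^+ 6.
have step2 x y z := transport_young3 (f (x, y, z)) (f1 (x, y, z)) (f2 (x, y, z))
  (f3 (x, y, z)) (T1 x) (T2 (x, y)) (T3 (x, y, z)) (d1 x) (d2 (x, y)) (d3 (x, y, z)) k0.
have ctau : continuous tau by rewrite /tau; cts.
have cN : continuous N by rewrite /N; cts.
have cst3 (c : R) : continuous (fun _ : R * R * R => c) by exact: continuous_cst.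
have cS : continuous (fun p : R * R * R => (T1 p.1.1, T2 p.1, T3 p)).
  exact: (continuous_pair_mk (continuous_pair_mk cT1' cT2') cT3).
have cL : continuous L.
  exact: (continuous_mul (continuous_mul (cst3 (2 / (3 * k))) (continuous_comp_top ctau cS)) cF).
have cTF : continuous (fun p : R * R * R => rho3 (T1 p.1.1, T2 p.1, T3 p) * f p ^+ 6).
  exact: (continuous_mul (continuous_comp_top crho cS) cF).
have cW := continuous_add (continuous_add cW1 cW2) cW3.
have cWk := continuous_mul cW (cst3 (1 / 3)).
have cNk := continuous_mul (cst3 (2 * k / 3)) cN.
have cNL := continuous_add cNk cL.
have := itg3_le cTF (continuous_add cWk cNL)
  (fun x y z (_ : - r <= x <= r) (_ : - r <= y <= r) (_ : 1 <= z <= r) =>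
   le_trans (step1 x y z) (step2 x y z)).
rewrite (itg3D _ _ _ _ _ _ cWk cNL) (itg3D _ _ _ _ _ _ cNk cL) (itg3Z _ _ _ _ _ _ _ cN).
have -> : itg3 (- r) r (- r) r 1 r (fun p => (W1 p + W2 p + W3 p) * (1 / 3)) =
    1 / 3 * itg3 (- r) r (- r) r 1 r (fun p => W1 p + W2 p + W3 p).
  by rewrite -(itg3Z _ _ _ _ _ _ _ cW); apply: eq_itg3 => x y z _ _ _; rewrite mulrC.
have cr2 : continuous (fun p => rho3 p ^- 2) by cts.
have -> : itg3 (- r) r (- r) r 1 r (fun p => rho3 (T1 p.1.1, T2 p.1, T3 p) * f p ^+ 6) =
    half_box r (fun p => rho3 p ^- 2).
  transitivity (itg3 (- r) r (- r) r 1 r (fun p => rho3 p * rho3 p ^- 3)).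
    exact: (Fphi rho3 crho).
  apply: eq_itg3 => x y z _ _ _; exact: (mulf_exprV3 (rho0 (x, y, z))).
have ctk := continuous_mul (cst3 (2 / (3 * k))) ctau.
have -> : itg3 (- r) r (- r) r 1 r L = 2 / (3 * k) * half_box r (fun p => rho3 p ^- 2).
  rewrite -(itg3Z _ _ _ _ _ _ _ cr2).
  transitivity (itg3 (- r) r (- r) r 1 r (fun p => 2 / (3 * k) * tau p * rho3 p ^- 3)).
    exact: (Fphi _ ctk).
  (* The target box lies in [z >= 1], where [rho3] is the squared norm [tau]. *)
  apply: eq_itg3 => x y z _ _ /andP[z1 _]; rewrite /tau/= -(rho3E _ _ z1).
  by rewrite -[in LHS]mulrA (mulf_exprV3 (rho0 (x, y, z))).
rewrite IBP -/(half_box r N).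
have M12 : M * (r - 1) * (r - - r) + M * (r - 1) * (r - - r) + M / 2 * (r - - r) * (r - - r)
    <= 12 * C ^+ 2 / r.
  have -> : 12 * C ^+ 2 / r = 12 * r ^+ 3 * (C ^+ 2 / r ^+ 4).
    by clear -r0; field; rewrite gt_eqF.
  exact: (far_faces_le r1 nn).
have k3 : 2 / k = 3 * (2 / (3 * k)).
  by clear -k0; field; rewrite gt_eqF.
rewrite k3.
move: face1 face2 face3 M12.
set u1 := itg2 _ _ _ _ _; set u2 := itg2 _ _ _ _ _; set u3 := itg2 _ _ _ _ _.
set u4 := itg2 _ _ _ _ _; set J := half_box r _; set E := half_box r N.
set m1 := M * _ * _; set m2 := M / 2 * _ * _; set m3 := 12 * _ / r; set kk := 2 / (3 * k).
clearbody u1 u2 u3 u4 J E m1 m2 m3 kk.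
clear -E; lra.
Qed.

End trace_box.

(** * Scaling, and the energy of harmonic functions on a half box *)

Section trace_energy.
Context {R : realType}.

(** [c] is the normalizing factor of [f] and has to drop out. With [s^2 = c^2 E / J], the choice
    [k = 1 / s] makes both terms in [k] equal to [2 s J]; then [4 s - 3 <= s^4] gives a bound in
    which the powers of [c] agree. *)
Lemma trace_optimize (A E J D c : R) : 0 < c -> 0 < J -> 0 <= E ->
  (forall k, 0 < k -> c ^+ 4 * A + 3 * J <= 2 * k * (c ^+ 2 * E) + 2 / k * J + c ^+ 4 * D) ->
  A <= E ^+ 2 / J + D.
Proof.
move=> c0 J0 E0 H; have c40 : 0 < c ^+ 4 by exact: exprn_gt0.
rewrite -(ler_pM2l c40) mulrDr.
move: E0; rewrite le_eqVlt => /predU1P[E0|E0].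
  have := H 1 ltr01; rewrite -E0 expr0n/= mul0r !mulr0 divr1.
  by clear -J0; lra.
pose s := Num.sqrt (c ^+ 2 * E / J).
have s0 : 0 < s by rewrite sqrtr_gt0 divr_gt0// mulr_gt0// exprn_gt0.
have s2 : s ^+ 2 = c ^+ 2 * E / J by rewrite sqr_sqrtr// ltW// divr_gt0// mulr_gt0// exprn_gt0.
have cE : c ^+ 2 * E = s ^+ 2 * J by rewrite s2 mulfVK// gt_eqF.
have k0 : 0 < s^-1 by rewrite invr_gt0.
have := H _ k0; rewrite cE invrK => {}H.
have -> : c ^+ 4 * (E ^+ 2 / J) = s ^+ 4 * J.
  have -> : c ^+ 4 * (E ^+ 2 / J) = (c ^+ 2 * E) ^+ 2 / J by ring.
  by rewrite cE; field; rewrite gt_eqF.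
have h1 : 2 * s^-1 * (s ^+ 2 * J) = 2 * s * J by field; rewrite gt_eqF.
rewrite h1 in H.
have h2 : 0 <= (s ^+ 4 - 4 * s + 3) * J.
  apply: mulr_ge0; last exact: ltW.
  have -> : s ^+ 4 - 4 * s + 3 = (s - 1) ^+ 2 * ((s + 1) ^+ 2 + 2) by ring.
  by rewrite mulr_ge0 ?sqr_ge0// addr_ge0// sqr_ge0.
by nra.
Qed.

Lemma root6_ex (m : R) : 0 < m -> exists2 c : R, 0 < c & c ^+ 6 = m.
Proof.
move=> m0; exists (m `^ (6%:R)^-1); first exact: powR_gt0.
by rewrite -powR_mulrn ?powR_ge0// -powRrM mulVf// powRr1// ltW.
Qed.

Lemma is_derive_scale (k : R) (f : R -> R) (x f' : R) : is_derive x 1 f f' ->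
  is_derive x 1 (fun x => k * f x) (k * f').
Proof. by move=> df; apply: is_derive_eq. Qed.

(** The mass normalization is removed by applying [trace_half_box] to [c f], with [c^6] the quotient
    of the masses. *)
Lemma trace_half_box_scaled (r C : R) (f f1 f2 f3 : R * R * R -> R) : 1 < r ->
  continuous f -> continuous f1 -> continuous f2 -> continuous f3 ->
  (forall p, 0 < f p) ->
  (forall x y z : R, is_derive x 1 (fun x => f (x, y, z)) (f1 (x, y, z))) ->
  (forall x y z : R, is_derive y 1 (fun y => f (x, y, z)) (f2 (x, y, z))) ->
  (forall x y z : R, 1 < z -> is_derive z 1 (fun z => f (x, y, z)) (f3 (x, y, z))) ->
  (forall p, f p ^+ 2 <= C / rho3 p) ->
  itg2 (- r) r (- r) r (fun p => f (p, 1) ^+ 4) <=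
  half_box r (fun p => f1 p ^+ 2 + f2 p ^+ 2 + f3 p ^+ 2) ^+ 2
  / half_box r (fun p => rho3 p ^- 2) + 12 * C ^+ 2 / r.
Proof.
move=> r1 cf cf1 cf2 cf3 f0 df1 df2 df3 fC.
have crho := @continuous_rho3 R.
have rho20 := @rho3_expr_neq0 R 2; have rho30 := @rho3_expr_neq0 R 3.
have r0 : 0 < r by exact: lt_trans r1.
have rr : - r < r by rewrite -subr_gt0 opprK addr_gt0.
have cF : continuous (fun p => f p ^+ 6) by cts.
have cG : continuous (fun p : R * R * R => rho3 p ^- 3) by cts.
have cJ : continuous (fun p : R * R * R => rho3 p ^- 2) by cts.
have F0 p : 0 < f p ^+ 6 by exact: exprn_gt0.
have mF : 0 < half_box r (fun p => f p ^+ 6) by exact: (itg3_gt0 rr rr r1 cF F0).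
have mG : 0 < half_box r (fun p => rho3 p ^- 3).
  exact: (itg3_gt0 rr rr r1 cG (rho3_exprV_gt0 3)).
have mJ : 0 < half_box r (fun p => rho3 p ^- 2).
  exact: (itg3_gt0 rr rr r1 cJ (rho3_exprV_gt0 2)).
have [c c0 cE] := root6_ex (divr_gt0 mG mF).
pose N p := f1 p ^+ 2 + f2 p ^+ 2 + f3 p ^+ 2.
have cN : continuous N by rewrite /N; cts.
have N0 : 0 <= half_box r N.
  by apply: itg3_ge0 => x y z _ _ _; rewrite /N !addr_ge0// sqr_ge0.
apply: (trace_optimize c0 mJ N0) => k k0.
have cst3 (a : R) : continuous (fun _ : R * R * R => a) by exact: continuous_cst.
have ccf (g : R * R * R -> R) : continuous g -> continuous (fun p => c * g p).
  by move=> cg; exact: (continuous_mul (cst3 c) cg).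
have cf0 p : 0 < c * f p by exact: mulr_gt0.
have cdf1 (x y z : R) := is_derive_scale c (df1 x y z).
have cdf2 (x y z : R) := is_derive_scale c (df2 x y z).
have cdf3 (x y z : R) (z1 : 1 < z) := is_derive_scale c (df3 x y z z1).
have cfC p : (c * f p) ^+ 2 <= c ^+ 2 * C / rho3 p.
  by rewrite exprMn -mulrA ler_pM2l ?exprn_gt0//; exact: fC.
have mass : half_box r (fun p => (c * f p) ^+ 6) = half_box r (fun p => rho3 p ^- 3).
  transitivity (half_box r (fun p => c ^+ 6 * f p ^+ 6)).
    by apply: eq_itg3 => x y z _ _ _; exact: exprMn.
  rewrite /half_box (itg3Z _ _ _ _ _ _ _ cF) cE.
  exact: (mulfVK (lt0r_neq0 mF)).
have := trace_half_box r1 k0 (ccf _ cf) (ccf _ cf1) (ccf _ cf2) (ccf _ cf3) cf0 cdf1 cdf2 cdf3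
  cfC mass.
have cA : continuous (fun p : R * R => f (p, 1) ^+ 4) by cts.
have -> : itg2 (- r) r (- r) r (fun p => (c * f (p, 1)) ^+ 4) =
    c ^+ 4 * itg2 (- r) r (- r) r (fun p => f (p, 1) ^+ 4).
  by rewrite -(itg2Z _ _ _ _ _ cA); apply: eq_itg2 => x y _ _; exact: exprMn.
have -> : half_box r (fun p => (c * f1 p) ^+ 2 + (c * f2 p) ^+ 2 + (c * f3 p) ^+ 2) =
    c ^+ 2 * half_box r N.
  rewrite /half_box -(itg3Z _ _ _ _ _ _ _ cN); apply: eq_itg3 => x y z _ _ _.
  by rewrite /N !exprMn !mulrDr.
have -> : 12 * (c ^+ 2 * C) ^+ 2 / r = c ^+ 4 * (12 * C ^+ 2 / r).
  by clear; ring.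
by [].
Qed.

Lemma is_derive_rho3_1 (x y z : R) : is_derive x 1 (fun x => rho3 (x, y, z)) (2 * x).
Proof. rewrite /rho3/=; apply: is_derive_eq; rewrite /GRing.scale/=; ring. Qed.
Lemma is_derive_rho3_2 (x y z : R) : is_derive y 1 (fun y => rho3 (x, y, z)) (2 * y).
Proof. rewrite /rho3/=; apply: is_derive_eq; rewrite /GRing.scale/=; ring. Qed.

(* On [1 < z] the truncation [max 1 z] is invisible to derivatives. *)
Lemma is_derive_max1 (f : R -> R) (z f' : R) : 1 < z -> is_derive z 1 f f' ->
  is_derive z 1 (fun z => f (Num.max 1 z)) f'.
Proof.
move=> z1 df; apply: (near_eq_is_derive _ df).
near=> t; rewrite (max_idPr _)//.
by near: t; exact: lt_le_nbhsr.
Unshelve. all: by end_near. Qed.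

Lemma is_derive_rho3_3 (x y z : R) : 1 < z ->
  is_derive z 1 (fun z => rho3 (x, y, z)) (2 * Num.max 1 z).
Proof.
move=> z1; rewrite (max_idPr (ltW z1)) /rho3/=.
apply: (@is_derive_max1 (fun z => x ^+ 2 + y ^+ 2 + z ^+ 2) _ _ z1).
apply: is_derive_eq; rewrite /GRing.scale/=; ring.
Qed.

Lemma is_derive_div_sqr (u q : R -> R) (x u' q' : R) : q x != 0 ->
  is_derive x 1 u u' -> is_derive x 1 q q' ->
  is_derive x 1 (fun x => u x / q x ^+ 2) (u' / q x ^+ 2 - 2 * u x * q' / q x ^+ 3).
Proof.
move=> q0 du dq; have q20 : q x ^+ 2 != 0 by rewrite expf_neq0.
apply: is_derive_eq; rewrite /GRing.scale/=; field; exact: q0.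
Qed.

(** The field [X / |X|^4] has divergence [- |X|^-4]; its flux through the bottom face is the planar
    integral of [rho2^-2], and the far faces contribute [O(1/r)]. *)
Lemma half_box_inv_rho2 (r : R) : 1 < r ->
  itg2 (- r) r (- r) r (fun p => rho2 p ^- 2) - 12 / r <= half_box r (fun p => rho3 p ^- 2)
  <= itg2 (- r) r (- r) r (fun p => rho2 p ^- 2).
Proof.
move=> r1; have crho := @continuous_rho3 R; have rho0 := @rho3_neq0 R.
have rho20 := @rho3_expr_neq0 R 2; have rho30 := @rho3_expr_neq0 R 3.
have r0 : 0 < r by exact: lt_trans r1.
have rr : - r <= r by rewrite -subr_ge0 opprK addr_ge0// ltW.
have r1' := ltW r1.
pose m (p : R * R * R) := Num.max 1 p.2.
have cm : continuous m by rewrite /m; cts.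
pose V1 (p : R * R * R) := p.1.1 / rho3 p ^+ 2.
pose V2 (p : R * R * R) := p.1.2 / rho3 p ^+ 2.
pose V3 p := m p / rho3 p ^+ 2.
pose W1 (p : R * R * R) := 1 / rho3 p ^+ 2 - 2 * p.1.1 * (2 * p.1.1) / rho3 p ^+ 3.
pose W2 (p : R * R * R) := 1 / rho3 p ^+ 2 - 2 * p.1.2 * (2 * p.1.2) / rho3 p ^+ 3.
pose W3 p := 1 / rho3 p ^+ 2 - 2 * m p * (2 * m p) / rho3 p ^+ 3.
have cV1 : continuous V1 by rewrite /V1; cts.
have cV2 : continuous V2 by rewrite /V2; cts.
have cV3 : continuous V3 by rewrite /V3; cts.
have cW1 : continuous W1 by rewrite /W1; cts.
have cW2 : continuous W2 by rewrite /W2; cts.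
have cW3 : continuous W3 by rewrite /W3; cts.
have dV1 (x y z : R) : - r < x < r -> is_derive x 1 (fun x => V1 (x, y, z)) (W1 (x, y, z)).
  move=> _; exact: (@is_derive_div_sqr (fun x => x) (fun x => rho3 (x, y, z)) x 1 (2 * x)
    (rho0 _) (is_derive_id _ _) (is_derive_rho3_1 x y z)).
have dV2 (x y z : R) : - r < y < r -> is_derive y 1 (fun y => V2 (x, y, z)) (W2 (x, y, z)).
  move=> _; exact: (@is_derive_div_sqr (fun x => x) (fun y => rho3 (x, y, z)) y 1 (2 * y)
    (rho0 _) (is_derive_id _ _) (is_derive_rho3_2 x y z)).
have dV3 (x y z : R) : 1 < z < r -> is_derive z 1 (fun z => V3 (x, y, z)) (W3 (x, y, z)).
  move=> /andP[z1 _].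
  exact: (@is_derive_div_sqr (fun z => Num.max 1 z) (fun z => rho3 (x, y, z)) z 1 (2 * Num.max 1 z)
    (rho0 _) (is_derive_max1 z1 (is_derive_id _ _)) (is_derive_rho3_3 x y z1)).
have := divergence3 rr rr r1' cV1 cV2 cV3 cW1 cW2 cW3 dV1 dV2 dV3.
have cJ : continuous (fun p : R * R * R => rho3 p ^- 2) by cts.
have -> : itg3 (- r) r (- r) r 1 r (fun p => W1 p + W2 p + W3 p) =
    - 1 * half_box r (fun p => rho3 p ^- 2).
  rewrite /half_box -(itg3Z _ _ _ _ _ _ _ cJ); apply: eq_itg3 => x y z _ _ _.
  rewrite /W1 /W2 /W3 /m/=.
  have := rho0 (x, y, z); have : rho3 (x, y, z) = x ^+ 2 + y ^+ 2 + Num.max 1 z ^+ 2 by [].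
  set q := rho3 _; set t := Num.max 1 z; move=> qE q0.
  have -> : 1 / q ^+ 2 - 2 * x * (2 * x) / q ^+ 3 + (1 / q ^+ 2 - 2 * y * (2 * y) / q ^+ 3) +
    (1 / q ^+ 2 - 2 * t * (2 * t) / q ^+ 3) = 3 / q ^+ 2 - 4 * (x ^+ 2 + y ^+ 2 + t ^+ 2) / q ^+ 3.
    by clear; ring.
  by rewrite -qE; clear -q0; field.
have invC p : r ^+ 2 <= rho3 p -> rho3 p ^- 2 <= r ^- 4.
  move=> rp; rewrite lef_pV2 ?posrE ?exprn_gt0 ?rho3_gt0//.
  have -> : r ^+ 4 = (r ^+ 2) ^+ 2 by clear; ring.
  rewrite ler_pXn2r// nnegrE ?sqr_ge0//.
  exact: ltW (rho3_gt0 p).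
have r40 : 0 <= r ^- 4 by rewrite invr_ge0 exprn_ge0// ltW.
have ge0 (p : R * R * R) : 0 <= rho3 p ^- 2 by exact: ltW (rho3_exprV_gt0 2 p).
pose M := 2 * r * r ^- 4.
have face1 : itg2 (- r) r 1 r (fun q => V1 (r, q.1, q.2) - V1 (- r, q.1, q.2)) <=
    M * (r - 1) * (r - - r).
  apply: face_bound; [exact: rr|exact: r1'|by cts|].
  move=> y z _ _; rewrite /V1/= !(mulrC _ (_^-1)).
  apply: face_pair_le; [exact: ltW|apply: invC; apply: sqr_le_add3; left => //|].
  by apply: invC; apply: sqr_le_add3; left; rewrite /= sqrrN.
have face1' : 0 <= itg2 (- r) r 1 r (fun q => V1 (r, q.1, q.2) - V1 (- r, q.1, q.2)).
  apply: itg2_ge0 => y z _ _; rewrite /V1/= mulNr opprK.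
  by apply: addr_ge0; apply: mulr_ge0; [exact: ltW|exact: ge0|exact: ltW|exact: ge0].
have face2 : itg2 (- r) r 1 r (fun q => V2 (q.1, r, q.2) - V2 (q.1, - r, q.2)) <=
    M * (r - 1) * (r - - r).
  apply: face_bound; [exact: rr|exact: r1'|by cts|].
  move=> y z _ _; rewrite /V2/= !(mulrC _ (_^-1)).
  apply: face_pair_le; [exact: ltW|apply: invC; apply: sqr_le_add3; right; left => //|].
  by apply: invC; apply: sqr_le_add3; right; left; rewrite /= sqrrN.
have face2' : 0 <= itg2 (- r) r 1 r (fun q => V2 (q.1, r, q.2) - V2 (q.1, - r, q.2)).
  apply: itg2_ge0 => y z _ _; rewrite /V2/= mulNr opprK.
  by apply: addr_ge0; apply: mulr_ge0; [exact: ltW|exact: ge0|exact: ltW|exact: ge0].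
have cr2 := @continuous_rho2 R.
have rho2n (p : R * R) : rho2 p ^+ 2 != 0 by rewrite expf_neq0// rho2_neq0.
have m1 : Num.max 1 1 = 1 :> R by rewrite maxxx.
have bot : itg2 (- r) r (- r) r (fun p => V3 (p, 1)) = itg2 (- r) r (- r) r (fun p => rho2 p ^- 2).
  by apply: eq_itg2 => x y _ _; rewrite /V3 /m/= m1 mul1r rho3_bottom.
have mr : Num.max 1 r = r by rewrite (max_idPr _).
have top : 0 <= itg2 (- r) r (- r) r (fun p => V3 (p, r)) <= M / 2 * (r - - r) * (r - - r).
  apply/andP; split.
    by apply: itg2_ge0 => x y _ _; rewrite /V3 /m/= mr; apply: mulr_ge0; [exact: ltW|exact: ge0].
  apply: face_bound; [exact: rr|exact: rr|by cts|].
  move=> x y _ _; rewrite /V3 /m/= mr /M.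
  have -> : 2 * r / r ^+ 4 / 2 = r / r ^+ 4 by clear -r0; field; rewrite gt_eqF.
  rewrite ler_pM2l//; exact: (invC _ (rho3_top x y r1')).
have -> : itg2 (- r) r (- r) r (fun q => V3 (q, r) - V3 (q, 1)) =
   itg2 (- r) r (- r) r (fun p => V3 (p, r)) - itg2 (- r) r (- r) r (fun p => rho2 p ^- 2).
  rewrite -bot -[X in _ - X]mul1r -mulNr.
  have c1 : continuous (fun p : R * R => V3 (p, 1)) by cts.
  have c2 : continuous (fun p : R * R => - 1 * V3 (p, 1)) by cts.
  have c3 : continuous (fun p : R * R => V3 (p, r)) by cts.
  rewrite -(itg2Z _ _ _ _ _ c1) -(itg2D _ _ _ _ c3 c2).
  by apply: eq_itg2 => x y _ _; rewrite mulN1r.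
have := far_faces_le r1 r40.
have -> : 12 * r ^+ 3 * r ^- 4 = 12 / r by clear -r0; field; rewrite gt_eqF.
rewrite -/M.
move: face1 face1' face2 face2' top.
set u1 := itg2 _ _ _ _ (fun q => V1 _ - _); set u2 := itg2 _ _ _ _ (fun q => V2 _ - _).
set u3 := itg2 _ _ _ _ (fun q => V3 _); set u4 := itg2 _ _ _ _ _; set J := half_box r _.
set m2 := M * _ * _; set m3 := M / 2 * _ * _; set m4 := 12 / r.
clearbody u1 u2 u3 u4 J m2 m3 m4.
clear; move=> h1 h2 h3 h4 /andP[h5 h6] h7 h8; apply/andP; split; lra.
Qed.

Lemma cross_bound (C r q a b : R) : 0 < r -> 0 < q -> r ^+ 2 <= q ->
  a ^+ 2 <= C / q -> b ^+ 2 <= C / q ^+ 2 -> `|a * b| <= C / r ^+ 3.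
Proof.
move=> r0 q0 rq aC bC; have C0 : 0 <= C.
  by have := le_trans (sqr_ge0 _) aC; rewrite pmulr_lge0// invr_gt0.
have h : 0 <= C / r ^+ 3 by rewrite divr_ge0// exprn_ge0// ltW.
have ar : a ^+ 2 <= C / r ^+ 2.
  by apply: (le_trans aC); rewrite ler_wpM2l// lef_pV2// posrE// exprn_gt0.
have br : b ^+ 2 <= C / (r ^+ 2) ^+ 2.
  apply: (le_trans bC); rewrite ler_wpM2l// lef_pV2// ?posrE ?exprn_gt0//.
  by rewrite ler_pXn2r// nnegrE ?sqr_ge0// ltW.
rewrite -(ler_pXn2r (n := 2))// ?nnegrE// -normrX ger0_norm ?sqr_ge0// exprMn.
have -> : (C / r ^+ 3) ^+ 2 = C / r ^+ 2 * (C / (r ^+ 2) ^+ 2).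
  by field; rewrite gt_eqF.
by apply: ler_pM => //; exact: sqr_ge0.
Qed.

(** Green's formula: for harmonic [F] the energy density is the divergence of [F] times its
    gradient, a field which is [O(r^-3)] on the far faces, of area [O(r^2)]. *)
Lemma half_box_energy (r C : R) (F F1 F2 F3 F11 F22 F33 : R * R * R -> R) : 1 < r ->
  continuous F -> continuous F1 -> continuous F2 -> continuous F3 ->
  continuous F11 -> continuous F22 -> continuous F33 ->
  (forall x y z : R, is_derive x 1 (fun x => F (x, y, z)) (F1 (x, y, z))) ->
  (forall x y z : R, is_derive y 1 (fun y => F (x, y, z)) (F2 (x, y, z))) ->
  (forall x y z : R, 1 < z -> is_derive z 1 (fun z => F (x, y, z)) (F3 (x, y, z))) ->
  (forall x y z : R, is_derive x 1 (fun x => F1 (x, y, z)) (F11 (x, y, z))) ->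
  (forall x y z : R, is_derive y 1 (fun y => F2 (x, y, z)) (F22 (x, y, z))) ->
  (forall x y z : R, 1 < z -> is_derive z 1 (fun z => F3 (x, y, z)) (F33 (x, y, z))) ->
  (forall p, F11 p + F22 p + F33 p = 0) ->
  (forall p, F p ^+ 2 <= C / rho3 p) ->
  (forall p, F1 p ^+ 2 <= C / rho3 p ^+ 2) -> (forall p, F2 p ^+ 2 <= C / rho3 p ^+ 2) ->
  (forall p, F3 p ^+ 2 <= C / rho3 p ^+ 2) ->
  half_box r (fun p => F1 p ^+ 2 + F2 p ^+ 2 + F3 p ^+ 2) <=
  - itg2 (- r) r (- r) r (fun p => F (p, 1) * F3 (p, 1)) + 12 * C / r.
Proof.
move=> r1 cF cF1 cF2 cF3 cF11 cF22 cF33 d1 d2 d3 d11 d22 d33 harm FC F1C F2C F3C.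
have r0 : 0 < r by exact: lt_trans r1.
have rr : - r <= r by rewrite -subr_ge0 opprK addr_ge0// ltW.
have r1' := ltW r1.
pose W1 p := F1 p * F1 p + F p * F11 p.
pose W2 p := F2 p * F2 p + F p * F22 p.
pose W3 p := F3 p * F3 p + F p * F33 p.
pose V1 p := F p * F1 p.
pose V2 p := F p * F2 p.
pose V3 p := F p * F3 p.
have cV1 : continuous V1 by rewrite /V1; cts.
have cV2 : continuous V2 by rewrite /V2; cts.
have cV3 : continuous V3 by rewrite /V3; cts.
have cW1 : continuous W1 by rewrite /W1; cts.
have cW2 : continuous W2 by rewrite /W2; cts.
have cW3 : continuous W3 by rewrite /W3; cts.
have dV1 (x y z : R) : - r < x < r -> is_derive x 1 (fun x => V1 (x, y, z)) (W1 (x, y, z)).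
  by move=> _; exact: (is_derive_mul (d1 x y z) (d11 x y z)).
have dV2 (x y z : R) : - r < y < r -> is_derive y 1 (fun y => V2 (x, y, z)) (W2 (x, y, z)).
  by move=> _; exact: (is_derive_mul (d2 x y z) (d22 x y z)).
have dV3 (x y z : R) : 1 < z < r -> is_derive z 1 (fun z => V3 (x, y, z)) (W3 (x, y, z)).
  by move=> /andP[z1 _]; exact: (is_derive_mul (d3 x y z z1) (d33 x y z z1)).
have := divergence3 rr rr r1' cV1 cV2 cV3 cW1 cW2 cW3 dV1 dV2 dV3.
have -> : itg3 (- r) r (- r) r 1 r (fun p => W1 p + W2 p + W3 p) =
    half_box r (fun p => F1 p ^+ 2 + F2 p ^+ 2 + F3 p ^+ 2).
  apply: eq_itg3 => x y z _ _ _; rewrite /W1 /W2 /W3.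
  have := harm (x, y, z).
  set a := F _; set a1 := F1 _; set a2 := F2 _; set a3 := F3 _.
  set b1 := F11 _; set b2 := F22 _; set b3 := F33 _ => h.
  have -> : b3 = - b1 - b2 by clear -h; lra.
  by clear; ring.
move=> ->.
have C0 : 0 <= C.
  have := le_trans (sqr_ge0 _) (FC (0, 0, 0)); rewrite pmulr_lge0// invr_gt0.
  exact: rho3_gt0.
have r30 : 0 <= C / r ^+ 3 by rewrite divr_ge0// exprn_ge0// ltW.
pose M := 2 * (C / r ^+ 3).
have pair_le (u v : R) : `|u| <= C / r ^+ 3 -> `|v| <= C / r ^+ 3 -> u - v <= M.
  by rewrite !ler_norml /M; clear; lra.
have face1 : itg2 (- r) r 1 r (fun q => V1 (r, q.1, q.2) - V1 (- r, q.1, q.2)) <=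
    M * (r - 1) * (r - - r).
  apply: face_bound; [exact: rr|exact: r1'|by cts|].
  move=> y z _ _; rewrite /V1/=; apply: pair_le; apply: (cross_bound r0 (rho3_gt0 _) _ (FC _) (F1C _)).
    by apply: sqr_le_add3; left.
  by apply: sqr_le_add3; left; rewrite /= sqrrN.
have face2 : itg2 (- r) r 1 r (fun q => V2 (q.1, r, q.2) - V2 (q.1, - r, q.2)) <=
    M * (r - 1) * (r - - r).
  apply: face_bound; [exact: rr|exact: r1'|by cts|].
  move=> y z _ _; rewrite /V2/=; apply: pair_le; apply: (cross_bound r0 (rho3_gt0 _) _ (FC _) (F2C _)).
    by apply: sqr_le_add3; right; left.
  by apply: sqr_le_add3; right; left; rewrite /= sqrrN.
have top : itg2 (- r) r (- r) r (fun p => V3 (p, r)) <= M / 2 * (r - - r) * (r - - r).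
  apply: face_bound; [exact: rr|exact: rr|by cts|].
  move=> x y _ _; rewrite /V3 /M.
  have -> : 2 * (C / r ^+ 3) / 2 = C / r ^+ 3 by rewrite mulrAC mulfV ?mul1r.
  apply: le_trans (ler_norm _) _.
  exact: (cross_bound r0 (rho3_gt0 _) (rho3_top x y r1') (FC _) (F3C _)).
have -> : itg2 (- r) r (- r) r (fun q => V3 (q, r) - V3 (q, 1)) =
   itg2 (- r) r (- r) r (fun p => V3 (p, r)) - itg2 (- r) r (- r) r (fun p => V3 (p, 1)).
  rewrite -[X in _ - X]mul1r -mulNr.
  have c1 : continuous (fun p : R * R => V3 (p, 1)) by cts.
  have c2 : continuous (fun p : R * R => - 1 * V3 (p, 1)) by cts.
  have c3 : continuous (fun p : R * R => V3 (p, r)) by cts.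
  rewrite -(itg2Z _ _ _ _ _ c1) -(itg2D _ _ _ _ c3 c2).
  by apply: eq_itg2 => x y _ _; rewrite mulN1r.
have r4C : 0 <= C / r ^+ 4 by rewrite divr_ge0// exprn_ge0// ltW.
have := far_faces_le r1 r4C.
have -> : 12 * r ^+ 3 * (C / r ^+ 4) = 12 * C / r by clear -r0; field; rewrite gt_eqF.
have -> : 2 * r * (C / r ^+ 4) = M by rewrite /M; clear -r0; field; rewrite gt_eqF.
move: face1 face2 top.
set u1 := itg2 _ _ _ _ (fun q => V1 _ - _); set u2 := itg2 _ _ _ _ (fun q => V2 _ - _).
set u3 := itg2 _ _ _ _ (fun q => V3 (_, r)); set u4 := itg2 _ _ _ _ _.
set m2 := M * _ * _; set m3 := M / 2 * _ * _; set m4 := 12 * C / r.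
rewrite -/u4.
clearbody u1 u2 u3 u4 m2 m3 m4.
clear; lra.
Qed.

End trace_energy.

(** * Functions of variable sign, and the limit over boxes *)

Section trace_regularized.
Context {R : realType}.

Lemma is_derive_eq_val (f : R -> R) (x a b : R) : a = b ->
  is_derive x 1 f a -> is_derive x 1 f b.
Proof. by move=> ->. Qed.

Lemma is_derive_sqrt_quad (F q : R -> R) (x F' q' : R) : 0 < F x ^+ 2 + q x ->
  is_derive x 1 F F' -> is_derive x 1 q q' ->
  is_derive x 1 (fun x => Num.sqrt (F x ^+ 2 + q x))
    ((F x * F' + q' / 2) / Num.sqrt (F x ^+ 2 + q x)).
Proof.
move=> p0 dF dq.
have du : is_derive x 1 (fun x => F x ^+ 2 + q x) (2 * F x * F' + q').
  apply: is_derive_eq; rewrite /GRing.scale/=; ring.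
have := @is_derive1_comp _ Num.sqrt (fun x => F x ^+ 2 + q x) x _ _ (is_derive1_sqrt p0) du.
apply: is_derive_eq_val.
rewrite invfM; have s0 : Num.sqrt (F x ^+ 2 + q x) != 0 by rewrite gt_eqF// sqrtr_gt0.
by field.
Qed.

(* Kato's inequality for the vector [(F, e |X|^-1)]. *)
Lemma kato_sqrt_quad (F a1 a2 a3 e x y z q s : R) : 0 < q -> 0 < s ->
  q = x ^+ 2 + y ^+ 2 + z ^+ 2 -> s ^+ 2 = F ^+ 2 + e / q -> 0 <= e ->
  ((F * a1 - e * x / q ^+ 2) / s) ^+ 2 + ((F * a2 - e * y / q ^+ 2) / s) ^+ 2
  + ((F * a3 - e * z / q ^+ 2) / s) ^+ 2 <=
  a1 ^+ 2 + a2 ^+ 2 + a3 ^+ 2 + e * q ^- 2.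
Proof.
move=> q0 s0 qE sE e0; rewrite !expr_div_n -!mulrDl ler_pdivrMr ?exprn_gt0// sE.
rewrite -subr_ge0; set S := (X in 0 <= X).
have -> : S = e / q * ((a1 + F * x / q) ^+ 2 + (a2 + F * y / q) ^+ 2 + (a3 + F * z / q) ^+ 2)
    + (q - (x ^+ 2 + y ^+ 2 + z ^+ 2)) * (e * F ^+ 2 / q ^+ 3 + e ^+ 2 / q ^+ 4).
  by rewrite /S; clear -q0; field; rewrite gt_eqF.
rewrite -qE subrr mul0r addr0; apply: mulr_ge0; first by rewrite divr_ge0// ltW.
by apply: addr_ge0; [apply: addr_ge0|]; exact: sqr_ge0.
Qed.

Lemma is_derive_div_rho (e : R) (q : R -> R) (x q' : R) : q x != 0 ->
  is_derive x 1 q (2 * q') -> is_derive x 1 (fun x => e / q x) (- 2 * e * q' / q x ^+ 2).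
Proof.
move=> q0 dq; apply: is_derive_eq; rewrite /GRing.scale/=; field; exact: q0.
Qed.

Lemma sqr_div_le (a b J : R) : 0 < J -> 0 <= a -> a <= b -> a ^+ 2 / J <= b ^+ 2 / J.
Proof.
move=> J0 a0 ab; rewrite ler_pM2r ?invr_gt0// ler_pXn2r// nnegrE//.
exact: le_trans ab.
Qed.

(** The transport needs a positive density while [F] may change sign, so the inequality is applied
    to the norm of the vector [(F, (e / rho3)^(1/2))], whose gradient is controlled by Kato's
    inequality. The added component decays like [F] and has energy density [e rho3^-2]. *)
Lemma trace_regularized (r C e : R) (F F1 F2 F3 F11 F22 F33 : R * R * R -> R) : 1 < r -> 0 < e ->
  continuous F -> continuous F1 -> continuous F2 -> continuous F3 ->
  continuous F11 -> continuous F22 -> continuous F33 ->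
  (forall x y z : R, is_derive x 1 (fun x => F (x, y, z)) (F1 (x, y, z))) ->
  (forall x y z : R, is_derive y 1 (fun y => F (x, y, z)) (F2 (x, y, z))) ->
  (forall x y z : R, 1 < z -> is_derive z 1 (fun z => F (x, y, z)) (F3 (x, y, z))) ->
  (forall x y z : R, is_derive x 1 (fun x => F1 (x, y, z)) (F11 (x, y, z))) ->
  (forall x y z : R, is_derive y 1 (fun y => F2 (x, y, z)) (F22 (x, y, z))) ->
  (forall x y z : R, 1 < z -> is_derive z 1 (fun z => F3 (x, y, z)) (F33 (x, y, z))) ->
  (forall p, F11 p + F22 p + F33 p = 0) ->
  (forall p, F p ^+ 2 <= C / rho3 p) ->
  (forall p, F1 p ^+ 2 <= C / rho3 p ^+ 2) -> (forall p, F2 p ^+ 2 <= C / rho3 p ^+ 2) ->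
  (forall p, F3 p ^+ 2 <= C / rho3 p ^+ 2) ->
  let J := half_box r (fun p => rho3 p ^- 2) in
  itg2 (- r) r (- r) r (fun p => F (p, 1) ^+ 4) <=
  (- itg2 (- r) r (- r) r (fun p => F (p, 1) * F3 (p, 1)) + 12 * C / r + e * J) ^+ 2 / J
  + 12 * (C + e) ^+ 2 / r.
Proof.
move=> r1 e0 cF cF1 cF2 cF3 cF11 cF22 cF33 d1 d2 d3 d11 d22 d33 harm FC F1C F2C F3C.
cbv zeta; set J := half_box r (fun p => rho3 p ^- 2).
have crho := @continuous_rho3 R; have rho0 := @rho3_neq0 R; have rhop := @rho3_gt0 R.
have rho20 := @rho3_expr_neq0 R 2.
have r0 : 0 < r by exact: lt_trans r1.
have rr : - r < r by rewrite -subr_gt0 opprK addr_gt0.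
pose m (p : R * R * R) := Num.max 1 p.2.
have cm : continuous m by rewrite /m; cts.
pose f p := Num.sqrt (F p ^+ 2 + e / rho3 p).
have q0 p : 0 < F p ^+ 2 + e / rho3 p.
  by apply: ltr_wpDl; [exact: sqr_ge0|exact: divr_gt0].
have f0 p : 0 < f p by rewrite sqrtr_gt0; exact: q0.
have f2 p : f p ^+ 2 = F p ^+ 2 + e / rho3 p by rewrite /f sqr_sqrtr// ltW.
have fn0 p : f p != 0 by exact: lt0r_neq0 (f0 p).
have cq : continuous (fun p => F p ^+ 2 + e / rho3 p) by cts.
have cf : continuous f by exact: (continuous_comp_top (@sqrt_continuous R) cq).
pose f1 p := (F p * F1 p - e * p.1.1 / rho3 p ^+ 2) / f p.
pose f2' p := (F p * F2 p - e * p.1.2 / rho3 p ^+ 2) / f p.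
pose f3 p := (F p * F3 p - e * m p / rho3 p ^+ 2) / f p.
have cf1 : continuous f1 by rewrite /f1; cts.
have cf2 : continuous f2' by rewrite /f2'; cts.
have cf3 : continuous f3 by rewrite /f3; cts.
have half (a b c : R) : (a + - 2 * b / 2) / c = (a - b) / c.
  by congr ((a + _) / c); rewrite mulNr mulNr mulrAC mulfV ?mul1r.
have df1 (x y z : R) : is_derive x 1 (fun x => f (x, y, z)) (f1 (x, y, z)).
  have := @is_derive_sqrt_quad (fun x => F (x, y, z)) (fun x => e / rho3 (x, y, z)) x _ _
    (q0 (x, y, z)) (d1 x y z) (@is_derive_div_rho e (fun x => rho3 (x, y, z)) x x
    (rho0 (x, y, z)) (is_derive_rho3_1 x y z)).
  apply: is_derive_eq_val; rewrite /f1 -half; congr ((_ + _ / 2) / _).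
  by rewrite /= !mulrA.
have df2 (x y z : R) : is_derive y 1 (fun y => f (x, y, z)) (f2' (x, y, z)).
  have := @is_derive_sqrt_quad (fun y => F (x, y, z)) (fun y => e / rho3 (x, y, z)) y _ _
    (q0 (x, y, z)) (d2 x y z) (@is_derive_div_rho e (fun y => rho3 (x, y, z)) y y
    (rho0 (x, y, z)) (is_derive_rho3_2 x y z)).
  apply: is_derive_eq_val; rewrite /f2' -half; congr ((_ + _ / 2) / _).
  by rewrite /= !mulrA.
have df3 (x y z : R) : 1 < z -> is_derive z 1 (fun z => f (x, y, z)) (f3 (x, y, z)).
  move=> z1; have := @is_derive_sqrt_quad (fun z => F (x, y, z)) (fun z => e / rho3 (x, y, z)) z _ _
    (q0 (x, y, z)) (d3 x y z z1) (@is_derive_div_rho e (fun z => rho3 (x, y, z)) z (Num.max 1 z)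
    (rho0 (x, y, z)) (is_derive_rho3_3 x y z1)).
  apply: is_derive_eq_val; rewrite /f3 -half; congr ((_ + _ / 2) / _).
  by rewrite /m /= !mulrA.
have fC p : f p ^+ 2 <= (C + e) / rho3 p.
  by rewrite f2 mulrDl lerD2r; exact: FC.
have trace := trace_half_box_scaled r1 cf cf1 cf2 cf3 f0 df1 df2 df3 fC.
have cN : continuous (fun p => F1 p ^+ 2 + F2 p ^+ 2 + F3 p ^+ 2) by cts.
have cNf : continuous (fun p => f1 p ^+ 2 + f2' p ^+ 2 + f3 p ^+ 2) by cts.
have cJ : continuous (fun p : R * R * R => rho3 p ^- 2) by cts.
have ceJ : continuous (fun p : R * R * R => e * rho3 p ^- 2) by cts.
have J0 : 0 < J by exact: (itg3_gt0 rr rr r1 cJ (rho3_exprV_gt0 2)).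
have kato : half_box r (fun p => f1 p ^+ 2 + f2' p ^+ 2 + f3 p ^+ 2) <=
    half_box r (fun p => F1 p ^+ 2 + F2 p ^+ 2 + F3 p ^+ 2) + e * J.
  rewrite /J /half_box -(itg3Z _ _ _ _ _ _ _ cJ) -(itg3D _ _ _ _ _ _ cN ceJ).
  apply: (itg3_le cNf (continuous_add cN ceJ)) => x y z _ _ _.
  apply: (kato_sqrt_quad _ _ _ (rhop (x, y, z)) (f0 (x, y, z)) _ (f2 (x, y, z)) (ltW e0)).
  by [].
have energy := half_box_energy r1 cF cF1 cF2 cF3 cF11 cF22 cF33 d1 d2 d3 d11 d22 d33 harm
  FC F1C F2C F3C.
have N0 : 0 <= half_box r (fun p => f1 p ^+ 2 + f2' p ^+ 2 + f3 p ^+ 2).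
  by apply: itg3_ge0 => x y z _ _ _; apply: addr_ge0; [apply: addr_ge0|]; exact: sqr_ge0.
have cF4 : continuous (fun p : R * R => F (p, 1) ^+ 4) by cts.
have cf4 : continuous (fun p : R * R => f (p, 1) ^+ 4) by cts.
have A1 : itg2 (- r) r (- r) r (fun p => F (p, 1) ^+ 4) <=
    itg2 (- r) r (- r) r (fun p => f (p, 1) ^+ 4).
  apply: (itg2_le cF4 cf4) => x y _ _.
  have h : F (x, y, 1) ^+ 2 <= f (x, y, 1) ^+ 2.
    by rewrite f2 lerDl; apply: ltW; exact: divr_gt0.
  have E4 (a : R) : a ^+ 4 = (a ^+ 2) ^+ 2 by rewrite -exprM.
  by rewrite !E4 ler_pXn2r// nnegrE sqr_ge0.
apply: (le_trans A1); apply: (le_trans trace); rewrite lerD2r.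
have le1 : half_box r (fun p => f1 p ^+ 2 + f2' p ^+ 2 + f3 p ^+ 2) <=
  - itg2 (- r) r (- r) r (fun p => F (p, 1) * F3 (p, 1)) + 12 * C / r + e * J.
  by apply: (le_trans kato); rewrite lerD2r.
exact: (sqr_div_le J0 N0 le1).
Qed.

(* The limit over growing boxes in the sharp trace inequality. *)
Lemma trace_limit (a phi M C : R) (A Phi m J : R -> R) : 0 < M ->
  A r @[r --> +oo] --> a -> Phi r @[r --> +oo] --> phi -> m r @[r --> +oo] --> M ->
  (forall r, 1 < r -> m r - 12 / r <= J r <= m r) ->
  (forall r e, 1 < r -> 0 < e ->
    A r <= (Phi r + 12 * C / r + e * J r) ^+ 2 / J r + 12 * (C + e) ^+ 2 / r) ->
  a <= phi ^+ 2 / M.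
Proof.
move=> M0 Aa Pp mM Jm H.
have inv0 (k : R) : k / r @[r --> +oo] --> 0.
  apply/cvgrPdist_lt => e e0; near=> r.
  have r0 : 0 < r by near: r; exact: nbhs_pinfty_gt.
  rewrite sub0r normrN normrM normfV (gtr0_norm r0) ltr_pdivrMr// mulrC -ltr_pdivrMr//.
  by near: r; apply: nbhs_pinfty_gt; exact: num_real.
have JM : J r @[r --> +oo] --> M.
  apply: (@squeeze_cvgr _ _ _ _ (fun r => m r - 12 / r) m) => //; last first.
    by rewrite -[M]subr0; apply: cvgB => //; exact: inv0.
  by near=> r; apply: Jm; near: r; exact: nbhs_pinfty_gt.
(* The box grows at fixed [e], which removes the error terms in [1 / r]; only afterwards does [e]
   tend to 0. *)
have He e : 0 < e -> a <= (phi + e * M) ^+ 2 / M.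
  move=> e0.
  have lim : (Phi r + 12 * C / r + e * J r) ^+ 2 / J r + 12 * (C + e) ^+ 2 / r @[r --> +oo]
      --> (phi + 0 + e * M) ^+ 2 / M + 0.
    apply: cvgD; last exact: inv0.
    apply: cvgM; last by apply: cvgV => //; rewrite gt_eqF.
    have h : Phi r + 12 * C / r + e * J r @[r --> +oo] --> phi + 0 + e * M.
      apply: cvgD; first by apply: cvgD => //; exact: inv0.
      by apply: cvgM => //; exact: cvg_cst.
    exact: (cvgM h h).
  rewrite !addr0 in lim.
  apply: (ler_cvg_to Aa lim).
  exact: (filterS (fun r r1 => H r e r1 e0) (nbhs_pinfty_gt (num_real 1))).
have lim : (phi + e * M) ^+ 2 / M @[e --> 0^'+] --> (phi + 0 * M) ^+ 2 / M.
  apply: cvg_at_right_filter.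
  set k := M^-1; have c : continuous (fun e : R => (phi + e * M) ^+ 2 * k) by cts.
  exact: c.
rewrite mul0r addr0 in lim.
apply: (ler_cvg_to (@cvg_cst _ a _ _ _) lim).
exact: (filterS (fun e => @He e) (nbhs_right_gt 0)).
Unshelve. all: by end_near. Qed.

End trace_regularized.

(** * Stereographic projection *)

Section square_polar.
Context {R : realType}.

Lemma is_derive_of_cvg (f : R -> R) (x l : R) :
  h^-1 * (f (h + x) - f x) @[h --> 0^'] --> l -> is_derive x 1 f l.
Proof.
move=> H.
have H' : h^-1 *: ((f \o shift x) (h *: (1 : R)) - f x) @[h --> 0^'] --> l.
  rewrite (_ : (fun h => _) = (fun h => h^-1 * (f (h + x) - f x)))//.
  by apply/funext => h; rewrite /= /shift/= /GRing.scale/= mulr1.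
by apply: DeriveDef; [apply/cvg_ex; exists l|exact: cvg_lim].
Qed.

Lemma cvg_of_is_derive (f : R -> R) (x l : R) : is_derive x 1 f l ->
  h^-1 * (f (h + x) - f x) @[h --> 0^'] --> l.
Proof.
move=> [df <-]; rewrite (_ : (fun h => _) =
  (fun h => h^-1 *: ((f \o shift x) (h *: (1 : R)) - f x))); first exact: df.
by apply/funext => h; rewrite /= /shift/= /GRing.scale/= mulr1.
Qed.

Lemma is_derive_affine (Q q : R -> R) (k c s : R) : (forall x : R, is_derive x 1 Q (q x)) ->
  is_derive s 1 (fun s => Q (k * s + c)) (k * q (k * s + c)).
Proof.
move=> dQ; have dl : is_derive s 1 (fun s => k * s + c) k.
  apply: is_derive_eq; rewrite /GRing.scale/=; ring.
by have := @is_derive1_comp _ Q (fun s => k * s + c) s _ _ (dQ _) dl; rewrite mulrC.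
Qed.

Lemma itg_affine (Q q : R -> R) (k c a b : R) : a <= b -> continuous q ->
  (forall x : R, is_derive x 1 Q (q x)) ->
  k * itg a b (fun s => q (k * s + c)) = Q (k * b + c) - Q (k * a + c).
Proof.
move=> ab cq dQ; have c1 : continuous (fun s : R => q (k * s + c)) by cts.
rewrite -(itgZ _ _ _ c1).
apply: (@itg_primitive _ _ (fun s => Q (k * s + c)) a b _ ab).
  by cts.
by move=> s; exact: is_derive_affine.
Qed.

(** A chain rule from separate derivatives: the increment is split at [(r, r + h)], and the part in
    the first variable is [h] times an average of the continuous function [A]. *)
Lemma is_derive_diag (f A B : R * R -> R) (r : R) : continuous A ->
  (forall a b : R, is_derive a 1 (fun a => f (a, b)) (A (a, b))) ->
  (forall a b : R, is_derive b 1 (fun b => f (a, b)) (B (a, b))) ->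
  is_derive r 1 (fun r => f (r, r)) (A (r, r) + B (r, r)).
Proof.
move=> cA dA dB; apply: is_derive_of_cvg.
pose K h := itg 0 1 (fun s => A (h * s + r, h + r)).
have cK : continuous K.
  apply: (@itg_continuous _ _ (fun q : R * R => A (q.1 * q.2 + r, q.1 + r))).
  by cts.
have K0 : K 0 = A (r, r).
  rewrite /K (@eq_itg _ _ _ _ (fun=> A (r, r))) ?itg_cst// ?subr0 ?mulr1//.
  by move=> s _; rewrite mul0r !add0r.
have cKl : K h @[h --> 0^'] --> A (r, r).
  by rewrite -K0; apply/(@continuous_withinNx _ _ K 0)/cK.
apply: cvg_trans (cvgD cKl (cvg_of_is_derive (dB r r))).
apply: near_eq_cvg; near=> h.
have h0 : h != 0 by near: h; exact: nbhs_dnbhs_neq.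
have cAh : continuous (fun a => A (a, h + r)) by cts.
have := @itg_affine (fun a => f (a, h + r)) _ h r 0 1 ler01 cAh (fun a => dA a (h + r)).
rewrite mulr0 mulr1 add0r => E.
have -> : f (h + r, h + r) - f (r, r) = h * K h + (f (r, h + r) - f (r, r)).
  by rewrite E; clear; lra.
by rewrite mulrDr mulrA mulVf// mul1r.
Unshelve. all: by end_near. Qed.

(** [I g (a, b)] is the integral of [g] over [[-a, a] x [-b, b]], rescaled to fixed bounds so that
    it is defined and differentiable for all real [a] and [b]; [A g] is its derivative in [a], the
    integral over the two vertical sides. *)
Let I (g : R * R -> R) (q : R * R) :=
  q.1 * itg (-1) 1 (fun s => q.2 * itg (-1) 1 (fun t => g (q.1 * s, q.2 * t))).
Let A (g : R * R -> R) (q : R * R) :=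
  q.2 * itg (-1) 1 (fun t => g (q.1, q.2 * t) + g (- q.1, q.2 * t)).

Let cinner (g : R * R -> R) (b : R) : continuous g ->
  continuous (fun x => b * itg (-1) 1 (fun t => g (x, b * t))).
Proof.
move=> cg; have c : continuous (fun x => itg (-1) 1 (fun t => g (x, b * t))).
  by apply: (@itg_continuous _ _ (fun q : R * R => g (q.1, b * q.2))); cts.
by cts.
Qed.

Let dI (g : R * R -> R) (a b : R) : continuous g ->
  is_derive a 1 (fun a => I g (a, b)) (A g (a, b)).
Proof.
move=> cg; set q := fun x => b * itg (-1) 1 (fun t => g (x, b * t)).
have cq : continuous q by exact: cinner.
have [Q dQ] := primitive_ex cq.
have -> : (fun a => I g (a, b)) = (fun a => Q (1 * a + 0) - Q (-1 * a + 0)).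
  apply/funext => x; have N1 : -1 <= 1 :> R by lra.
  have := @itg_affine Q q x 0 (-1) 1 N1 cq dQ.
  rewrite !addr0 mulr1 mulrN1 mul1r mulN1r => <-.
  rewrite /I /=; congr (_ * _); apply: eq_itg => s _; rewrite /q addr0//.
have d1 := @is_derive_affine Q q 1 0 a dQ.
have d2 := @is_derive_affine Q q (-1) 0 a dQ.
apply: is_derive_eq.
rewrite !addr0 !mul1r !mulN1r opprK /q /A /= -mulrDr.
rewrite itgD//; [have c : continuous (fun t => g (a, b * t)) by cts|
  have c : continuous (fun t => g (- a, b * t)) by cts]; exact: c.
Qed.

Let swap (q : R * R) := (q.2, q.1).

Let I_swap (g : R * R -> R) (a b : R) : continuous g -> I g (a, b) = I (g \o swap) (b, a).
Proof.
move=> cg; rewrite /I /=.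
have c1 : continuous (fun q : R * R => g (a * q.1, b * q.2)) by cts.
have c2 : continuous (fun s : R => itg (-1) 1 (fun t => g (a * s, b * t))).
  by apply: (@itg_continuous _ _ (fun q : R * R => g (a * q.1, b * q.2))).
have c3 : continuous (fun q : R * R => g (a * q.2, b * q.1)) by cts.
have c4 : continuous (fun t : R => itg (-1) 1 (fun s => g (a * s, b * t))).
  by apply: (@itg_continuous _ _ (fun q : R * R => g (a * q.2, b * q.1))).
rewrite (itgZ _ _ _ c2) (itgZ _ _ _ c4) (itg_fubini _ _ _ _ c1) !mulrA.
by rewrite (mulrC a).
Qed.

(** The integral over a square is differentiated with respect to its half side, that is, along the
    diagonal [a = b]. The derivative is the integral over the four sides, each parametrized by [t]
    in [[-1, 1]]. Squares stand in for discs because the transport lives on squares. *)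
Lemma square_polar (g : R * R -> R) (r : R) : 0 <= r -> continuous g ->
  itg2 (- r) r (- r) r g =
  itg 0 r (fun s => itg (-1) 1 (fun t => s *
    (g (s, s * t) + g (- s, s * t) + g (s * t, s) + g (s * t, - s)))).
Proof.
move=> r0 cg; have N1 : -1 <= 1 :> R by lra.
have rr : - r <= r by lra.
have IE : itg2 (- r) r (- r) r g = I g (r, r).
  have inner x : itg (- r) r (fun y => g (x, y)) = r * itg (-1) 1 (fun t => g (x, r * t)).
    have cx : continuous (fun y => g (x, y)) by cts.
    have [Q dQ] := primitive_ex cx.
    rewrite (itg_primitive cx rr dQ).
    have := itg_affine 1 0 N1; have := @itg_affine Q _ r 0 (-1) 1 N1 cx dQ.
    rewrite !addr0 mulr1 mulrN1 => <- _; congr (_ * _).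
    by apply: eq_itg => t _; rewrite addr0.
  rewrite /itg2 (eq_itg (fun x _ => inner x)).
  have cx := cinner (b := r) cg; have [Q dQ] := primitive_ex cx.
  rewrite (itg_primitive cx rr dQ) /I.
  have := @itg_affine Q _ r 0 (-1) 1 N1 cx dQ.
  rewrite !addr0 mulr1 mulrN1 => <-; congr (_ * _).
  by apply: eq_itg => t _; rewrite addr0.
have cgs : continuous (g \o swap) by rewrite /comp /swap; cts.
have cA (h : R * R -> R) : continuous h -> continuous (A h).
  move=> ch; have c : continuous (fun q : R * R =>
      itg (-1) 1 (fun t => h (q.1, q.2 * t) + h (- q.1, q.2 * t))).
    apply: (@itg_continuous _ _ (fun z : R * R * R =>
      h (z.1.1, z.1.2 * z.2) + h (- z.1.1, z.1.2 * z.2))); by cts.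
  by rewrite /A; cts.
have dd (s : R) : is_derive s 1 (fun s => I g (s, s)) (A g (s, s) + A (g \o swap) (s, s)).
  apply: (@is_derive_diag (I g) (A g) (fun q => A (g \o swap) (q.2, q.1)) s (cA _ cg)).
    by move=> a b; exact: dI.
  move=> a b; rewrite (_ : (fun b => I g (a, b)) = (fun b => I (g \o swap) (b, a))).
    exact: dI.
  by apply/funext => x; exact: I_swap.
have I0 : I g (0, 0) = 0 by rewrite /I mul0r.
have -> : itg2 (- r) r (- r) r g = I g (r, r) - I g (0, 0) by rewrite IE I0 subr0.
have cdd : continuous (fun s => A g (s, s) + A (g \o swap) (s, s)).
  have cA1 := cA _ cg; have cA2 := cA _ cgs; by cts.
rewrite -(itg_primitive cdd r0 dd); apply: eq_itg => s _.
rewrite /A /=.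
have c1 : continuous (fun t : R => g (s, s * t) + g (- s, s * t)) by cts.
have c2 : continuous (fun t : R => g (s * t, s) + g (s * t, - s)) by cts.
have c3 := continuous_add c1 c2.
rewrite -mulrDr -(itgD _ _ c1 c2) -(itgZ _ _ _ c3).
by apply: eq_itg => t _; rewrite !addrA.
Qed.

End square_polar.

(** * Change of variables between the plane and the sphere *)

Section stereographic.
Context {R : realType}.

(** The inverse of stereographic projection from the south pole: the origin goes to the north pole,
    infinity to the south pole. *)
Definition stereo3 (p : R * R) : R * R * R :=
  (2 * p.1 / rho2 p, 2 * p.2 / rho2 p, (2 - rho2 p) / rho2 p).

Lemma continuous_stereo3 : continuous stereo3.
Proof. by have h1 := @continuous_rho2 R; have h2 := @rho2_neq0 R; rewrite /stereo3; cts. Qed.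

Definition cyl (t z : R) : R * R * R :=
  (Num.sqrt (1 - z ^+ 2) * cos t, Num.sqrt (1 - z ^+ 2) * sin t, z).

Let csqrt := @sqrt_continuous R.

Lemma cylE (z c d : R) : -1 <= z <= 1 -> c ^+ 2 + d ^+ 2 = 1 ->
  (Num.sqrt (1 - z ^+ 2) * c) ^+ 2 + (Num.sqrt (1 - z ^+ 2) * d) ^+ 2 + z ^+ 2 = 1.
Proof.
move=> z1 cd; rewrite !exprMn sqr_sqrtr; last by nra.
by rewrite -mulrDr cd; lra.
Qed.

Variable phi : R * R * R -> R.
Hypothesis cphi : continuous phi.

Let S (c d z : R) := phi (Num.sqrt (1 - z ^+ 2) * c, Num.sqrt (1 - z ^+ 2) * d, z).

Let cS (c d : R) : continuous (S c d).
Proof. by rewrite /S; cts. Qed.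

Let Psi (c d : R) := itg (-1) 1 (S c d).

Let cPsi : continuous (fun q : R * R => Psi q.1 q.2).
Proof.
apply: (@itg_continuous _ _ (fun q : R * R * R => S q.1.1 q.1.2 q.2)).
by rewrite /S; cts.
Qed.

(* The height [z = (1 - s^2) / (1 + s^2)] parametrizes a ray of the stereographic plane. *)
Let radial (c d k r : R) : c ^+ 2 + d ^+ 2 = 1 -> 0 < k -> 0 <= r ->
  itg 0 r (fun s => s * (4 * phi (stereo3 (s * k * c, s * k * d)) / rho2 (s * k * c, s * k * d) ^+ 2))
  = k ^- 2 * itg (2 / (1 + r ^+ 2 * k ^+ 2) - 1) 1 (S c d).
Proof.
move=> cd k0 r0; have [P dP] := primitive_ex (@cS c d).
have rhoE s : rho2 (s * k * c, s * k * d) = 1 + s ^+ 2 * k ^+ 2.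
  by rewrite /rho2/= -[X in _ = _ + X]mulr1 -cd; ring.
pose w s := 1 + s ^+ 2 * k ^+ 2.
have w0 s : 0 < w s by rewrite /w ltr_pwDl// mulr_ge0// sqr_ge0.
have wn0 s : w s != 0 by rewrite gt_eqF.
have cw : continuous w by rewrite /w; cts.
pose F s := - k ^- 2 * P (2 / w s - 1).
have cP := is_derive_continuous dP.
have crho := @continuous_rho2 R; have rho0 := @rho2_neq0 R.
have cst := continuous_stereo3.
have rho20 (s : R) : rho2 (s * k * c, s * k * d) ^+ 2 != 0 by rewrite expf_neq0// rho0.
set H := (fun s => s * _).
have dF (s : R) : 0 < s < r -> is_derive s 1 F (H s).
  move=> /andP[s0 sr].
  have dw : is_derive s 1 w (2 * s * k ^+ 2).
    rewrite /w; apply: is_derive_eq; rewrite /GRing.scale/=; ring.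
  have dz : is_derive s 1 (fun s => 2 / w s - 1) (- 4 * s * k ^+ 2 / w s ^+ 2).
    by apply: is_derive_eq; rewrite /GRing.scale/=; field.
  have dPz := @is_derive1_comp _ P (fun s => 2 / w s - 1) s _ _ (dP _) dz.
  have dF : is_derive s 1 F (- k ^- 2 * (S c d (2 / w s - 1) * (- 4 * s * k ^+ 2 / w s ^+ 2))).
    rewrite /F; apply: is_derive_eq; rewrite /GRing.scale/=; ring.
  apply: is_derive_eq_val dF; rewrite /H rhoE -/(w s).
  have sq : Num.sqrt (1 - (2 / w s - 1) ^+ 2) = 2 * s * k / w s.
    rewrite (_ : 1 - _ = (2 * s * k / w s) ^+ 2).
      by rewrite sqrtr_sqr ger0_norm// divr_ge0// ltW// !mulr_gt0.
    have : (s * k) ^+ 2 = w s - 1 by rewrite /w; ring.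
    move: (wn0 s); set V := w s; move=> V0 e.
    have -> : (2 * s * k / V) ^+ 2 = 4 * (s * k) ^+ 2 / V ^+ 2 by field.
    by rewrite e; field.
  have -> : stereo3 (s * k * c, s * k * d) =
      (Num.sqrt (1 - (2 / w s - 1) ^+ 2) * c, Num.sqrt (1 - (2 / w s - 1) ^+ 2) * d, 2 / w s - 1).
    rewrite sq /stereo3 rhoE -/(w s) /=.
    congr (_, _, _); move: (wn0 s); set V := w s; move=> V0; by field.
  rewrite -/(S c d _); move: (S c d _) (wn0 s) (lt0r_neq0 k0) => X; set V := w s.
  by move=> V0 kn0; field; rewrite kn0 V0.
rewrite (itg_FTC r0 _ _ dF).
- have wr : 2 / w r - 1 <= 1.
    rewrite lerBlDr ler_pdivrMr//; suff : 1 <= w r by lra.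
    by rewrite /w lerDl mulr_ge0// sqr_ge0.
  rewrite (itg_primitive (@cS c d) wr dP) /F /w.
  have -> : 2 / (1 + 0 ^+ 2 * k ^+ 2) - 1 = 1 :> R.
    by rewrite expr0n/= mul0r addr0 divr1; lra.
  ring.
- by rewrite /H; cts.
- by rewrite /F; set kk := - k ^- 2; cts.
Qed.

(** A full period may start anywhere; [- 3 pi / 4] is the direction of a corner of the square. *)
Let angular (W : R -> R) : (forall t : R, is_derive t 1 W (Psi (cos t) (sin t))) ->
  W (pi * (5 / 4)) - W (- pi * (3 / 4)) = itg 0 (2 * pi) (fun t => Psi (cos t) (sin t)).
Proof.
move=> dW.
have cc := @continuous_cos R; have cs := @continuous_sin R.
have cPt : continuous (fun t => Psi (cos t) (sin t)).
  exact: (continuous_comp_top cPsi (continuous_pair_mk cc cs)).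
have pi0 : 0 <= 2 * pi :> R by rewrite mulr_ge0// pi_ge0.
rewrite (itg_primitive cPt pi0 dW).
have dz (x : R) : is_derive x 1 (fun x => W (1 * x + 2 * pi) - W (1 * x + 0)) 0.
  have d1 := @is_derive_affine _ _ _ 1 (2 * pi) x dW.
  have d2 := @is_derive_affine _ _ _ 1 0 x dW.
  apply: is_derive_eq.
  by rewrite !mul1r addr0 [2 * pi]mulr_natl cosD2pi sinD2pi subrr.
have /= := is_derive_0_is_cst (- pi * (3 / 4)) 0 dz.
rewrite !mul1r !addr0 add0r => <-; congr (W _ - _).
by field.
Qed.

(** The square misses only a neighbourhood of the south pole: along each ray the missing heights
    form an interval of length at most [2 / (1 + r^2)]. *)
Lemma stereographic_square (M r : R) :
  (forall p : R * R * R, p.1.1 ^+ 2 + p.1.2 ^+ 2 + p.2 ^+ 2 = 1 -> `|phi p| <= M) -> 0 <= r ->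
  `|itg2 (- r) r (- r) r (fun p => 4 * phi (stereo3 p) / rho2 p ^+ 2) -
    itg 0 (2 * pi) (fun t => itg (-1) 1 (fun z => phi (cyl t z)))| <= 16 * M / (1 + r ^+ 2).
Proof.
move=> phiM r0.
have cc := @continuous_cos R; have cs := @continuous_sin R.
have cPt : continuous (fun t => Psi (cos t) (sin t)).
  exact: (continuous_comp_top cPsi (continuous_pair_mk cc cs)).
have crho := @continuous_rho2 R; have rho0 := @rho2_neq0 R.
have rho20 (p : R * R) : rho2 p ^+ 2 != 0 by rewrite expf_neq0// rho0.
have cst := continuous_stereo3.
pose g p := 4 * phi (stereo3 p) / rho2 p ^+ 2.
have cg : continuous g by rewrite /g; cts.
have [W dW] := primitive_ex cPt.
(* The four sides of the square: the points [(1, t)], [(-1, t)], [(t, 1)], [(t, -1)] have directions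
   [a], [pi - a], [pi / 2 - a], [a - pi / 2] with [a = atan t]. As [t] runs over [[-1, 1]] they
   sweep one full turn. *)
pose V t := W (1 * t + 0) - W (-1 * t + pi) - W (-1 * t + pi / 2) + W (1 * t + (- (pi / 2))).
pose Sum4 (c d : R) := Psi c d + Psi (- c) d + Psi d c + Psi d (- c).
have dV (t : R) : is_derive t 1 V (Sum4 (cos t) (sin t)).
  have d1 := @is_derive_affine _ _ _ 1 0 t dW.
  have d2 := @is_derive_affine _ _ _ (-1) pi t dW.
  have d3 := @is_derive_affine _ _ _ (-1) (pi / 2) t dW.
  have d4 := @is_derive_affine _ _ _ 1 (- (pi / 2)) t dW.
  rewrite /V; apply: is_derive_eq.
  rewrite !mul1r addr0 !mulN1r !opprK cosDpi sinDpi cosDpihalf sinDpihalf.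
  by rewrite cosBpihalf sinBpihalf !cosN !sinN !opprK.
pose k t : R := Num.sqrt (1 + t ^+ 2).
have k2 t : k t ^+ 2 = 1 + t ^+ 2 by rewrite /k sqr_sqrtr// addr_ge0// sqr_ge0.
have k0 t : 0 < k t by rewrite /k sqrtr_gt0 ltr_pwDl// sqr_ge0.
have kn0 t : k t != 0 by rewrite gt_eqF.
have atanE t : cos (atan t) = 1 / k t /\ sin (atan t) = t / k t.
  have ca : cos (atan t) = 1 / k t by rewrite cos_atan div1r.
  split=> //; have := atanK t; rewrite /tan ca => /(congr1 (fun x => x * (1 / k t))).
  rewrite divfK ?ca; last by rewrite div1r invr_eq0.
  by move=> ->; rewrite div1r.
have ck : continuous k by rewrite /k; cts.
have ct2 : continuous (fun t : R => 1 + t ^+ 2) by cts.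
have t20 (t : R) : 1 + t ^+ 2 != 0 by rewrite -k2 expf_neq0.
have cSum : continuous (fun t : R => Sum4 (1 / k t) (t / k t) / (1 + t ^+ 2)).
  have cP2 (a b : R -> R) : continuous a -> continuous b -> continuous (fun t => Psi (a t) (b t)).
    by move=> ca cb; exact: (continuous_comp_top cPsi (continuous_pair_mk ca cb)).
  rewrite /Sum4; apply: continuous_mul; last by cts.
  by apply: continuous_add; [apply: continuous_add; [apply: continuous_add|]|]; apply: cP2; cts.
have N1 : -1 <= 1 :> R by lra.
have dVa (t : R) : is_derive t 1 (V \o atan) (Sum4 (1 / k t) (t / k t) / (1 + t ^+ 2)).
  have [<- <-] := atanE t.
  exact: is_derive1_comp.
have tot : itg 0 (2 * pi) (fun t => itg (-1) 1 (fun z => phi (cyl t z))) =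
    itg (-1) 1 (fun t => Sum4 (1 / k t) (t / k t) / (1 + t ^+ 2)).
  rewrite (itg_primitive cSum N1 dVa) -[LHS](angular dW) /V/= atanN atan1.
  rewrite !mul1r !mulN1r !addr0 !opprK.
  have -> : pi / 4 + pi = pi * (5 / 4) :> R by field.
  have -> : - (pi / 4) + pi / 2 = pi / 4 :> R by field.
  have -> : pi / 4 - pi / 2 = - (pi / 4) :> R by field.
  have -> : - (pi / 4) - pi / 2 = - pi * (3 / 4) :> R by field.
  have -> : - (pi / 4) + pi = pi / 4 + pi / 2 :> R by field.
  ring.
rewrite -/g tot square_polar//.
have cg4 : continuous (fun q : R * R => q.1 * (g (q.1, q.1 * q.2) + g (- q.1, q.1 * q.2) +
    g (q.1 * q.2, q.1) + g (q.1 * q.2, - q.1))) by cts.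
rewrite (itg_fubini _ _ _ _ cg4)/=.
have cL : continuous (fun t => itg 0 r (fun s => s * (g (s, s * t) + g (- s, s * t) +
    g (s * t, s) + g (s * t, - s)))).
  by apply: (@itg_continuous _ _ (fun q : R * R => q.2 * (g (q.2, q.2 * q.1) + g (- q.2, q.2 * q.1) +
    g (q.2 * q.1, q.2) + g (q.2 * q.1, - q.2)))); cts.
rewrite -(itgB _ _ cL cSum).
apply: (le_trans (@itg_bound _ _ _ _ (8 * M / (1 + r ^+ 2)) N1 _ _)).
- by apply: continuous_add => //; exact: continuous_opp.
- move=> t _; set kt := k t.
  have gE (a b c d : R) : c ^+ 2 + d ^+ 2 = 1 -> (forall s, a * s = s * kt * c) ->
      (forall s, b * s = s * kt * d) -> itg 0 r (fun s => s * g (a * s, b * s)) =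
      kt ^- 2 * itg (2 / (1 + r ^+ 2 * kt ^+ 2) - 1) 1 (S c d).
    move=> cd ea eb; rewrite -radial//; last exact: k0.
    by apply: eq_itg => s _; rewrite /g ea eb.
  set zr := 2 / (1 + r ^+ 2 * kt ^+ 2) - 1.
  have u0 : 0 < 1 + r ^+ 2 * kt ^+ 2 by rewrite ltr_pwDl// mulr_ge0// sqr_ge0.
  have r20 : 0 < 1 + r ^+ 2 by rewrite ltr_pwDl// sqr_ge0.
  have kt1 : 1 <= kt ^+ 2 by rewrite /kt k2 lerDl sqr_ge0.
  have zrN : -1 <= zr by rewrite /zr lerBrDr addNr divr_ge0// ltW.
  have zr1 : zr <= 1.
    rewrite /zr lerBlDr ler_pdivrMr//; suff : 0 <= r ^+ 2 * kt ^+ 2 by lra.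
    by rewrite mulr_ge0// sqr_ge0.
  have kti : 0 <= kt ^- 2 <= 1.
    rewrite invr_ge0 sqr_ge0/= invf_le1//.
    by rewrite (lt_le_trans ltr01).
  have errS (c d : R) : c ^+ 2 + d ^+ 2 = 1 ->
      `|kt ^- 2 * itg zr 1 (S c d) - kt ^- 2 * Psi c d| <= 2 * M / (1 + r ^+ 2).
    move=> cd; rewrite /Psi (itg_split (@cS c d) zrN zr1).
    rewrite -mulrBr opprD addrCA subrr addr0 normrM normrN.
    have b1 : `|itg (-1) zr (S c d)| <= M * (zr - -1).
      apply: itg_bound => // z /andP[z1 z2]; apply: phiM => /=.
      by apply: cylE => //; rewrite z1/= (le_trans z2).
    have zrE : zr - -1 <= 2 / (1 + r ^+ 2).
      rewrite /zr opprK subrK ler_pM2l// lef_pV2 ?posrE// lerD2l ler_peMr ?sqr_ge0//.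
    have M0 : 0 <= M.
      by apply: le_trans (phiM (1, 0, 0) _); rewrite ?normr_ge0//= expr1n !expr0n/= !addr0.
    have b2 : `|itg (-1) zr (S c d)| <= 2 * M / (1 + r ^+ 2).
      apply: (le_trans b1); apply: (le_trans (ler_wpM2l M0 zrE)).
      by rewrite mulrCA mulrA.
    apply: le_trans b2; case/andP: kti => k1 k3.
    rewrite ger0_norm//; exact: ler_piMl.
  have cd1 : (1 / kt) ^+ 2 + (t / kt) ^+ 2 = 1.
    rewrite !expr_div_n -mulrDl expr1n -k2 divff// expf_neq0//; exact: kn0.
  have cd2 : (- (1 / kt)) ^+ 2 + (t / kt) ^+ 2 = 1 by rewrite sqrrN.
  have cd3 : (t / kt) ^+ 2 + (1 / kt) ^+ 2 = 1 by rewrite addrC.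
  have cd4 : (t / kt) ^+ 2 + (- (1 / kt)) ^+ 2 = 1 by rewrite sqrrN addrC.
  have ktn0 : kt != 0 by exact: kn0.
  have e1 s : 1 * s = s * kt * (1 / kt) by field.
  have e2 s : -1 * s = s * kt * (- (1 / kt)) by field.
  have e3 s : t * s = s * kt * (t / kt) by field.
  have c1 : continuous (fun s : R => s * g (1 * s, t * s)) by cts.
  have c2 : continuous (fun s : R => s * g (-1 * s, t * s)) by cts.
  have c3 : continuous (fun s : R => s * g (t * s, 1 * s)) by cts.
  have c4 : continuous (fun s : R => s * g (t * s, -1 * s)) by cts.
  have -> : itg 0 r (fun s => s * (g (s, s * t) + g (- s, s * t) + g (s * t, s) + g (s * t, - s))) =
     itg 0 r (fun s => s * g (1 * s, t * s) + s * g (-1 * s, t * s) + s * g (t * s, 1 * s) +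
       s * g (t * s, -1 * s)).
    by apply: eq_itg => s _; rewrite !mul1r !mulN1r !mulrDr !(mulrC t).
  rewrite (itgD _ _ (continuous_add (continuous_add c1 c2) c3) c4).
  rewrite (itgD _ _ (continuous_add c1 c2) c3) (itgD _ _ c1 c2).
  rewrite (gE _ _ _ _ cd1 e1 e3) (gE _ _ _ _ cd2 e2 e3) (gE _ _ _ _ cd3 e3 e1).
  rewrite (gE _ _ _ _ cd4 e3 e2) -k2 -/kt /Sum4.
  move: (errS _ _ cd1) (errS _ _ cd2) (errS _ _ cd3) (errS _ _ cd4).
  rewrite -/zr.
  set x1 := kt ^- 2 * itg _ _ _; set x2 := kt ^- 2 * itg _ _ _.
  set x3 := kt ^- 2 * itg _ _ _; set x4 := kt ^- 2 * itg _ _ _.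
  set y1 := Psi _ _; set y2 := Psi _ _; set y3 := Psi _ _; set y4 := Psi _ _.
  have -> : x1 + x2 + x3 + x4 - (y1 + y2 + y3 + y4) / kt ^+ 2 =
    (x1 - kt ^- 2 * y1) + (x2 - kt ^- 2 * y2) + (x3 - kt ^- 2 * y3) + (x4 - kt ^- 2 * y4).
    by ring.
  have -> : 8 * M / (1 + r ^+ 2) = 2 * M / (1 + r ^+ 2) + 2 * M / (1 + r ^+ 2) +
    2 * M / (1 + r ^+ 2) + 2 * M / (1 + r ^+ 2) by ring.
  move=> h1 h2 h3 h4.
  apply: (le_trans (ler_normD _ _)); apply: lerD => //.
  apply: (le_trans (ler_normD _ _)); apply: lerD => //.
  by apply: (le_trans (ler_normD _ _)); apply: lerD.
- have -> : 1 - -1 = 2 :> R by lra.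
  by rewrite le_eqVlt; apply/orP; left; apply/eqP; ring.
Qed.

End stereographic.

(** * The area measure of the sphere *)

Section sphere_measure.
Context {R : realType}.
Local Notation E := 'rV[R]_3.
Local Notation mu := (@lebesgue_measure R).
Local Notation sig := (@sphere_measure R).

Lemma measurable_coord (i : 'I_3) : measurable_fun [set: E] (fun x => x 0 i).
Proof.
move=> _ B mB; rewrite setTI; apply: sub_sigma_algebra => /=.
rewrite -bigcup_seq/=; exists i => //=; first by rewrite mem_index_enum.
by exists B => //; rewrite setTI.
Qed.

Definition coords (x : E) : R * R * R := (x 0 0, x 0 1, x 0 2).

Lemma measurable_comp_coords (phi : R * R * R -> R) : continuous phi ->
  measurable_fun [set: E] (fun x => phi (coords x)).
Proof. by move=> cp; apply: measurable_continuous3 => //; exact: measurable_coord. Qed.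

Lemma dotE (x y : E) : dot x y = x 0 0 * y 0 0 + x 0 1 * y 0 1 + x 0 2 * y 0 2.
Proof.
rewrite /dot !big_ord_recl big_ord0 addr0 addrA; congr (_ * _ + _ * _ + _ * _).
- by congr (x _ _); exact/val_inj.
- by congr (y _ _); exact/val_inj.
- by congr (x _ _); exact/val_inj.
- by congr (y _ _); exact/val_inj.
Qed.

Lemma coords_chart (p : R * R) : coords (chart p) = cyl p.2 p.1.
Proof. by rewrite /coords /chart /cyl !mxE. Qed.

Lemma measurable_sphere : measurable (@sphere R).
Proof.
have m : measurable_fun [set: E] (fun x : E => dot x x).
  have c : continuous (fun p : R * R * R => p.1.1 * p.1.1 + p.1.2 * p.1.2 + p.2 * p.2) by cts.
  apply: (eq_measurable_fun _ _ (measurable_comp_coords c)).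
  by move=> x _; rewrite dotE.
have := m measurableT _ (measurable_set1 (1 : R)); rewrite setTI.
by congr (measurable _); apply/seteqP; split => x.
Qed.

Lemma sphere_measure_sphereC : sig (~` (@sphere R)) = 0%E.
Proof.
rewrite /sphere_measure /pushforward /mrestr (_ : _ `&` _ = set0) ?measure0//.
apply/seteqP; split => // p [/= + Dp]; apply; exact: sphere_chart.
Qed.

Lemma sphere_measure_finite : (sig [set: E] < +oo)%E.
Proof. by rewrite sphere_area ltry. Qed.

Lemma sphere_measure_fin_num : fin_num_fun sig.
Proof.
move=> A mA; rewrite ge0_fin_numE//; apply: le_lt_trans sphere_measure_finite.
by apply: le_measure; rewrite ?inE.
Qed.

HB.instance Definition _ := Measure_isFinite.Build _ _ _ sig sphere_measure_fin_num.

Lemma ae_sphere : \forall x \ae sig, sphere x.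
Proof.
exists (~` (@sphere R)); split => //.
  apply: measurableC; exact: measurable_sphere.
exact: sphere_measure_sphereC.
Qed.

Lemma sphere_bounded_integrable (f : E -> R) (M : R) : measurable_fun [set: E] f ->
  (forall x, sphere x -> `|f x| <= M) -> sig.-integrable setT (EFin \o f).
Proof.
move=> mf fM.
have mC : measurable (~` (@sphere R)) by apply: measurableC; exact: measurable_sphere.
apply/(negligible_integrable mC _ _ sphere_measure_sphereC) => //.
  exact/measurable_EFinP.
rewrite setTD setCK; apply: measurable_bounded_integrable.
- exact: measurable_sphere.
- by apply: le_lt_trans sphere_measure_finite; apply: le_measure; rewrite ?inE//; exact: measurable_sphere.
- exact: measurable_funS mf.
- exists M; split; first exact: num_real.
  by move=> N MN x /= Sx; apply: (le_trans (fM _ Sx)); exact: ltW.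
Qed.

(** Unfolds the image measure: the complement of the chart domain is null for the restricted
    Lebesgue measure, Fubini applies to the bounded integrand, and closing the intervals does not
    change the integrals. *)
Lemma sphere_integral_cyl (phi : R * R * R -> R) : continuous phi ->
  \int[sig]_x phi (coords x) = itg 0 (2 * pi) (fun t => itg (-1) 1 (fun z => phi (cyl t z))).
Proof.
move=> cphi.
have csqrt := @sqrt_continuous R; have cc := @continuous_cos R; have cs := @continuous_sin R.
pose g (p : R * R) := phi (coords (chart p)).
have gE p : g p = phi (cyl p.2 p.1) by rewrite /g coords_chart.
have cg : continuous g.
  rewrite (_ : g = fun p => phi (cyl p.2 p.1)); last by apply/funext.
  by rewrite /cyl; cts.
have mg : measurable_fun [set: R * R] g.
  have := @measurable_continuous2 _ _ _ g _ _ cg (@measurable_fst _ _ _ _) (@measurable_snd _ _ _ _).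
  by apply: eq_measurable_fun => -[].
pose D := @chart_dom R.
have mD : measurable D := measurable_chart_dom.
pose m1 := [the measure _ _ of mrestr (mu \x mu)%E (@measurable_chart_dom R)].
have m1E A : m1 A = (mu \x mu)%E (A `&` D) by [].
have m1D : m1 (~` D) = 0%E by rewrite m1E setICl measure0.
have [M gM] := continuous_bounded_box (-1) 1 0 (2 * pi) cg.
have gMD p : D p -> `|g p| <= M.
  case: p => x y [/=]; rewrite !in_itv/= => /andP[h1 h2] /andP[h3 h4].
  by apply: gM; rewrite !ltW.
have Dfin : ((mu \x mu)%E D < +oo)%E.
  rewrite [X in (X < _)%E]product_measure1E//.
  rewrite [X in (X * _)%E](@lebesgue_measure_itv R `]-1, 1[)/=.
  rewrite [X in (_ * X)%E](@lebesgue_measure_itv R `]0, 2 * pi[)/=.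
  by do 2 case: ifP => _; rewrite -EFinM ?ltry.
have bg : [bounded g p | p in D].
  exists M; split; first exact: num_real.
  by move=> N MN p /= Dp; apply: (le_trans (gMD _ Dp)); exact: ltW.
have igD : (mu \x mu)%E.-integrable D (EFin \o g).
  by apply: measurable_bounded_integrable => //; exact: measurable_funS mg.
have TD : [set: R * R] `\` ~` D = D by rewrite setTD setCK.
have ig1 : m1.-integrable setT (EFin \o g).
  have mEg : measurable_fun setT (EFin \o g) by exact/measurable_EFinP.
  have [_ h] := @negligible_integrable _ _ R m1 setT (~` D) (EFin \o g) (measurableC mD)
    measurableT mEg m1D.
  apply: h.
  rewrite TD; apply: measurable_bounded_integrable => //; last exact: measurable_funS mg.
  by rewrite m1E setIid.
rewrite /Rintegral /sphere_measure.
rewrite (@integral_pushforward _ _ (measurableTypeR R * measurableTypeR R)%type _ R (@chart R) _ m1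
  _ (fun x => (phi (coords x))%:E))//; first last.
- by apply/measurable_EFinP; exact: (measurable_comp_coords cphi).
- by move=> mT B mB; exact: (@measurable_chart R measurableT B mB).
have negl := @negligible_integral _ _ R m1 setT (~` D) (EFin \o g) (measurableC mD) measurableT
  ig1 m1D.
rewrite preimage_setT negl TD.
rewrite (@eq_measure_integral _ _ _ _ (mu \x mu)%E); last first.
  by move=> A mA AD; rewrite m1E setIidl.
rewrite [X in fine X]integral_mkcond -integral21_prod_meas1; last by rewrite -integrable_mkcond.
have inner (h : R -> R) a b : continuous h ->
    (\int[mu]_(y in `]a, b[) (h y)%:E)%E = (itg a b h)%:E.
  move=> ch; rewrite -(@integral_itv_bndoo _ _ _ _ true false).
    by rewrite /itg /Rintegral fineK//; apply: integrable_fin_num => //; exact: continuous_integrable.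
  by apply/measurable_EFinP; apply: measurable_funTS; exact: (continuous_measurable_fun ch).
transitivity (fine (\int[mu]_(t in `]0, 2 * pi[) (itg (-1) 1 (fun z => phi (cyl t z)))%:E)).
  congr fine; rewrite [RHS]integral_mkcond; apply: eq_integral => t _; rewrite /patch.
  case: ifPn => tD.
    rewrite -inner; last by rewrite /cyl; cts.
    rewrite [RHS]integral_mkcond; apply: eq_integral => z _.
    rewrite /patch/= gE/=; congr (if _ then _ else _).
    apply/idP/idP; rewrite !inE/=; first by case.
    by split=> //=; rewrite inE in tD.
  rewrite /fubini_G integral0_eq// => z _; rewrite ifN//.
  by apply: contra tD; rewrite !inE => -[].
rewrite inner//; apply: (@itg_continuous _ _ (fun q : R * R => phi (cyl q.1 q.2))).
by rewrite /cyl; cts.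
Qed.

Lemma eq_sphere_integral (f g : E -> R) : (forall x, sphere x -> f x = g x) ->
  measurable_fun [set: E] f -> measurable_fun [set: E] g ->
  \int[sig]_x f x = \int[sig]_x g x.
Proof.
move=> fg mf mg; rewrite /Rintegral; congr fine.
apply: ae_eq_integral => //; [exact/measurable_EFinP|exact/measurable_EFinP|].
by apply: filterS ae_sphere => x Sx _ /=; rewrite fg.
Qed.

Lemma cvg_stereographic (phi : R * R * R -> R) (M : R) : continuous phi ->
  (forall p, p.1.1 ^+ 2 + p.1.2 ^+ 2 + p.2 ^+ 2 = 1 -> `|phi p| <= M) ->
  itg2 (- r) r (- r) r (fun p => 4 * phi (stereo3 p) / rho2 p ^+ 2) @[r --> +oo] -->
  \int[sig]_x phi (coords x).
Proof.
move=> cphi pM; rewrite sphere_integral_cyl//; set L := itg 0 _ _.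
have M0 : 0 <= M.
  by apply: le_trans (pM (1, 0, 0) _); rewrite ?normr_ge0//= expr1n !expr0n/= !addr0.
apply/cvgrPdist_le => e e0; near=> r.
have r1 : 1 <= r by near: r; apply: nbhs_pinfty_ge; exact: num_real.
have re : 16 * M / e <= r by near: r; apply: nbhs_pinfty_ge; exact: num_real.
rewrite distrC; apply: (le_trans (stereographic_square cphi pM (le_trans ler01 r1))).
rewrite ler_pdivrMr; last by rewrite ltr_pwDl// sqr_ge0.
move: re; rewrite ler_pdivrMr// => re; apply: (le_trans re).
by rewrite mulrC ler_pM2l//; nra.
Unshelve. all: by end_near. Qed.

End sphere_measure.

(** * Ambient calculus along the sphere *)

Section chain_rule.
Context {R : realType}.
Local Notation E := 'rV[R]_3.

Definition pt (p : R * R * R) : E := \row_(k < 3) [:: p.1.1; p.1.2; p.2]`_k.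

Definition partial (k : 'I_3) (f : E -> R) (x : E) : R := 'D_(delta_mx 0 k) f x.

Lemma coordsK : cancel (@coords R) pt.
Proof.
move=> x; apply/rowP => -[[|[|[|//]]] i3]; rewrite !mxE /=; congr (x _ _); exact/val_inj.
Qed.

Lemma ptK : cancel pt (@coords R).
Proof. by move=> [[x y] z]; rewrite /coords !mxE. Qed.

Lemma ord3P (P : 'I_3 -> Prop) : P 0 -> P 1 -> P 2 -> forall k, P k.
Proof.
move=> P0 P1 P2 [[|[|[|//]]] i3].
- by rewrite (_ : Ordinal i3 = 0)//; exact/val_inj.
- by rewrite (_ : Ordinal i3 = 1)//; exact/val_inj.
- by rewrite (_ : Ordinal i3 = 2)//; exact/val_inj.
Qed.

Lemma sum3E (V : nmodType) (F : 'I_3 -> V) : \sum_k F k = F 0 + F 1 + F 2.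
Proof.
rewrite !big_ord_recl big_ord0 addr0 addrA; congr (F _ + F _ + F _); exact/val_inj.
Qed.

Lemma derive_partial (f : E -> R) (x v : E) : differentiable f x ->
  'D_v f x = v 0 0 * partial 0 f x + v 0 1 * partial 1 f x + v 0 2 * partial 2 f x.
Proof.
move=> df; rewrite /partial !deriveE// [in LHS](row_sum_delta v) linear_sum sum3E.
by rewrite !linearZ.
Qed.

Lemma continuous_coord (k : 'I_3) : continuous (fun x : E => x 0 k).
Proof. exact: coord_continuous. Qed.

Lemma is_derive_path (f : E -> R) (a b c : R -> R) (t a' b' c' : R) :
  differentiable f (pt (a t, b t, c t)) ->
  is_derive t 1 a a' -> is_derive t 1 b b' -> is_derive t 1 c c' ->
  is_derive t 1 (fun t => f (pt (a t, b t, c t)))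
    (a' * partial 0 f (pt (a t, b t, c t)) + b' * partial 1 f (pt (a t, b t, c t)) +
     c' * partial 2 f (pt (a t, b t, c t))).
Proof.
move=> df da db dc; pose g t := pt (a t, b t, c t).
have dgk i k : is_derive t 1 (fun t => g t i k) ([:: a'; b'; c']`_k).
  move: k; apply: ord3P => /=.
  - by rewrite (_ : (fun t => _) = a)//; apply/funext => s; rewrite mxE.
  - by rewrite (_ : (fun t => _) = b)//; apply/funext => s; rewrite mxE.
  - by rewrite (_ : (fun t => _) = c)//; apply/funext => s; rewrite mxE.
have dg : derivable g t 1.
  by apply/derivable_mxP => i k; have [] := dgk i k.
have gE : 'D_1 g t = pt (a', b', c').
  rewrite derive_mx//; apply/matrixP => i k; rewrite !mxE.
  by have [_ ->] := dgk i k; rewrite /=.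
have dg' : differentiable g t by apply/derivable1_diffP.
have dfg : differentiable (f \o g) t by exact: differentiable_comp.
apply: DeriveDef; first exact/derivable1_diffP.
transitivity ('d f (g t) ('d g t 1)).
  by rewrite (_ : (fun t => _) = f \o g)// deriveE// diff_comp.
by rewrite -(deriveE _ dg') gE -deriveE// derive_partial// !mxE.
Qed.

Lemma sphere_coords (x : E) : sphere x <-> (x 0 0) ^+ 2 + (x 0 1) ^+ 2 + (x 0 2) ^+ 2 = 1.
Proof. by rewrite /sphere/= dotE -!expr2. Qed.

Lemma continuous_pt : continuous pt.
Proof.
move=> p; apply/(@cvg_ballP _ E) => e e0.
have c k : continuous (fun q => pt q 0 k).
  move: k; apply: ord3P.
  - by rewrite (_ : (fun q => _) = (fun q => q.1.1)); [cts|apply/funext => q; rewrite mxE].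
  - by rewrite (_ : (fun q => _) = (fun q => q.1.2)); [cts|apply/funext => q; rewrite mxE].
  - by rewrite (_ : (fun q => _) = snd); [cts|apply/funext => q; rewrite mxE].
have h k : \forall q \near p, ball (pt p 0 k) e (pt q 0 k).
  by have /cvg_ballP := c k p; apply.
have := h 0; have := h 1; have := h 2; apply: filterS3 => q h2 h1 h0; split=> // i k.
by rewrite (ord1 i); move: k; exact: ord3P.
Qed.

Lemma continuous_coords : continuous (@coords R).
Proof. by apply: continuous_pair_mk; [apply: continuous_pair_mk|]; exact: continuous_coord. Qed.

Lemma sphere_compact : compact (@sphere R).
Proof.
apply: bounded_closed_compact.
- exists 1; split; first exact: num_real.
  move=> M M1 x /= /sphere_coords xS; apply: le_trans (ltW M1).
  rewrite /Num.Def.normr/= mx_normrE; apply/bigmax_leP; split => //= -[i k] _ /=.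
  rewrite (ord1 i) -(@ler_pXn2r _ 2)// ?nnegrE// real_normK ?num_real// expr1n -xS.
  move: k; apply: ord3P.
  + by rewrite -addrA lerDl addr_ge0// sqr_ge0.
  + by rewrite addrAC lerDr addr_ge0// sqr_ge0.
  + by rewrite lerDr addr_ge0// sqr_ge0.
- rewrite (_ : @sphere R = (fun x : E => dot x x) @^-1` [set 1])//.
  apply: closed_comp => [x _|]; last exact: closed_eq.
  rewrite (_ : (fun x : E => _) = (fun p : R * R * R =>
    p.1.1 * p.1.1 + p.1.2 * p.1.2 + p.2 * p.2) \o coords); last first.
    by apply/funext => y; rewrite dotE.
  apply: continuous_comp; first exact: continuous_coords.
  have c : continuous (fun p : R * R * R => p.1.1 * p.1.1 + p.1.2 * p.1.2 + p.2 * p.2) by cts.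
  exact: c.
Qed.

Lemma sphere_bounded (f : E -> R) : continuous f -> exists M, forall x, sphere x -> `|f x| <= M.
Proof.
move=> cf; have := @continuous_compact _ _ f (@sphere R) (continuous_subspaceT cf) sphere_compact.
move=> /compact_bounded[M [Mr MP]]; exists (M + 1) => x Sx.
by apply: (MP (M + 1)); [rewrite ltrDl|exists x].
Qed.

Lemma continuous_on_pt (f : E -> R) : continuous f -> continuous (f \o pt).
Proof. by move=> cf; exact: (continuous_comp_top cf continuous_pt). Qed.

Lemma measurable_continuous_rV (f : E -> R) : continuous f -> measurable_fun [set: E] f.
Proof.
move=> cf; have := measurable_comp_coords (continuous_on_pt cf).
by apply: eq_measurable_fun => x _ /=; rewrite coordsK.
Qed.

Lemma cvg_stereographic_rV (f : E -> R) : continuous f ->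
  itg2 (- r) r (- r) r (fun p => 4 * f (pt (stereo3 p)) / rho2 p ^+ 2) @[r --> +oo] -->
  \int[@sphere_measure R]_x f x.
Proof.
move=> cf; have [M fM] := sphere_bounded cf.
have := cvg_stereographic (M := M) (continuous_on_pt cf).
rewrite [X in _ --> X](_ : _ = \int[@sphere_measure R]_x f x); last first.
  by apply: eq_Rintegral => x _; rewrite /= coordsK.
apply=> p pS; apply: fM; apply/sphere_coords; rewrite !mxE/=; exact: pS.
Qed.

Lemma continuous_integrable_sphere (f : E -> R) : continuous f ->
  (@sphere_measure R).-integrable setT (EFin \o f).
Proof.
move=> cf; have [M fM] := sphere_bounded cf.
exact: (sphere_bounded_integrable (measurable_continuous_rV cf) fM).
Qed.

End chain_rule.

(** * Conformality of the stereographic coordinates *)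

Section stereographic_derivatives.
Context {R : realType}.
Local Notation E := 'rV[R]_3.

Definition C1 (f : E -> R) : Prop :=
  (forall x, differentiable f x) /\ forall k, continuous (partial k f).

Lemma C1_continuous (f : E -> R) : C1 f -> continuous f.
Proof. by move=> [df _] x; exact: differentiable_continuous. Qed.

Definition stereo (p : R * R) : E := pt (stereo3 p).

Lemma continuous_stereo : continuous stereo.
Proof. exact: (continuous_comp_top (@continuous_pt R) (@continuous_stereo3 R)). Qed.

Lemma sphere_stereo p : sphere (stereo p).
Proof.
apply/sphere_coords; rewrite !mxE/= /rho2; have := @rho2_neq0 R p; rewrite /rho2 => h.
by field; exact: h.
Qed.

Definition stereo_dx (p : R * R) : R * R * R :=
  (2 / rho2 p - 4 * p.1 ^+ 2 / rho2 p ^+ 2, - (4 * p.1 * p.2 / rho2 p ^+ 2),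
   - (4 * p.1 / rho2 p ^+ 2)).
Definition stereo_dy (p : R * R) : R * R * R :=
  (- (4 * p.1 * p.2 / rho2 p ^+ 2), 2 / rho2 p - 4 * p.2 ^+ 2 / rho2 p ^+ 2,
   - (4 * p.2 / rho2 p ^+ 2)).

Lemma is_derive_rho2_1 (x y : R) : is_derive x 1 (fun x => rho2 (x, y)) (2 * x).
Proof. rewrite /rho2/=; apply: is_derive_eq; rewrite /GRing.scale/=; ring. Qed.
Lemma is_derive_rho2_2 (x y : R) : is_derive y 1 (fun y => rho2 (x, y)) (2 * y).
Proof. rewrite /rho2/=; apply: is_derive_eq; rewrite /GRing.scale/=; ring. Qed.

Definition dotp (u : R * R * R) (f : E -> R) (x : E) : R :=
  u.1.1 * partial 0 f x + u.1.2 * partial 1 f x + u.2 * partial 2 f x.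

Lemma is_derive_stereo_x (f : E -> R) (x y : R) : C1 f ->
  is_derive x 1 (fun x => f (stereo (x, y))) (dotp (stereo_dx (x, y)) f (stereo (x, y))).
Proof.
move=> [df _]; rewrite /dotp /stereo /stereo3 /stereo_dx.
have r0 := @rho2_neq0 R (x, y); have dr := is_derive_rho2_1 x y.
apply: (@is_derive_path _ f (fun x => 2 * x / rho2 (x, y)) (fun x => 2 * y / rho2 (x, y))
  (fun x => (2 - rho2 (x, y)) / rho2 (x, y))) => //.
- by apply: is_derive_eq; rewrite /GRing.scale/=; field; exact: r0.
- by apply: is_derive_eq; rewrite /GRing.scale/=; field; exact: r0.
- by apply: is_derive_eq; rewrite /GRing.scale/=; field; exact: r0.
Qed.

Lemma is_derive_stereo_y (f : E -> R) (x y : R) : C1 f ->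
  is_derive y 1 (fun y => f (stereo (x, y))) (dotp (stereo_dy (x, y)) f (stereo (x, y))).
Proof.
move=> [df _]; rewrite /dotp /stereo /stereo3 /stereo_dy.
have r0 := @rho2_neq0 R (x, y); have dr := is_derive_rho2_2 x y.
apply: (@is_derive_path _ f (fun y => 2 * x / rho2 (x, y)) (fun y => 2 * y / rho2 (x, y))
  (fun y => (2 - rho2 (x, y)) / rho2 (x, y))) => //.
- by apply: is_derive_eq; rewrite /GRing.scale/=; field; exact: r0.
- by apply: is_derive_eq; rewrite /GRing.scale/=; field; exact: r0.
- by apply: is_derive_eq; rewrite /GRing.scale/=; field; exact: r0.
Qed.

Lemma continuous_dotp_stereo (u : R * R -> R * R * R) (f : E -> R) : continuous u -> C1 f ->
  continuous (fun p => dotp (u p) f (stereo p)).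
Proof.
move=> cu [_ cf]; have cs := continuous_stereo.
have c0 := cf 0; have c1 := cf 1; have c2 := cf 2.
by rewrite /dotp; cts.
Qed.

Lemma continuous_stereo_dx : continuous stereo_dx.
Proof.
have h1 := @continuous_rho2 R; have h2 := @rho2_neq0 R.
have h3 (p : R * R) : rho2 p ^+ 2 != 0 by rewrite expf_neq0.
by rewrite /stereo_dx; cts.
Qed.

Lemma continuous_stereo_dy : continuous stereo_dy.
Proof.
have h1 := @continuous_rho2 R; have h2 := @rho2_neq0 R.
have h3 (p : R * R) : rho2 p ^+ 2 != 0 by rewrite expf_neq0.
by rewrite /stereo_dy; cts.
Qed.

(** The derivative along the position vector; on the sphere, the radial derivative. *)
Definition euler (f : E -> R) (x : E) : R := dotp (coords x) f x.

(** On the sphere, the [k]-th ambient component of the tangential gradient. *)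
Definition sgrad (k : 'I_3) (f : E -> R) (x : E) : R := partial k f x - x 0 k * euler f x.

(** The vectors [stereo_dx] and [stereo_dy] are tangent, orthogonal and of length [2 / rho2], so
    contracting them with the derivatives along them gives [4 / rho2^2] times the tangential
    projection. *)
Lemma stereo_conformal (k : 'I_3) (f : E -> R) (p : R * R) :
  pt (stereo_dx p) 0 k * dotp (stereo_dx p) f (stereo p) +
  pt (stereo_dy p) 0 k * dotp (stereo_dy p) f (stereo p) =
  4 / rho2 p ^+ 2 * sgrad k f (stereo p).
Proof.
move: k; rewrite /sgrad /euler /dotp /stereo ptK /stereo_dx /stereo_dy /stereo3.
apply: ord3P; rewrite !mxE /=; have := @rho2_neq0 R p; rewrite /rho2.
- move: (partial 0 f _) (partial 1 f _) (partial 2 f _) => a b c; move: p.1 p.2 => x y h.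
  by field; exact: h.
- move: (partial 0 f _) (partial 1 f _) (partial 2 f _) => a b c; move: p.1 p.2 => x y h.
  by field; exact: h.
- move: (partial 0 f _) (partial 1 f _) (partial 2 f _) => a b c; move: p.1 p.2 => x y h.
  by field; exact: h.
Qed.

(** Conformal invariance of the Dirichlet energy in dimension two: the factor [4 / rho2^2] is the
    density of the area. *)
Lemma stereo_energy (f : E -> R) (p : R * R) :
  dotp (stereo_dx p) f (stereo p) ^+ 2 + dotp (stereo_dy p) f (stereo p) ^+ 2 =
  4 / rho2 p ^+ 2 * (sgrad 0 f (stereo p) ^+ 2 + sgrad 1 f (stereo p) ^+ 2 + sgrad 2 f (stereo p) ^+ 2).
Proof.
rewrite /sgrad /euler /dotp /stereo ptK /stereo_dx /stereo_dy /stereo3 !mxE /=.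
have := @rho2_neq0 R p; rewrite /rho2.
move: (partial 0 f _) (partial 1 f _) (partial 2 f _) => a b c; move: p.1 p.2 => x y h.
by field; exact: h.
Qed.

End stereographic_derivatives.

(** * Integration by parts on the sphere *)

Section integration_by_parts.
Context {R : realType}.
Local Notation E := 'rV[R]_3.

Definition stereo_dxx (p : R * R) : R * R * R :=
  (- 12 * p.1 / rho2 p ^+ 2 + 16 * p.1 ^+ 3 / rho2 p ^+ 3,
   - 4 * p.2 / rho2 p ^+ 2 + 16 * p.1 ^+ 2 * p.2 / rho2 p ^+ 3,
   - 4 / rho2 p ^+ 2 + 16 * p.1 ^+ 2 / rho2 p ^+ 3).
Definition stereo_dyy (p : R * R) : R * R * R :=
  (- 4 * p.1 / rho2 p ^+ 2 + 16 * p.2 ^+ 2 * p.1 / rho2 p ^+ 3,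
   - 12 * p.2 / rho2 p ^+ 2 + 16 * p.2 ^+ 3 / rho2 p ^+ 3,
   - 4 / rho2 p ^+ 2 + 16 * p.2 ^+ 2 / rho2 p ^+ 3).

Let ptE0 (a b c : R) : pt (a, b, c) 0 0 = a. Proof. by rewrite mxE. Qed.
Let ptE1 (a b c : R) : pt (a, b, c) 0 1 = b. Proof. by rewrite mxE. Qed.
Let ptE2 (a b c : R) : pt (a, b, c) 0 2 = c. Proof. by rewrite mxE. Qed.
Let ptE := (ptE0, ptE1, ptE2).

Lemma is_derive_pt (a b c : R -> R) (t : R) (a' b' c' : R) (k : 'I_3) :
  is_derive t 1 a a' -> is_derive t 1 b b' -> is_derive t 1 c c' ->
  is_derive t 1 (fun t => pt (a t, b t, c t) 0 k) (pt (a', b', c') 0 k).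
Proof.
move=> da db dc; move: k; apply: ord3P; rewrite ptE.
- by rewrite (_ : (fun t => _) = a)//; apply/funext => s; rewrite ptE.
- by rewrite (_ : (fun t => _) = b)//; apply/funext => s; rewrite ptE.
- by rewrite (_ : (fun t => _) = c)//; apply/funext => s; rewrite ptE.
Qed.

Lemma is_derive_stereo_dx (x y : R) (k : 'I_3) :
  is_derive x 1 (fun x => pt (stereo_dx (x, y)) 0 k) (pt (stereo_dxx (x, y)) 0 k).
Proof.
have r0 := @rho2_neq0 R (x, y); have dr := is_derive_rho2_1 x y.
have r2 : rho2 (x, y) ^+ 2 != 0 by rewrite expf_neq0.
rewrite /stereo_dx /stereo_dxx; apply: is_derive_pt => /=.
- apply: is_derive_eq; rewrite /GRing.scale/=.
  by move: (rho2 (x, y)) r0 => q q0; field.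
- apply: is_derive_eq; rewrite /GRing.scale/=.
  by move: (rho2 (x, y)) r0 => q q0; field.
- apply: is_derive_eq; rewrite /GRing.scale/=.
  by move: (rho2 (x, y)) r0 => q q0; field.
Qed.

Lemma is_derive_stereo_dy (x y : R) (k : 'I_3) :
  is_derive y 1 (fun y => pt (stereo_dy (x, y)) 0 k) (pt (stereo_dyy (x, y)) 0 k).
Proof.
have r0 := @rho2_neq0 R (x, y); have dr := is_derive_rho2_2 x y.
have r2 : rho2 (x, y) ^+ 2 != 0 by rewrite expf_neq0.
rewrite /stereo_dy /stereo_dyy; apply: is_derive_pt => /=.
- apply: is_derive_eq; rewrite /GRing.scale/=.
  by move: (rho2 (x, y)) r0 => q q0; field.
- apply: is_derive_eq; rewrite /GRing.scale/=.
  by move: (rho2 (x, y)) r0 => q q0; field.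
- apply: is_derive_eq; rewrite /GRing.scale/=.
  by move: (rho2 (x, y)) r0 => q q0; field.
Qed.

(** The coordinates are eigenfunctions of the spherical Laplacian for the eigenvalue -2, and the
    planar Laplacian is [4 / rho2^2] times the spherical one. *)
Lemma stereo_laplacian (k : 'I_3) (p : R * R) :
  pt (stereo_dxx p) 0 k + pt (stereo_dyy p) 0 k = - 8 / rho2 p ^+ 2 * stereo p 0 k.
Proof.
have := @rho2_neq0 R p; rewrite /rho2; case: p => x y /= h.
move: k; rewrite /stereo /stereo_dxx /stereo_dyy /stereo3 /rho2 /=.
by apply: ord3P; rewrite !ptE; field; exact: h.
Qed.

Let bound1 (a b q : R) : 0 <= b -> q = 1 + a ^+ 2 + b -> `|2 / q - 4 * a ^+ 2 / q ^+ 2| <= 6 / q.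
Proof.
move=> b0 qE; have a0 := sqr_ge0 a; have q0 : 0 < q by lra.
have -> : 2 / q - 4 * a ^+ 2 / q ^+ 2 = (2 * q - 4 * a ^+ 2) / q ^+ 2 by field; rewrite gt_eqF.
have -> : 6 / q = 6 * q / q ^+ 2 by field; rewrite gt_eqF.
rewrite ler_norml -mulNr !ler_pM2r ?invr_gt0 ?exprn_gt0//; lra.
Qed.

Let bound2 (a b q : R) : q = 1 + a ^+ 2 + b ^+ 2 -> `|- (4 * a * b / q ^+ 2)| <= 6 / q.
Proof.
move=> qE; have q0 : 0 < q by nra.
have -> : - (4 * a * b / q ^+ 2) = (- 4 * a * b) / q ^+ 2 by field; rewrite gt_eqF.
have -> : 6 / q = 6 * q / q ^+ 2 by field; rewrite gt_eqF.
rewrite ler_norml -mulNr !ler_pM2r ?invr_gt0 ?exprn_gt0//; nra.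
Qed.

Let bound3 (a b q : R) : 0 <= b -> q = 1 + a ^+ 2 + b -> `|- (4 * a / q ^+ 2)| <= 6 / q.
Proof.
move=> b0 qE; have q0 : 0 < q by nra.
have -> : - (4 * a / q ^+ 2) = (- 4 * a) / q ^+ 2 by field; rewrite gt_eqF.
have -> : 6 / q = 6 * q / q ^+ 2 by field; rewrite gt_eqF.
rewrite ler_norml -mulNr !ler_pM2r ?invr_gt0 ?exprn_gt0//; nra.
Qed.

Lemma stereo_dx_bound (p : R * R) (k : 'I_3) : `|pt (stereo_dx p) 0 k| <= 6 / rho2 p.
Proof.
move: k; apply: ord3P; rewrite ptE.
- by apply: (@bound1 _ (p.2 ^+ 2)); rewrite ?sqr_ge0.
- exact: bound2.
- by apply: (@bound3 _ (p.2 ^+ 2)); rewrite ?sqr_ge0.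
Qed.

Lemma stereo_dy_bound (p : R * R) (k : 'I_3) : `|pt (stereo_dy p) 0 k| <= 6 / rho2 p.
Proof.
have E : rho2 p = 1 + p.2 ^+ 2 + p.1 ^+ 2 by rewrite /rho2 addrAC.
move: k; apply: ord3P; rewrite ptE.
- exact: bound2.
- by apply: (@bound1 _ (p.1 ^+ 2)); rewrite ?sqr_ge0.
- by apply: (@bound3 _ (p.1 ^+ 2)); rewrite ?sqr_ge0.
Qed.

Lemma continuous_pt_comp (u : R * R -> R * R * R) (k : 'I_3) : continuous u ->
  continuous (fun p => pt (u p) 0 k).
Proof.
move=> cu; have cp : continuous (fun p => pt (u p)).
  exact: (continuous_comp_top (@continuous_pt R) cu).
exact: (continuous_comp_top (@continuous_coord R k) cp).
Qed.

Lemma cvg_div_pinfty (k : R) : k / r @[r --> +oo] --> (0 : R).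
Proof.
apply/cvgrPdist_lt => e e0; near=> r.
have r0 : 0 < r by near: r; exact: nbhs_pinfty_gt.
rewrite sub0r normrN normrM normfV (gtr0_norm r0) ltr_pdivrMr// mulrC -ltr_pdivrMr//.
by near: r; apply: nbhs_pinfty_gt; exact: num_real.
Unshelve. all: by end_near. Qed.

Lemma continuous_sgrad (k : 'I_3) (f : E -> R) : C1 f -> continuous (sgrad k f).
Proof.
move=> [_ cf]; have c0 := cf 0; have c1 := cf 1; have c2 := cf 2; have ck := cf k.
have x0 := @continuous_coord R 0; have x1 := @continuous_coord R 1.
have x2 := @continuous_coord R 2; have xk := @continuous_coord R k.
have ce : continuous (euler f).
  exact: (continuous_add (continuous_add (continuous_mul x0 c0) (continuous_mul x1 c1))
    (continuous_mul x2 c2)).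
apply: continuous_add => //; apply: continuous_opp; exact: continuous_mul.
Qed.

Let flux_eq (a1 a2 b1 b2 b3 b4 s u v q : R) : q != 0 ->
  b1 * a1 + b3 * a2 = 4 / q ^+ 2 * s -> b2 + b4 = - 8 / q ^+ 2 * v ->
  a1 * b1 + u * b2 + (a2 * b3 + u * b4) = 4 * (s - 2 * v * u) / q ^+ 2.
Proof.
move=> q0 e1 e2.
have -> : a1 * b1 + u * b2 + (a2 * b3 + u * b4) = (b1 * a1 + b3 * a2) + u * (b2 + b4) by ring.
by rewrite e1 e2; field.
Qed.

Let far_le (a b c : R) : 0 <= b -> 0 <= c -> a <= b \/ a <= c -> a <= 1 + b + c.
Proof. by move=> b0 c0 [] h; lra. Qed.

Let face_eq (M r : R) : 0 < r -> 2 * (M * (6 / r ^+ 2)) * (r - - r) = 24 * M / r.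
Proof. by move=> r0; field; rewrite gt_eqF. Qed.

Let norm_add_le (a b c : R) : `|a| <= c -> `|b| <= c -> - (c + c) <= a + b <= c + c.
Proof.
by rewrite !ler_norml => /andP[h1 h2] /andP[h3 h4]; apply/andP; split; lra.
Qed.

(** The divergence theorem on growing squares for [f] times the planar gradient of the [k]-th
    coordinate, a field which is [O(r^-2)] on the boundary. The term [2 x_k f] comes from the
    Laplacian of the coordinate, geometrically from the mean curvature. *)
Lemma sphere_ibp (k : 'I_3) (f : E -> R) : C1 f ->
  \int[@sphere_measure R]_x (sgrad k f x - 2 * x 0 k * f x) = 0.
Proof.
move=> C1f; have cf := C1_continuous C1f.
have cfs : continuous (fun p => f (stereo p)) by exact: (continuous_comp_top cf (@continuous_stereo R)).
have [M fM] := sphere_bounded cf.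
have M0 : 0 <= M by apply: le_trans (normr_ge0 _) (fM _ (sphere_stereo (0, 0))).
have r1 := @continuous_rho2 R; have r2 := @rho2_neq0 R.
have r22 (p : R * R) : rho2 p ^+ 2 != 0 by rewrite expf_neq0.
have r23 (p : R * R) : rho2 p ^+ 3 != 0 by rewrite expf_neq0.
pose V1 p := f (stereo p) * pt (stereo_dx p) 0 k.
pose V2 p := f (stereo p) * pt (stereo_dy p) 0 k.
pose W1 p := dotp (stereo_dx p) f (stereo p) * pt (stereo_dx p) 0 k + f (stereo p) * pt (stereo_dxx p) 0 k.
pose W2 p := dotp (stereo_dy p) f (stereo p) * pt (stereo_dy p) 0 k + f (stereo p) * pt (stereo_dyy p) 0 k.
have cdx := continuous_pt_comp (k := k) (@continuous_stereo_dx R).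
have cdy := continuous_pt_comp (k := k) (@continuous_stereo_dy R).
have cdxx : continuous (fun p => pt (stereo_dxx p) 0 k).
  by apply: (@continuous_pt_comp stereo_dxx); rewrite /stereo_dxx; cts.
have cdyy : continuous (fun p => pt (stereo_dyy p) 0 k).
  by apply: (@continuous_pt_comp stereo_dyy); rewrite /stereo_dyy; cts.
have cV1 : continuous V1 by exact: continuous_mul.
have cV2 : continuous V2 by exact: continuous_mul.
have cW1 : continuous W1.
  apply: continuous_add; apply: continuous_mul => //.
  exact: (continuous_dotp_stereo (@continuous_stereo_dx R)).
have cW2 : continuous W2.
  apply: continuous_add; apply: continuous_mul => //.
  exact: (continuous_dotp_stereo (@continuous_stereo_dy R)).
have dV1 (x y : R) : is_derive x 1 (fun x => V1 (x, y)) (W1 (x, y)).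
  have := @is_derive_mul _ (fun x => f (stereo (x, y))) (fun x => pt (stereo_dx (x, y)) 0 k) x _ _
    (is_derive_stereo_x x y C1f) (is_derive_stereo_dx x y k).
  by apply: is_derive_eq_val; rewrite /W1; ring.
have dV2 (x y : R) : is_derive y 1 (fun y => V2 (x, y)) (W2 (x, y)).
  have := @is_derive_mul _ (fun y => f (stereo (x, y))) (fun y => pt (stereo_dy (x, y)) 0 k) y _ _
    (is_derive_stereo_y x y C1f) (is_derive_stereo_dy x y k).
  by apply: is_derive_eq_val; rewrite /W2; ring.
pose h (x : E) := sgrad k f x - 2 * x 0 k * f x.
have ch : continuous h.
  have c1 := continuous_sgrad (k := k) C1f; have c2 := @continuous_coord R k.
  apply: continuous_add => //; apply: continuous_opp; apply: continuous_mul => //.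
  by apply: continuous_mul => //; exact: continuous_cst.
have WE p : W1 p + W2 p = 4 * h (stereo p) / rho2 p ^+ 2.
  exact: (flux_eq _ (r2 p) (stereo_conformal k f p) (stereo_laplacian k p)).
have lim := cvg_stereographic_rV ch.
apply: (cvg_unique _ lim); first exact: Rhausdorff.
apply: (@squeeze_cvgr _ _ _ _ (fun r => - (48 * M) / r) (fun r => (48 * M) / r)); last 2 first.
- exact: cvg_div_pinfty.
- exact: cvg_div_pinfty.
near=> r.
have r0 : 0 < r by near: r; exact: nbhs_pinfty_gt.
have rr : - r <= r by rewrite -subr_ge0 opprK addr_ge0 ?ltW.
have -> : itg2 (- r) r (- r) r (fun p => 4 * h (pt (stereo3 p)) / rho2 p ^+ 2) =
    itg2 (- r) r (- r) r (fun p => W1 p + W2 p).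
  by apply: eq_itg2 => x y _ _; rewrite WE.
rewrite (divergence2 rr rr cV1 cV2 cW1 cW2 (fun x y _ => dV1 x y) (fun x y _ => dV2 x y)).
have far (p : R * R) : r ^+ 2 <= p.1 ^+ 2 \/ r ^+ 2 <= p.2 ^+ 2 -> 6 / rho2 p <= 6 / r ^+ 2.
  move=> H; rewrite ler_pM2l// lef_pV2 ?posrE ?rho2_gt0 ?exprn_gt0// /rho2.
  exact: (far_le (sqr_ge0 _) (sqr_ge0 _) H).
have B1 (p : R * R) : r ^+ 2 <= p.1 ^+ 2 \/ r ^+ 2 <= p.2 ^+ 2 -> `|V1 p| <= M * (6 / r ^+ 2).
  move=> H; rewrite normrM; apply: ler_pM => //; first exact/fM/sphere_stereo.
  exact: le_trans (stereo_dx_bound p k) (far _ H).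
have B2 (p : R * R) : r ^+ 2 <= p.1 ^+ 2 \/ r ^+ 2 <= p.2 ^+ 2 -> `|V2 p| <= M * (6 / r ^+ 2).
  move=> H; rewrite normrM; apply: ler_pM => //; first exact/fM/sphere_stereo.
  exact: le_trans (stereo_dy_bound p k) (far _ H).
have I1 : `|itg (- r) r (fun y => V1 (r, y) - V1 (- r, y))| <= 2 * (M * (6 / r ^+ 2)) * (r - - r).
  apply: itg_bound => //; first by cts.
  move=> y _; apply: (le_trans (ler_normB _ _)); rewrite mulr2n mulrDl mul1r.
  by apply: lerD; apply: B1; left; rewrite ?sqrrN.
have I2 : `|itg (- r) r (fun x => V2 (x, r) - V2 (x, - r))| <= 2 * (M * (6 / r ^+ 2)) * (r - - r).
  apply: itg_bound => //; first by cts.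
  move=> y _; apply: (le_trans (ler_normB _ _)); rewrite mulr2n mulrDl mul1r.
  by apply: lerD; apply: B2; right; rewrite ?sqrrN.
have E24 : 2 * (M * (6 / r ^+ 2)) * (r - - r) = 24 * M / r by exact: face_eq.
have E48 : 48 * M / r = 24 * M / r + 24 * M / r by rewrite -!mulrDl; congr (_ * _ / _); ring.
have E48' : - (48 * M) / r = - (24 * M / r + 24 * M / r) by rewrite -E48 mulNr.
rewrite E48 E48'; move: I1 I2; rewrite E24.
exact: norm_add_le.
Unshelve. all: by end_near. Qed.

End integration_by_parts.

(** * Onofri's inequality on the sphere *)

Section sphere_integral.
Context {R : realType}.
Local Notation E := 'rV[R]_3.
Local Notation sig := (@sphere_measure R).

Definition sint (f : E -> R) : R := \int[sig]_x f x.
Definition sintegrable (f : E -> R) : Prop := sig.-integrable setT (EFin \o f).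

Lemma sintegrable_measurable f : sintegrable f -> measurable_fun [set: E] f.
Proof. by move=> /integrableP[/measurable_EFinP]. Qed.

Lemma sint_sphere f : sintegrable f -> sint f = \int[sig]_(x in @sphere R) f x.
Proof.
move=> fi; have mC : measurable (~` (@sphere R)) by apply: measurableC; exact: measurable_sphere.
rewrite /sint /Rintegral (negligible_integral mC measurableT fi (@sphere_measure_sphereC R)).
by rewrite setTD setCK.
Qed.

Lemma sintegrable_sphere f : sintegrable f -> sig.-integrable (@sphere R) (EFin \o f).
Proof. by apply: integrableS => //; exact: measurable_sphere. Qed.

Lemma sint_le f g : sintegrable f -> sintegrable g ->
  (forall x, sphere x -> f x <= g x) -> sint f <= sint g.
Proof.
move=> fi gi fg; rewrite !sint_sphere//; apply: le_Rintegral fg.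
- exact: measurable_sphere.
- exact: sintegrable_sphere.
- exact: sintegrable_sphere.
Qed.

Lemma eq_sint f g : (forall x, sphere x -> f x = g x) ->
  measurable_fun [set: E] f -> measurable_fun [set: E] g -> sint f = sint g.
Proof. exact: eq_sphere_integral. Qed.

Lemma sintegrable_eq f g : (forall x, sphere x -> f x = g x) -> measurable_fun [set: E] g ->
  sintegrable f -> sintegrable g.
Proof.
move=> fg mg fi; have mC : measurable (~` (@sphere R)).
  by apply: measurableC; exact: measurable_sphere.
apply/(negligible_integrable mC _ _ (@sphere_measure_sphereC R)) => //; first exact/measurable_EFinP.
rewrite setTD setCK; apply: eq_integrable (sintegrable_sphere fi); first exact: measurable_sphere.
by move=> x /set_mem Sx /=; rewrite fg.
Qed.

Lemma sintegrableD f g : sintegrable f -> sintegrable g -> sintegrable (fun x => f x + g x).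
Proof. by move=> fi gi; have := integrableD measurableT fi gi. Qed.

Lemma sintegrableZ k f : sintegrable f -> sintegrable (fun x => k * f x).
Proof. by move=> fi; have := integrableZl measurableT k fi. Qed.

Lemma sintegrable_cst k : sintegrable (fun=> k).
Proof. by apply: continuous_integrable_sphere; exact: continuous_cst. Qed.

Lemma sintD f g : sintegrable f -> sintegrable g -> sint (fun x => f x + g x) = sint f + sint g.
Proof. by move=> fi gi; exact: RintegralD. Qed.

Lemma sintZ k f : sintegrable f -> sint (fun x => k * f x) = k * sint f.
Proof. by move=> fi; exact: RintegralZl. Qed.

Lemma sint_cst k : sint (fun=> k) = k * (4 * pi).
Proof.
rewrite /sint (@Rintegral_cst _ _ _ sig setT measurableT k); congr (_ * _).
by rewrite [X in fine X](@sphere_area R).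
Qed.

Lemma sint_ge0 f : (forall x, 0 <= f x) -> 0 <= sint f.
Proof. by move=> f0; apply: Rintegral_ge0. Qed.

Lemma sintegrable_bounded (f : E -> R) (M : R) : measurable_fun [set: E] f ->
  (forall x, sphere x -> `|f x| <= M) -> sintegrable f.
Proof. exact: sphere_bounded_integrable. Qed.

Lemma sintegrable_continuous f : continuous f -> sintegrable f.
Proof. exact: continuous_integrable_sphere. Qed.

Lemma sphere_dominated (f_ : nat -> E -> R) (f g : E -> R) :
  (forall n, measurable_fun [set: E] (f_ n)) -> measurable_fun [set: E] f -> sintegrable g ->
  (forall n x, sphere x -> `|f_ n x| <= g x) ->
  (\forall x \ae sig, sphere x -> f_ n x @[n --> \oo] --> f x) ->
  sint (f_ n) @[n --> \oo] --> sint f.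
Proof.
move=> mf_ mf ig fM fae.
have D1 : \forall x \ae sig, [set: E] x ->
    (EFin \o f_ n) x @[n --> \oo] --> (EFin \o f) x.
  have as_ := @ae_sphere R; move: fae as_; apply: filterS2 => x h Sx _.
  by apply: cvg_EFin; [exact: nearW|exact: (h Sx)].
have D2 : \forall x \ae sig, forall n, [set: E] x -> (`|(EFin \o f_ n) x| <= (EFin \o g) x)%E.
  by have := @ae_sphere R; apply: filterS => x Sx n _ /=; rewrite lee_fin; exact: fM.
have mE (h : E -> R) : measurable_fun [set: E] h -> measurable_fun [set: E] (EFin \o h).
  by move=> mh; exact/measurable_EFinP.
have [fi _ lim] := @dominated_convergence _ E R sig setT measurableT (fun n => EFin \o f_ n)
  (EFin \o f) (EFin \o g) (fun n => mE _ (mf_ n)) (mE _ mf) D1 ig D2.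
rewrite /sint /Rintegral; apply: fine_cvg; rewrite fineK//.
exact: integrable_fin_num.
Qed.

End sphere_integral.

Section C1_calculus.
Context {R : realType}.
Local Notation E := 'rV[R]_3.

Lemma partialD (k : 'I_3) (f g : E -> R) x : differentiable f x -> differentiable g x ->
  partial k (fun x => f x + g x) x = partial k f x + partial k g x.
Proof. by move=> df dg; rewrite /partial deriveD//; exact: diff_derivable. Qed.

Lemma partialM (k : 'I_3) (f g : E -> R) x : differentiable f x -> differentiable g x ->
  partial k (fun x => f x * g x) x = f x * partial k g x + g x * partial k f x.
Proof. by move=> df dg; rewrite /partial deriveM//; exact: diff_derivable. Qed.

Lemma partial_cst (k : 'I_3) (c : R) x : partial k (fun=> c) x = 0.
Proof. by rewrite /partial derive_cst. Qed.

Lemma differentiable_coord (k : 'I_3) (x : E) : differentiable (fun x : E => x 0 k) x.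
Proof. exact: differentiable_coord. Qed.

Lemma partial_coord (j k : 'I_3) x : partial k (fun x : E => x 0 j) x = (j == k)%:R.
Proof.
have di : derivable (fun x : E => x) x (delta_mx 0 k) by exact: derivable_id.
have := derive_mx di; rewrite derive_id => /matrixP/(_ 0 j).
by rewrite !mxE eqxx /= => ->.
Qed.

Lemma partial_comp (k : 'I_3) (h : R -> R) (f : E -> R) x h' : differentiable f x ->
  is_derive (f x) 1 h h' -> partial k (fun x => h (f x)) x = h' * partial k f x.
Proof.
move=> df dh; have dh' : differentiable h (f x) by apply/derivable1_diffP; case: dh.
rewrite /partial deriveE; last exact: differentiable_comp.
rewrite (_ : (fun x => h (f x)) = h \o f)// diff_comp//= diff1E// derive1E.
by have [_ ->] := dh; rewrite deriveE// /GRing.scale/= mulrC.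
Qed.

End C1_calculus.

Section onofri_sphere.
Context {R : realType}.
Local Notation E := 'rV[R]_3.

Definition sgrad2 (f : E -> R) (x : E) : R := sgrad 0 f x ^+ 2 + sgrad 1 f x ^+ 2 + sgrad 2 f x ^+ 2.

Lemma continuous_sgrad2 (f : E -> R) : C1 f -> continuous (sgrad2 f).
Proof.
move=> C1f; have c0 := continuous_sgrad (k := 0) C1f; have c1 := continuous_sgrad (k := 1) C1f.
have c2 := continuous_sgrad (k := 2) C1f; by rewrite /sgrad2; cts.
Qed.

Definition south : E := pt (0, 0, -1).

(** Points outside a large square are uniformly close to the south pole; a function vanishing there
    thus meets the boundary hypothesis of [onofri_square] for every [e]. *)
Lemma stereo_far (f : E -> R) (e : R) : continuous f -> f south = 0 -> 0 < e ->
  \forall r \near +oo, forall p : R * R, r <= `|p.1| \/ r <= `|p.2| -> `|f (stereo p)| <= e.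
Proof.
move=> cf f0 e0; have /cvgrPdist_le/(_ _ e0) := cf south.
rewrite f0 => /nbhs_ballP[d /= d0 H]; near=> r.
have r1 : 1 < r by near: r; apply: nbhs_pinfty_gt; exact: num_real.
have rd : 2 / d < r by near: r; apply: nbhs_pinfty_gt; exact: num_real.
have r0 : 0 < r by exact: lt_trans r1.
have d2 : 2 / r < d by rewrite ltr_pdivrMr// mulrC -ltr_pdivrMr.
move=> p far; have q0 := @rho2_gt0 R p.
have qr : r ^+ 2 <= rho2 p.
  have sq (a : R) : r <= `|a| -> r ^+ 2 <= a ^+ 2.
    by move=> ra; rewrite -[leRHS]real_normK ?num_real// ler_pXn2r ?nnegrE// ltW.
  have := sqr_ge0 p.1; have := sqr_ge0 p.2; rewrite /rho2.
  by case: far => /sq; lra.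
have small (a : R) : a ^+ 2 <= rho2 p -> `|2 * a / rho2 p| <= 2 / r.
  move=> aq; rewrite -(@ler_pXn2r _ 2)// ?nnegrE ?divr_ge0 ?(ltW r0)//.
  rewrite real_normK ?num_real// !expr_div_n exprMn.
  apply: (@le_trans _ _ (2 ^+ 2 / rho2 p)).
    rewrite ler_pdivrMr ?exprn_gt0//.
    have -> : 2 ^+ 2 / rho2 p * rho2 p ^+ 2 = 2 ^+ 2 * rho2 p by field; rewrite gt_eqF.
    by rewrite ler_pM2l.
  by rewrite ler_pM2l// lef_pV2 ?posrE ?exprn_gt0.
suff : ball south d (stereo p) by move=> /H; rewrite sub0r normrN.
split=> // i k; rewrite (ord1 i); apply: le_lt_trans d2; move: k.
apply: ord3P; rewrite /stereo !mxE /= distrC.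
- by rewrite subr0; apply: small; rewrite /rho2; have := sqr_ge0 p.2; lra.
- by rewrite subr0; apply: small; rewrite /rho2; have := sqr_ge0 p.1; lra.
- rewrite (_ : _ - _ = 2 / rho2 p); last by field; rewrite gt_eqF.
  rewrite ger0_norm ?divr_ge0 ?(ltW q0)// ler_pM2l// lef_pV2 ?posrE//.
  by apply: le_trans qr; rewrite expr2 ler_peMl// ltW.
Unshelve. all: by end_near. Qed.

Lemma cvg_stereographic_quarter (g : E -> R) : continuous g ->
  itg2 (- r) r (- r) r (fun p => g (stereo p) / rho2 p ^+ 2) @[r --> +oo] --> 1 / 4 * sint g.
Proof.
move=> cg; have cg4 : continuous (fun x => 1 / 4 * g x).
  by apply: continuous_mul => //; exact: continuous_cst.
have := cvg_stereographic_rV cg4; rewrite -/(sint _) sintZ; last exact: sintegrable_continuous.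
have <- // : (fun r => itg2 (- r) r (- r) r (fun p => g (stereo p) / rho2 p ^+ 2)) =
  (fun r => itg2 (- r) r (- r) r (fun p => 4 * (1 / 4 * g (pt (stereo3 p))) / rho2 p ^+ 2)).
apply/funext => r; apply: eq_itg2 => x y _ _; congr (_ / _).
by rewrite /stereo; move: (g _) => a; field.
Qed.

(** The limit of [onofri_square] as the square grows and then [e] tends to 0. Since [rho2^-2] is a
    quarter of the area density, [m] tends to [pi] and the term linear in [w] gets the factor
    1/8. *)
Lemma onofri_south (w : E -> R) : C1 w -> w south = 0 ->
  pi <= Num.sqrt (4 * pi / sint (fun x => expR (w x))) * pi + 1 / 32 * sint (sgrad2 w) + 1 / 8 * sint w.
Proof.
move=> C1w w0; have cw := C1_continuous C1w.
have cs := @continuous_stereo R.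
have cf : continuous (fun p => w (stereo p)) by exact: (continuous_comp_top cw cs).
have cdx := continuous_dotp_stereo (@continuous_stereo_dx R) C1w.
have cdy := continuous_dotp_stereo (@continuous_stereo_dy R) C1w.
have cew : continuous (fun x => expR (w x)) by exact: (continuous_comp_top (@continuous_expR R) cw).
pose m r : R := itg2 (- r) r (- r) r (fun p => rho2 p ^- 2).
pose Z r := itg2 (- r) r (- r) r (fun p => expR (w (stereo p)) / rho2 p ^+ 2).
pose D r := itg2 (- r) r (- r) r (fun p => dotp (stereo_dx p) w (stereo p) ^+ 2 +
  dotp (stereo_dy p) w (stereo p) ^+ 2).
pose A r := itg2 (- r) r (- r) r (fun p => w (stereo p) / rho2 p ^+ 2).
have mL : m r @[r --> +oo] --> pi.
  have := cvg_stereographic_quarter (@continuous_cst _ _ 1); rewrite sint_cst.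
  rewrite (_ : 1 / 4 * (1 * (4 * pi)) = pi); last by field.
  have <- // : m = (fun r => itg2 (- r) r (- r) r (fun p => 1 / rho2 p ^+ 2)).
  by apply/funext => r; apply: eq_itg2 => x y _ _; rewrite mul1r.
have ZL := cvg_stereographic_quarter cew; have AL := cvg_stereographic_quarter cw.
have DL : D r @[r --> +oo] --> sint (sgrad2 w).
  have := cvg_stereographic_rV (continuous_sgrad2 C1w).
  have <- // : D = (fun r => itg2 (- r) r (- r) r (fun p => 4 * sgrad2 w (pt (stereo3 p)) / rho2 p ^+ 2)).
  by apply/funext => r; apply: eq_itg2 => x y _ _; rewrite stereo_energy mulrAC.
have S0 : 0 < sint (fun x => expR (w x)).
  have [M wM] := sphere_bounded cw.
  apply: (@lt_le_trans _ _ (sint (fun=> expR (- M)))).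
    by rewrite sint_cst mulr_gt0 ?expR_gt0// mulr_gt0// pi_gt0.
  apply: sint_le; [exact: sintegrable_cst|exact: sintegrable_continuous|].
  by move=> x Sx; rewrite ler_expR; have := wM x Sx; rewrite ler_norml => /andP[].
have He (e : R) : 0 < e -> pi <= Num.sqrt (4 * pi / sint (fun x => expR (w x))) * expR (e / 2) * pi +
    e / 2 * pi + 1 / 32 * sint (sgrad2 w) + 1 / 2 * (1 / 4 * sint w).
  move=> e0.
  have lim : Num.sqrt (m r / Z r) * expR (e / 2) * m r + e / 2 * m r + 1 / 32 * D r + 1 / 2 * A r
    @[r --> +oo] --> Num.sqrt (pi / (1 / 4 * sint (fun x => expR (w x)))) * expR (e / 2) * pi +
    e / 2 * pi + 1 / 32 * sint (sgrad2 w) + 1 / 2 * (1 / 4 * sint w).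
    apply: cvgD; last by apply: cvgM => //; exact: cvg_cst.
    apply: cvgD; last by apply: cvgM => //; exact: cvg_cst.
    apply: cvgD; last by apply: cvgM => //; exact: cvg_cst.
    apply: cvgM => //; apply: cvgM; last exact: cvg_cst.
    have hq : m r / Z r @[r --> +oo] --> pi / (1 / 4 * sint (fun x => expR (w x))).
      by apply: cvgM => //; apply: cvgV => //; rewrite gt_eqF// mulr_gt0.
    by apply: (cvg_comp (fun r => m r / Z r) Num.sqrt hq); exact: sqrt_continuous.
  have -> : 4 * pi / sint (fun x => expR (w x)) = pi / (1 / 4 * sint (fun x => expR (w x))).
    by move: S0; set S := sint _ => S0; field; rewrite gt_eqF.
  apply: (ler_cvg_to mL lim); near=> r.
  have r0 : 0 < r by near: r; exact: nbhs_pinfty_gt.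
  apply: (onofri_square r0 cf cdx cdy) => [x y|x y|].
  - exact: is_derive_stereo_x.
  - exact: is_derive_stereo_y.
  - by near: r; exact: stereo_far.
have lim : Num.sqrt (4 * pi / sint (fun x => expR (w x))) * expR (e / 2) * pi +
    e / 2 * pi + 1 / 32 * sint (sgrad2 w) + 1 / 2 * (1 / 4 * sint w) @[e --> 0^'+] -->
    Num.sqrt (4 * pi / sint (fun x => expR (w x))) * expR (0 / 2) * pi +
    0 / 2 * pi + 1 / 32 * sint (sgrad2 w) + 1 / 2 * (1 / 4 * sint w).
  set a := Num.sqrt _; set b := sint _; set c := sint _; set h := 2^-1.
  have cc : continuous (fun e : R => a * expR (e * h) * pi + e * h * pi + 1 / 32 * b + 1 / 2 * (1 / 4 * c)).
    by cts.
  by apply: cvg_at_right_filter; exact: cc.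
have := ler_cvg_to (@cvg_cst _ pi _ _ _) lim (filterS (fun e => @He e) (nbhs_right_gt 0)).
rewrite !mul0r expR0 mulr1 addr0.
have -> : 1 / 8 * sint w = 1 / 2 * (1 / 4 * sint w) by field.
by apply.
Unshelve. all: by end_near. Qed.

End onofri_sphere.

(** * Logarithmic cutoffs at the south pole *)

Section cutoff.
Context {R : realType}.
Local Notation E := 'rV[R]_3.

Lemma C1_cst (c : R) : C1 (fun _ : E => c).
Proof.
split=> [x|k]; first exact: differentiable_cst.
by rewrite (_ : partial k _ = fun=> 0); [exact: continuous_cst|apply/funext => x; exact: partial_cst].
Qed.

Lemma C1_coord (j : 'I_3) : C1 (fun x : E => x 0 j).
Proof.
split=> [x|k]; first exact: differentiable_coord.
rewrite (_ : partial k _ = fun=> (j == k)%:R); first exact: continuous_cst.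
by apply/funext => x; exact: partial_coord.
Qed.

Lemma C1D (f g : E -> R) : C1 f -> C1 g -> C1 (fun x => f x + g x).
Proof.
move=> [df cf] [dg cg]; split=> [x|k]; first exact: differentiableD.
rewrite (_ : partial k _ = fun x => partial k f x + partial k g x).
  exact: continuous_add.
by apply/funext => x; exact: partialD.
Qed.

Lemma C1M (f g : E -> R) : C1 f -> C1 g -> C1 (fun x => f x * g x).
Proof.
move=> C1f C1g; have cf' := C1_continuous C1f; have cg' := C1_continuous C1g.
move: C1f C1g => [df cf] [dg cg]; split=> [x|k]; first exact: differentiableM.
rewrite (_ : partial k _ = fun x => f x * partial k g x + g x * partial k f x).
  by apply: continuous_add; exact: continuous_mul.
by apply/funext => x; exact: partialM.
Qed.

Lemma C1_comp (h h' : R -> R) (f : E -> R) : C1 f ->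
  (forall x, is_derive (f x) 1 h (h' (f x))) -> continuous (fun x => h' (f x)) ->
  C1 (fun x => h (f x)).
Proof.
move=> [df cf] dh ch; split=> [x|k].
  by apply: differentiable_comp => //; apply/derivable1_diffP; case: (dh x).
rewrite (_ : partial k _ = fun x => h' (f x) * partial k f x).
  exact: continuous_mul.
by apply/funext => x; exact: partial_comp.
Qed.

Lemma sgradM (k : 'I_3) (f g : E -> R) x : C1 f -> C1 g ->
  sgrad k (fun x => f x * g x) x = f x * sgrad k g x + g x * sgrad k f x.
Proof.
move=> [df _] [dg _]; rewrite /sgrad /euler /dotp !(partialM _ (df x) (dg x)).
move: (partial k f x) (partial k g x) (partial 0 f x) (partial 0 g x) (partial 1 f x) (partial 1 g x).
by move: (partial 2 f x) (partial 2 g x) (coords x) => a b c a0 b0 a1 b1 a2 b2; ring.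
Qed.

Lemma sgradD_cst (k : 'I_3) (f : E -> R) (c : R) x : C1 f ->
  sgrad k (fun x => f x + c) x = sgrad k f x.
Proof.
move=> [df _]; have dc := @differentiable_cst R E R c x.
have E j : partial j (fun x => f x + c) x = partial j f x.
  by rewrite (partialD _ (df x) dc) partial_cst addr0.
by rewrite /sgrad /euler /dotp !E.
Qed.

Lemma sgrad_comp (k : 'I_3) (h : R -> R) (f : E -> R) x h' : C1 f ->
  is_derive (f x) 1 h h' -> sgrad k (fun x => h (f x)) x = h' * sgrad k f x.
Proof.
move=> [df _] dh; rewrite /sgrad /euler /dotp !(partial_comp _ (df x) dh).
move: (partial k f x) (partial 0 f x) (partial 1 f x) (partial 2 f x) (coords x) => a b c d e.
by ring.
Qed.

(** A quarter of the squared distance to the south pole, hence nonnegative on all of R^3; on the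
    sphere it is the affine function [(1 + x_3) / 2], uniformly distributed on [[0, 1]]. *)
Definition height (x : E) : R :=
  4^-1 * (x 0 0 * x 0 0 + x 0 1 * x 0 1 + (1 + x 0 2) * (1 + x 0 2)).

Lemma height_ge0 x : 0 <= height x.
Proof. by rewrite /height mulr_ge0// !addr_ge0// -expr2 sqr_ge0. Qed.

Lemma C1_height : C1 height.
Proof.
apply: C1M; first exact: C1_cst.
have C1z := C1D (C1_cst 1) (C1_coord 2).
by apply: C1D; [apply: C1D; apply: C1M; exact: C1_coord|exact: C1M].
Qed.

Lemma height_sphere x : sphere x -> height x = (1 + x 0 2) / 2.
Proof. by move=> /sphere_coords; rewrite /height => h; lra. Qed.

Lemma height_le1 x : sphere x -> height x <= 1.
Proof.
move=> Sx; rewrite height_sphere//; move/sphere_coords: Sx.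
by have := sqr_ge0 (x 0 0); have := sqr_ge0 (x 0 1); nra.
Qed.

Lemma partial_height (k : 'I_3) (x : E) : partial k height x = (x 0 k + (k == 2)%:R) / 2.
Proof.
have dx j := @differentiable_coord R j x.
have dx2 j := differentiableM (dx j) (dx j).
have dz := differentiableD (@differentiable_cst R E R 1 x) (dx 2).
have dz2 := differentiableM dz dz.
have d2 := differentiableD (differentiableD (dx2 0) (dx2 1)) dz2.
rewrite /height (partialM _ _ d2); last exact: differentiable_cst.
rewrite partial_cst (partialD _ _ dz2); last exact: (differentiableD (dx2 0) (dx2 1)).
rewrite (partialD _ (dx2 0) (dx2 1)) !partialM// (partialD _ _ (dx 2)); last exact: differentiable_cst.
rewrite partial_cst !partial_coord.
rewrite mulr0 addr0; set z := (_ + _) x; have -> : z = 1 + x 0 2 by [].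
by move: k; apply: ord3P => /=; field.
Qed.

Lemma sgrad2_height x : sphere x -> sgrad2 height x = height x * (1 - height x).
Proof.
move=> Sx; rewrite height_sphere// /sgrad2 /sgrad /euler /dotp !partial_height /=.
move/sphere_coords: Sx; move: (x 0 0) (x 0 1) (x 0 2) => a b c h.
rewrite !addr0.
have -> : a * (a / 2) + b * (b / 2) + c * ((c + 1) / 2) = (1 + c) / 2 by lra.
have -> : (a / 2 - a * ((1 + c) / 2)) ^+ 2 + (b / 2 - b * ((1 + c) / 2)) ^+ 2 +
  ((c + 1) / 2 - c * ((1 + c) / 2)) ^+ 2 =
  (a ^+ 2 + b ^+ 2) * (c / 2) ^+ 2 + ((c + 1) / 2 - c * ((1 + c) / 2)) ^+ 2 by field.
have -> : a ^+ 2 + b ^+ 2 = 1 - c ^+ 2 by lra.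
by field.
Qed.

(** Rises from 0 at the south pole to 1 at the north pole, with energy at most
    [4 pi / ln (n + 2)]. *)
Definition cutoff (n : nat) (x : E) : R := ln (1 + n.+1%:R * height x) / ln n.+2%:R.

Let ln2 (n : nat) : 0 < ln n.+2%:R :> R.
Proof. by rewrite ln_gt0// ltr1n. Qed.

Let pos (n : nat) (x : E) : 0 < 1 + n.+1%:R * height x.
Proof. by rewrite ltr_pwDl// mulr_ge0// height_ge0. Qed.

Let arg_le (n : nat) x : sphere x -> 1 + n.+1%:R * height x <= n.+2%:R.
Proof.
move=> Sx; rewrite -(addn1 n.+1) natrD addrC lerD2r ler_piMr// height_le1//.
Qed.

Lemma cutoff_itv (n : nat) x : sphere x -> 0 <= cutoff n x <= 1.
Proof.
move=> Sx; apply/andP; split.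
  apply: divr_ge0; apply: ln_ge0; last by rewrite ler1n.
  by rewrite lerDl mulr_ge0// height_ge0.
by rewrite ler_pdivrMr ?ln2// mul1r ler_ln ?posrE ?pos// arg_le.
Qed.

Let is_derive_cutoff (n : nat) (t : R) : 0 < 1 + n.+1%:R * t ->
  is_derive t 1 (fun t => ln (1 + n.+1%:R * t) / ln n.+2%:R)
    (n.+1%:R / (1 + n.+1%:R * t) / ln n.+2%:R).
Proof.
move=> t0; have dl : is_derive t 1 (fun t => 1 + n.+1%:R * t) n.+1%:R.
  by apply: is_derive_eq; rewrite /GRing.scale/=; ring.
have := @is_derive1_comp _ (@ln R) (fun t => 1 + n.+1%:R * t) t _ _ (is_derive1_ln t0) dl.
move=> dc; apply: is_derive_eq; rewrite /GRing.scale/=; ring.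
Qed.

Lemma C1_cutoff n : C1 (cutoff n).
Proof.
apply: (@C1_comp (fun t => ln (1 + n.+1%:R * t) / ln n.+2%:R)
  (fun t => n.+1%:R / (1 + n.+1%:R * t) / ln n.+2%:R) height C1_height).
  by move=> x; apply: is_derive_cutoff; exact: pos.
have ch := C1_continuous C1_height.
have p0 (x : E) : 1 + n.+1%:R * height x != 0 by rewrite gt_eqF// pos.
set k := (ln _)^-1; by cts.
Qed.

(** Since the squared gradient of the height is [h (1 - h)], one of the two factors
    [1 / (1 + (n + 1) h)] is absorbed. What remains is a derivative of a logarithm in the height,
    hence has the explicit integral [sint_cutoff_le]. *)
Lemma sgrad2_cutoff_le n x : sphere x ->
  sgrad2 (cutoff n) x <= n.+1%:R / (1 + n.+1%:R * height x) / ln n.+2%:R ^+ 2.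
Proof.
move=> Sx; have dc := is_derive_cutoff (pos n x).
have E k := @sgrad_comp k (fun t => ln (1 + n.+1%:R * t) / ln n.+2%:R) height x _ C1_height dc.
rewrite /sgrad2 (_ : cutoff n = (fun x => ln (1 + n.+1%:R * height x) / ln n.+2%:R))// !E.
rewrite !exprMn -!mulrDr -/(sgrad2 height x) sgrad2_height//.
have := pos n x; have := height_ge0 x; have := height_le1 Sx; have := ln2 n.
have : 0 < n.+1%:R :> R by [].
move: (height x) (ln _) (n.+1%:R) => t l N N0 l0 t1 t0 p0.
have -> : N ^+ 2 * (1 + N * t)^-1 ^+ 2 * l^-1 ^+ 2 * (t * (1 - t)) =
    N ^+ 2 / (1 + N * t) ^+ 2 * (t * (1 - t)) / l ^+ 2.
  by field; rewrite !gt_eqF.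
rewrite ler_pM2r ?invr_gt0 ?exprn_gt0//.
have -> : N ^+ 2 / (1 + N * t) ^+ 2 * (t * (1 - t)) = N / (1 + N * t) * (N * t * (1 - t) / (1 + N * t)).
  by field; rewrite gt_eqF.
rewrite ler_piMr ?divr_ge0 ?(ltW N0) ?(ltW p0)// ler_pdivrMr//; nra.
Qed.

Lemma sint_cutoff_le n : sint (fun x => n.+1%:R / (1 + n.+1%:R * height x)) = 4 * pi * ln n.+2%:R.
Proof.
have ch := C1_continuous C1_height.
have p0 (x : E) : 1 + n.+1%:R * height x != 0 by rewrite gt_eqF// pos.
pose f (x : E) := n.+1%:R / (1 + n.+1%:R * height x) : R.
have cf : continuous f by rewrite /f; cts.
have := sphere_integral_cyl (continuous_on_pt cf).
have -> : \int[@sphere_measure R]_x (f \o pt) (coords x) = sint f.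
  by apply: eq_Rintegral => x _; rewrite /= coordsK.
move=> ->; have N1 : -1 <= 1 :> R by lra.
have pi0 : 0 <= 2 * pi :> R by rewrite mulr_ge0// pi_ge0.
have hE (z : R) : -1 <= z <= 1 -> 0 < 1 + n.+1%:R * ((1 + z) / 2).
  by move=> /andP[z1 z2]; rewrite ltr_pwDl// mulr_ge0// divr_ge0//; lra.
have inner t : itg (-1) 1 (fun z => (f \o pt) (cyl t z)) = 2 * ln n.+2%:R.
  (* Keeps the argument of the logarithm positive on the whole line, where continuity is
     required. *)
  pose m (z : R) := Num.max z (-1); have cm : continuous m by rewrite /m; cts.
  have m1 z : 0 < 1 + n.+1%:R * ((1 + m z) / 2).
    by rewrite ltr_pwDl// mulr_ge0// divr_ge0// addrC -lerBlDr sub0r le_max lexx orbT.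
  pose G (z : R) := n.+1%:R / (1 + n.+1%:R * ((1 + m z) / 2)).
  pose F (z : R) := 2 * ln (1 + n.+1%:R * ((1 + m z) / 2)).
  have m0 z : 1 + n.+1%:R * ((1 + m z) / 2) != 0 by rewrite gt_eqF.
  have cG : continuous G by rewrite /G; cts.
  have cF : continuous F.
    apply: continuous_mul; first exact: continuous_cst.
    move=> z; apply: (@continuous_comp _ _ _ (fun z => 1 + n.+1%:R * ((1 + m z) / 2)) (@ln R)).
      have c : continuous (fun z => 1 + n.+1%:R * ((1 + m z) / 2)) by cts.
      exact: c.
    exact: continuous_ln.
  have dF (z : R) : -1 < z < 1 -> is_derive z 1 F (G z).
    move=> /andP[z1 z2]; have mz : m z = z by rewrite /m (max_idPl _)// ltW.
    have p1 : 0 < 1 + n.+1%:R * ((1 + z) / 2) by have := m1 z; rewrite mz.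
    have dl : is_derive z 1 (fun z => 1 + n.+1%:R * ((1 + z) / 2)) (n.+1%:R / 2).
      by apply: is_derive_eq; rewrite /GRing.scale/=; field.
    have d1 := @is_derive1_comp _ (@ln R) (fun z => 1 + n.+1%:R * ((1 + z) / 2)) z _ _ (is_derive1_ln p1) dl.
    have d2 : is_derive z 1 (fun z => 2 * ln (1 + n.+1%:R * ((1 + z) / 2))) (G z).
      apply: is_derive_eq; rewrite /GRing.scale/= /G mz.
      by move: p1; set q := 1 + _ => p1; field; rewrite gt_eqF.
    apply: (near_eq_is_derive _ d2); near=> y; rewrite /F /m (max_idPl _)//.
    by apply: ltW; near: y; exact: lt_nbhsr.
  rewrite (eq_itg (g := G)); last first.
    move=> z zI; rewrite /= /f height_sphere; last first.
      by apply/sphere_coords; rewrite !mxE /=; apply: cylE => //; exact: cos2Dsin2.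
    rewrite mxE /= /G /m (max_idPl _)//; by case/andP: zI.
  rewrite (itg_FTC N1 cG cF dF) /F /m maxxx (max_idPl _)//.
  have -> : 1 + n.+1%:R * ((1 + 1) / 2) = n.+2%:R :> R by rewrite -(addn1 n.+1) natrD; field.
  have -> : 1 + n.+1%:R * ((1 - 1) / 2) = 1 :> R by rewrite subrr mul0r mulr0 addr0.
  by rewrite ln1 mulr0 subr0.
rewrite (eq_itg (fun t _ => inner t)) itg_cst// subr0; ring.
Unshelve. all: by end_near. Qed.

Let ln_pinfty (K : R) : \forall n \near \oo, K <= ln n.+2%:R.
Proof.
have /cvgryPge/(_ (expR K)) := @cvgr_idn R; apply: filterS => n Kn.
rewrite -[leLHS]expRK ler_ln ?posrE ?expR_gt0//; apply: (le_trans Kn).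
by rewrite ler_nat; exact: leq_trans (leqnSn _).
Qed.

Lemma cvg_inv_ln (k : R) : k / ln n.+2%:R @[n --> \oo] --> (0 : R).
Proof.
apply/cvgrPdist_le => e e0; near=> n.
rewrite sub0r normrN normrM normfV (gtr0_norm (ln2 n)) ler_pdivrMr ?ln2// mulrC -ler_pdivrMr//.
by near: n; exact: ln_pinfty.
Unshelve. all: by end_near. Qed.

Lemma cvg_cutoff x : 0 < height x <= 1 -> cutoff n x @[n --> \oo] --> (1 : R).
Proof.
move=> /andP[h0 h1].
apply: (@squeeze_cvgr _ _ _ _ (fun n => 1 + ln (height x) / ln n.+2%:R) (fun=> 1)).
- near=> n; apply/andP; split.
    rewrite -(@ler_pM2r _ (ln n.+2%:R))// /cutoff divfK ?gt_eqF// mulrDl mul1r divfK ?gt_eqF//.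
    rewrite -lnM ?posrE// ler_ln ?posrE ?pos//; last exact: (mulr_gt0 _ h0).
    by rewrite -(addn1 n.+1) natrD mulrDl mul1r addrC lerD2r.
  rewrite ler_pdivrMr ?ln2// mul1r ler_ln ?posrE ?pos//.
  by rewrite -(addn1 n.+1) natrD addrC lerD2r ler_piMr.
- by rewrite -[X in _ --> X]addr0; apply: cvgD; [exact: cvg_cst|exact: cvg_inv_ln].
- exact: cvg_cst.
Unshelve. all: by end_near. Qed.

End cutoff.

(** * Onofri's inequality for continuously differentiable functions *)

Section onofri_C1.
Context {R : realType}.
Local Notation E := 'rV[R]_3.
Local Notation sig := (@sphere_measure R).

Lemma ae_height : \forall x \ae sig, sphere x -> 0 < height x <= 1.
Proof.
pose N := (fun x : E => x 0 2) @^-1` [set (-1 : R)].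
exists N; split.
- by rewrite -[N]setTI; apply: (measurable_coord 2) => //; exact: measurable_set1.
- rewrite /sphere_measure /pushforward /mrestr (_ : _ `&` _ = set0) ?measure0//.
  apply/seteqP; split => // p [/= pz [/= + _]]; have : chart p 0 2 = p.1 by rewrite mxE.
  by rewrite pz => <-; rewrite in_itv /= ltxx.
- move=> x /=; apply: contra_notP => h Sx.
  rewrite height_le1// andbT lt_neqAle height_ge0 andbT eq_sym height_sphere//.
  by apply: contra_not_neq h => /eqP; rewrite /N/= mulf_eq0 invr_eq0 pnatr_eq0 orbF => /eqP; lra.
Qed.

Let young (k a b p q K : R) : 0 < k -> p ^+ 2 <= 1 -> q ^+ 2 <= K ->
  (q * a + p * b) ^+ 2 <= (1 + k) * b ^+ 2 + (1 + k^-1) * K * a ^+ 2.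
Proof.
move=> k0 p1 qK.
have h1 : (q * a + p * b) ^+ 2 <= (1 + k) * (p * b) ^+ 2 + (1 + k^-1) * (q * a) ^+ 2.
  rewrite -subr_ge0; have -> : (1 + k) * (p * b) ^+ 2 + (1 + k^-1) * (q * a) ^+ 2 - (q * a + p * b) ^+ 2 =
    k^-1 * (k * (p * b) - q * a) ^+ 2 by field; rewrite gt_eqF.
  by apply: mulr_ge0; [rewrite invr_ge0 ltW|exact: sqr_ge0].
apply: (le_trans h1); apply: lerD; rewrite ?exprMn.
  by apply: ler_wpM2l; [lra|apply: ler_piMl => //; exact: sqr_ge0].
rewrite -[leRHS]mulrA ler_pM2l; last by rewrite ltr_pwDl// invr_ge0 ltW.
by apply: ler_wpM2r => //; exact: sqr_ge0.
Qed.

Let young3 (k p q K a0 a1 a2 b0 b1 b2 : R) : 0 < k -> p ^+ 2 <= 1 -> q ^+ 2 <= K ->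
  (q * a0 + p * b0) ^+ 2 + (q * a1 + p * b1) ^+ 2 + (q * a2 + p * b2) ^+ 2 <=
  (1 + k) * (b0 ^+ 2 + b1 ^+ 2 + b2 ^+ 2) + (1 + k^-1) * K * (a0 ^+ 2 + a1 ^+ 2 + a2 ^+ 2).
Proof.
move=> k0 p1 qK; have y a b := young a b k0 p1 qK.
rewrite !(mulrDr (1 + k)) !(mulrDr ((1 + k^-1) * K)) [leRHS]addrACA [X in _ <= X + _]addrACA.
by apply: lerD; [apply: lerD|]; exact: y.
Qed.

Lemma sint_expR_gt0 (v : E -> R) : continuous v -> 0 < sint (fun x => expR (v x)).
Proof.
move=> cv; have cew : continuous (fun x => expR (v x)).
  exact: (continuous_comp_top (@continuous_expR R) cv).
have [M wM] := sphere_bounded cv.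
apply: (@lt_le_trans _ _ (sint (fun _ : E => expR (- M)))).
  by rewrite sint_cst mulr_gt0 ?expR_gt0// mulr_gt0// pi_gt0.
apply: sint_le; [exact: sintegrable_cst|exact: sintegrable_continuous|].
by move=> x Sx; rewrite ler_expR; have := wM x Sx; rewrite ler_norml => /andP[].
Qed.

Lemma le_of_le_eps (a b d : R) : 0 <= d -> (forall k, 0 < k -> a <= b + (1 + k) * d) -> a <= b + d.
Proof.
move=> d0 H; apply/ler_addgt0Pr => e e0.
have d1 : 0 < d + 1 by lra.
apply: (le_trans (H (e / (d + 1)) (divr_gt0 e0 d1))).
rewrite mulrDl mul1r -addrA lerD2l lerD2l mulrAC ler_pdivrMr// ler_pM2l//; lra.
Qed.

(** A constant [c] is subtracted so that [e^u] has mean 1. The square root in [onofri_south] then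
    tends to 1, the terms [pi] cancel, and what remains is linear in [c]. *)
Lemma onofri_C1 (v : E -> R) : C1 v ->
  4 * pi * ln (sint (fun x => expR (v x)) / (4 * pi)) <= sint v + 1 / 4 * sint (sgrad2 v).
Proof.
move=> C1v; have cv := C1_continuous C1v; have S0 := sint_expR_gt0 cv.
set S := sint (fun x => _) in S0 *; set c := ln _; set D := sint (sgrad2 v).
have pi0 := pi_gt0 R; have p40 : 0 < 4 * pi :> R by rewrite mulr_gt0.
pose u x := v x + - c; have C1u : C1 u by apply: C1D => //; exact: C1_cst.
have cu := C1_continuous C1u.
have [K0 uK] := sphere_bounded cu.
pose w n x := u x * cutoff n x.
have C1w n : C1 (w n) by apply: C1M => //; exact: C1_cutoff.
have cw n := C1_continuous (C1w n).
have south0 n : cutoff n (@south R) = 0.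
  by rewrite /cutoff /height /south !mxE /= subrr !mul0r !addr0 mulr0 mulr0 addr0 ln1 mul0r.
have cex (f : E -> R) : continuous f -> continuous (fun x => expR (f x)).
  by move=> cf; exact: (continuous_comp_top (@continuous_expR R) cf).
have main n := onofri_south (C1w n) (etrans (congr1 _ (south0 n)) (mulr0 _)).
have D0 : 0 <= D by apply: sint_ge0 => x; rewrite /sgrad2 !addr_ge0 ?sqr_ge0.
have wK n x : sphere x -> `|w n x| <= K0.
  move=> Sx; have /andP[c0 c1] := cutoff_itv n Sx.
  rewrite normrM (ger0_norm c0); apply: le_trans (uK x Sx).
  by rewrite ler_piMr.
have aew : \forall x \ae sig, sphere x -> w n x @[n --> \oo] --> u x.
  apply: filterS ae_height => x h Sx; rewrite -[X in _ --> X]mulr1.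
  by apply: cvgM; [exact: cvg_cst|exact/cvg_cutoff/h].
have mcont (f : E -> R) : continuous f -> measurable_fun [set: E] f by exact: measurable_continuous_rV.
have L1 : sint (w n) @[n --> \oo] --> sint u.
  apply: (@sphere_dominated R _ _ (fun=> K0)) => //.
  - by move=> n; apply: mcont.
  - by apply: mcont.
  - exact: sintegrable_cst.
have L2 : sint (fun x => expR (w n x)) @[n --> \oo] --> sint (fun x => expR (u x)).
  apply: (@sphere_dominated R _ _ (fun=> expR K0)) => //.
  - by move=> n; apply: mcont; exact: cex.
  - by apply: mcont; exact: cex.
  - exact: sintegrable_cst.
  - move=> n x Sx; rewrite ger0_norm ?expR_ge0// ler_expR.
    by have := wK n x Sx; rewrite ler_norml => /andP[].
  - apply: filterS aew => x h Sx.
    by apply: (cvg_comp _ _ (h Sx)); exact: continuous_expR.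
have Eu : sint (fun x => expR (u x)) = 4 * pi.
  have -> : sint (fun x => expR (u x)) = sint (fun x => expR (- c) * expR (v x)).
    by apply: eq_Rintegral => x _; rewrite /u expRD mulrC.
  rewrite sintZ; last by apply: sintegrable_continuous; exact: cex.
  rewrite expRN /c lnK ?posrE ?divr_gt0// invf_div -/S divfK// gt_eqF//.
have Su : sint u = sint v - c * (4 * pi).
  rewrite /u sintD; [by rewrite sint_cst mulNr|exact: sintegrable_continuous|exact: sintegrable_cst].
pose L n : R := ln n.+2%:R.
have LL n : 0 < L n by rewrite ln_gt0// ltr1n.
have cut n : sint (sgrad2 (cutoff n)) <= 4 * pi / L n.
  pose f (x : E) := (L n ^+ 2)^-1 * (n.+1%:R / (1 + n.+1%:R * height x)).
  have ch := C1_continuous (@C1_height R).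
  have p0 (x : E) : 1 + n.+1%:R * height x != 0.
    by rewrite gt_eqF// ltr_pwDl// mulr_ge0// height_ge0.
  have cg : continuous (fun x : E => n.+1%:R / (1 + n.+1%:R * height x) : R) by cts.
  have cf : continuous f by apply: continuous_mul => //; exact: continuous_cst.
  apply: (@le_trans _ _ (sint f)).
    apply: sint_le; [apply: sintegrable_continuous; apply: continuous_sgrad2; exact: C1_cutoff| |].
      exact: sintegrable_continuous.
    by move=> x Sx; rewrite /f mulrC; exact: sgrad2_cutoff_le.
  rewrite /f sintZ; last exact: sintegrable_continuous.
  rewrite sint_cutoff_le -/(L n) le_eqVlt; apply/orP; left; apply/eqP.
  by move: (LL n); move: (L n) => l l0; field; rewrite gt_eqF.
(* [k] is the parameter of Young's inequality for the gradient of [u * cutoff]. The energy of the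
   cutoff carries the factor [1 + k^-1] but vanishes as [n] grows, so that [k] may tend to 0
   afterwards. *)
have step k : 0 < k -> 4 * pi * c <= sint v + (1 + k) * (1 / 4 * D).
  move=> k0; pose K := K0 ^+ 2.
  have gradw n : sint (sgrad2 (w n)) <= (1 + k) * D + (1 + k^-1) * K * (4 * pi / L n).
    have ck : sintegrable (sgrad2 (@cutoff R n)).
      by apply: sintegrable_continuous; apply: continuous_sgrad2; exact: C1_cutoff.
    have cvk : sintegrable (sgrad2 v) by apply: sintegrable_continuous; exact: continuous_sgrad2.
    apply: (@le_trans _ _ (sint (fun x => (1 + k) * sgrad2 v x + (1 + k^-1) * K * sgrad2 (cutoff n) x))).
      apply: sint_le.
      - by apply: sintegrable_continuous; exact: continuous_sgrad2.
      - by apply: sintegrableD; exact: sintegrableZ.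
      move=> x Sx; have /andP[c0 c1] := cutoff_itv n Sx.
      have p1 : cutoff n x ^+ 2 <= 1 by rewrite expr_le1.
      have q1 : u x ^+ 2 <= K.
        by rewrite -real_normK ?num_real// ler_pXn2r ?nnegrE// ?uK// (le_trans _ (uK x Sx)).
      have E j : sgrad j (w n) x = u x * sgrad j (cutoff n) x + cutoff n x * sgrad j v x.
        by rewrite sgradM//; [rewrite sgradD_cst|exact: C1_cutoff].
      rewrite /sgrad2 !E; exact: (young3 _ _ _ _ _ _ k0 p1 q1).
    rewrite sintD; [|exact: sintegrableZ|exact: sintegrableZ].
    rewrite !sintZ// lerD2l ler_wpM2l// mulr_ge0 ?sqr_ge0// addr_ge0// invr_ge0 ltW//.
  have lim : Num.sqrt (4 * pi / sint (fun x => expR (w n x))) * pi +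
      1 / 32 * ((1 + k) * D + (1 + k^-1) * K * (4 * pi) / L n) + 1 / 8 * sint (w n) @[n --> \oo] -->
      Num.sqrt (4 * pi / (4 * pi)) * pi + 1 / 32 * ((1 + k) * D + 0) + 1 / 8 * sint u.
    apply: cvgD; last by apply: cvgM => //; exact: cvg_cst.
    apply: cvgD; last first.
      apply: cvgM; first exact: cvg_cst.
      by apply: cvgD; [exact: cvg_cst|exact: cvg_inv_ln].
    apply: cvgM; last exact: cvg_cst.
    have hq : 4 * pi / sint (fun x => expR (w n x)) @[n --> \oo] --> 4 * pi / (4 * pi).
      rewrite Eu in L2; apply: cvgM; first exact: cvg_cst.
      by apply: cvgV => //; rewrite gt_eqF.
    by apply: (cvg_comp (fun n => 4 * pi / sint (fun x => expR (w n x))) Num.sqrt hq); exact: sqrt_continuous.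
  have := ler_cvg_to (@cvg_cst _ pi _ _ _) lim.
  rewrite divff ?gt_eqF// sqrtr1 [1 * pi]mul1r addr0 Su => H.
  have {}H : pi <= pi + 1 / 32 * ((1 + k) * D) + 1 / 8 * (sint v - c * (4 * pi)).
    apply: H; apply: nearW => n; apply: (le_trans (main n)).
    rewrite lerD2r lerD2l ler_pM2l//; apply: (le_trans (gradw n)).
    by rewrite lerD2l mulrA.
  move: H; rewrite mulrCA; move: (sint v) (c * (4 * pi)) (mulrC c (4 * pi)) => s a ->.
  by move: ((1 + k) * D) (4 * pi * c) => b d; move: pi; clear => p; lra.
apply: le_of_le_eps step; by rewrite mulr_ge0.
Qed.

End onofri_C1.

(** * Square integrable functions on the sphere *)

Section L2_toolbox.
Context {R : realType}.
Local Notation E := 'rV[R]_3.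
Local Notation sig := (@sphere_measure R).

Definition L2 (f : E -> R) : Prop :=
  measurable_fun [set: E] f /\ sintegrable (fun x => f x ^+ 2).

Lemma sintegrable_le (f g : E -> R) : measurable_fun [set: E] f -> sintegrable g ->
  (forall x, sphere x -> `|f x| <= g x) -> sintegrable f.
Proof.
move=> mf gi fg; have mC : measurable (~` (@sphere R)).
  by apply: measurableC; exact: measurable_sphere.
apply/(negligible_integrable mC _ _ (@sphere_measure_sphereC R)) => //; first exact/measurable_EFinP.
rewrite setTD setCK; apply: le_integrable (sintegrable_sphere gi).
- exact: measurable_sphere.
- by apply: measurable_funTS; exact/measurable_EFinP.
- move=> x Sx /=; rewrite lee_fin; apply: (le_trans (fg x Sx)); exact: ler_norm.
Qed.

Lemma integral_lt_pinfty (f : E -> R) : measurable_fun [set: E] f -> (forall x, 0 <= f x) ->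
  (\int[sig]_x (f x)%:E < +oo)%E -> sintegrable f.
Proof.
move=> mf f0 fi; apply/integrableP; split; first exact/measurable_EFinP.
by under eq_integral do rewrite /= ger0_norm//.
Qed.

Lemma sintEFin (f : E -> R) : sintegrable f -> (\int[sig]_x (f x)%:E)%E = (sint f)%:E.
Proof. by move=> fi; rewrite /sint /Rintegral fineK//; exact: integrable_fin_num. Qed.

Lemma L2P (f : E -> R) : L2fun f -> L2 f.
Proof.
move=> [mf fi]; split=> //; apply: integral_lt_pinfty => // [|x]; last exact: sqr_ge0.
exact: measurable_funX.
Qed.

Lemma L2M (f g : E -> R) : L2 f -> L2 g -> sintegrable (fun x => f x * g x).
Proof.
move=> [mf fi] [mg gi].
apply: (@sintegrable_le _ (fun x => f x ^+ 2 + g x ^+ 2)); first exact: measurable_funM.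
  exact: sintegrableD.
move=> x _; rewrite normrM -(@real_normK _ (f x)) ?num_real// -(@real_normK _ (g x)) ?num_real//.
move: `|f x| `|g x| (normr_ge0 (f x)) (normr_ge0 (g x)) => a b a0 b0; nra.
Qed.

Lemma L2Z (k : R) (f : E -> R) : L2 f -> L2 (fun x => k * f x).
Proof.
move=> [mf fi]; split; first exact: measurable_funM.
have := sintegrableZ (k ^+ 2) fi; congr sintegrable; apply/funext => x; by rewrite exprMn.
Qed.

Lemma L2D (f g : E -> R) : L2 f -> L2 g -> L2 (fun x => f x + g x).
Proof.
move=> Lf Lg; have [mf fi] := Lf; have [mg gi] := Lg; split; first exact: measurable_funD.
have := sintegrableD (sintegrableD fi gi) (sintegrableZ 2 (L2M Lf Lg)).
congr sintegrable; apply/funext => x; ring.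
Qed.

Lemma L2_bounded_mul (b f : E -> R) (M : R) : measurable_fun [set: E] b ->
  (forall x, sphere x -> `|b x| <= M) -> L2 f -> L2 (fun x => b x * f x).
Proof.
move=> mb bM [mf fi]; split; first exact: measurable_funM.
apply: (sintegrable_le _ (sintegrableZ (M ^+ 2) fi)) => [|x Sx].
  by apply: measurable_funX; exact: measurable_funM.
rewrite ger0_norm ?sqr_ge0// exprMn; apply: ler_wpM2r; first exact: sqr_ge0.
have M0 : 0 <= M by apply: le_trans (normr_ge0 _) (bM x Sx).
by rewrite -real_normK ?num_real// ler_pXn2r ?nnegrE// bM.
Qed.

Lemma L2_cst (k : R) : L2 (fun=> k).
Proof. by split; [exact: measurable_cst|exact: sintegrable_cst]. Qed.

Lemma L2_bounded (b : E -> R) (M : R) : measurable_fun [set: E] b ->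
  (forall x, sphere x -> `|b x| <= M) -> L2 b.
Proof.
move=> mb bM; have := L2_bounded_mul mb bM (L2_cst 1).
by congr L2; apply/funext => x; rewrite mulr1.
Qed.

Lemma L2_continuous (f : E -> R) : continuous f -> L2 f.
Proof.
move=> cf; have [M fM] := sphere_bounded cf.
by apply: L2_bounded fM; exact: measurable_continuous_rV.
Qed.

Lemma sint_sqr_ge0 (f : E -> R) : 0 <= sint (fun x => f x ^+ 2).
Proof. by apply: sint_ge0 => x; exact: sqr_ge0. Qed.

Lemma discriminant_le (a b c : R) : 0 <= a -> (forall t, 0 <= a * t ^+ 2 + 2 * b * t + c) ->
  b ^+ 2 <= a * c.
Proof.
move=> a0 H; have [a00|an0] := eqVneq a 0.
  rewrite a00 in H *; rewrite mul0r; have [->|bn0] := eqVneq b 0; first by rewrite expr0n.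
  have := H (- (c + 1) / (2 * b)); have -> : 2 * b * (- (c + 1) / (2 * b)) = - (c + 1).
    by rewrite mulrCA divff ?mulr1// mulf_neq0.
  by rewrite mul0r => h; exfalso; move: h; clear; lra.
have ap : 0 < a by rewrite lt_neqAle eq_sym an0.
have := H (- b / a); have -> : a * (- b / a) ^+ 2 + 2 * b * (- b / a) + c = (a * c - b ^+ 2) / a.
  by field.
by rewrite pmulr_lge0 ?invr_gt0// subr_ge0.
Qed.

Lemma sint_CS (f g : E -> R) : L2 f -> L2 g ->
  sint (fun x => f x * g x) ^+ 2 <= sint (fun x => f x ^+ 2) * sint (fun x => g x ^+ 2).
Proof.
move=> Lf Lg; have fg := L2M Lf Lg; apply: discriminant_le; first exact: sint_sqr_ge0.
move=> t; have := sint_sqr_ge0 (fun x => t * f x + g x).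
have [mf fi] := Lf; have [mg gi] := Lg.
have -> : sint (fun x => (t * f x + g x) ^+ 2) =
    sint (fun x => t ^+ 2 * f x ^+ 2 + 2 * t * (f x * g x) + g x ^+ 2).
  by apply: eq_Rintegral => x _; ring.
rewrite !sintD//; [|exact: sintegrableZ|exact: sintegrableZ|by apply: sintegrableD; exact: sintegrableZ].
rewrite !sintZ//; move: (sint _) (sint _) (sint _) => a b c.
by have -> : t ^+ 2 * c + 2 * t * b + a = c * t ^+ 2 + 2 * b * t + a by ring.
Qed.

Definition L2cvg (f_ : nat -> E -> R) (f : E -> R) : Prop :=
  sint (fun x => (f_ n x - f x) ^+ 2) @[n --> \oo] --> (0 : R).

Lemma L2B (f g : E -> R) : L2 f -> L2 g -> L2 (fun x => f x - g x).
Proof.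
move=> Lf Lg; have := L2D Lf (L2Z (-1) Lg).
by congr L2; apply/funext => x; rewrite mulN1r.
Qed.

Lemma cvg_of_sqr (a : nat -> R) : a n ^+ 2 @[n --> \oo] --> (0 : R) -> a n @[n --> \oo] --> (0 : R).
Proof.
move=> a2; have h : Num.sqrt (a n ^+ 2) @[n --> \oo] --> Num.sqrt (0 : R).
  by apply: (cvg_comp (fun n => a n ^+ 2) Num.sqrt a2); exact: sqrt_continuous.
rewrite sqrtr0 in h; apply/norm_cvg0P.
by rewrite (_ : (fun n => `|a n|) = (fun n => Num.sqrt (a n ^+ 2)))//; apply/funext => n; rewrite sqrtr_sqr.
Qed.

Lemma cvg_eq_seq (a b : nat -> R) (l : R) : (forall n, a n = b n) ->
  a n @[n --> \oo] --> l -> b n @[n --> \oo] --> l.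
Proof. by move=> /funext ->. Qed.

Lemma L2cvg_weak (f_ : nat -> E -> R) (f g : E -> R) : (forall n, L2 (f_ n)) -> L2 f -> L2 g ->
  L2cvg f_ f -> sint (fun x => f_ n x * g x) @[n --> \oo] --> sint (fun x => f x * g x).
Proof.
move=> Lf_ Lf Lg fc; have h : sint (fun x => (f_ n x - f x) * g x) @[n --> \oo] --> (0 : R).
  apply: cvg_of_sqr; apply: (@squeeze_cvgr _ _ _ _ (fun=> 0)
    (fun n => sint (fun x => (f_ n x - f x) ^+ 2) * sint (fun x => g x ^+ 2))).
  - apply: nearW => n; rewrite sqr_ge0 /=; apply: sint_CS => //; exact: L2B.
  - exact: cvg_cst.
  - by rewrite -[X in _ --> X](mul0r (sint (fun x => g x ^+ 2))); apply: cvgM => //; exact: cvg_cst.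
rewrite -[X in _ --> X]add0r.
apply: (cvg_eq_seq _ (cvgD h (@cvg_cst _ (sint (fun x => f x * g x)) _ \oo _))) => n.
rewrite /= -sintD; [|by apply: L2M => //; exact: L2B|exact: L2M].
by apply: eq_Rintegral => x _; ring.
Qed.

Lemma L2cvg_sqr (f_ : nat -> E -> R) (f : E -> R) : (forall n, L2 (f_ n)) -> L2 f ->
  L2cvg f_ f -> sint (fun x => f_ n x ^+ 2) @[n --> \oo] --> sint (fun x => f x ^+ 2).
Proof.
move=> Lf_ Lf fc; have w := L2cvg_weak Lf_ Lf Lf fc.
have E : 0 + 2 * sint (fun x => f x * f x) + - sint (fun x => f x ^+ 2) = sint (fun x => f x ^+ 2).
  rewrite add0r (_ : sint (fun x => f x * f x) = sint (fun x => f x ^+ 2)); first by ring.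
  by apply: eq_Rintegral.
rewrite -[X in _ --> X]E;
apply: (cvg_eq_seq _ (cvgD (cvgD fc (cvgM (@cvg_cst _ (2 : R) _ \oo _) w))
  (@cvg_cst _ (- sint (fun x => f x ^+ 2)) _ \oo _))) => n.
have [_ fi] := Lf; have [_ gi] := L2B (Lf_ n) Lf; have fg := L2M (Lf_ n) Lf.
transitivity (sint (fun x => (f_ n x - f x) ^+ 2) + 2 * sint (fun x => f_ n x * f x) +
  -1 * sint (fun x => f x ^+ 2)); first by rewrite mulN1r.
have i1 := sintegrableZ 2 fg; have i2 := sintegrableZ (-1) fi.
rewrite -(sintZ 2 fg) -(sintZ (-1) fi) -(sintD gi i1) -(sintD (sintegrableD gi i1) i2).
by apply: eq_Rintegral => x _; ring.
Qed.

Lemma L2cvg_ereal (f_ : nat -> E -> R) (f : E -> R) : (forall n, L2 (f_ n)) -> L2 f ->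
  (\int[sig]_x ((f_ n x - f x) ^+ 2)%:E)%E @[n --> \oo] --> 0%E -> L2cvg f_ f.
Proof.
move=> Lf_ Lf h; rewrite /L2cvg.
exact: (@fine_cvg _ _ _ _ (fun n => \int[sig]_x ((f_ n x - f x) ^+ 2)%:E)%E 0).
Qed.

End L2_toolbox.

(** * Onofri's inequality in H^1 *)

Section onofri_H1.
Context {R : realType}.
Local Notation E := 'rV[R]_3.
Local Notation sig := (@sphere_measure R).

Lemma smooth_C1 (f : E -> R) : smooth f -> C1 f.
Proof.
move=> sf; split; first by have [] := sf 1%N.
move=> k x; apply: differentiable_continuous.
by have [_ /(_ (delta_mx 0 k))[]] := sf 2%N.
Qed.

(** The difference of [df] and the tangential gradient is itself a tangent vector, so it may be used
    as a test vector, and its norm is 0. *)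
Lemma gradient_sgrad (f : E -> R) (df : E -> E) : C1 f -> gradient f df ->
  forall x, sphere x -> forall k, df x 0 k = sgrad k f x.
Proof.
move=> [dif _] gf x Sx; have [tx H] := gf x Sx.
pose s : E := \row_k sgrad k f x.
have xs : dot x s = 0.
  rewrite dotE !mxE /sgrad; have := sphere_coords x; rewrite /euler /dotp /coords /=.
  move=> [/(_ Sx) + _]; move: (partial 0 f x) (partial 1 f x) (partial 2 f x) => a b c h.
  move: (x 0 0) (x 0 1) (x 0 2) h => x0 x1 x2 h.
  have -> : x0 * (a - x0 * (x0 * a + x1 * b + x2 * c)) + x1 * (b - x1 * (x0 * a + x1 * b + x2 * c)) +
    x2 * (c - x2 * (x0 * a + x1 * b + x2 * c)) =
    (x0 * a + x1 * b + x2 * c) * (1 - (x0 ^+ 2 + x1 ^+ 2 + x2 ^+ 2)) by ring.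
  by rewrite h subrr mulr0.
pose d := df x - s.
have td : tangent x d.
  move: tx xs; rewrite /tangent /d !dotE !mxE; lra.
have dd : dot d d = 0.
  have := H d td; rewrite derive_partial//; move: td; rewrite /tangent /d !dotE !mxE.
  rewrite /sgrad; move: (euler f x) (partial 0 f x) (partial 1 f x) (partial 2 f x) => e a b c.
  move: (x 0 0) (x 0 1) (x 0 2) (df x 0 0) (df x 0 1) (df x 0 2) => x0 x1 x2 d0 d1 d2 h1 h2.
  have -> : (d0 - (a - x0 * e)) * (d0 - (a - x0 * e)) + (d1 - (b - x1 * e)) * (d1 - (b - x1 * e)) +
    (d2 - (c - x2 * e)) * (d2 - (c - x2 * e)) =
    (d0 * (d0 - (a - x0 * e)) + d1 * (d1 - (b - x1 * e)) + d2 * (d2 - (c - x2 * e))) -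
    ((d0 - (a - x0 * e)) * a + (d1 - (b - x1 * e)) * b + (d2 - (c - x2 * e)) * c) +
    e * (x0 * (d0 - (a - x0 * e)) + x1 * (d1 - (b - x1 * e)) + x2 * (d2 - (c - x2 * e))) by ring.
  by rewrite h1 h2 mulr0 addr0 subrr.
have d0 k : d 0 k = 0.
  move: dd; rewrite dotE -!expr2 => dd; apply/eqP; rewrite -sqrf_eq0.
  have := sqr_ge0 (d 0 0); have := sqr_ge0 (d 0 1); have := sqr_ge0 (d 0 2).
  move: k; apply: ord3P; move: dd; move: (_ ^+ 2) (_ ^+ 2) (_ ^+ 2) => a b c h a0 b0 c0;
    apply/eqP; lra.
by move=> k; have := d0 k; rewrite /d !mxE => /eqP; rewrite subr_eq0 => /eqP.
Qed.

(** Smooth approximations converge in H^1, while the exponential need not stay bounded. By convexity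
    [e^(2f) >= e^(2t) (1 + 2 (f - t))] with the truncation [t = min(u, M)]: the right side is affine
    in [f] with a bounded weight, so it passes to the limit, and [M] is then removed by monotone
    convergence. The integral is extended so that its finiteness is part of the conclusion. *)
Lemma onofri_H1 (u : E -> R) (du : E -> E) : weak_gradient u du ->
  (\int[sig]_x (expR (2 * u x))%:E <=
   (4 * pi * expR ((2 * sint u + sint (fun x => dot (du x) (du x))) / (4 * pi)))%:E)%E.
Proof.
move=> [/L2P Lu [mdu idu] [f [df [Hf cf cdf]]]].
have pi0 := pi_gt0 R; have p40 : 0 < 4 * pi :> R by rewrite mulr_gt0.
have C1f n : C1 (f n) by apply: smooth_C1; have [] := Hf n.
have cfn n := C1_continuous (C1f n); have Lf n := L2_continuous (cfn n).
have fu : L2cvg f u by exact: L2cvg_ereal.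
have mk k : measurable_fun [set: E] (fun x => du x 0 k).
  by apply: (measurableT_comp (measurable_coord k)).
have m2 : measurable_fun [set: E] (fun x => dot (du x) (du x)).
  have m : measurable_fun [set: E] (fun x => du x 0 0 * du x 0 0 + du x 0 1 * du x 0 1 + du x 0 2 * du x 0 2).
    by apply: measurable_funD; [apply: measurable_funD|]; exact: measurable_funM.
  by move: m; congr (measurable_fun _ _); apply/funext => x; rewrite dotE.
have dot0 (X : E) : 0 <= dot X X.
  by rewrite dotE -!expr2 !addr_ge0 ?sqr_ge0.
have Idu : sintegrable (fun x => dot (du x) (du x)) by apply: integral_lt_pinfty.
have Lk k : L2 (fun x => du x 0 k).
  split=> //; apply: (sintegrable_le _ Idu) => [|x _]; first exact: measurable_funX.
  rewrite ger0_norm ?sqr_ge0// dotE -!expr2; have := sqr_ge0 (du x 0 0); have := sqr_ge0 (du x 0 1).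
  have := sqr_ge0 (du x 0 2); move: k; apply: ord3P; move: (_ ^+ 2) (_ ^+ 2) (_ ^+ 2) => a b c; lra.
pose s k n x := sgrad k (f n) x.
have cs k n : continuous (s k n) by exact: continuous_sgrad.
have Ls k n : L2 (s k n) by exact: L2_continuous.
have scv k : L2cvg (s k) (fun x => du x 0 k).
  rewrite /L2cvg.
  have h : sint (fun x => dot (df n x - du x) (df n x - du x)) @[n --> \oo] --> (0 : R).
    exact: (@fine_cvg _ _ _ _ (fun n => \int[sig]_x (dot (df n x - du x) (df n x - du x))%:E)%E 0).
  apply: (@squeeze_cvgr _ _ _ _ (fun=> 0)
    (fun n => sint (fun x => dot (df n x - du x) (df n x - du x)))) => //; last exact: cvg_cst.
  apply: nearW => n; rewrite sint_sqr_ge0 /=.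
  have [_ gfn [mdf idf]] := Hf n.
  have mdk j : measurable_fun [set: E] (fun x => (df n x - du x) 0 j).
    have m : measurable_fun [set: E] (fun x => df n x 0 j - du x 0 j).
      by apply: measurable_funB; [exact: (measurableT_comp (measurable_coord j))|].
    by move: m; congr (measurable_fun _ _); apply/funext => x; rewrite !mxE.
  have E j x : sphere x -> (df n x - du x) 0 j = s j n x - du x 0 j.
    by move=> Sx; rewrite !mxE (gradient_sgrad (C1f n) gfn Sx).
  have I2 : sintegrable (fun x => dot (df n x - du x) (df n x - du x)).
    have I1 j : sintegrable (fun x => (df n x - du x) 0 j ^+ 2).
      have [_ I0] := L2B (Ls j n) (Lk j).
      apply: (sintegrable_eq _ _ I0) => [x Sx|]; first by rewrite E.
      exact: measurable_funX.
    have := sintegrableD (sintegrableD (I1 0) (I1 1)) (I1 2).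
    by congr sintegrable; apply/funext => x; rewrite dotE -!expr2.
  apply: sint_le => // [|x Sx]; first by have [] := L2B (Ls k n) (Lk k).
  rewrite -E// dotE -!expr2; have := sqr_ge0 ((df n x - du x) 0 0).
  have := sqr_ge0 ((df n x - du x) 0 1); have := sqr_ge0 ((df n x - du x) 0 2).
  by move: k; apply: ord3P; move: (_ ^+ 2) (_ ^+ 2) (_ ^+ 2) => a b c; lra.
have L2s k := L2cvg_sqr (Ls k) (Lk k) (scv k).
pose G n := sint (sgrad2 (f n)).
have Glim : G n @[n --> \oo] --> sint (fun x => dot (du x) (du x)).
  have -> : sint (fun x => dot (du x) (du x)) =
      sint (fun x => du x 0 0 ^+ 2) + sint (fun x => du x 0 1 ^+ 2) + sint (fun x => du x 0 2 ^+ 2).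
    have [_ I0] := Lk 0; have [_ I1] := Lk 1; have [_ I2] := Lk 2.
    rewrite -!sintD//; last exact: sintegrableD.
    by apply: eq_Rintegral => x _; rewrite dotE -!expr2.
  apply: (cvg_eq_seq _ (cvgD (cvgD (L2s 0) (L2s 1)) (L2s 2))) => n.
  have [_ I0] := Ls 0 n; have [_ I1] := Ls 1 n; have [_ I2] := Ls 2 n.
  apply: esym; transitivity (sint (fun x => s 0 n x ^+ 2) + sint (fun x => s 1 n x ^+ 2) +
    sint (fun x => s 2 n x ^+ 2)) => //.
  by rewrite -!sintD//; exact: sintegrableD.
have flim : sint (f n) @[n --> \oo] --> sint u.
  have := L2cvg_weak Lf Lu (L2_cst 1) fu.
  have e g : sint (fun x => g x * 1) = sint g by apply: eq_Rintegral => x _; rewrite mulr1.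
  by rewrite e => lim; apply: (cvg_eq_seq _ lim) => n; rewrite e.
pose B n := 4 * pi * expR ((2 * sint (f n) + G n) / (4 * pi)).
set b := 4 * pi * expR _.
have Blim : B n @[n --> \oo] --> b.
  apply: cvgM; first exact: cvg_cst.
  have h : (2 * sint (f n) + G n) / (4 * pi) @[n --> \oo] -->
      (2 * sint u + sint (fun x => dot (du x) (du x))) / (4 * pi).
    by apply: cvgM; [apply: cvgD => //; apply: cvgM => //; exact: cvg_cst|exact: cvg_cst].
  by apply: (cvg_comp (fun n => (2 * sint (f n) + G n) / (4 * pi)) expR h); exact: continuous_expR.
have cex (g : E -> R) : continuous g -> continuous (fun x => expR (g x)).
  by move=> cg; exact: (continuous_comp_top (@continuous_expR R) cg).
have c2f n : continuous (fun x => 2 * f n x).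
  by apply: continuous_mul => //; exact: continuous_cst.
have fB n : sint (fun x => expR (2 * f n x)) <= B n.
  have C12 : C1 (fun x => 2 * f n x) by apply: C1M => //; exact: C1_cst.
  have := onofri_C1 C12; have S0 := sint_expR_gt0 (C1_continuous C12).
  set S := sint _ in S0 *; rewrite sintZ; last exact: sintegrable_continuous.
  have -> : sint (sgrad2 (fun x => 2 * f n x)) = 4 * G n.
    rewrite /G -sintZ; last by apply: sintegrable_continuous; exact: continuous_sgrad2.
    apply: eq_Rintegral => x _; rewrite /sgrad2.
    have e k : sgrad k (fun x => 2 * f n x) x = 2 * sgrad k (f n) x.
      by rewrite (sgradM _ _ (C1_cst 2) (C1f n)) {2}/sgrad /euler /dotp !partial_cst; ring.
    by rewrite !e; ring.
  have -> : 1 / 4 * (4 * G n) = G n by field.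
  move=> H; rewrite /B mulrC -ler_pdivrMr// -[leLHS]lnK ?posrE ?divr_gt0//.
  by rewrite ler_expR ler_pdivlMr// mulrC.
have trunc (M : nat) : sint (fun x => expR (2 * Num.min (u x) M%:R)) <= b.
  pose t x := Num.min (u x) M%:R; have [mu _] := Lu.
  have mt : measurable_fun [set: E] t by apply: measurable_minr.
  have Lt : L2 t.
    split=> //; have [_ iu] := Lu.
    apply: (sintegrable_le _ (sintegrableD iu (sintegrable_cst (M%:R ^+ 2)))) => [|x _].
      exact: measurable_funX.
    rewrite ger0_norm ?sqr_ge0// /t; have [_|_] := leP (u x) M%:R.
      by rewrite lerDl sqr_ge0.
    by rewrite lerDr sqr_ge0.
  pose w x := expR (2 * t x).
  have mw : measurable_fun [set: E] w.
    by apply: measurableT_comp => //; exact: measurable_funM.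
  have wM x : sphere x -> `|w x| <= expR (2 * M%:R).
    by rewrite ger0_norm ?expR_ge0// ler_expR ler_pM2l// /t ge_min lexx orbT.
  have Lw : L2 w by exact: L2_bounded wM.
  have iw : sintegrable w by exact: sintegrable_bounded wM.
  have H n : sint w + 2 * (sint (fun x => f n x * w x) - sint (fun x => t x * w x)) <= B n.
    apply: le_trans (fB n); have fw := L2M (Lf n) Lw; have tw := L2M Lt Lw.
    have -> : sint w + 2 * (sint (fun x => f n x * w x) - sint (fun x => t x * w x)) =
        sint (fun x => w x + (2 * (f n x * w x) + -2 * (t x * w x))).
      rewrite sintD//; last by apply: sintegrableD; exact: sintegrableZ.
      rewrite sintD; [|exact: sintegrableZ|exact: sintegrableZ].
      by rewrite !sintZ//; ring.
    apply: sint_le.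
    - by apply: sintegrableD => //; apply: sintegrableD; exact: sintegrableZ.
    - by apply: sintegrable_continuous; exact: cex.
    move=> x _; have -> : 2 * f n x = 2 * t x + 2 * (f n x - t x) by ring.
    rewrite expRD -/(w x).
    have -> : w x + (2 * (f n x * w x) + -2 * (t x * w x)) = w x * (1 + 2 * (f n x - t x)) by ring.
    by apply: ler_wpM2l; [exact: expR_ge0|exact: expR_ge1Dx].
  have wlim := L2cvg_weak Lf Lu Lw fu.
  have lim : sint w + 2 * (sint (fun x => f n x * w x) - sint (fun x => t x * w x)) @[n --> \oo] -->
      sint w + 2 * (sint (fun x => u x * w x) - sint (fun x => t x * w x)).
    apply: cvgD; first exact: cvg_cst.
    by apply: cvgM; [exact: cvg_cst|apply: cvgB => //; exact: cvg_cst].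
  have := ler_cvg_to lim Blim (nearW _ H).
  have tu : sint (fun x => t x * w x) <= sint (fun x => u x * w x).
    apply: sint_le; [exact: L2M|exact: L2M|] => x _.
    by apply: ler_wpM2r; [exact: expR_ge0|rewrite /t ge_min lexx].
  by move=> h; apply: le_trans (h _ _); rewrite lerDl mulr_ge0// subr_ge0.
pose g (M : nat) (x : E) := (expR (2 * Num.min (u x) M%:R))%:E.
have [mu _] := Lu.
have mg M : measurable_fun [set: E] (fun x => expR (2 * Num.min (u x) M%:R)).
  apply: measurableT_comp => //; apply: measurable_funM => //; exact: measurable_minr.
have ig M : sintegrable (fun x => expR (2 * Num.min (u x) M%:R)).
  apply: (sintegrable_bounded (M := expR (2 * M%:R))) => // x _.
  by rewrite ger0_norm ?expR_ge0// ler_expR ler_pM2l// ge_min lexx orbT.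
have nd x : {homo g^~ x : n m / (n <= m)%N >-> (n <= m)%E}.
  move=> n m nm; rewrite lee_fin ler_expR ler_pM2l// le_min ge_min lexx /= ge_min.
  by rewrite ler_nat nm orbT.
have glim x : g M x @[M --> \oo] --> (expR (2 * u x))%:E.
  apply: cvg_near_cst; have /cvgryPge/(_ (u x)) := @cvgr_idn R.
  by apply: filterS => M uM; rewrite /g (min_idPl uM).
have mg' M : measurable_fun [set: E] (g M) by apply/measurable_EFinP; exact: mg.
have g0 M x : [set: E] x -> (0 <= g M x)%E by move=> _; rewrite lee_fin expR_ge0.
have := @cvg_monotone_convergence _ E R sig setT measurableT g mg' g0 (fun x _ => nd x).
have -> : (\int[sig]_x limn (g^~ x) = \int[sig]_x (expR (2 * u x))%:E)%E.
  by apply: eq_integral => x _; apply/cvg_lim => //; exact: glim.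
move=> lim; apply: (cvge_to_le lim).
by apply: nearW => M; rewrite /g sintEFin// lee_fin.
Qed.

End onofri_H1.

(** * The trace inequality on the sphere *)

Section kelvin.
Context {R : realType}.
Local Notation E := 'rV[R]_3.

(* The derivatives along a coordinate line of [sqrt 2 * s * phi], where [s = 1 / |X|] and
   [phi] is a function composed with the inversion. *)
Lemma is_derive_kelvin (s xi phi : R -> R) (t phii g : R) :
  is_derive t 1 s (- xi t * s t ^+ 3) ->
  is_derive t 1 phi (2 * s t ^+ 2 * phii - 4 * xi t * s t ^+ 4 * g) ->
  is_derive t 1 (fun t => Num.sqrt 2 * (s t * phi t))
    (Num.sqrt 2 * (- xi t * s t ^+ 3 * phi t + 2 * s t ^+ 3 * phii - 4 * xi t * s t ^+ 5 * g)).
Proof. by move=> ds dphi; apply: is_derive_eq; rewrite /GRing.scale/=; ring. Qed.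

Lemma is_derive_kelvin2 (s xi phi phii g : R -> R) (t phi' phii' g' : R) :
  is_derive t 1 s (- xi t * s t ^+ 3) -> is_derive t 1 xi 1 -> is_derive t 1 phi phi' ->
  is_derive t 1 phii phii' -> is_derive t 1 g g' ->
  is_derive t 1 (fun t => Num.sqrt 2 *
      (- xi t * s t ^+ 3 * phi t + 2 * s t ^+ 3 * phii t - 4 * xi t * s t ^+ 5 * g t))
    (Num.sqrt 2 * (- s t ^+ 3 * phi t + 3 * xi t ^+ 2 * s t ^+ 5 * phi t - xi t * s t ^+ 3 * phi' -
       6 * xi t * s t ^+ 5 * phii t + 2 * s t ^+ 3 * phii' - 4 * s t ^+ 5 * g t +
       20 * xi t ^+ 2 * s t ^+ 7 * g t - 4 * xi t * s t ^+ 5 * g')).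
Proof. by move=> ds dxi dphi dphii dg; apply: is_derive_eq; rewrite /GRing.scale/=; ring. Qed.

Lemma is_derive_inv_sqrt (q : R -> R) (t xi : R) : 0 < q t -> is_derive t 1 q (2 * xi) ->
  is_derive t 1 (fun t => (Num.sqrt (q t))^-1) (- xi * ((Num.sqrt (q t))^-1) ^+ 3).
Proof.
move=> q0 dq; have s0 : Num.sqrt (q t) != 0 by rewrite gt_eqF// sqrtr_gt0.
have ds := @is_derive1_comp _ Num.sqrt q t _ _ (is_derive1_sqrt q0) dq.
have dss : is_derive t 1 (fun t => Num.sqrt (q t)) (xi / Num.sqrt (q t)).
  by apply: is_derive_eq_val ds; field.
by apply: is_derive_eq; rewrite /GRing.scale/=; field.
Qed.

Definition inv_norm (p : R * R * R) : R := (Num.sqrt (rho3 p))^-1.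

Lemma inv_norm_sqr p : inv_norm p ^+ 2 = (rho3 p)^-1.
Proof. by rewrite /inv_norm exprVn sqr_sqrtr// ltW// rho3_gt0. Qed.

Lemma continuous_inv_norm : continuous inv_norm.
Proof.
have cr := @continuous_rho3 R; apply: continuous_inv.
  exact: (continuous_comp_top (@sqrt_continuous R) cr).
by move=> p; rewrite gt_eqF// sqrtr_gt0 rho3_gt0.
Qed.

Let X1 (p : R * R * R) := p.1.1.
Let X2 (p : R * R * R) := p.1.2.
Let X3 (p : R * R * R) := Num.max 1 p.2.

(* The inversion exchanging the half space above the plane [z = 1] and the unit ball;
   the plane itself is mapped to the sphere by stereographic projection. *)
Definition inversion (p : R * R * R) : E :=
  pt (2 * X1 p * inv_norm p ^+ 2, 2 * X2 p * inv_norm p ^+ 2, 2 * X3 p * inv_norm p ^+ 2 - 1).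

Lemma continuous_inversion : continuous inversion.
Proof.
have cs := continuous_inv_norm; apply: (continuous_comp_top (@continuous_pt R)).
by rewrite /X1 /X2 /X3; cts.
Qed.

Let radial (f : E -> R) (p : R * R * R) : R :=
  X1 p * partial 0 f (inversion p) + X2 p * partial 1 f (inversion p) + X3 p * partial 2 f (inversion p).

Let ds1 (x y z : R) : is_derive x 1 (fun x => inv_norm (x, y, z))
  (- x * inv_norm (x, y, z) ^+ 3).
Proof. exact: (@is_derive_inv_sqrt (fun x => rho3 (x, y, z)) x x (rho3_gt0 _) (is_derive_rho3_1 x y z)). Qed.
Let ds2 (x y z : R) : is_derive y 1 (fun y => inv_norm (x, y, z))
  (- y * inv_norm (x, y, z) ^+ 3).
Proof. exact: (@is_derive_inv_sqrt (fun y => rho3 (x, y, z)) y y (rho3_gt0 _) (is_derive_rho3_2 x y z)). Qed.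
Let ds3 (x y z : R) : 1 < z -> is_derive z 1 (fun z => inv_norm (x, y, z))
  (- Num.max 1 z * inv_norm (x, y, z) ^+ 3).
Proof. by move=> z1; exact: (@is_derive_inv_sqrt (fun z => rho3 (x, y, z)) z (Num.max 1 z) (rho3_gt0 _)
  (is_derive_rho3_3 x y z1)). Qed.
Let dm (z : R) : 1 < z -> is_derive z 1 (fun z => Num.max 1 z) 1.
Proof. by move=> z1; exact: (is_derive_max1 z1 (is_derive_id _ _)). Qed.

(** With [s = 1 / |X|], the differential of the inversion is [2 s^2] times the reflection along [X];
    these identities apply its columns to the gradient [(a, b, c)]. *)
Let path_eq1 (a b c s x y z : R) :
  (2 * s ^+ 2 - 4 * x ^+ 2 * s ^+ 4) * a + (- 4 * x * y * s ^+ 4) * b +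
  (- 4 * x * z * s ^+ 4) * c = 2 * s ^+ 2 * a - 4 * x * s ^+ 4 * (x * a + y * b + z * c).
Proof. by ring. Qed.
Let path_eq2 (a b c s x y z : R) :
  (- 4 * y * x * s ^+ 4) * a + (2 * s ^+ 2 - 4 * y ^+ 2 * s ^+ 4) * b +
  (- 4 * y * z * s ^+ 4) * c = 2 * s ^+ 2 * b - 4 * y * s ^+ 4 * (x * a + y * b + z * c).
Proof. by ring. Qed.
Let path_eq3 (a b c s x y z : R) :
  (- 4 * z * x * s ^+ 4) * a + (- 4 * z * y * s ^+ 4) * b +
  (2 * s ^+ 2 - 4 * z ^+ 2 * s ^+ 4) * c = 2 * s ^+ 2 * c - 4 * z * s ^+ 4 * (x * a + y * b + z * c).
Proof. by ring. Qed.

Lemma is_derive_inversion1 (f : E -> R) (x y z : R) : C1 f ->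
  is_derive x 1 (fun x => f (inversion (x, y, z)))
    (2 * inv_norm (x, y, z) ^+ 2 * partial 0 f (inversion (x, y, z)) -
     4 * x * inv_norm (x, y, z) ^+ 4 * radial f (x, y, z)).
Proof.
move=> [df _]; have d := ds1 x y z; set s := inv_norm _ in d *; have dfp := df (inversion (x, y, z)).
have := @is_derive_path _ f (fun x => 2 * x * inv_norm (x, y, z) ^+ 2)
  (fun x => 2 * y * inv_norm (x, y, z) ^+ 2) (fun x => 2 * Num.max 1 z * inv_norm (x, y, z) ^+ 2 - 1) x
  (2 * s ^+ 2 - 4 * x ^+ 2 * s ^+ 4) (- 4 * x * y * s ^+ 4) (- 4 * x * Num.max 1 z * s ^+ 4) dfp.
move=> H; apply: (is_derive_eq_val _ (H _ _ _)); first exact: path_eq1.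
- by apply: is_derive_eq; rewrite /GRing.scale/= -/s; ring.
- by apply: is_derive_eq; rewrite /GRing.scale/= -/s; ring.
- by apply: is_derive_eq; rewrite /GRing.scale/= -/s; ring.
Qed.

Lemma is_derive_inversion2 (f : E -> R) (x y z : R) : C1 f ->
  is_derive y 1 (fun y => f (inversion (x, y, z)))
    (2 * inv_norm (x, y, z) ^+ 2 * partial 1 f (inversion (x, y, z)) -
     4 * y * inv_norm (x, y, z) ^+ 4 * radial f (x, y, z)).
Proof.
move=> [df _]; have d := ds2 x y z; set s := inv_norm _ in d *; have dfp := df (inversion (x, y, z)).
have := @is_derive_path _ f (fun y => 2 * x * inv_norm (x, y, z) ^+ 2)
  (fun y => 2 * y * inv_norm (x, y, z) ^+ 2) (fun y => 2 * Num.max 1 z * inv_norm (x, y, z) ^+ 2 - 1) y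
  (- 4 * y * x * s ^+ 4) (2 * s ^+ 2 - 4 * y ^+ 2 * s ^+ 4) (- 4 * y * Num.max 1 z * s ^+ 4) dfp.
move=> H; apply: (is_derive_eq_val _ (H _ _ _)); first exact: path_eq2.
- by apply: is_derive_eq; rewrite /GRing.scale/= -/s; ring.
- by apply: is_derive_eq; rewrite /GRing.scale/= -/s; ring.
- by apply: is_derive_eq; rewrite /GRing.scale/= -/s; ring.
Qed.

Lemma is_derive_inversion3 (f : E -> R) (x y z : R) : C1 f -> 1 < z ->
  is_derive z 1 (fun z => f (inversion (x, y, z)))
    (2 * inv_norm (x, y, z) ^+ 2 * partial 2 f (inversion (x, y, z)) -
     4 * Num.max 1 z * inv_norm (x, y, z) ^+ 4 * radial f (x, y, z)).
Proof.
move=> [df _] z1; have d := ds3 x y z1; have dmz := dm z1.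
set s := inv_norm _ in d *; have dfp := df (inversion (x, y, z)).
have := @is_derive_path _ f (fun z => 2 * x * inv_norm (x, y, z) ^+ 2)
  (fun z => 2 * y * inv_norm (x, y, z) ^+ 2) (fun z => 2 * Num.max 1 z * inv_norm (x, y, z) ^+ 2 - 1) z
  (- 4 * Num.max 1 z * x * s ^+ 4) (- 4 * Num.max 1 z * y * s ^+ 4)
  (2 * s ^+ 2 - 4 * Num.max 1 z ^+ 2 * s ^+ 4) dfp.
move=> H; apply: (is_derive_eq_val _ (H _ _ _)); first exact: path_eq3.
- by apply: is_derive_eq; rewrite /GRing.scale/= -/s; ring.
- by apply: is_derive_eq; rewrite /GRing.scale/= -/s; ring.
- by apply: is_derive_eq; rewrite /GRing.scale/= -/s; ring.
Qed.

Variable f : E -> R.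
Hypothesis C1f : C1 f.
Hypothesis C1pf : forall k, C1 (partial k f).
Hypothesis harm : forall x, partial 0 (partial 0 f) x + partial 1 (partial 1 f) x +
  partial 2 (partial 2 f) x = 0.

Let phi p := f (inversion p).
Let phik k p := partial k f (inversion p).
Let g p := radial f p.

(** The Kelvin transform of [f]. The factor [2^(1/2)] makes its fourth power on the plane [z = 1]
    equal to [f^4] times the area density [4 / rho2^2]. *)
Let kelvin p := Num.sqrt 2 * (inv_norm p * phi p).
(** The first derivatives, and in [kelvin2] the second ones, along the coordinate [k]. [X] is that
    coordinate, truncated to [max 1 z] for the third, so that the three directions share one
    formula. *)
Let kelvin1 (X : R * R * R -> R) k p := Num.sqrt 2 * (- X p * inv_norm p ^+ 3 * phi p +
  2 * inv_norm p ^+ 3 * phik k p - 4 * X p * inv_norm p ^+ 5 * g p).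
Let dphi (X : R * R * R -> R) k p := 2 * inv_norm p ^+ 2 * phik k p - 4 * X p * inv_norm p ^+ 4 * g p.
Let dphik (X : R * R * R -> R) j k p := 2 * inv_norm p ^+ 2 * partial k (partial j f) (inversion p) -
  4 * X p * inv_norm p ^+ 4 * radial (partial j f) p.
Let dg (X : R * R * R -> R) k p := phik k p + X1 p * dphik X 0 k p + X2 p * dphik X 1 k p + X3 p * dphik X 2 k p.
Let kelvin2 (X : R * R * R -> R) k p := let s := inv_norm p in Num.sqrt 2 * (- s ^+ 3 * phi p +
  3 * X p ^+ 2 * s ^+ 5 * phi p - X p * s ^+ 3 * dphi X k p - 6 * X p * s ^+ 5 * phik k p +
  2 * s ^+ 3 * dphik X k k p - 4 * s ^+ 5 * g p + 20 * X p ^+ 2 * s ^+ 7 * g p - 4 * X p * s ^+ 5 * dg X k p).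

(** Kelvin transforms are harmonic: the sum of the second derivatives is a combination of
    [s^2 |X|^2 - 1] and of the Laplacian of [f]. *)
Let kelvin_laplacian (c s x y z p f1 f2 f3 a11 a12 a13 a21 a22 a23 a31 a32 a33 : R) :
  let g := x * f1 + y * f2 + z * f3 in
  let h1 := x * a11 + y * a12 + z * a13 in
  let h2 := x * a21 + y * a22 + z * a23 in
  let h3 := x * a31 + y * a32 + z * a33 in
  let K t fi d dg := c * (- s ^+ 3 * p + 3 * t ^+ 2 * s ^+ 5 * p -
    t * s ^+ 3 * (2 * s ^+ 2 * fi - 4 * t * s ^+ 4 * g) - 6 * t * s ^+ 5 * fi + 2 * s ^+ 3 * d -
    4 * s ^+ 5 * g + 20 * t ^+ 2 * s ^+ 7 * g - 4 * t * s ^+ 5 * dg) in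
  let D t a h := 2 * s ^+ 2 * a - 4 * t * s ^+ 4 * h in
  s ^+ 2 * (x ^+ 2 + y ^+ 2 + z ^+ 2) = 1 -> a11 + a22 + a33 = 0 ->
  K x f1 (D x a11 h1) (f1 + x * D x a11 h1 + y * D x a21 h2 + z * D x a31 h3) +
  K y f2 (D y a22 h2) (f2 + x * D y a12 h1 + y * D y a22 h2 + z * D y a32 h3) +
  K z f3 (D z a33 h3) (f3 + x * D z a13 h1 + y * D z a23 h2 + z * D z a33 h3) = 0.
Proof.
move=> g0 h1 h2 h3 K D u a0.
have -> : K x f1 (D x a11 h1) (f1 + x * D x a11 h1 + y * D x a21 h2 + z * D x a31 h3) +
  K y f2 (D y a22 h2) (f2 + x * D y a12 h1 + y * D y a22 h2 + z * D y a32 h3) +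
  K z f3 (D z a33 h3) (f3 + x * D z a13 h1 + y * D z a23 h2 + z * D z a33 h3) =
  c * ((s ^+ 2 * (x ^+ 2 + y ^+ 2 + z ^+ 2) - 1) * (3 * s ^+ 3 * p + 24 * s ^+ 5 * g0 +
    16 * s ^+ 7 * (x * h1 + y * h2 + z * h3)) + 4 * s ^+ 5 * (a11 + a22 + a33)).
  by rewrite /K /D /h1 /h2 /h3 /g0; ring.
by rewrite u a0 subrr; ring.
Qed.

Let kelvin_harmonic p : kelvin2 X1 0 p + kelvin2 X2 1 p + kelvin2 X3 2 p = 0.
Proof.
apply: kelvin_laplacian; last exact: harm.
by rewrite inv_norm_sqr mulVf// rho3_neq0.
Qed.

Let cinv := continuous_inversion.
Let cs := continuous_inv_norm.
Let cX1 : continuous X1. Proof. by rewrite /X1; cts. Qed.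
Let cX2 : continuous X2. Proof. by rewrite /X2; cts. Qed.
Let cX3 : continuous X3. Proof. by rewrite /X3; cts. Qed.
Let ccomp (h : E -> R) : continuous h -> continuous (fun p => h (inversion p)).
Proof. by move=> ch; exact: (continuous_comp_top ch cinv). Qed.
Let cphi : continuous phi. Proof. by apply: ccomp; exact: C1_continuous. Qed.
Let cphik k : continuous (phik k).
Proof. by apply: ccomp; case: C1f. Qed.
Let cradial (h : E -> R) : C1 h -> continuous (radial h).
Proof.
move=> [_ ch]; have c0 := ccomp (ch 0); have c1 := ccomp (ch 1); have c2 := ccomp (ch 2).
exact: (continuous_add (continuous_add (continuous_mul cX1 c0) (continuous_mul cX2 c1))
  (continuous_mul cX3 c2)).
Qed.
Let cg : continuous g. Proof. exact: cradial. Qed.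

Let ckelvin : continuous kelvin.
Proof. by have h1 := cs; have h2 := cphi; rewrite /kelvin; cts. Qed.
Let ckelvin1 X k : continuous X -> continuous (kelvin1 X k).
Proof.
by move=> h0; have h1 := cs; have h2 := cphi; have h3 := @cphik k; have h4 := cg; rewrite /kelvin1; cts.
Qed.
Let cdphik X j k : continuous X -> continuous (dphik X j k).
Proof.
move=> h0; have h1 := cs; have h2 := ccomp ((C1pf j).2 k); have h3 := cradial (C1pf j).
by rewrite /dphik; cts.
Qed.
Let ckelvin2 X k : continuous X -> continuous (kelvin2 X k).
Proof.
move=> h0; have h1 := cs; have h2 := cphi; have h3 := @cphik k; have h4 := cg.
have e0 := @cdphik X 0 k h0; have e1 := @cdphik X 1 k h0; have e2 := @cdphik X 2 k h0.
have e3 := @cdphik X k k h0; have x1 := cX1; have x2 := cX2; have x3 := cX3.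
have cdg : continuous (dg X k) by rewrite /dg; cts.
have cdp : continuous (dphi X k) by rewrite /dphi; cts.
by rewrite /kelvin2; cts.
Qed.

Let d1 (x y z : R) : is_derive x 1 (fun x => kelvin (x, y, z)) (kelvin1 X1 0 (x, y, z)).
Proof.
exact: (@is_derive_kelvin (fun x => inv_norm (x, y, z)) (fun x => x) (fun x => phi (x, y, z)) x _ _
  (ds1 x y z) (is_derive_inversion1 x y z C1f)).
Qed.
Let d2 (x y z : R) : is_derive y 1 (fun y => kelvin (x, y, z)) (kelvin1 X2 1 (x, y, z)).
Proof.
exact: (@is_derive_kelvin (fun y => inv_norm (x, y, z)) (fun y => y) (fun y => phi (x, y, z)) y _ _
  (ds2 x y z) (is_derive_inversion2 x y z C1f)).
Qed.
Let d3 (x y z : R) : 1 < z -> is_derive z 1 (fun z => kelvin (x, y, z)) (kelvin1 X3 2 (x, y, z)).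
Proof.
move=> z1.
exact: (@is_derive_kelvin (fun z => inv_norm (x, y, z)) (fun z => Num.max 1 z) (fun z => phi (x, y, z))
  z _ _ (ds3 x y z1) (is_derive_inversion3 x y C1f z1)).
Qed.

Let is_derive_radial (a b c u v w : R -> R) (t a' b' c' u' v' w' : R) :
  is_derive t 1 a a' -> is_derive t 1 b b' -> is_derive t 1 c c' ->
  is_derive t 1 u u' -> is_derive t 1 v v' -> is_derive t 1 w w' ->
  is_derive t 1 (fun t => a t * u t + b t * v t + c t * w t)
    (a' * u t + b' * v t + c' * w t + a t * u' + b t * v' + c t * w').
Proof. by move=> da db dc du dv dw; apply: is_derive_eq; rewrite /GRing.scale/=; ring. Qed.

Let dg1 (x y z : R) : is_derive x 1 (fun x => g (x, y, z)) (dg X1 0 (x, y, z)).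
Proof.
have := @is_derive_radial (fun x => x) (fun=> y) (fun=> Num.max 1 z) (fun x => phik 0 (x, y, z))
  (fun x => phik 1 (x, y, z)) (fun x => phik 2 (x, y, z)) x _ _ _ _ _ _ (is_derive_id _ _)
  (is_derive_cst _ _ _) (is_derive_cst _ _ _) (is_derive_inversion1 x y z (C1pf 0))
  (is_derive_inversion1 x y z (C1pf 1)) (is_derive_inversion1 x y z (C1pf 2)).
by apply: is_derive_eq_val; rewrite mul1r !mul0r !addr0.
Qed.
Let dg2 (x y z : R) : is_derive y 1 (fun y => g (x, y, z)) (dg X2 1 (x, y, z)).
Proof.
have := @is_derive_radial (fun=> x) (fun y => y) (fun=> Num.max 1 z) (fun y => phik 0 (x, y, z))
  (fun y => phik 1 (x, y, z)) (fun y => phik 2 (x, y, z)) y _ _ _ _ _ _ (is_derive_cst _ _ _)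
  (is_derive_id _ _) (is_derive_cst _ _ _) (is_derive_inversion2 x y z (C1pf 0))
  (is_derive_inversion2 x y z (C1pf 1)) (is_derive_inversion2 x y z (C1pf 2)).
by apply: is_derive_eq_val; rewrite mul1r !mul0r !addr0 add0r.
Qed.
Let dg3 (x y z : R) : 1 < z -> is_derive z 1 (fun z => g (x, y, z)) (dg X3 2 (x, y, z)).
Proof.
move=> z1; have := @is_derive_radial (fun=> x) (fun=> y) (fun z => Num.max 1 z) (fun z => phik 0 (x, y, z))
  (fun z => phik 1 (x, y, z)) (fun z => phik 2 (x, y, z)) z _ _ _ _ _ _ (is_derive_cst _ _ _)
  (is_derive_cst _ _ _) (dm z1) (is_derive_inversion3 x y (C1pf 0) z1)
  (is_derive_inversion3 x y (C1pf 1) z1) (is_derive_inversion3 x y (C1pf 2) z1).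
by apply: is_derive_eq_val; rewrite mul1r !mul0r !add0r.
Qed.

Let d11 (x y z : R) : is_derive x 1 (fun x => kelvin1 X1 0 (x, y, z)) (kelvin2 X1 0 (x, y, z)).
Proof.
exact: (@is_derive_kelvin2 (fun x => inv_norm (x, y, z)) (fun x => x) (fun x => phi (x, y, z))
  (fun x => phik 0 (x, y, z)) (fun x => g (x, y, z)) x _ _ _ (ds1 x y z) (is_derive_id _ _)
  (is_derive_inversion1 x y z C1f) (is_derive_inversion1 x y z (C1pf 0)) (dg1 x y z)).
Qed.
Let d22 (x y z : R) : is_derive y 1 (fun y => kelvin1 X2 1 (x, y, z)) (kelvin2 X2 1 (x, y, z)).
Proof.
exact: (@is_derive_kelvin2 (fun y => inv_norm (x, y, z)) (fun y => y) (fun y => phi (x, y, z))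
  (fun y => phik 1 (x, y, z)) (fun y => g (x, y, z)) y _ _ _ (ds2 x y z) (is_derive_id _ _)
  (is_derive_inversion2 x y z C1f) (is_derive_inversion2 x y z (C1pf 1)) (dg2 x y z)).
Qed.
Let d33 (x y z : R) : 1 < z -> is_derive z 1 (fun z => kelvin1 X3 2 (x, y, z)) (kelvin2 X3 2 (x, y, z)).
Proof.
move=> z1; exact: (@is_derive_kelvin2 (fun z => inv_norm (x, y, z)) (fun z => Num.max 1 z)
  (fun z => phi (x, y, z)) (fun z => phik 2 (x, y, z)) (fun z => g (x, y, z)) z _ _ _ (ds3 x y z1) (dm z1)
  (is_derive_inversion3 x y C1f z1) (is_derive_inversion3 x y (C1pf 2) z1) (dg3 x y z1)).
Qed.

(** The truncation at [z = 1] keeps the image of the inversion inside a fixed compact ball, on which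
    [h] is bounded. *)
Let bounded_box (h : E -> R) : continuous h -> exists M, forall p, `|h (inversion p)| <= M.
Proof.
move=> ch; pose B := [set x : E | `|x| <= 2].
have cB : compact B.
  apply: bounded_closed_compact; first by exists 2; split; [exact: num_real|move=> M M2 x /= xB; exact: le_trans (ltW M2)].
  rewrite (_ : B = (fun x : E => `|x|) @^-1` [set r | r <= 2])//.
  by apply: closed_comp => [x _|]; [exact: norm_continuous|exact: closed_le].
have /compact_bounded[M [Mr MP]] := continuous_compact (continuous_subspaceT ch) cB.
exists (M + 1) => p; apply: (MP (M + 1)); first by rewrite ltrDl.
exists (inversion p) => //; rewrite /B /=.
rewrite /Num.Def.normr/= mx_normrE; apply/bigmax_leP; split => //= -[i k] _ /=; rewrite (ord1 i).
have s1 : inv_norm p ^+ 2 <= 1 by rewrite inv_norm_sqr invf_le1 ?rho3_gt0 ?rho3_ge1.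
have s0 : 0 <= inv_norm p ^+ 2 by exact: sqr_ge0.
have E : inv_norm p ^+ 2 * (X1 p ^+ 2 + X2 p ^+ 2 + X3 p ^+ 2) = 1.
  by rewrite inv_norm_sqr mulVf// rho3_neq0.
have x1 : 0 <= X1 p ^+ 2 by exact: sqr_ge0.
have x2 : 0 <= X2 p ^+ 2 by exact: sqr_ge0.
have x3 : 0 <= X3 p ^+ 2 by exact: sqr_ge0.
have small x : inv_norm p ^+ 2 * x ^+ 2 <= 1 -> `|x * inv_norm p ^+ 2| <= 1.
  move=> hx; rewrite -(@ler_pXn2r _ 2)// ?nnegrE// real_normK ?num_real// expr1n exprMn.
  have -> : (inv_norm p ^+ 2) ^+ 2 = inv_norm p ^+ 2 * inv_norm p ^+ 2 by rewrite -expr2.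
  rewrite mulrA; apply: mulr_ile1 => //; [by rewrite mulr_ge0 ?sqr_ge0|by rewrite mulrC].
have y1 : `|X1 p * inv_norm p ^+ 2| <= 1.
  by apply: small; rewrite -E ler_wpM2l// -addrA lerDl addr_ge0.
have y2 : `|X2 p * inv_norm p ^+ 2| <= 1.
  by apply: small; rewrite -E ler_wpM2l// addrAC lerDr addr_ge0.
have y3 : `|X3 p * inv_norm p ^+ 2| <= 1.
  by apply: small; rewrite -E ler_wpM2l// lerDr addr_ge0.
have y30 : 0 <= X3 p * inv_norm p ^+ 2 by rewrite mulr_ge0// /X3 le_max ler01.
move: y1 y2 y3 y30; rewrite /inversion; move: (inv_norm p ^+ 2) (X1 p) (X2 p) (X3 p) => s a b c.
rewrite !ler_norml => /andP[a1 a2] /andP[b1 b2] /andP[c1 c2] c0.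
by move: k; apply: ord3P; rewrite !mxE /= ?ler_norml -?mulrA; apply/andP; split; lra.
Qed.

(** Here 450 is [2 * 15^2], with [15 = 1 + 2 + 4 * 3] from the three terms of the derivative. *)
Let kelvin1_pure (M q s x gg p pk : R) : 0 <= M -> s ^+ 2 = q^-1 -> `|s| <= 1 -> `|x * s| <= 1 ->
  `|p| <= M -> `|pk| <= M -> `|s * gg| <= 3 * M ->
  (Num.sqrt 2 * (- x * s ^+ 3 * p + 2 * s ^+ 3 * pk - 4 * x * s ^+ 5 * gg)) ^+ 2 <= 450 * M ^+ 2 / q ^+ 2.
Proof.
move=> M0 s2 s1 x1 p1 pk1 g1.
have -> : - x * s ^+ 3 * p + 2 * s ^+ 3 * pk - 4 * x * s ^+ 5 * gg =
  s ^+ 2 * (- (x * s * p) + 2 * (s * pk) - 4 * (x * s * s * (s * gg))) by ring.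
set c := (_ - _ in X in s ^+ 2 * X).
have -> : (Num.sqrt 2 * (s ^+ 2 * c)) ^+ 2 = 2 * c ^+ 2 / q ^+ 2.
  by rewrite s2 !exprMn sqr_sqrtr// exprVn mulrCA mulrC mulrA.
apply: ler_wpM2r; first by rewrite invr_ge0 sqr_ge0.
have mul1 (a b N : R) : `|a| <= 1 -> `|b| <= N -> `|a * b| <= N.
  by move=> a1 bN; rewrite normrM -[N]mul1r ler_pM.
have cM : `|c| <= 15 * M.
  have h1 : `|x * s * p| <= M by exact: mul1.
  have h2 : `|s * pk| <= M by exact: mul1.
  have h3 : `|x * s * s * (s * gg)| <= 3 * M by apply: (mul1) => //; exact: mul1.
  move: h1 h2 h3; rewrite /c; move: (x * s * p) (s * pk) (x * s * s * (s * gg)) => u v w.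
  rewrite !ler_norml => /andP[u1 u2] /andP[v1 v2] /andP[w1 w2]; apply/andP; split; lra.
have : c ^+ 2 <= (15 * M) ^+ 2 by rewrite -real_normK ?num_real// ler_pXn2r// nnegrE mulr_ge0.
rewrite exprMn; move: (c ^+ 2) (M ^+ 2) => u v h0; lra.
Qed.

Let three_pure (M s a b c u v w : R) : `|a * s| <= 1 -> `|b * s| <= 1 -> `|c * s| <= 1 ->
  `|u| <= M -> `|v| <= M -> `|w| <= M -> `|s * (a * u + b * v + c * w)| <= 3 * M.
Proof.
move=> a1 b1 c1 u1 v1 w1.
have mul1 (x y : R) : `|x| <= 1 -> `|y| <= M -> `|x * y| <= M.
  by move=> x1 yM; rewrite normrM -[M]mul1r ler_pM.
have -> : s * (a * u + b * v + c * w) = a * s * u + b * s * v + c * s * w by ring.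
have := mul1 _ _ a1 u1; have := mul1 _ _ b1 v1; have := mul1 _ _ c1 w1.
move: (a * s * u) (b * s * v) (c * s * w) => x y z.
rewrite !ler_norml => /andP[h1 h2] /andP[h3 h4] /andP[h5 h6]; apply/andP; split; lra.
Qed.

Let kelvin_bounds : exists C, [/\ forall p, kelvin p ^+ 2 <= C / rho3 p,
  forall p, kelvin1 X1 0 p ^+ 2 <= C / rho3 p ^+ 2, forall p, kelvin1 X2 1 p ^+ 2 <= C / rho3 p ^+ 2 &
  forall p, kelvin1 X3 2 p ^+ 2 <= C / rho3 p ^+ 2].
Proof.
have [N0 B] := bounded_box (C1_continuous C1f).
have [Na B0] := bounded_box (C1f.2 0); have [Nb B1] := bounded_box (C1f.2 1).
have [Nc B2] := bounded_box (C1f.2 2).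
pose M := Num.max (Num.max N0 Na) (Num.max Nb Nc).
have bM p : `|phi p| <= M by apply: (le_trans (B p)); rewrite !le_max lexx.
have b0 p : `|phik 0 p| <= M by apply: (le_trans (B0 p)); rewrite !le_max lexx orbT.
have b1 p : `|phik 1 p| <= M by apply: (le_trans (B1 p)); rewrite !le_max lexx !orbT.
have b2 p : `|phik 2 p| <= M by apply: (le_trans (B2 p)); rewrite !le_max lexx !orbT.
have M0 : 0 <= M by apply: le_trans (normr_ge0 _) (bM (0, 0, 0)).
have s1 p : `|inv_norm p| <= 1.
  rewrite -(@ler_pXn2r _ 2)// ?nnegrE// real_normK ?num_real// expr1n inv_norm_sqr.
  by rewrite invf_le1 ?rho3_gt0 ?rho3_ge1.
have Xs (x : R) p : x ^+ 2 <= rho3 p -> `|x * inv_norm p| <= 1.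
  move=> xq; rewrite -(@ler_pXn2r _ 2)// ?nnegrE// real_normK ?num_real// expr1n exprMn.
  by rewrite inv_norm_sqr ler_pdivrMr ?rho3_gt0// mul1r.
have x1 p : `|X1 p * inv_norm p| <= 1 by apply: Xs; rewrite /rho3 -addrA lerDl addr_ge0 ?sqr_ge0.
have x2 p : `|X2 p * inv_norm p| <= 1 by apply: Xs; rewrite /rho3 addrAC lerDr addr_ge0 ?sqr_ge0.
have x3 p : `|X3 p * inv_norm p| <= 1 by apply: Xs; rewrite /rho3 lerDr addr_ge0 ?sqr_ge0.
have gb p : `|inv_norm p * g p| <= 3 * M.
  exact: (three_pure (x1 p) (x2 p) (x3 p) (b0 p) (b1 p) (b2 p)).
have K X k : (forall p, `|X p * inv_norm p| <= 1) -> (forall p, `|phik k p| <= M) ->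
    forall p, kelvin1 X k p ^+ 2 <= 450 * M ^+ 2 / rho3 p ^+ 2.
  by move=> hX hk p; exact: (kelvin1_pure M0 (inv_norm_sqr p)).
exists (450 * M ^+ 2); split; [|exact: K|exact: K|exact: K].
move=> p; rewrite /kelvin !exprMn sqr_sqrtr// inv_norm_sqr mulrCA mulrC.
apply: ler_wpM2r; first by rewrite invr_ge0 ltW// rho3_gt0.
have : phi p ^+ 2 <= M ^+ 2 by rewrite -real_normK ?num_real// ler_pXn2r// nnegrE.
by have := sqr_ge0 M; move: (phi p ^+ 2) (M ^+ 2) => u v; lra.
Qed.

Let max11 : Num.max 1 1 = 1 :> R. Proof. by rewrite maxxx. Qed.

Let inversion_bottom (p : R * R) : inversion (p, 1) = stereo p.
Proof.
case: p => x y; rewrite /inversion /stereo /stereo3 /X1 /X2 /X3 /= max11 inv_norm_sqr rho3_bottom mulr1.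
by congr (pt (_, _, _)); rewrite mulrBl divff ?rho2_neq0.
Qed.

Let cfe : continuous (fun x => f x * (1 / 2 * f x + euler f x)).
Proof.
have cf := C1_continuous C1f.
have ce : continuous (euler f).
  have x0 := @continuous_coord R 0; have x1 := @continuous_coord R 1.
  have x2 := @continuous_coord R 2; have [_ cp] := C1f.
  exact: (continuous_add (continuous_add (continuous_mul x0 (cp 0)) (continuous_mul x1 (cp 1)))
    (continuous_mul x2 (cp 2))).
by cts.
Qed.

(** The normal derivative of the Kelvin transform becomes the conformally covariant boundary
    operator [f / 2 + d_r f] of the ball, where 1/2 is [(n - 2) / 2] for [n = 3]. *)
Let kelvin_flux_cvg :
  - itg2 (- r) r (- r) r (fun p => kelvin (p, 1) * kelvin1 X3 2 (p, 1)) @[r --> +oo] -->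
    sint (fun x => f x * (1 / 2 * f x + euler f x)).
Proof.
have := cvg_stereographic_rV cfe.
have <- // : (fun r : R => - itg2 (- r) r (- r) r (fun p => kelvin (p, 1) * kelvin1 X3 2 (p, 1))) =
  (fun r => itg2 (- r) r (- r) r (fun p => 4 * (f (pt (stereo3 p)) *
    (1 / 2 * f (pt (stereo3 p)) + euler f (pt (stereo3 p)))) / rho2 p ^+ 2)).
apply/funext => r; rewrite -mulN1r.
have ck : continuous (fun p : R * R => kelvin (p, 1) * kelvin1 X3 2 (p, 1)).
  by have h1 := ckelvin; have h2 := @ckelvin1 X3 2 cX3; cts.
rewrite -(itg2Z _ _ _ _ _ ck); apply: eq_itg2 => x y _ _; rewrite -/(stereo (x, y)).
rewrite /kelvin /kelvin1 /g /radial /phi /phik inversion_bottom /X1 /X2 /X3 /= max11.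
rewrite /euler /dotp {1}/stereo ptK /stereo3 /=.
have := inv_norm_sqr (x, y, 1); rewrite rho3_bottom; have := @rho2_neq0 R (x, y).
move: (inv_norm _) (rho2 _) (f _) (partial 0 f _) (partial 1 f _) (partial 2 f _) => s q p a b c q0 s2.
have -> : -1 * (Num.sqrt 2 * (s * p) * (Num.sqrt 2 * (- 1 * s ^+ 3 * p + 2 * s ^+ 3 * c -
    4 * 1 * s ^+ 5 * (x * a + y * b + 1 * c)))) =
  - (Num.sqrt 2 ^+ 2 * (s ^+ 2) ^+ 2 * p * (- p + 2 * c - 4 * s ^+ 2 * (x * a + y * b + c))) by ring.
by rewrite s2 sqr_sqrtr//; field.
Qed.

(** The flux is a limit of energies. This sign complements [trace_sphere], where only the square of
    the flux appears. *)
Theorem trace_flux_ge0 : 0 <= sint (fun x => f x * (1 / 2 * f x + euler f x)).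
Proof.
have [C [BF B1 B2 B3]] := kelvin_bounds.
have lim : - itg2 (- r) r (- r) r (fun p => kelvin (p, 1) * kelvin1 X3 2 (p, 1)) + 12 * C / r
    @[r --> +oo] --> sint (fun x => f x * (1 / 2 * f x + euler f x)) + 0.
  by apply: cvgD; [exact: kelvin_flux_cvg|exact: cvg_div_pinfty].
rewrite addr0 in lim; apply: (ler_cvg_to (@cvg_cst _ (0 : R) _ _ _) lim).
have pos : forall r : R, 1 < r -> 0 <= - itg2 (- r) r (- r) r (fun p => kelvin (p, 1) * kelvin1 X3 2 (p, 1)) +
    12 * C / r.
  move=> r r1; have := half_box_energy r1 ckelvin (@ckelvin1 X1 0 cX1) (@ckelvin1 X2 1 cX2)
    (@ckelvin1 X3 2 cX3) (@ckelvin2 X1 0 cX1) (@ckelvin2 X2 1 cX2) (@ckelvin2 X3 2 cX3) d1 d2 d3 d11 d22 d33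
    kelvin_harmonic BF B1 B2 B3.
  apply: le_trans; apply: itg3_ge0 => x y z _ _ _.
  by apply: addr_ge0; [apply: addr_ge0|]; exact: sqr_ge0.
exact: (filterS pos (nbhs_pinfty_gt (num_real 1))).
Qed.

(** Equality holds for constants: for [f = 1] both sides are [4 pi]. *)
Theorem trace_sphere :
  sint (fun x => f x ^+ 4) <= sint (fun x => f x * (1 / 2 * f x + euler f x)) ^+ 2 / pi.
Proof.
have [C [BF B1 B2 B3]] := kelvin_bounds.
have cf := C1_continuous C1f.
have cf4 : continuous (fun x => f x ^+ 4) by cts.
have pL : itg2 (- r) r (- r) r (fun p : R * R => rho2 p ^- 2) @[r --> +oo] --> (pi : R).
  have := @cvg_stereographic_quarter R (fun=> 1) (@continuous_cst _ _ 1); rewrite sint_cst.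
  rewrite (_ : 1 / 4 * (1 * (4 * pi)) = pi); last by field.
  have <- // : (fun r : R => itg2 (- r) r (- r) r (fun p : R * R => rho2 p ^- 2)) =
    (fun r => itg2 (- r) r (- r) r (fun p : R * R => 1 / rho2 p ^+ 2)).
  by apply/funext => r; apply: eq_itg2 => x y _ _; rewrite mul1r.
have s4 (p : R * R) : inv_norm (p, 1) ^+ 4 = rho2 p ^- 2.
  by case: p => x y; rewrite -rho3_bottom -exprVn -inv_norm_sqr -exprM.
have AL : itg2 (- r) r (- r) r (fun p => kelvin (p, 1) ^+ 4) @[r --> +oo] --> sint (fun x => f x ^+ 4).
  have := cvg_stereographic_rV cf4.
  have <- // : (fun r : R => itg2 (- r) r (- r) r (fun p => kelvin (p, 1) ^+ 4)) =
    (fun r => itg2 (- r) r (- r) r (fun p => 4 * f (pt (stereo3 p)) ^+ 4 / rho2 p ^+ 2)).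
  apply/funext => r; apply: eq_itg2 => x y _ _.
  rewrite /kelvin /phi inversion_bottom -/(stereo (x, y)) !exprMn s4.
  have -> : Num.sqrt 2 ^+ 4 = 4 :> R by rewrite (exprM _ 2 2) sqr_sqrtr//; ring.
  by rewrite mulrA mulrAC.
have PL := kelvin_flux_cvg.
apply: (@trace_limit R _ _ _ C _ _ _ (fun r => half_box r (fun p => rho3 p ^- 2)) (pi_gt0 R) AL PL pL).
  by move=> r r1; exact: half_box_inv_rho2.
move=> r e r1 e0.
exact: (trace_regularized r1 e0 ckelvin (@ckelvin1 X1 0 cX1) (@ckelvin1 X2 1 cX2) (@ckelvin1 X3 2 cX3)
  (@ckelvin2 X1 0 cX1) (@ckelvin2 X2 1 cX2) (@ckelvin2 X3 2 cX3) d1 d2 d3 d11 d22 d33 kelvin_harmonic BF B1 B2 B3).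
Qed.

End kelvin.

(** * Monogenic polynomials *)

Section homogeneous.
Context {R : realType}.
Local Notation E := 'rV[R]_3.

(** Homogeneous polynomials as functions, generated so that facts about degrees and derivatives go
    by induction; the zero function has every degree. *)
Inductive hpol : nat -> (E -> R) -> Prop :=
| hpol_cst c : hpol 0 (fun=> c)
| hpolX n k f : hpol n f -> hpol n.+1 (fun x => x 0 k * f x)
| hpolD n f g : hpol n f -> hpol n g -> hpol n (fun x => f x + g x).

Lemma hpolZ n f c : hpol n f -> hpol n (fun x => c * f x).
Proof.
elim=> [a|m k g hg ih|m g h hg ihg hh ihh]; first exact: hpol_cst.
- rewrite (_ : (fun x : E => _) = (fun x => x 0 k * (c * g x))); first exact: hpolX.
  by apply/funext => x; rewrite mulrCA.
- rewrite (_ : (fun x => _) = (fun x => c * g x + c * h x)); first exact: hpolD.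
  by apply/funext => x; rewrite mulrDr.
Qed.

Lemma hpol0 n : hpol n (fun=> 0).
Proof.
elim: n => [|n ih]; first exact: hpol_cst.
have := hpolX 0 ih; rewrite (_ : (fun x : E => x 0 0 * 0) = (fun=> 0))//.
by apply/funext => x; rewrite mulr0.
Qed.

Lemma hpolN n f : hpol n f -> hpol n (fun x => - f x).
Proof.
move=> /(hpolZ (-1)); rewrite (_ : (fun x => -1 * f x) = (fun x => - f x))//.
by apply/funext => x; rewrite mulN1r.
Qed.

Lemma hpolB n f g : hpol n f -> hpol n g -> hpol n (fun x => f x - g x).
Proof. by move=> hf hg; apply: hpolD => //; exact: hpolN. Qed.

Lemma hpol_differentiable n f : hpol n f -> forall x, differentiable f x.
Proof.
elim=> [c|m k g hg ih|m g h hg ihg hh ihh] x; first exact: differentiable_cst.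
- by apply: differentiableM => //; exact: differentiable_coord.
- exact: differentiableD.
Qed.

Lemma partial_coordM (j k : 'I_3) (f : E -> R) x : differentiable f x ->
  partial j (fun x => x 0 k * f x) x = (k == j)%:R * f x + x 0 k * partial j f x.
Proof.
move=> df; rewrite partialM//; last exact: differentiable_coord.
by rewrite partial_coord addrC mulrC.
Qed.

Lemma partial_hpol0 n f k : hpol n f -> n = 0%N -> partial k f = (fun=> 0).
Proof.
elim=> [c _|//|m g h hg ihg hh ihh m0]; apply/funext => x; first exact: partial_cst.
have dg := hpol_differentiable hg x; have dh := hpol_differentiable hh x.
by rewrite (partialD _ dg dh) ihg// ihh// addr0.
Qed.

Lemma partial_hpol n f k : hpol n f -> hpol n.-1 (partial k f).
Proof.
elim=> [c|m j g hg ih|m g h hg ihg hh ihh] /=.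
- rewrite (_ : partial k _ = (fun=> 0)); first exact: hpol_cst.
  by apply/funext => x; exact: partial_cst.
- rewrite (_ : partial k _ = (fun x => (j == k)%:R * g x + x 0 j * partial k g x)); last first.
    by apply/funext => x; apply: partial_coordM; exact: (hpol_differentiable hg).
  apply: hpolD; first exact: hpolZ.
  (* For [m = 0] the degrees do not match, since [m.-1.+1] is then 1; but [partial k g] vanishes in
     that case. *)
  case: m hg ih => [|m] hg ih; last exact: hpolX.
  rewrite (_ : (fun x : E => x 0 j * partial k g x) = (fun=> 0)); first exact: hpol_cst.
  by apply/funext => x; rewrite (partial_hpol0 k hg)// mulr0.
- rewrite (_ : partial k _ = (fun x => partial k g x + partial k h x)); first exact: hpolD.
  apply/funext => x.
  by rewrite (partialD _ (hpol_differentiable hg x) (hpol_differentiable hh x)).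
Qed.

Lemma derive_hpol n f v : hpol n f -> hpol n.-1 (fun x => 'D_v f x).
Proof.
move=> hf; have := hpolD (hpolD (hpolZ (v 0 0) (partial_hpol 0 hf)) (hpolZ (v 0 1) (partial_hpol 1 hf)))
  (hpolZ (v 0 2) (partial_hpol 2 hf)).
congr hpol; apply/funext => x; rewrite derive_partial//; exact: (hpol_differentiable hf).
Qed.

Lemma smooth_hpol n f : hpol n f -> smooth f.
Proof.
move=> + m; elim: m n f => [//|m ih] n f hf; split; first exact: (hpol_differentiable hf).
by move=> v; exact: ih (derive_hpol v hf).
Qed.

Lemma C1_hpol n f : hpol n f -> C1 f.
Proof. by move=> /smooth_hpol; exact: smooth_C1. Qed.

Lemma euler_hpol n f x : hpol n f -> euler f x = n%:R * f x.
Proof.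
elim=> [c|m j g hg ih|m g h hg ihg hh ihh].
- by rewrite /euler /dotp !partial_cst !mulr0 !addr0 mul0r.
- have dg := hpol_differentiable hg x.
  rewrite /euler /dotp !(partial_coordM _ _ dg).
  have -> : m.+1%:R * (x 0 j * g x) = x 0 j * g x + x 0 j * (m%:R * g x).
    by rewrite -(addn1 m) natrD; ring.
  rewrite -ih /euler /dotp /coords /=.
  move: (g x) (partial 0 g x) (partial 1 g x) (partial 2 g x) => u a b c.
  by move: j; apply: ord3P => /=; ring.
- have dg := hpol_differentiable hg x; have dh := hpol_differentiable hh x.
  rewrite mulrDr -ihg -ihh /euler /dotp !(partialD _ dg dh).
  move: (partial 0 g x) (partial 1 g x) (partial 2 g x) (partial 0 h x) (partial 1 h x) (partial 2 h x).
  by move: (coords x) => c *; ring.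
Qed.

Lemma partialC_hpol n f j k : hpol n f -> partial j (partial k f) = partial k (partial j f).
Proof.
elim=> [c|m i g hg ih|m g h hg ihg hh ihh]; apply/funext => x.
- have p0 l : partial l (fun _ : E => c) = (fun=> 0) by apply/funext => y; exact: partial_cst.
  by rewrite !p0 !partial_cst.
- have dg := hpol_differentiable hg; have dp l := hpol_differentiable (partial_hpol l hg).
  have eP l : partial l (fun x => x 0 i * g x) = (fun x => (i == l)%:R * g x + x 0 i * partial l g x).
    by apply/funext => y; exact: partial_coordM.
  have eP2 l l' : partial l (fun x => (i == l')%:R * g x + x 0 i * partial l' g x) x =
      (i == l')%:R * partial l g x + ((i == l)%:R * partial l' g x + x 0 i * partial l (partial l' g) x).
    have d1 := differentiableM (@differentiable_cst R E R (i == l')%:R x) (dg x).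
    have d2 := differentiableM (differentiable_coord i x) (dp l' x).
    rewrite (partialD _ d1 d2) (partialM _ _ (dg x)); last exact: differentiable_cst.
    by rewrite partial_cst mulr0 addr0 partial_coordM.
  by rewrite !eP !eP2 ih; ring.
- have eP l : partial l (fun x => g x + h x) = (fun x => partial l g x + partial l h x).
    by apply/funext => y; exact: (partialD _ (hpol_differentiable hg y) (hpol_differentiable hh y)).
  have dg l := hpol_differentiable (partial_hpol l hg) x.
  have dh l := hpol_differentiable (partial_hpol l hh) x.
  by rewrite !eP (partialD _ (dg k) (dh k)) (partialD _ (dg j) (dh j)) ihg ihh.
Qed.

End homogeneous.

(** * Clifford multiplication and the flat Dirac operator on polynomials *)

Section clifford_polynomials.
Context {R : realType}.
Local Notation E := 'rV[R]_3.

Lemma ord4P (P : 'I_4 -> Prop) : P 0 -> P 1 -> P 2 -> P 3 -> forall k, P k.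
Proof.
move=> P0 P1 P2 P3 [[|[|[|[|//]]]] i3].
- by rewrite (_ : Ordinal i3 = 0)//; exact/val_inj.
- by rewrite (_ : Ordinal i3 = 1)//; exact/val_inj.
- by rewrite (_ : Ordinal i3 = 2)//; exact/val_inj.
- by rewrite (_ : Ordinal i3 = 3)//; exact/val_inj.
Qed.

(* A spinor is given by the real and imaginary parts [Re s_0, Im s_0, Re s_1, Im s_1];
   [cliff t] is [sum_k clifford e_k *m t_k]. *)
Definition cliff (t : 'I_3 -> 'I_4 -> R) (j : 'I_4) : R :=
  [:: - t 2 1 + t 1 2 - t 0 3; t 2 0 + t 1 3 + t 0 2; - t 1 0 - t 0 1 + t 2 3; - t 1 1 + t 0 0 - t 2 2]`_j.

Lemma cliff0 t : cliff t 0 = - t 2 1 + t 1 2 - t 0 3. Proof. by []. Qed.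
Lemma cliff1 t : cliff t 1 = t 2 0 + t 1 3 + t 0 2. Proof. by []. Qed.
Lemma cliff2 t : cliff t 2 = - t 1 0 - t 0 1 + t 2 3. Proof. by []. Qed.
Lemma cliff3 t : cliff t 3 = - t 1 1 + t 0 0 - t 2 2. Proof. by []. Qed.
Definition cliffE := (cliff0, cliff1, cliff2, cliff3).

(** Contraction with a symmetric array retains only the squares [e_k e_k = -1]. For second
    derivatives: the flat Dirac operator squares to minus the Laplacian. *)
Lemma cliff_cliff (p : 'I_3 -> 'I_3 -> 'I_4 -> R) j : (forall k m, p k m = p m k) ->
  cliff (fun k => cliff (p k)) j = - (p 0 0 j + p 1 1 j + p 2 2 j).
Proof.
move=> pC; move: j; apply: ord4P; rewrite !cliffE !(pC 1 0) !(pC 2 0) !(pC 2 1); ring.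
Qed.

(** The pointwise form of [D (x F) = - 3 F - 2 E F - x D F], with [E] the Euler operator: the 3
    counts the squares of the [e_k], and the term in [E] comes from moving [e_k] past [x]. *)
Lemma cliff_leibniz (f : 'I_4 -> R) (a : 'I_3 -> R) (p : 'I_3 -> 'I_4 -> R) j :
  cliff (fun k => cliff (fun m i => (m == k)%:R * f i + a m * p k i)) j =
  - 3 * f j - 2 * (a 0 * p 0 j + a 1 * p 1 j + a 2 * p 2 j) - cliff (fun k l => a k * cliff p l) j.
Proof.
have d01 : ((0 : 'I_3) == 1) = false by [].
have d02 : ((0 : 'I_3) == 2) = false by [].
have d10 : ((1 : 'I_3) == 0) = false by [].
have d12 : ((1 : 'I_3) == 2) = false by [].
have d20 : ((2 : 'I_3) == 0) = false by [].
have d21 : ((2 : 'I_3) == 1) = false by [].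
move: j; apply: ord4P; rewrite !cliffE !eqxx d01 d02 d10 d12 d20 d21 /=;
  move: (p 0 0) (p 0 1) (p 0 2) (p 0 3) (p 1 0) (p 1 1) (p 1 2) (p 1 3);
  move: (p 2 0) (p 2 1) (p 2 2) (p 2 3) (a 0) (a 1) (a 2) (f 0) (f 1) (f 2) (f 3);
  move=> p1 p2 p3 p4 a1 a2 a3 f1 f2 f3 f4 q1 q2 q3 q4 q5 q6 q7 q8; ring.
Qed.

(** Clifford multiplication by the position vector; [dirop] is the Dirac operator of flat R^3. *)
Definition mulx (F : 'I_4 -> E -> R) (j : 'I_4) (x : E) : R := cliff (fun k l => x 0 k * F l x) j.
Definition dirop (F : 'I_4 -> E -> R) (j : 'I_4) (x : E) : R := cliff (fun k l => partial k (F l) x) j.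

Definition hspin n (F : 'I_4 -> E -> R) : Prop := forall j, hpol n (F j).

Lemma hpol_cliff n (T : 'I_3 -> 'I_4 -> E -> R) j : (forall k l, hpol n (T k l)) ->
  hpol n (fun x => cliff (fun k l => T k l x) j).
Proof.
move=> h; move: j; apply: ord4P; rewrite /cliff /=.
- by apply: hpolB => //; apply: hpolD => //; exact: hpolN.
- by apply: hpolD => //; exact: hpolD.
- by apply: hpolD => //; apply: hpolB => //; exact: hpolN.
- by apply: hpolB => //; apply: hpolD => //; exact: hpolN.
Qed.

Lemma partial_cliff (T : 'I_3 -> 'I_4 -> E -> R) j k x : (forall m l, differentiable (T m l) x) ->
  partial k (fun x => cliff (fun m l => T m l x) j) x = cliff (fun m l => partial k (T m l) x) j.
Proof.
move=> d.
have pD (f g : E -> R) : differentiable f x -> differentiable g x ->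
  partial k (f + g) x = partial k f x + partial k g x by move=> df dg; exact: partialD.
have pN (f : E -> R) : differentiable f x -> partial k (- f) x = - partial k f x.
  by move=> df; rewrite /partial deriveN//; exact: diff_derivable.
have dD (f g : E -> R) : differentiable f x -> differentiable g x -> differentiable (f + g) x.
  exact: differentiableD.
have dN (f : E -> R) : differentiable f x -> differentiable (- f) x by exact: differentiableN.
move: j; apply: ord4P; rewrite /cliff /=.
- rewrite (_ : (fun x => _) = - T 2 1 + T 1 2 + (- T 0 3))//.
  by rewrite !pD ?pN//; do ?[apply: dD|apply: dN].
- rewrite (_ : (fun x => _) = T 2 0 + T 1 3 + T 0 2)//.
  by rewrite !pD ?pN//; do ?[apply: dD|apply: dN].
- rewrite (_ : (fun x => _) = - T 1 0 + (- T 0 1) + T 2 3)//.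
  by rewrite !pD ?pN//; do ?[apply: dD|apply: dN].
- rewrite (_ : (fun x => _) = - T 1 1 + T 0 0 + (- T 2 2))//.
  by rewrite !pD ?pN//; do ?[apply: dD|apply: dN].
Qed.

Lemma eq_cliff (t u : 'I_3 -> 'I_4 -> R) : (forall k l, t k l = u k l) -> cliff t = cliff u.
Proof. by move=> tu; congr cliff; apply/funext => k; apply/funext. Qed.

Lemma hspin_mulx n F : hspin n F -> hspin n.+1 (mulx F).
Proof. by move=> h j; apply: (hpol_cliff (T := fun k l x => x 0 k * F l x)) => k l; exact: hpolX. Qed.

Lemma hspin_dirop n F : hspin n F -> hspin n.-1 (dirop F).
Proof. by move=> h j; apply: (hpol_cliff (T := fun k l => partial k (F l))) => k l; exact: partial_hpol. Qed.

Lemma hspin_comb n F G (a b : R) : hspin n F -> hspin n G -> hspin n (fun j x => a * F j x + b * G j x).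
Proof. by move=> hF hG j; apply: hpolD; exact: hpolZ. Qed.

Lemma dirop_comb n F G (a b : R) : hspin n F -> hspin n G ->
  dirop (fun j x => a * F j x + b * G j x) = (fun j x => a * dirop F j x + b * dirop G j x).
Proof.
move=> hF hG; apply/funext => j; apply/funext => x.
have eP k l : partial k (fun x => a * F l x + b * G l x) x = a * partial k (F l) x + b * partial k (G l) x.
  have dF := hpol_differentiable (hF l) x; have dG := hpol_differentiable (hG l) x.
  have daF := hpol_differentiable (hpolZ a (hF l)) x; have dbG := hpol_differentiable (hpolZ b (hG l)) x.
  rewrite (partialD _ daF dbG) !partialM//; try exact: differentiable_cst.
  by rewrite !partial_cst !mulr0 !addr0.
rewrite /dirop (eq_cliff eP).
by move: j; apply: ord4P; rewrite !cliffE; ring.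
Qed.

Lemma mulx_comb F G (a b : R) :
  mulx (fun j x => a * F j x + b * G j x) = (fun j x => a * mulx F j x + b * mulx G j x).
Proof.
apply/funext => j; apply/funext => x; rewrite /mulx.
by move: j; apply: ord4P; rewrite !cliffE; ring.
Qed.

Lemma mulxx F j x : mulx (mulx F) j x = - (x 0 0 ^+ 2 + x 0 1 ^+ 2 + x 0 2 ^+ 2) * F j x.
Proof. by rewrite /mulx; move: j; apply: ord4P; rewrite !cliffE; ring. Qed.

Lemma dirop_mulx n F j x : hspin n F ->
  dirop (mulx F) j x = - (3 + 2 * n%:R) * F j x - mulx (dirop F) j x.
Proof.
move=> hF; have dF l := hpol_differentiable (hF l) x.
have P k l : partial k (mulx F l) x =
    cliff (fun m i => (m == k)%:R * F i x + x 0 m * partial k (F i) x) l.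
  rewrite (@partial_cliff (fun m i x => x 0 m * F i x)); last first.
    by move=> m i; exact: (differentiableM (differentiable_coord m x) (dF i)).
  by congr (cliff _ _); apply/funext => m; apply/funext => i; exact: partial_coordM.
rewrite /dirop (eq_cliff P).
have e l := euler_hpol x (hF l).
have -> : - (3 + 2 * n%:R) * F j x = - 3 * F j x - 2 * euler (F j) x by rewrite e; ring.
rewrite /mulx /dirop /euler /dotp /coords /=.
exact: (cliff_leibniz (fun l => F l x) (fun k => x 0 k) (fun k l => partial k (F l) x) j).
Qed.

Lemma dirop_dirop n F j x : hspin n F -> dirop (dirop F) j x =
  - (partial 0 (partial 0 (F j)) x + partial 1 (partial 1 (F j)) x + partial 2 (partial 2 (F j)) x).
Proof.
move=> hF; have dF k l := hpol_differentiable (partial_hpol k (hF l)) x.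
have P k l : partial k (dirop F l) x = cliff (fun m i => partial k (partial m (F i)) x) l.
  exact: (@partial_cliff (fun m i => partial m (F i))).
rewrite /dirop (eq_cliff P).
apply: (@cliff_cliff (fun k m i => partial k (partial m (F i)) x)) => k m.
by apply/funext => i; rewrite (partialC_hpol _ _ (hF i)).
Qed.

End clifford_polynomials.

(** * Fischer decomposition *)

Section fischer_decomposition.
Context {R : realType}.
Local Notation E := 'rV[R]_3.
Local Notation sfun := ('I_4 -> E -> R).

Definition szero : sfun := fun _ _ => 0.
Definition scomb (a : R) (F : sfun) (b : R) (G : sfun) : sfun := fun j x => a * F j x + b * G j x.

(** The monogenic spinors of degree [n]; by [dirop_dirop] their components are harmonic. *)
Definition mono n (A : sfun) : Prop := hspin n A /\ dirop A = szero.

Lemma sfunP (F G : sfun) : (forall j x, F j x = G j x) -> F = G.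
Proof. by move=> FG; apply/funext => j; apply/funext => x. Qed.

Lemma hspin_zero n : hspin n szero.
Proof. by move=> j; exact: hpol0. Qed.

Lemma scomb00 (F G : sfun) : scomb 0 F 0 G = szero.
Proof. by apply: sfunP => j x; rewrite /scomb !mul0r addr0. Qed.

Lemma scombr0 a (F : sfun) b : scomb a F b szero = (fun j x => a * F j x).
Proof. by apply: sfunP => j x; rewrite /scomb mulr0 addr0. Qed.

Lemma dirop_zero : dirop szero = szero :> sfun.
Proof.
have h := hspin_zero 0; have := dirop_comb 0 0 h h.
rewrite -[X in dirop X]/(scomb 0 szero 0 szero) scomb00 => ->.
by apply: sfunP => j x; rewrite !mul0r addr0.
Qed.

Lemma mulx_zero : mulx szero = szero :> sfun.
Proof.
have := mulx_comb szero szero 0 0.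
rewrite -[X in mulx X]/(scomb 0 szero 0 szero) scomb00 => ->.
by apply: sfunP => j x; rewrite !mul0r addr0.
Qed.

Lemma mono_zero n : mono n szero.
Proof. by split; [exact: hspin_zero|exact: dirop_zero]. Qed.

Lemma mono_comb n a A b B : mono n A -> mono n B -> mono n (scomb a A b B).
Proof.
move=> [hA dA] [hB dB]; split; first exact: hspin_comb.
rewrite /scomb (dirop_comb a b hA hB) dA dB.
by apply: sfunP => j x; rewrite /szero !mulr0 addr0.
Qed.

Lemma hspin_iter_dirop k n (F : sfun) : hspin n F -> hspin (n - k) (iter k dirop F).
Proof.
move=> hF; elim: k => [|k ih]; first by rewrite subn0.
by rewrite subnS iterS; exact: hspin_dirop.
Qed.

Lemma iter_dirop_comb k n (F G : sfun) a b : hspin n F -> hspin n G ->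
  iter k dirop (scomb a F b G) = scomb a (iter k dirop F) b (iter k dirop G).
Proof.
move=> hF hG; elim: k => [//|k ih]; rewrite !iterS ih.
exact: (dirop_comb a b (hspin_iter_dirop k hF) (hspin_iter_dirop k hG)).
Qed.

Lemma iter_dirop_eq0 n (F : sfun) : hspin n F -> iter n.+1 dirop F = szero.
Proof.
move=> hF; have := hspin_iter_dirop n hF; rewrite subnn => h.
rewrite iterS; apply: sfunP => j x; rewrite /dirop.
rewrite (eq_cliff (u := fun _ _ => 0)); last by move=> k l; rewrite (partial_hpol0 k (h l)).
by move: j; apply: ord4P; rewrite !cliffE; rewrite ?oppr0 ?addr0 ?subr0.
Qed.

Lemma hspin_iter_mulx k n (F : sfun) : hspin n F -> hspin (n + k) (iter k mulx F).
Proof.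
move=> hF; elim: k => [|k ih]; first by rewrite addn0.
by rewrite addnS iterS; exact: hspin_mulx.
Qed.

(** The constants in [D x^k M = - coef m k x^(k-1) M] for [M] monogenic of degree [m]; the parity of
    [k] matters because even powers of [x] are scalars, up to sign powers of [|x|^2]. They are
    nonzero for [k > 0]. *)
Let coef (m k : nat) : nat := if odd k then (2 * m + k + 2)%N else k.

Lemma dirop_iter_mulx m (M : sfun) k : mono m M ->
  dirop (iter k.+1 mulx M) = (fun j x => - (coef m k.+1)%:R * iter k mulx M j x).
Proof.
move=> [hM dM]; elim: k => [|k ih]; apply: sfunP => j x.
  rewrite [iter 1 _ _]/= (dirop_mulx _ _ hM) dM mulx_zero /szero subr0 /coef /=.
  have -> : (2 * m + 1 + 2)%N%:R = 3 + 2 * m%:R :> R by ring.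
  by [].
rewrite iterS (dirop_mulx _ _ (hspin_iter_mulx k.+1 hM)) ih.
have -> : mulx (fun j x => - (coef m k.+1)%:R * iter k mulx M j x) =
    (fun j x => - (coef m k.+1)%:R * mulx (iter k mulx M) j x).
  have := mulx_comb (iter k mulx M) szero (- (coef m k.+1)%:R) 0.
  rewrite -[X in mulx X]/(scomb _ _ _ _) scombr0 => ->.
  by apply: sfunP => i y; rewrite mul0r addr0.
have cE : (coef m k.+2 + coef m k.+1 = 3 + 2 * (m + k.+1))%N.
  by rewrite /coef /=; case: (odd k) => /=; lia.
have -> : 3 + 2 * (m + k.+1)%:R = (coef m k.+2)%:R + (coef m k.+1)%:R :> R.
  by rewrite -natrD cE; ring.
by rewrite -!iterS; ring.
Qed.

(** The constants being nonzero, [D^k] undoes multiplication by [x^k] up to a factor; this is what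
    allows a leading term to be subtracted in [fischer_hspin]. *)
Lemma iter_dirop_mulx m (M : sfun) k : mono m M -> exists2 c : R, c != 0 &
  iter k dirop (iter k mulx M) = (fun j x => c * M j x).
Proof.
move=> mM; have [hM _] := mM; elim: k => [|k [c c0 ih]].
  by exists 1; [exact: oner_neq0|apply: sfunP => j x; rewrite mul1r].
exists (- (coef m k.+1)%:R * c).
  rewrite mulf_neq0// oppr_eq0 pnatr_eq0 /coef /=; case: ifP => _; lia.
rewrite iterSr (dirop_iter_mulx _ mM) -[X in iter k dirop X](scombr0 _ (iter k mulx M) 0).
rewrite (iter_dirop_comb k _ _ (hspin_iter_mulx k hM) (hspin_zero _)) ih.
have z : iter k dirop szero = szero by elim: (k) => [//|i ihi]; rewrite iterS ihi dirop_zero.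
by rewrite z scombr0; apply: sfunP => j x; rewrite mulrA.
Qed.

(* The Fischer decomposition into monogenic spinors, restricted to the sphere. *)
Definition decomposed (N : nat) (A B : nat -> sfun) (F : sfun) : Prop :=
  [/\ forall i, mono i (A i), forall i, mono i (B i) &
      forall x, sphere x -> forall j, F j x = \sum_(i < N) (A i j x + mulx (B i) j x)].

Definition fischer (F : sfun) : Prop := exists N A B, decomposed N A B F.

(** The families of a decomposition are monogenic at every index but summed only below [N]; two
    decompositions are added after the terms beyond have been set to 0. *)
Let pad (N : nat) (A : nat -> sfun) (i : nat) : sfun := if (i < N)%N then A i else szero.

Let sum_pad N M A B j x : (N <= M)%N -> \sum_(i < M) (pad N A i j x + mulx (pad N B i) j x) =
  \sum_(i < N) (A i j x + mulx (B i) j x).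
Proof.
move=> NM; rewrite (big_ord_widen _ (fun i => A i j x + mulx (B i) j x) NM) [RHS]big_mkcond.
apply: eq_bigr => i _; rewrite /pad; case: ifP => // _.
by rewrite mulx_zero /szero addr0.
Qed.

Lemma fischer_comb a F b G : fischer F -> fischer G -> fischer (scomb a F b G).
Proof.
move=> [N [A [B [mA mB FE]]]] [M [C [D [mC mD GE]]]].
exists (N + M)%N, (fun i => scomb a (pad N A i) b (pad M C i)), (fun i => scomb a (pad N B i) b (pad M D i)).
have mp L H i : (forall i, mono i (H i)) -> mono i (pad L H i).
  by move=> mH; rewrite /pad; case: ifP => _ //; exact: mono_zero.
split=> [i|i|x Sx j]; [by apply: mono_comb; exact: mp|by apply: mono_comb; exact: mp|].
rewrite /scomb FE// GE// -(sum_pad A B j x (leq_addr M N)) -(sum_pad C D j x (leq_addl N M)).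
rewrite !mulr_sumr -big_split; apply: eq_bigr => i _ /=; rewrite mulx_comb; ring.
Qed.

Lemma fischer_eq F G : (forall x, sphere x -> forall j, F j x = G j x) -> fischer F -> fischer G.
Proof.
move=> FG [N [A [B [mA mB FE]]]]; exists N, A, B; split=> // x Sx j; rewrite -FG// FE//.
Qed.

Lemma fischer_zero : fischer szero.
Proof.
exists 0%N, (fun=> szero), (fun=> szero); split=> [i|i|x _ j]; try exact: mono_zero.
by rewrite big_ord0.
Qed.

Lemma fischer_mono m (M : sfun) : mono m M -> fischer M /\ fischer (mulx M).
Proof.
move=> mM; pose A i := if i == m then M else szero.
have mA i : mono i (A i) by rewrite /A; case: eqVneq => [->//|_]; exact: mono_zero.
have sumA (f : sfun -> R) : f szero = 0 -> \sum_(i < m.+1) f (A i) = f M.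
  move=> f0; rewrite (bigD1 ord_max)//= big1 ?addr0; first by rewrite /A eqxx.
  by move=> i; rewrite -(inj_eq val_inj) /= => im; rewrite /A (negbTE im).
split.
- exists m.+1, A, (fun=> szero); split=> // [i|x _ j]; first exact: mono_zero.
  under eq_bigr do rewrite mulx_zero /szero addr0.
  by rewrite (sumA (fun F => F j x)).
- exists m.+1, (fun=> szero), A; split=> // [i|x _ j]; first exact: mono_zero.
  under eq_bigr do rewrite /szero add0r.
  by rewrite (sumA (fun F => mulx F j x))// mulx_zero.
Qed.

Lemma fischer_iter_mulx m (M : sfun) k : mono m M -> fischer (iter k mulx M).
Proof.
move=> mM; have [g0 g1] := fischer_mono mM.
suff : fischer (iter k mulx M) /\ fischer (iter k.+1 mulx M) by case.
elim: k => [//|k [ih1 ih2]]; split=> //.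
apply: fischer_eq (fischer_comb (-1) 0 ih1 fischer_zero) => x /sphere_coords Sx j.
by rewrite /scomb /szero mulr0 addr0 !iterS mulxx Sx.
Qed.

(** Induction on the number of applications of [D] that kill [F]. If [D^(k+1) F = 0], then
    [M = D^k F] is monogenic, and subtracting a multiple of [x^k M] leaves a spinor killed by [D^k].
    On the sphere [x^2 = -1], so [x^k M] is [M] or [x M] up to sign. *)
Lemma fischer_hspin n (F : sfun) : hspin n F -> fischer F.
Proof.
suff H k : (k <= n.+1)%N -> forall F, hspin n F -> iter k dirop F = szero -> fischer F.
  by move=> hF; exact: (H n.+1 (leqnn _) F hF (iter_dirop_eq0 hF)).
elim: k => [_|k ih kn] {}F hF dF; first by have := fischer_zero; rewrite -dF.
pose M := iter k dirop F.
have mM : mono (n - k) M by split; [exact: hspin_iter_dirop|rewrite -dF iterS].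
have [hM _] := mM; have [c c0 cE] := iter_dirop_mulx k mM.
have hX : hspin n (iter k mulx M).
  by have := hspin_iter_mulx k hM; rewrite subnK// -ltnS.
pose G := scomb 1 F (- c^-1) (iter k mulx M).
have gG : fischer G.
  apply: ih; [exact: ltnW|exact: hspin_comb|].
  rewrite /G (iter_dirop_comb k _ _ hF hX) cE -/M; apply: sfunP => j x.
  by rewrite /scomb /szero mulrA mulNr mulVf// mulN1r mul1r subrr.
apply: fischer_eq (fischer_comb 1 c^-1 gG (fischer_iter_mulx k mM)) => x _ j.
by rewrite /G /scomb; ring.
Qed.

Inductive pol : (E -> R) -> Prop :=
| pol_hpol n f : hpol n f -> pol f
| polD f g : pol f -> pol g -> pol (fun x => f x + g x).

Lemma hpolM n (f : E -> R) m (g : E -> R) : hpol n f -> hpol m g -> hpol (n + m) (fun x => f x * g x).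
Proof.
move=> + hg; elim=> [c|i k h hh ih|i h1 h2 hh1 ih1 hh2 ih2]; first exact: hpolZ.
- rewrite (_ : (fun x : E => _) = (fun x => x 0 k * (h x * g x))); first exact: hpolX.
  by apply/funext => x; rewrite mulrA.
- rewrite (_ : (fun x : E => _) = (fun x => h1 x * g x + h2 x * g x)); first exact: hpolD.
  by apply/funext => x; rewrite mulrDl.
Qed.

Lemma polM f g : pol f -> pol g -> pol (fun x => f x * g x).
Proof.
elim=> [n {}f hf|f1 f2 p1 ih1 p2 ih2] pg; last first.
  rewrite (_ : (fun x : E => _) = (fun x => f1 x * g x + f2 x * g x)).
    by apply: polD; [exact: ih1|exact: ih2].
  by apply/funext => x; rewrite mulrDl.
elim: pg => [m {}g hg|g1 g2 q1 ih1 q2 ih2]; first exact: pol_hpol (hpolM hf hg).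
rewrite (_ : (fun x : E => _) = (fun x => f x * g1 x + f x * g2 x)); first exact: polD.
by apply/funext => x; rewrite mulrDr.
Qed.

Lemma pol_cst c : pol (fun=> c). Proof. exact: pol_hpol (hpol_cst c). Qed.

Lemma pol_coord k : pol (fun x : E => x 0 k).
Proof.
have := pol_hpol (hpolX k (hpol_cst 1)); congr pol.
by apply/funext => x; rewrite mulr1.
Qed.

Lemma continuous_pol f : pol f -> continuous f.
Proof.
elim=> [n g hg|g h _ cg _ ch]; first exact: C1_continuous (C1_hpol hg).
exact: continuous_add.
Qed.

Lemma fischer_pol (G : sfun) : (forall j, pol (G j)) -> fischer G.
Proof.
move=> pG; pose slot (f : E -> R) (j i : 'I_4) (x : E) := (i == j)%:R * f x : R.
have gs f j : pol f -> fischer (slot f j).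
  elim=> [n g hg|g h _ ihg _ ihh].
    by apply: (@fischer_hspin n) => i; exact: hpolZ.
  by apply: fischer_eq (fischer_comb 1 1 ihg ihh) => x _ i; rewrite /scomb /slot; ring.
have g01 := fischer_comb 1 1 (gs _ 0 (pG 0)) (gs _ 1 (pG 1)).
have g23 := fischer_comb 1 1 (gs _ 2 (pG 2)) (gs _ 3 (pG 3)).
apply: fischer_eq (fischer_comb 1 1 g01 g23) => x _ i; rewrite /scomb /slot.
by move: i; apply: ord4P => /=; ring.
Qed.

End fischer_decomposition.

(** * The Dirac operator *)

Section spinor_components.
Context {R : realType}.
Local Notation E := 'rV[R]_3.
Local Notation spinor := 'cV[R[i]]_2.
Local Notation Re := complex.Re.
Local Notation Im := complex.Im.
Local Notation sfun := ('I_4 -> E -> R).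

Definition cmp (s : spinor) (j : 'I_4) : R := [:: Re (s 0 0); Im (s 0 0); Re (s 1 0); Im (s 1 0)]`_j.
Definition cmps (Psi : E -> spinor) : sfun := fun j x => cmp (Psi x) j.
Definition mks (F : sfun) (x : E) : spinor :=
  \col_k (if k == 0 then (F 0 x +i* F 1 x)%C else (F 2 x +i* F 3 x)%C).

Lemma cmp0 s : cmp s 0 = Re (s 0 0). Proof. by []. Qed.
Lemma cmp1 s : cmp s 1 = Im (s 0 0). Proof. by []. Qed.
Lemma cmp2 s : cmp s 2 = Re (s 1 0). Proof. by []. Qed.
Lemma cmp3 s : cmp s 3 = Im (s 1 0). Proof. by []. Qed.
Definition cmpE := (cmp0, cmp1, cmp2, cmp3).

Lemma ord2P (P : 'I_2 -> Prop) : P 0 -> P 1 -> forall k, P k.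
Proof.
move=> P0 P1 [[|[|//]] i2].
- by rewrite (_ : Ordinal i2 = 0)//; exact/val_inj.
- by rewrite (_ : Ordinal i2 = 1)//; exact/val_inj.
Qed.

Lemma sum2E (V : nmodType) (F : 'I_2 -> V) : \sum_k F k = F 0 + F 1.
Proof. by rewrite !big_ord_recl big_ord0 addr0; congr (_ + F _); exact/val_inj. Qed.

Lemma sum4E (V : nmodType) (F : 'I_4 -> V) : \sum_k F k = F 0 + F 1 + F 2 + F 3.
Proof.
rewrite !big_ord_recl big_ord0 addr0 !addrA.
by congr (F _ + F _ + F _ + F _); exact/val_inj.
Qed.

Lemma cmp_inj s t : (forall j, cmp s j = cmp t j) -> s = t.
Proof.
move=> st; apply/matrixP => k l; rewrite (ord1 l) {l}; apply/eqP; rewrite eq_complex.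
have := (st 0, st 1, (st 2, st 3)); rewrite !cmpE => -[[e0 e1] [e2 e3]].
by move: k; apply: ord2P; rewrite ?e0 ?e1 ?e2 ?e3 !eqxx.
Qed.

Lemma cmp_mks F x j : cmp (mks F x) j = F j x.
Proof. by move: j; apply: ord4P; rewrite cmpE mxE. Qed.

Lemma cmps_mks F : cmps (mks F) = F.
Proof. by apply: sfunP => j x; exact: cmp_mks. Qed.

Lemma cmpD s t j : cmp (s + t) j = cmp s j + cmp t j.
Proof.
by move: j; apply: ord4P; rewrite !cmpE mxE; case: (s _ _) => a b; case: (t _ _).
Qed.

Lemma cmpN s j : cmp (- s) j = - cmp s j.
Proof. by move: j; apply: ord4P; rewrite !cmpE mxE; case: (s _ _). Qed.

Lemma cmpB s t j : cmp (s - t) j = cmp s j - cmp t j.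
Proof. by rewrite cmpD cmpN. Qed.

Lemma cmpZ (c : R) s j : cmp (c%:C%C *: s) j = c * cmp s j.
Proof.
by move: j; apply: ord4P; rewrite !cmpE mxE; case: (s _ _) => a b /=; ring.
Qed.

Lemma cmp_zero j : cmp 0 j = 0.
Proof. by move: j; apply: ord4P; rewrite !cmpE mxE. Qed.

Lemma normsq_cmp s : normsq s = \sum_j cmp s j ^+ 2.
Proof. by rewrite /normsq sum2E sum4E !cmpE addrA. Qed.

Lemma Re_hdot s t : Re (hdot s t) = \sum_j cmp s j * cmp t j.
Proof.
rewrite /hdot sum2E sum4E !cmpE; case: (s 0 0) => a b; case: (t 0 0) => c d.
by case: (s 1 0) => a' b'; case: (t 1 0) => c' d' /=; ring.
Qed.

Lemma cliffordE (X : E) (a b : 'I_2) : clifford X a b =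
  if a == 0 then if b == 0 then (0 +i* X 0 2)%C else (X 0 1 +i* X 0 0)%C
  else if b == 0 then (- X 0 1 +i* X 0 0)%C else (0 +i* - X 0 2)%C.
Proof.
rewrite /clifford sum3E !mxE /pauli/=; move: a b; apply: ord2P; apply: ord2P;
  by apply/eqP; rewrite eq_complex/=; apply/andP; split; apply/eqP; rewrite /=; ring.
Qed.

Lemma cmp_clifford (X : E) s j : cmp (clifford X *m s) j = cliff (fun k l => X 0 k * cmp s l) j.
Proof.
have mE k : (clifford X *m s) k 0 = clifford X k 0 * s 0 0 + clifford X k 1 * s 1 0.
  by rewrite mxE sum2E.
move: j; apply: ord4P; rewrite cliffE !cmpE mE !cliffordE /=; case: (s 0 0) => a b;
  case: (s 1 0) => c d /=; ring.
Qed.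

Lemma cmp_Dspinor (X : E) Psi x j : cmp (Dspinor X Psi x) j = 'D_X (cmps Psi j) x.
Proof. by move: j; apply: ord4P; rewrite cmpE mxE. Qed.

Lemma smooth_spinor_cmps Psi : smooth_spinor Psi <-> forall j, smooth (cmps Psi j).
Proof.
split=> [sP|sP k]; first by apply: ord4P; [have [] := sP 0|have [] := sP 0|have [] := sP 1|have [] := sP 1].
by move: k; apply: ord2P; [have := (sP 0, sP 1) => -[]|have := (sP 2, sP 3) => -[]].
Qed.

End spinor_components.

(** * The Dirac operator of the sphere in ambient coordinates *)

Section dirac_components.
Context {R : realType}.
Local Notation E := 'rV[R]_3.
Local Notation spinor := 'cV[R[i]]_2.
Local Notation sfun := ('I_4 -> E -> R).

Lemma cliff_comb (t u : 'I_3 -> 'I_4 -> R) (a b : R) j :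
  cliff (fun k l => a * t k l + b * u k l) j = a * cliff t j + b * cliff u j.
Proof.
have h (p q r p' q' r' : R) :
  [/\ - (a * p + b * p') + (a * q + b * q') - (a * r + b * r') = a * (- p + q - r) + b * (- p' + q' - r'),
   (a * p + b * p') + (a * q + b * q') + (a * r + b * r') = a * (p + q + r) + b * (p' + q' + r'),
   - (a * p + b * p') - (a * q + b * q') + (a * r + b * r') = a * (- p - q + r) + b * (- p' - q' + r') &
   - (a * p + b * p') + (a * q + b * q') - (a * r + b * r') = a * (- p + q - r) + b * (- p' + q' - r')].
  by split; ring.
move: j; apply: ord4P; rewrite !cliffE.
- by case: (h (t 2 1) (t 1 2) (t 0 3) (u 2 1) (u 1 2) (u 0 3)).
- by case: (h (t 2 0) (t 1 3) (t 0 2) (u 2 0) (u 1 3) (u 0 2)).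
- by case: (h (t 1 0) (t 0 1) (t 2 3) (u 1 0) (u 0 1) (u 2 3)).
- by case: (h (t 1 1) (t 0 0) (t 2 2) (u 1 1) (u 0 0) (u 2 2)).
Qed.

Lemma frame_sgrad (x e1 e2 : E) (p : 'I_3 -> R) k :
  (forall k m, e1 0 k * e1 0 m + e2 0 k * e2 0 m = (k == m)%:R - x 0 k * x 0 m) ->
  p k - x 0 k * (x 0 0 * p 0 + x 0 1 * p 1 + x 0 2 * p 2) =
  e1 0 k * (e1 0 0 * p 0 + e1 0 1 * p 1 + e1 0 2 * p 2) + e2 0 k * (e2 0 0 * p 0 + e2 0 1 * p 1 + e2 0 2 * p 2).
Proof.
move=> comp; transitivity ((e1 0 k * e1 0 0 + e2 0 k * e2 0 0) * p 0 +
  (e1 0 k * e1 0 1 + e2 0 k * e2 0 1) * p 1 + (e1 0 k * e1 0 2 + e2 0 k * e2 0 2) * p 2); last by ring.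
rewrite !comp; move: (x 0 0) (x 0 1) (x 0 2) (x 0 k) => a b c d.
have -> : p k = (k == 0)%:R * p 0 + (k == 1)%:R * p 1 + (k == 2)%:R * p 2.
  by move: k {comp}; apply: ord3P => /=; ring.
by ring.
Qed.

(** The matrix with rows [x], [e1], [e2] is orthogonal, so its columns are orthonormal as well. *)
Lemma frame_completeness (x e1 e2 : E) : sphere x -> tangent_frame x e1 e2 ->
  forall k m, e1 0 k * e1 0 m + e2 0 k * e2 0 m = (k == m)%:R - x 0 k * x 0 m.
Proof.
rewrite /sphere /tangent_frame /tangent /= => xx [xe1 xe2 e11 e22 e12].
pose M : 'M[R]_3 := \matrix_(a, k) (if a == 0 then x 0 k else if a == 1 then e1 0 k else e2 0 k).
have MM : M *m M^T = 1%:M.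
  apply/matrixP => a b; rewrite !mxE; under eq_bigr do rewrite !mxE.
  have dC (v w : E) : dot v w = dot w v by apply: eq_bigr => k _; rewrite mulrC.
  move: a b; apply: ord3P; apply: ord3P => /=; rewrite ?eqxx.
  - exact: xx. - exact: xe1. - exact: xe2.
  - by rewrite -/(dot e1 x) dC. - exact: e11. - exact: e12.
  - by rewrite -/(dot e2 x) dC. - by rewrite -/(dot e2 e1) dC. - exact: e22.
have /matrixP MM' : M^T *m M = 1%:M by exact: mulmx1C.
move=> k m; have := MM' k m; rewrite !mxE sum3E !mxE /= => <-.
by ring.
Qed.

(** [dirac_smooth] quantifies over frames, so a pointwise equation is extracted from it only once a
    frame exists. Away from the poles it is the frame of longitude and latitude; at the poles, where
    that one degenerates, a coordinate frame. *)
Lemma tangent_frame_exists (x : E) : sphere x -> exists e1 e2, tangent_frame x e1 e2.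
Proof.
move=> /sphere_coords xx.
have [r0|r0] := eqVneq (x 0 0 ^+ 2 + x 0 1 ^+ 2) 0.
  have /eqP x0 : x 0 0 == 0 by rewrite -sqrf_eq0; have := sqr_ge0 (x 0 1); have := sqr_ge0 (x 0 0); lra.
  have /eqP x1 : x 0 1 == 0 by rewrite -sqrf_eq0; have := sqr_ge0 (x 0 1); have := sqr_ge0 (x 0 0); lra.
  exists (pt (1, 0, 0)), (pt (0, 1, 0)); rewrite /tangent_frame /tangent !dotE !mxE /= x0 x1.
  by split; ring.
pose s := Num.sqrt (x 0 0 ^+ 2 + x 0 1 ^+ 2).
have s2 : s ^+ 2 = x 0 0 ^+ 2 + x 0 1 ^+ 2 by rewrite sqr_sqrtr// addr_ge0// sqr_ge0.
have s0 : s != 0 by rewrite -sqrf_eq0 s2.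
have x2 : x 0 2 ^+ 2 = 1 - s ^+ 2 by rewrite s2; lra.
have x1 : x 0 1 ^+ 2 = s ^+ 2 - x 0 0 ^+ 2 by rewrite s2; lra.
exists (pt (- x 0 1 / s, x 0 0 / s, 0)), (pt (- x 0 2 * x 0 0 / s, - x 0 2 * x 0 1 / s, s)).
rewrite /tangent_frame /tangent !dotE !mxE /=.
move: (x 0 0) (x 0 1) (x 0 2) (s) s0 x1 x2 => a b c r rn0 b2 c2.
split.
- by field.
- have -> : a * (- c * a / r) + b * (- c * b / r) + c * r = c * (r ^+ 2 - a ^+ 2 - b ^+ 2) / r by field.
  by rewrite b2 opprB addrA subrK addrN mulr0 mul0r.
- have -> : - b / r * (- b / r) + a / r * (a / r) + 0 * 0 = (a ^+ 2 + b ^+ 2) / r ^+ 2 by field.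
  by rewrite b2 addrC subrK divff// expf_neq0.
- have -> : - c * a / r * (- c * a / r) + - c * b / r * (- c * b / r) + r * r =
    c ^+ 2 * (a ^+ 2 + b ^+ 2) / r ^+ 2 + r ^+ 2 by field.
  by rewrite b2 c2; field.
- by field.
Qed.

Lemma clifford_sqr (e : E) : dot e e = 1 -> clifford e *m clifford e = - 1%:M.
Proof.
move=> ee; have := clifford_relation e e; rewrite ee mulr1 => h.
apply/matrixP => a b; have /matrixP/(_ a b) := h; rewrite !mxE.
move: (\sum_j _) => z; case: z => p q; case: (a == b); rewrite ?mulr1n ?mulr0n => -[h1 h2];
  apply/eqP; rewrite eq_complex /=; apply/andP; split; apply/eqP; lra.
Qed.

(* The Dirac operator of the sphere in the ambient trivialization, in components. *)
Definition sdirac (F : sfun) (j : 'I_4) (x : E) : R :=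
  cliff (fun k l => sgrad k (F l) x) j - mulx F j x.

Let two_halves (a b m : R) : a - 2^-1 * m + (b - 2^-1 * m) = a + b - m.
Proof. by lra. Qed.

(** Since [e e = -1], each of the two frame vectors turns its connection term into [- x / 2];
    together they give the zeroth order term [- x]. *)
Lemma cmp_nabla_frame (Psi : E -> spinor) (x e1 e2 : E) j :
  (forall l, differentiable (cmps Psi l) x) -> sphere x -> tangent_frame x e1 e2 ->
  cmp (clifford e1 *m nabla e1 Psi x + clifford e2 *m nabla e2 Psi x) j = sdirac (cmps Psi) j x.
Proof.
move=> dP Sx fr; have [_ _ e11 e22 _] := fr; have comp := frame_completeness Sx fr.
have nE e : dot e e = 1 -> clifford e *m nabla e Psi x =
    clifford e *m Dspinor e Psi x - (2^-1)%:C%C *: (clifford x *m Psi x).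
  move=> ee; rewrite /nabla mulmxDr -scalemxAr !mulmxA (clifford_sqr ee).
  by rewrite mulNmx mul1mx mulNmx scalerN.
have DE e l : cmp (Dspinor e Psi x) l =
    e 0 0 * partial 0 (cmps Psi l) x + e 0 1 * partial 1 (cmps Psi l) x + e 0 2 * partial 2 (cmps Psi l) x.
  by rewrite cmp_Dspinor derive_partial.
have sg : cliff (fun k l => sgrad k (cmps Psi l) x) j =
    cmp (clifford e1 *m Dspinor e1 Psi x) j + cmp (clifford e2 *m Dspinor e2 Psi x) j.
  rewrite !cmp_clifford.
  rewrite (@eq_cliff _ _ (fun k l => 1 * (e1 0 k * cmp (Dspinor e1 Psi x) l) + 1 * (e2 0 k * cmp (Dspinor e2 Psi x) l))).
    by rewrite cliff_comb !mul1r.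
  move=> k l; rewrite !DE !mul1r; exact: (frame_sgrad (fun k => partial k (cmps Psi l) x) k comp).
have nE' e : dot e e = 1 -> cmp (clifford e *m nabla e Psi x) j =
    cmp (clifford e *m Dspinor e Psi x) j - 2^-1 * mulx (cmps Psi) j x.
  by move=> ee; rewrite (nE e ee) cmpB cmpZ; congr (_ - _ * _); exact: cmp_clifford.
rewrite /sdirac sg; apply: (etrans (cmpD _ _ _)).
apply: (etrans (congr2 +%R (nE' e1 e11) (nE' e2 e22))).
exact: (two_halves (cmp _ j) (cmp _ j) (mulx (cmps Psi) j x)).
Qed.

Lemma dirac_smooth_cmps (Psi Phi : E -> spinor) : (forall l x, differentiable (cmps Psi l) x) ->
  dirac_smooth Psi Phi <-> forall x, sphere x -> forall j, cmps Phi j x = sdirac (cmps Psi) j x.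
Proof.
move=> dP; split=> [h x Sx j|h x e1 e2 Sx fr].
  have [e1 [e2 fr]] := tangent_frame_exists Sx.
  by rewrite /cmps (h _ _ _ Sx fr) (cmp_nabla_frame _ _ Sx fr).
by apply: cmp_inj => j; rewrite (cmp_nabla_frame _ _ Sx fr)// -h.
Qed.

(** Projecting the gradient to the tangent plane subtracts [x] times the Euler operator, that is
    [n x] in degree [n]; the connection subtracts one more [x]. *)
Lemma sdirac_hspin n (F : sfun) j x : hspin n F ->
  sdirac F j x = dirop F j x - n.+1%:R * mulx F j x.
Proof.
move=> hF; have e l := euler_hpol x (hF l).
rewrite /sdirac (@eq_cliff _ _ (fun k l => 1 * partial k (F l) x + - n%:R * (x 0 k * F l x))); last first.
  by move=> k l; rewrite /sgrad e mul1r mulNr mulrCA.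
rewrite cliff_comb mul1r -/(dirop F j x) -/(mulx F j x) -(addn1 n) natrD.
by move: (dirop _ _ _) (mulx _ _ _) => a b; ring.
Qed.

Lemma sdirac_mono n (A : sfun) j x : mono n A -> sdirac A j x = - n.+1%:R * mulx A j x.
Proof. by move=> [hA dA]; rewrite (sdirac_hspin _ _ hA) dA /szero add0r mulNr. Qed.

Lemma sdirac_mulx_mono n (A : sfun) j x : mono n A -> sphere x ->
  sdirac (mulx A) j x = - n.+1%:R * A j x.
Proof.
move=> [hA dA] /sphere_coords Sx.
rewrite (sdirac_hspin _ _ (hspin_mulx hA)) (dirop_mulx _ _ hA) dA mulx_zero /szero mulxx Sx.
by rewrite -(addn2 n) -(addn1 n) !natrD; ring.
Qed.

Lemma sdirac_comb (F G : sfun) a b j x : (forall l, differentiable (F l) x) -> (forall l, differentiable (G l) x) ->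
  sdirac (scomb a F b G) j x = a * sdirac F j x + b * sdirac G j x.
Proof.
move=> dF dG.
have pE k l : partial k (scomb a F b G l) x = a * partial k (F l) x + b * partial k (G l) x.
  have daF := differentiableM (@differentiable_cst R E R a x) (dF l).
  have dbG := differentiableM (@differentiable_cst R E R b x) (dG l).
  rewrite /scomb (partialD _ daF dbG) !partialM//; try exact: differentiable_cst.
  by rewrite !partial_cst !mulr0 !addr0.
rewrite /sdirac {2}/scomb mulx_comb.
rewrite (@eq_cliff _ _ (fun k l => a * sgrad k (F l) x + b * sgrad k (G l) x)); last first.
  move=> k l; rewrite /sgrad /euler /dotp !pE /=.
  move: (x 0 k) (x 0 0) (x 0 1) (x 0 2) (partial k (F l) x) (partial k (G l) x) => y y0 y1 y2 p q.
  move: (partial 0 (F l) x) (partial 1 (F l) x) (partial 2 (F l) x) => p0 p1 p2.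
  move: (partial 0 (G l) x) (partial 1 (G l) x) (partial 2 (G l) x) => q0 q1 q2.
  by clear; ring.
rewrite cliff_comb; move: (cliff _ _) (cliff _ _) (mulx _ _ _) (mulx _ _ _) => p q r s.
by clear; ring.
Qed.

End dirac_components.

(** * The real inner product of spinors *)

Section real_inner_product.
Context {R : realType}.
Local Notation E := 'rV[R]_3.
Local Notation sfun := ('I_4 -> E -> R).

Definition L2s (F : sfun) : Prop := forall j, L2 (F j).

(* The real part of the L^2 inner product of spinors. *)
Definition rin (F G : sfun) : R := sint (fun x => \sum_j F j x * G j x).

Lemma L2s_dot (F G : sfun) : L2s F -> L2s G -> sintegrable (fun x => \sum_j F j x * G j x).
Proof.
move=> hF hG.
rewrite (_ : (fun x => _) = (fun x => F 0 x * G 0 x + F 1 x * G 1 x + F 2 x * G 2 x + F 3 x * G 3 x)).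
  by do 3![apply: sintegrableD; last exact: L2M]; exact: L2M.
by apply/funext => x; rewrite sum4E.
Qed.

Lemma L2s_comb a F b G : L2s F -> L2s G -> L2s (scomb a F b G).
Proof. by move=> hF hG j; apply: L2D; apply: L2Z. Qed.

Lemma rinC F G : rin F G = rin G F.
Proof. by congr sint; apply/funext => x; apply: eq_bigr => j _; rewrite mulrC. Qed.

Lemma rin_combl a F b G H : L2s F -> L2s G -> L2s H ->
  rin (scomb a F b G) H = a * rin F H + b * rin G H.
Proof.
move=> hF hG hH; have iF := L2s_dot hF hH; have iG := L2s_dot hG hH.
rewrite /rin -(sintZ a iF) -(sintZ b iG) -sintD; try exact: sintegrableZ.
congr sint; apply/funext => x; rewrite !mulr_sumr -big_split; apply: eq_bigr => j _ /=.
by rewrite /scomb; ring.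
Qed.

Lemma rin_combr a F b G H : L2s F -> L2s G -> L2s H ->
  rin H (scomb a F b G) = a * rin H F + b * rin H G.
Proof. by move=> hF hG hH; rewrite rinC rin_combl// ![rin _ H]rinC. Qed.

Lemma rin_ge0 F : 0 <= rin F F.
Proof. by apply: sint_ge0 => x; apply: sumr_ge0 => j _; rewrite -expr2 sqr_ge0. Qed.

Lemma rin_CS F G : L2s F -> L2s G -> rin F G ^+ 2 <= rin F F * rin G G.
Proof.
move=> hF hG; rewrite mulrC; apply: discriminant_le; first exact: rin_ge0.
move=> t; have hC := L2s_comb 1 t hF hG; have := rin_ge0 (scomb 1 F t G).
rewrite (rin_combl _ _ hF hG hC) !rin_combr// (rinC G F).
by move: (rin F F) (rin F G) (rin G G) => a b c; lra.
Qed.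

Lemma eq_rin F F' G G' : (forall j x, sphere x -> F j x = F' j x) ->
  (forall j x, sphere x -> G j x = G' j x) -> L2s F -> L2s F' -> L2s G -> L2s G' -> rin F G = rin F' G'.
Proof.
move=> eF eG hF hF' hG hG'; apply: eq_sint.
- by move=> x Sx; apply: eq_bigr => j _; rewrite eF// eG.
- exact: sintegrable_measurable (L2s_dot hF hG).
- exact: sintegrable_measurable (L2s_dot hF' hG').
Qed.

Lemma rin_sint F G : L2s F -> L2s G -> rin F G = \sum_j sint (fun x => F j x * G j x).
Proof.
move=> hF hG; rewrite sum4E -!sintD; try exact: L2M; try exact: sintegrableD (L2M _ _) (L2M _ _).
  by congr sint; apply/funext => x; rewrite sum4E.
by apply: sintegrableD; [apply: sintegrableD|]; exact: L2M.
Qed.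

Lemma L2s_zero : L2s szero.
Proof. by move=> j; exact: L2_cst. Qed.

Lemma rin_zero F : rin F szero = 0.
Proof.
rewrite /rin (_ : (fun x => _) = fun=> 0) ?sint_cst ?mul0r//.
by apply/funext => x; rewrite big1// => j _; rewrite mulr0.
Qed.

Definition ssum (I : Type) (s : seq I) (F : I -> sfun) : sfun := fun j x => \sum_(i <- s) F i j x.

Lemma ssum_cons (I : Type) (i : I) s (F : I -> sfun) : ssum (i :: s) F = scomb 1 (F i) 1 (ssum s F).
Proof. by apply: sfunP => j x; rewrite /ssum /scomb big_cons !mul1r. Qed.

Lemma L2s_ssum (I : Type) (s : seq I) (F : I -> sfun) : (forall i, L2s (F i)) -> L2s (ssum s F).
Proof.
move=> hF; elim: s => [|i s ih]; last by rewrite ssum_cons; exact: L2s_comb.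
by rewrite (_ : ssum _ _ = szero); [exact: L2s_zero|apply: sfunP => j x; rewrite /ssum big_nil].
Qed.

Lemma rin_ssuml (I : Type) (s : seq I) (F : I -> sfun) G : (forall i, L2s (F i)) -> L2s G ->
  rin (ssum s F) G = \sum_(i <- s) rin (F i) G.
Proof.
move=> hF hG; elim: s => [|i s ih].
  rewrite big_nil (_ : ssum _ _ = szero) 1?rinC ?rin_zero//.
  by apply: sfunP => j x; rewrite /ssum big_nil.
rewrite ssum_cons rin_combl//; last exact: L2s_ssum.
by rewrite !mul1r ih big_cons.
Qed.

Lemma rin_ssumr (I : Type) (s : seq I) (F : I -> sfun) G : (forall i, L2s (F i)) -> L2s G ->
  rin G (ssum s F) = \sum_(i <- s) rin G (F i).
Proof. by move=> hF hG; rewrite rinC rin_ssuml//; apply: eq_bigr => i _; exact: rinC. Qed.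

Lemma scale_scomb a (F : sfun) : (fun j x => a * F j x) = scomb a F 0 szero.
Proof. by rewrite scombr0. Qed.

Lemma L2s_scale a F : L2s F -> L2s (fun j x => a * F j x).
Proof. by move=> hF; rewrite scale_scomb; apply: L2s_comb => //; exact: L2s_zero. Qed.

Lemma rin_scaler a F G : L2s F -> L2s G -> rin F (fun j x => a * G j x) = a * rin F G.
Proof. by move=> hF hG; rewrite scale_scomb rin_combr//; [rewrite mul0r addr0|exact: L2s_zero]. Qed.

Lemma rin_scalel a F G : L2s F -> L2s G -> rin (fun j x => a * F j x) G = a * rin F G.
Proof. by move=> hF hG; rewrite rinC rin_scaler// rinC. Qed.

End real_inner_product.

(** * Symmetry of the Dirac operator *)

Section dirac_symmetric.
Context {R : realType}.
Local Notation E := 'rV[R]_3.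
Local Notation sfun := ('I_4 -> E -> R).

Definition C1s (F : sfun) : Prop := forall j, C1 (F j).

Lemma sgrad_affine (k : 'I_3) (a : R) (f g : E -> R) x : C1 f -> C1 g ->
  sgrad k (fun x => a * f x + g x) x = a * sgrad k f x + sgrad k g x.
Proof.
move=> [df _] [dg _].
have daf := differentiableM (@differentiable_cst R E R a x) (df x).
have pE l : partial l (fun x => a * f x + g x) x = a * partial l f x + partial l g x.
  rewrite (partialD _ daf (dg x)) partialM//; try exact: differentiable_cst.
  by rewrite partial_cst mulr0 addr0.
rewrite /sgrad /euler /dotp /coords !pE /=.
move: (x 0 k) (x 0 0) (x 0 1) (x 0 2) (partial k f x) (partial k g x) => y y0 y1 y2 p q.
move: (partial 0 f x) (partial 1 f x) (partial 2 f x) => p0 p1 p2.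
move: (partial 0 g x) (partial 1 g x) (partial 2 g x) => q0 q1 q2.
by clear; ring.
Qed.

Lemma sgrad_cst (k : 'I_3) (c : R) (x : E) : sgrad k (fun=> c) x = 0.
Proof. by rewrite /sgrad /euler /dotp !partial_cst; ring. Qed.

(** With suitable signs and indices, the pointwise pairing of [e_k F] with [G]. *)
Let quad (a b c d : R) (i j k l : 'I_4) (F G : sfun) (x : E) : R :=
  a * (F i x * G 0 x) + (b * (F j x * G 1 x) + (c * (F k x * G 2 x) + (d * (F l x * G 3 x) + 0))).

Let C1_quad a b c d i j k l F G : C1s F -> C1s G -> C1 (quad a b c d i j k l F G).
Proof.
move=> cF cG; rewrite /quad.
do 4![apply: C1D; first by apply: C1M (C1_cst _) _; exact: C1M].
exact: C1_cst.
Qed.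

Let sgrad_quad m a b c d i j k l F G x : C1s F -> C1s G ->
  sgrad m (quad a b c d i j k l F G) x =
  a * (F i x * sgrad m (G 0) x + G 0 x * sgrad m (F i) x) +
  b * (F j x * sgrad m (G 1) x + G 1 x * sgrad m (F j) x) +
  c * (F k x * sgrad m (G 2) x + G 2 x * sgrad m (F k) x) +
  d * (F l x * sgrad m (G 3) x + G 3 x * sgrad m (F l) x).
Proof.
move=> cF cG.
have cM (u v : 'I_4) : C1 (fun x => F u x * G v x) by exact: C1M.
have cA (e : R) f g : C1 f -> C1 g -> C1 (fun x : E => e * f x + g x).
  by move=> cf cg; apply: C1D => //; exact: C1M (C1_cst _) _.
have c0 := @C1_cst R 0.
have c1 := cA d _ _ (cM l 3) c0; have c2 := cA c _ _ (cM k 2) c1; have c3 := cA b _ _ (cM j 1) c2.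
rewrite /quad (sgrad_affine _ _ _ (cM i 0) c3) (sgrad_affine _ _ _ (cM j 1) c2).
rewrite (sgrad_affine _ _ _ (cM k 2) c1) (sgrad_affine _ _ _ (cM l 3) c0) !(sgradM m x (cF _) (cG _)).
rewrite sgrad_cst.
by rewrite addr0 !addrA.
Qed.

Let bracket_eq (x0 x1 x2 f0 f1 f2 f3 g0 g1 g2 g3 : R) (p q : 'I_3 -> 'I_4 -> R) :
  ((- p 2 1 + p 1 2 - p 0 3 - (- (x2 * f1) + x1 * f2 - x0 * f3)) * g0 +
   (p 2 0 + p 1 3 + p 0 2 - (x2 * f0 + x1 * f3 + x0 * f2)) * g1 +
   (- p 1 0 - p 0 1 + p 2 3 - (- (x1 * f0) - x0 * f1 + x2 * f3)) * g2 +
   (- p 1 1 + p 0 0 - p 2 2 - (- (x1 * f1) + x0 * f0 - x2 * f2)) * g3) -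
  (f0 * (- q 2 1 + q 1 2 - q 0 3 - (- (x2 * g1) + x1 * g2 - x0 * g3)) +
   f1 * (q 2 0 + q 1 3 + q 0 2 - (x2 * g0 + x1 * g3 + x0 * g2)) +
   f2 * (- q 1 0 - q 0 1 + q 2 3 - (- (x1 * g0) - x0 * g1 + x2 * g3)) +
   f3 * (- q 1 1 + q 0 0 - q 2 2 - (- (x1 * g1) + x0 * g0 - x2 * g2))) =
  (-1 * (f3 * q 0 0 + g0 * p 0 3) + 1 * (f2 * q 0 1 + g1 * p 0 2) +
   -1 * (f1 * q 0 2 + g2 * p 0 1) + 1 * (f0 * q 0 3 + g3 * p 0 0) -
   2 * x0 * (-1 * (f3 * g0) + (1 * (f2 * g1) + (-1 * (f1 * g2) + (1 * (f0 * g3) + 0))))) +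
  (1 * (f2 * q 1 0 + g0 * p 1 2) + 1 * (f3 * q 1 1 + g1 * p 1 3) +
   -1 * (f0 * q 1 2 + g2 * p 1 0) + -1 * (f1 * q 1 3 + g3 * p 1 1) -
   2 * x1 * (1 * (f2 * g0) + (1 * (f3 * g1) + (-1 * (f0 * g2) + (-1 * (f1 * g3) + 0))))) +
  (-1 * (f1 * q 2 0 + g0 * p 2 1) + 1 * (f0 * q 2 1 + g1 * p 2 0) +
   1 * (f3 * q 2 2 + g2 * p 2 3) + -1 * (f2 * q 2 3 + g3 * p 2 2) -
   2 * x2 * (-1 * (f1 * g0) + (1 * (f0 * g1) + (1 * (f3 * g2) + (-1 * (f2 * g3) + 0))))).
Proof.
move: (p 0 0) (p 0 1) (p 0 2) (p 0 3) (p 1 0) (p 1 1) (p 1 2) (p 1 3) (p 2 0) (p 2 1) (p 2 2) (p 2 3).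
move: (q 0 0) (q 0 1) (q 0 2) (q 0 3) (q 1 0) (q 1 1) (q 1 2) (q 1 3) (q 2 0) (q 2 1) (q 2 2) (q 2 3).
by move=> *; ring.
Qed.

Lemma continuous_cliff (T : 'I_3 -> 'I_4 -> E -> R) j : (forall k l, continuous (T k l)) ->
  continuous (fun x => cliff (fun k l => T k l x) j).
Proof.
move=> cT; have cN k l : continuous (fun x => - T k l x) by exact: continuous_opp.
move: j; apply: ord4P; rewrite /cliff /=.
- by apply: continuous_add => //; exact: continuous_add.
- by apply: continuous_add => //; exact: continuous_add.
- by apply: continuous_add => //; exact: continuous_add.
- by apply: continuous_add => //; exact: continuous_add.
Qed.

Lemma continuous_sdirac F j : C1s F -> continuous (sdirac F j).
Proof.
move=> cF; have cS k l : continuous (sgrad k (F l)) by exact: continuous_sgrad.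
have cX k l : continuous (fun x : E => x 0 k * F l x).
  by apply: continuous_mul; [exact: continuous_coord|exact: C1_continuous].
apply: continuous_add; first exact: (continuous_cliff (T := fun k l x => sgrad k (F l) x)).
by apply: continuous_opp; exact: (continuous_cliff (T := fun k l x => x 0 k * F l x)).
Qed.

Lemma L2s_continuous (F : sfun) : (forall j, continuous (F j)) -> L2s F.
Proof. by move=> cF j; exact: L2_continuous. Qed.

Lemma L2s_C1 F : C1s F -> L2s F.
Proof. by move=> cF; apply: L2s_continuous => j; exact: C1_continuous. Qed.

Lemma L2s_sdirac F : C1s F -> L2s (sdirac F).
Proof. by move=> cF; apply: L2s_continuous => j; exact: continuous_sdirac. Qed.

(** Pointwise, the difference of the two pairings is the divergence of the field whose [k]-th
    component is the pairing of [e_k F] with [G]. It integrates to 0 by [sphere_ibp], whose terms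
    [2 x_k] account for the zeroth order part of [sdirac]. *)
Lemma sdirac_symmetric F G : C1s F -> C1s G -> rin (sdirac F) G = rin F (sdirac G).
Proof.
move=> cF cG; have LF := L2s_C1 cF; have LG := L2s_C1 cG.
have LdF := L2s_sdirac cF; have LdG := L2s_sdirac cG.
pose f0 := quad (-1) 1 (-1) 1 3 2 1 0 F G; pose f1 := quad 1 1 (-1) (-1) 2 3 0 1 F G.
pose f2 := quad (-1) 1 1 (-1) 1 0 3 2 F G.
have C1f0 : C1 f0 by exact: C1_quad.
have C1f1 : C1 f1 by exact: C1_quad.
have C1f2 : C1 f2 by exact: C1_quad.
pose D k f (x : E) : R := sgrad k f x - 2 * x 0 k * f x.
have cD k f : C1 f -> sintegrable (D k f).
  move=> cf; apply: sintegrable_continuous.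
  apply: continuous_add; first exact: continuous_sgrad.
  apply: continuous_opp; apply: continuous_mul; last exact: C1_continuous.
  by apply: continuous_mul; [exact: cst_continuous|exact: continuous_coord].
have iD k f : C1 f -> sint (D k f) = 0 by exact: sphere_ibp.
apply/eqP; rewrite -subr_eq0; apply/eqP.
have i1 := L2s_dot LdF LG; have i2 := L2s_dot LF LdG.
have i0 := sintegrableD (cD 0 _ C1f0) (cD 1 _ C1f1).
rewrite -[X in _ + X]mulN1r /rin -(sintZ (-1) i2) -(sintD i1 (sintegrableZ _ i2)).
transitivity (sint (fun x => D 0 f0 x + D 1 f1 x + D 2 f2 x)).
  congr sint; apply/funext => x; rewrite /D !sgrad_quad// /f0 /f1 /f2 /quad !sum4E /sdirac /mulx !cliffE.
  rewrite [X in _ + X]mulN1r.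
  exact: (bracket_eq (x 0 0) (x 0 1) (x 0 2) (F 0 x) (F 1 x) (F 2 x) (F 3 x) (G 0 x) (G 1 x) (G 2 x) (G 3 x)
    (fun k l => sgrad k (F l) x) (fun k l => sgrad k (G l) x)).
by rewrite (sintD i0 (cD 2 _ C1f2)) sintD ?iD ?addr0//; exact: cD.
Qed.

End dirac_symmetric.

(** * Eigenspinors and the spectral calculus *)

Section dirac_spectrum.
Context {R : realType}.
Local Notation E := 'rV[R]_3.
Local Notation spinor := 'cV[R[i]]_2.
Local Notation sfun := ('I_4 -> E -> R).
Local Notation sig := (@sphere_measure R).

Lemma measurable_cmps (psi : E -> spinor) :
  (forall k, measurable_fun [set: E] (fun x => complex.Re (psi x k 0)) /\
             measurable_fun [set: E] (fun x => complex.Im (psi x k 0))) <->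
  forall j, measurable_fun [set: E] (cmps psi j).
Proof.
split=> [mP|mP k].
  by apply: ord4P; [have [] := mP 0|have [] := mP 0|have [] := mP 1|have [] := mP 1].
by move: k; apply: ord2P; [have := (mP 0, mP 1) => -[]|have := (mP 2, mP 3) => -[]].
Qed.

Lemma normsq_sum (psi : E -> spinor) : (fun x => normsq (psi x)) = (fun x => \sum_j cmps psi j x * cmps psi j x).
Proof. by apply/funext => x; rewrite normsq_cmp; apply: eq_bigr => j _; rewrite expr2. Qed.

Lemma measurable_dot4 (F : sfun) : (forall j, measurable_fun [set: E] (F j)) ->
  measurable_fun [set: E] (fun x => \sum_j F j x * F j x).
Proof.
move=> mF; rewrite (_ : (fun x => _) = (fun x => F 0 x * F 0 x + F 1 x * F 1 x + F 2 x * F 2 x + F 3 x * F 3 x)).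
  by do 3![apply: measurable_funD; last exact: measurable_funM]; exact: measurable_funM.
by apply/funext => x; rewrite sum4E.
Qed.

Lemma sqr_le_sum4 (a : 'I_4 -> R) j : a j ^+ 2 <= \sum_i a i * a i.
Proof.
rewrite (bigD1 j)//= -expr2 lerDl; apply: sumr_ge0 => i _; rewrite -expr2; exact: sqr_ge0.
Qed.

Lemma L2spinorP (psi : E -> spinor) : L2spinor psi <-> L2s (cmps psi).
Proof.
split=> [[/measurable_cmps mP iP] j|LP].
  split; first exact: mP.
  have ni : sintegrable (fun x => normsq (psi x)).
    apply: integral_lt_pinfty => //; first by rewrite normsq_sum; exact: measurable_dot4.
    by move=> x; rewrite normsq_cmp; apply: sumr_ge0 => i _; exact: sqr_ge0.
  apply: (sintegrable_le _ ni); first exact: measurable_funX.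
  move=> x _; rewrite ger0_norm ?sqr_ge0// normsq_cmp.
  under eq_bigr do rewrite expr2; exact: (sqr_le_sum4 (cmp (psi x))).
split; first by apply/measurable_cmps => j; have [] := LP j.
rewrite (_ : (fun x => _) = EFin \o (fun x => normsq (psi x)))// normsq_sum.
by rewrite sintEFin ?ltry//; exact: L2s_dot.
Qed.

Lemma cmpsB (psi phi : E -> spinor) : cmps (fun x => psi x - phi x) = scomb 1 (cmps psi) (-1) (cmps phi).
Proof. by apply: sfunP => j x; rewrite /cmps cmpB /scomb mul1r mulN1r. Qed.

Lemma L2spinorB (psi phi : E -> spinor) : L2spinor psi -> L2spinor phi -> L2spinor (fun x => psi x - phi x).
Proof. by move=> /L2spinorP hp /L2spinorP hq; apply/L2spinorP; rewrite cmpsB; exact: L2s_comb. Qed.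

Lemma sint_normsq (psi : E -> spinor) : sint (fun x => normsq (psi x)) = rin (cmps psi) (cmps psi).
Proof. by rewrite normsq_sum. Qed.

Lemma L2cvg_cmps (Psi : nat -> E -> spinor) (psi : E -> spinor) :
  (forall n, L2spinor (Psi n)) -> L2spinor psi ->
  (\int[sig]_x (normsq (Psi n x - psi x))%:E)%E @[n --> \oo] --> 0%E ->
  forall j, L2cvg (fun n => cmps (Psi n) j) (cmps psi j).
Proof.
move=> LP Lp h j.
have h' : rin (cmps (fun x => Psi n x - psi x)) (cmps (fun x => Psi n x - psi x)) @[n --> \oo] --> (0 : R).
  apply: (cvg_eq_seq _ (@fine_cvg _ _ _ _ (fun n => \int[sig]_x (normsq (Psi n x - psi x))%:E)%E 0 h)).
  by move=> n; rewrite -sint_normsq.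
rewrite /L2cvg; apply: (squeeze_cvgr _ (cvg_cst (0 : R)) h').
near=> n; rewrite sint_sqr_ge0 /=.
have Ld := L2spinorB (LP n) Lp; move/L2spinorP : (Ld) => Lc.
rewrite (_ : (fun x => _) = (fun x => cmps (fun x => Psi n x - psi x) j x ^+ 2)); last first.
  by apply/funext => x; rewrite /cmps cmpB.
apply: sint_le; [by have [] := Lc j|exact: L2s_dot|].
move=> x _; exact: (sqr_le_sum4 (fun i => cmps (fun x => Psi n x - psi x) i x)).
Unshelve. all: by end_near.
Qed.

Lemma rin_cvg (F_ : nat -> sfun) F G : (forall n, L2s (F_ n)) -> L2s F -> L2s G ->
  (forall j, L2cvg (fun n => F_ n j) (F j)) -> rin (F_ n) G @[n --> \oo] --> rin F G.
Proof.
move=> LF_ LF LG h; have w j := L2cvg_weak (fun n => LF_ n j) (LF j) (LG j) (h j).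
rewrite (rin_sint LF LG) sum4E.
by apply: (cvg_eq_seq _ (cvgD (cvgD (cvgD (w 0) (w 1)) (w 2)) (w 3))) => n; rewrite rin_sint// sum4E.
Qed.

Lemma smooth_spinor_C1s (Psi : E -> spinor) : smooth_spinor Psi -> C1s (cmps Psi).
Proof. by move=> /smooth_spinor_cmps sP j; exact: smooth_C1. Qed.

(** Symmetry on smooth spinors passes to the closed graph, both pairings being continuous for L^2
    convergence. *)
Lemma dirac_weak (psi phi : E -> spinor) (G : sfun) : dirac psi phi -> C1s G ->
  rin (cmps phi) G = rin (cmps psi) (sdirac G).
Proof.
move=> [Lp Lq [Psi [Phi [sP cP cQ]]]] cG.
have C1P n : C1s (cmps (Psi n)) by have [h _ _] := sP n; exact: smooth_spinor_C1s.
have LP n : L2s (cmps (Psi n)) by exact: L2s_C1.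
have LQ n : L2s (cmps (Phi n)) by apply/L2spinorP; have [] := sP n.
have c1 := rin_cvg LQ ((L2spinorP _).1 Lq) (L2s_C1 cG)
  (L2cvg_cmps (fun n => (L2spinorP _).2 (LQ n)) Lq cQ).
have c2 := rin_cvg LP ((L2spinorP _).1 Lp) (L2s_sdirac cG)
  (L2cvg_cmps (fun n => (L2spinorP _).2 (LP n)) Lp cP).
apply: (cvg_unique (@Rhausdorff R) c1).
apply: (cvg_eq_seq _ c2) => n; rewrite -sdirac_symmetric//.
have [_ dP _] := sP n.
apply: eq_rin => //; try exact: L2s_C1; try exact: L2s_sdirac.
move=> j x Sx; rewrite ((dirac_smooth_cmps _ _).1 dP)// => l y; exact: ((C1P n l).1 y).
Qed.

(** Classical eigenspinors, for which the equation holds pointwise on the sphere, as opposed to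
    [eigenspinor], which refers to the closed operator. *)
Definition eig (l : R) (U : sfun) : Prop :=
  (forall j, smooth (U j)) /\ forall j x, sphere x -> sdirac U j x = l * U j x.

Lemma eig_C1s l U : eig l U -> C1s U.
Proof. by move=> [sU _] j; exact: smooth_C1. Qed.

Lemma eig_L2s l U : eig l U -> L2s U.
Proof. by move=> /eig_C1s; exact: L2s_C1. Qed.

Lemma rin_sdirac_eig l U F : eig l U -> L2s F -> rin F (sdirac U) = l * rin F U.
Proof.
move=> eU LF; have LU := eig_L2s eU; rewrite -rin_scaler//.
by apply: eq_rin => //; [move=> j x; exact: eU.2|exact: L2s_sdirac (eig_C1s eU)|exact: L2s_scale].
Qed.

Lemma eig_orthogonal l m U V : eig l U -> eig m V -> l != m -> rin U V = 0.
Proof.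
move=> eU eV lm; have LU := eig_L2s eU; have LV := eig_L2s eV.
have := sdirac_symmetric (eig_C1s eU) (eig_C1s eV).
rewrite (rin_sdirac_eig eV LU) rinC (rin_sdirac_eig eU LV) (rinC V U) => /eqP.
by rewrite -subr_eq0 -mulrBl mulf_eq0 subr_eq0 (negbTE lm) => /eqP.
Qed.

Lemma cmps_scale l (phi : E -> spinor) : cmps (fun x => l%:C%C *: phi x) = (fun j x => l * cmps phi j x).
Proof. by apply: sfunP => j x; rewrite /cmps cmpZ. Qed.

Lemma eigenspinor_L2s l (phi : E -> spinor) : eigenspinor l phi -> L2s (cmps phi).
Proof. by case=> /L2spinorP. Qed.

Lemma eigenspinor_orthogonal l m (phi : E -> spinor) U : eigenspinor l phi -> eig m U -> l != m ->
  rin (cmps phi) U = 0.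
Proof.
move=> ep eU lm; have LU := eig_L2s eU; have Lp := eigenspinor_L2s ep.
have := dirac_weak ep (eig_C1s eU).
rewrite cmps_scale (rin_scalel _ Lp LU) (rin_sdirac_eig eU Lp) => /eqP.
by rewrite -subr_eq0 -mulrBl mulf_eq0 subr_eq0 (negbTE lm) => /eqP.
Qed.

Lemma eig_eigenspinor l U : eig l U -> eigenspinor l (mks U).
Proof.
move=> eU; have LU := eig_L2s eU.
have L1 : L2spinor (mks U) by apply/L2spinorP; rewrite cmps_mks.
have L2' : L2spinor (fun x => l%:C%C *: mks U x).
  by apply/L2spinorP; rewrite cmps_scale cmps_mks; exact: L2s_scale.
have n0 (f : E -> spinor) : (\int[sig]_x (normsq (f x - f x))%:E)%E = 0%E.
  apply: integral0_eq => x _; rewrite subrr normsq_cmp big1// => j _.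
  by rewrite cmp_zero expr0n.
split=> //; exists (fun=> mks U), (fun _ x => l%:C%C *: mks U x); split; last first.
- by rewrite n0; exact: cvg_cst.
- by rewrite n0; exact: cvg_cst.
move=> _; split=> //; first by apply/smooth_spinor_cmps; rewrite cmps_mks => j; exact: eU.1.
apply/dirac_smooth_cmps => [j x|x Sx j]; first by rewrite cmps_mks; exact: ((eig_C1s eU j).1 x).
by rewrite cmps_mks cmps_scale cmps_mks eU.2.
Qed.

Lemma projection_rin l (psi p : E -> spinor) U : L2spinor psi -> spectral_projection l psi p -> eig l U ->
  rin (cmps psi) U = rin (cmps p) U.
Proof.
move=> /L2spinorP Lp [ep h] eU; have LU := eig_L2s eU; have Lq := eigenspinor_L2s ep.
have /(congr1 (@complex.Re R)) := h _ (eig_eigenspinor eU); rewrite /inner /= => h0.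
have : rin (scomb 1 (cmps psi) (-1) (cmps p)) U = 0.
  have <- : sint (fun x => complex.Re (hdot (psi x - p x) (mks U x))) = 0 by [].
  rewrite -cmpsB /rin; congr sint; apply/funext => x.
  by rewrite Re_hdot; apply: eq_bigr => j _; rewrite cmp_mks.
by rewrite rin_combl// mul1r mulN1r => /eqP; rewrite subr_eq0 => /eqP.
Qed.

(** By orthogonality an eigenspinor for [m] sees only the term [l = m] of the spectral sum. Its
    pairing with the remainder is the constant [c] as soon as [m] belongs to the finite set, while
    Cauchy-Schwarz bounds this pairing by a quantity tending to 0; hence [c = 0]. *)
Lemma calculus_rin h (psi phi : E -> spinor) m U : dirac_calculus h psi phi -> eig m U ->
  rin (cmps phi) U = h m * rin (cmps psi) U.
Proof.
move=> [Lp Lq [P [sP cP]]] eU; have LU := eig_L2s eU.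
have PF : ProperFilter (totally : set_system {fset R}) by exact: totally_filter.
have Lq' : L2s (cmps phi) by exact/L2spinorP.
have LP l : L2s (cmps (P l)) := eigenspinor_L2s (sP l).1.
pose T (A : {fset R}) : sfun := ssum A (fun l j x => h l * cmps (P l) j x).
have LT A : L2s (T A) by apply: L2s_ssum => l; exact: L2s_scale.
have LD A : L2s (scomb 1 (T A) (-1) (cmps phi)) by exact: L2s_comb.
pose d A := rin (scomb 1 (T A) (-1) (cmps phi)) (scomb 1 (T A) (-1) (cmps phi)).
have TE (A : {fset R}) x j : cmp (\sum_(l <- A) (h l)%:C%C *: P l x) j = T A j x.
  rewrite /T /ssum; elim/big_rec2: _ => [|l y s _ <-]; first exact: cmp_zero.
  by rewrite cmpD cmpZ.
have cd : d A @[A --> (totally : set_system {fset R})] --> (0 : R).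
  pose I (A : {fset R}) := (\int[sig]_x (normsq (\sum_(l <- A) (h l)%:C%C *: P l x - phi x))%:E)%E.
  have cP' : I A @[A --> (totally : set_system {fset R})] --> 0%E by move=> B /cP.
  have dE : d = fine \o I; last first.
    rewrite dE.
    exact: (@fine_cvg _ _ _ _ I 0 cP').
  apply/funext => A /=; apply/esym.
  transitivity (sint (fun x => normsq (\sum_(l <- A) (h l)%:C%C *: P l x - phi x))) => //.
  rewrite sint_normsq cmpsB /d; congr rin; congr (scomb _ _ _ _);
    by apply: sfunP => j x; rewrite /cmps TE.
pose c := h m * rin (cmps psi) U - rin (cmps phi) U.
have rinT (A : {fset R}) : m \in A -> rin (scomb 1 (T A) (-1) (cmps phi)) U = c.
  move=> mA; rewrite rin_combl// mul1r mulN1r /c; congr (_ - _).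
  rewrite /T rin_ssuml//; last by move=> l; exact: L2s_scale.
  rewrite (bigD1_seq m) ?fset_uniq//= big1 => [|l lm]; last first.
    by rewrite rin_scalel// (eigenspinor_orthogonal (sP l).1 eU lm) mulr0.
  by rewrite addr0 rin_scalel// (projection_rin Lp (sP m) eU).
have [c0|c0] := eqVneq c 0; first by move/eqP: c0; rewrite subr_eq0 => /eqP.
have K0 : 0 < rin U U + 1 by rewrite ltr_wpDl// rin_ge0.
have c2 : 0 < c ^+ 2 by rewrite exprn_even_gt0.
have n1 : \forall A \near (totally : set_system {fset R}), m \in A.
  by exists [fset m]%fset => // B /= /fsubsetP; apply; rewrite inE.
have n2 : \forall A \near (totally : set_system {fset R}), `|d A - 0| < c ^+ 2 / (rin U U + 1).
  by apply: (cvgr_distC_lt _ _ cd); rewrite divr_gt0.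
have [A [mA dA]] := filter_ex (filterI n1 n2).
have := rin_CS (LD A) LU; rewrite (rinT _ mA) -/(d A) => le.
have d0 : 0 <= d A by exact: rin_ge0.
move: dA; rewrite subr0 ger0_norm// ltr_pdivlMr// => lt.
have : c ^+ 2 < c ^+ 2.
  apply: (le_lt_trans le); apply: le_lt_trans lt.
  by rewrite ler_wpM2l// lerDl.
by rewrite ltxx.
Qed.

Lemma calculus_L2s h (psi phi : E -> spinor) : dirac_calculus h psi phi -> L2s (cmps psi) /\ L2s (cmps phi).
Proof. by move=> [/L2spinorP ? /L2spinorP ?]. Qed.

End dirac_spectrum.

(** * Harmonic polynomial spinors *)

Section smooth_polynomials.
Context {R : realType}.
Local Notation E := 'rV[R]_3.
Local Notation sfun := ('I_4 -> E -> R).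

Lemma smoothD (f g : E -> R) : smooth f -> smooth g -> smooth (fun x => f x + g x).
Proof.
move=> + + n; elim: n f g => [//|n ih] f g sf sg.
have [df _] := sf 1%N; have [dg _] := sg 1%N; split; first by move=> x; exact: differentiableD.
move=> v; rewrite (_ : (fun x => _) = (fun x => 'D_v f x + 'D_v g x)); last first.
  by apply/funext => x; rewrite deriveD//; exact: diff_derivable.
by apply: ih => m; [have [_] := sf m.+1|have [_] := sg m.+1]; exact.
Qed.

Lemma smooth_pol (f : E -> R) : pol f -> smooth f.
Proof. by elim=> [n g|g h _ sg _ sh]; [exact: smooth_hpol|exact: smoothD]. Qed.

Lemma C1_pol (f : E -> R) : pol f -> C1 f.
Proof. by move=> /smooth_pol; exact: smooth_C1. Qed.

Lemma partial_comb (k : 'I_3) (a b : R) (f g : E -> R) x : differentiable f x -> differentiable g x ->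
  partial k (fun x => a * f x + b * g x) x = a * partial k f x + b * partial k g x.
Proof.
move=> df dg.
have daf := differentiableM (@differentiable_cst R E R a x) df.
have dbg := differentiableM (@differentiable_cst R E R b x) dg.
rewrite (partialD _ daf dbg) !partialM//; try exact: differentiable_cst.
by rewrite !partial_cst !mulr0 !addr0.
Qed.

Lemma pol_comb a b (f g : E -> R) : pol f -> pol g -> pol (fun x => a * f x + b * g x).
Proof. by move=> pf pg; apply: polD; apply: polM => //; exact: pol_cst. Qed.

Lemma pol_partial k (f : E -> R) : pol f -> pol (partial k f).
Proof.
elim=> [n g hg|g h pg ig ph ih]; first exact: pol_hpol (partial_hpol k hg).
rewrite (_ : partial k _ = (fun x => partial k g x + partial k h x)); first exact: polD.
by apply/funext => x; apply: partialD; [exact: ((C1_pol pg).1 x)|exact: ((C1_pol ph).1 x)].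
Qed.

Definition laplacian (f : E -> R) x :=
  partial 0 (partial 0 f) x + partial 1 (partial 1 f) x + partial 2 (partial 2 f) x.

Definition harmonic_pol (f : E -> R) := pol f /\ forall x, laplacian f x = 0.

Lemma harmonic_comb a b (f g : E -> R) : harmonic_pol f -> harmonic_pol g ->
  harmonic_pol (fun x => a * f x + b * g x).
Proof.
move=> [pf lf] [pg lg]; split; first exact: pol_comb.
move=> x; have pE k : partial k (fun x => a * f x + b * g x) = (fun x => a * partial k f x + b * partial k g x).
  by apply/funext => y; apply: partial_comb; [exact: ((C1_pol pf).1 y)|exact: ((C1_pol pg).1 y)].
have ppE k : partial k (partial k (fun x => a * f x + b * g x)) x =
    a * partial k (partial k f) x + b * partial k (partial k g) x.
  by rewrite pE; apply: partial_comb; [exact: ((C1_pol (pol_partial k pf)).1 x)|exact: ((C1_pol (pol_partial k pg)).1 x)].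
rewrite /laplacian !ppE; transitivity (a * laplacian f x + b * laplacian g x); last by rewrite lf lg !mulr0 addr0.
rewrite /laplacian; move: (partial 0 _ _) (partial 1 _ _) (partial 2 _ _) (partial 0 _ _) (partial 1 _ _) (partial 2 _ _).
by move=> *; ring.
Qed.

Lemma euler_comb a b (f g : E -> R) x : differentiable f x -> differentiable g x ->
  euler (fun x => a * f x + b * g x) x = a * euler f x + b * euler g x.
Proof.
move=> df dg; rewrite /euler /dotp !(partial_comb _ _ _ df dg).
move: (partial 0 f x) (partial 1 f x) (partial 2 f x) (partial 0 g x) (partial 1 g x) (partial 2 g x).
by clear; move=> *; ring.
Qed.

Definition spol (F : sfun) : Prop := forall j, pol (F j).
Definition sharm (F : sfun) : Prop := forall j, harmonic_pol (F j).

Lemma sharm_zero : sharm szero.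
Proof.
move=> j; split; first exact: pol_cst.
move=> x; have p0 k : partial k (szero j) = (fun=> 0) :> (E -> R).
  by apply/funext => y; exact: partial_cst.
by rewrite /laplacian (p0 0) (p0 1) (p0 2) (partial_cst 0) (partial_cst 1) (partial_cst 2) !addr0.
Qed.

Lemma sharm_comb a b F G : sharm F -> sharm G -> sharm (scomb a F b G).
Proof. by move=> hF hG j; exact: harmonic_comb. Qed.

Lemma sharm_ssum (I : Type) (s : seq I) (F : I -> sfun) : (forall i, sharm (F i)) -> sharm (ssum s F).
Proof.
move=> hF; elim: s => [|i s ih]; last by rewrite ssum_cons; apply: sharm_comb; [exact: hF|exact: ih].
by rewrite (_ : ssum _ _ = szero); [exact: sharm_zero|apply: sfunP => j x; rewrite /ssum big_nil].
Qed.

Lemma spol_hspin n F : hspin n F -> spol F.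
Proof. by move=> hF j; exact: pol_hpol. Qed.

Lemma sharm_dirop n F : hspin n F -> dirop (dirop F) = szero -> sharm F.
Proof.
move=> hF dF j; split; first exact: spol_hspin hF j.
move=> x; have := dirop_dirop j x hF; rewrite dF /szero /laplacian => /eqP.
by rewrite eq_sym oppr_eq0 => /eqP.
Qed.

Lemma sharm_mono n A : mono n A -> sharm A.
Proof. by move=> [hA dA]; apply: (sharm_dirop hA); rewrite dA dirop_zero. Qed.

Lemma sharm_mulx_mono n A : mono n A -> sharm (mulx A).
Proof.
move=> [hA dA]; apply: (sharm_dirop (hspin_mulx hA)).
have -> : dirop (mulx A) = scomb (- (3 + 2 * n%:R)) A 0 szero.
  by apply: sfunP => j x; rewrite (dirop_mulx _ _ hA) dA mulx_zero /szero subr0 /scomb mul0r addr0.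
rewrite /scomb (dirop_comb _ _ hA (hspin_zero n)) dA dirop_zero.
by apply: sfunP => j x; rewrite /szero !mulr0 addr0.
Qed.

Lemma mulx_ssum (I : Type) (s : seq I) (F : I -> sfun) : mulx (ssum s F) = ssum s (fun i => mulx (F i)).
Proof.
elim: s => [|i s ih]; last by rewrite !ssum_cons -ih /scomb mulx_comb.
have z (G : I -> sfun) : ssum [::] G = szero by apply: sfunP => j x; rewrite /ssum big_nil.
by rewrite !z mulx_zero.
Qed.

Lemma mulx_isometry (F G : sfun) x :
  \sum_j mulx F j x * mulx G j x = (x 0 0 ^+ 2 + x 0 1 ^+ 2 + x 0 2 ^+ 2) * \sum_j F j x * G j x.
Proof.
rewrite !sum4E /mulx !cliffE; move: (x 0 0) (x 0 1) (x 0 2) => a b c.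
move: (F 0 x) (F 1 x) (F 2 x) (F 3 x) (G 0 x) (G 1 x) (G 2 x) (G 3 x) => f0 f1 f2 f3 g0 g1 g2 g3.
by ring.
Qed.

Lemma cliff_euler (f : 'I_4 -> R) (a : 'I_3 -> R) (p : 'I_3 -> 'I_4 -> R) j :
  a 0 * cliff (fun m i => (m == 0)%:R * f i + a m * p 0 i) j +
  a 1 * cliff (fun m i => (m == 1)%:R * f i + a m * p 1 i) j +
  a 2 * cliff (fun m i => (m == 2)%:R * f i + a m * p 2 i) j =
  cliff (fun m i => a m * f i) j + cliff (fun m i => a m * (a 0 * p 0 i + a 1 * p 1 i + a 2 * p 2 i)) j.
Proof.
pose T k m i := (m == k)%:R * f i + a m * p k i.
transitivity (cliff (fun m i => 1 * (a 0 * T 0 m i + a 1 * T 1 m i) + a 2 * T 2 m i) j).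
  by rewrite (cliff_comb (fun m i => a 0 * T 0 m i + a 1 * T 1 m i)) mul1r cliff_comb.
transitivity (cliff (fun m i => 1 * (a m * f i) + 1 * (a m * (a 0 * p 0 i + a 1 * p 1 i + a 2 * p 2 i))) j).
  congr cliff; apply/funext => m; apply/funext => i; rewrite /T.
  by move: m; apply: ord3P => /=; ring.
by rewrite (cliff_comb (fun m i => a m * f i)) !mul1r.
Qed.

Lemma euler_mulx (F : sfun) j x : spol F ->
  euler (mulx F j) x = mulx F j x + mulx (fun l => euler (F l)) j x.
Proof.
move=> pF; have dF l : differentiable (F l) x := (C1_pol (pF l)).1 x.
have P k : partial k (mulx F j) x =
    cliff (fun m i => (m == k)%:R * F i x + x 0 m * partial k (F i) x) j.
  rewrite (@partial_cliff _ (fun m i x => x 0 m * F i x)); last first.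
    by move=> m i; exact: (differentiableM (differentiable_coord m x) (dF i)).
  by congr (cliff _ _); apply/funext => m; apply/funext => i; exact: partial_coordM.
rewrite {1}/euler /dotp (P 0) (P 1) (P 2).
exact: (cliff_euler (fun i => F i x) (fun m => x 0 m) (fun k i => partial k (F i) x) j).
Qed.

End smooth_polynomials.

(** * The weighted spectral inequality *)

Lemma measurable_invr d (T : measurableType d) (R : realType) (f : T -> R) : measurable_fun [set: T] f ->
  (forall x, 0 < f x) -> measurable_fun [set: T] (fun x => (f x)^-1).
Proof.
move=> mf f0; rewrite (_ : (fun x => _) = (fun x => expR (- ln (f x)))).
  apply: (@measurableT_comp _ _ _ _ _ _ expR) => //; apply: measurableT_comp => //.
  exact: (measurableT_comp (@measurable_ln R) mf).
by apply/funext => x; rewrite expRN lnK// posrE.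
Qed.

Section spectral_bound.
Context {R : realType}.
Local Notation E := 'rV[R]_3.
Local Notation spinor := 'cV[R[i]]_2.
Local Notation sfun := ('I_4 -> E -> R).

(* For monogenic [C] of degree [n], [C + xC] and [C - xC] are eigenspinors of the Dirac
   operator of the sphere with eigenvalues [-(n+1)] and [n+1]. *)
Lemma eig_mono n (C : sfun) (a : R) (s : bool) : mono n C ->
  eig ((-1) ^+ s * - n.+1%:R) (scomb a C ((-1) ^+ s * a) (mulx C)).
Proof.
move=> mC; have [hC _] := mC; have hM := hspin_mulx hC.
split=> [j|j x Sx].
  by apply: smooth_pol; apply: pol_comb; [exact: spol_hspin hC j|exact: spol_hspin hM j].
rewrite sdirac_comb; last 2 first.
- by move=> l; exact: (hpol_differentiable (hC l)).
- by move=> l; exact: (hpol_differentiable (hM l)).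
rewrite (sdirac_mono _ _ mC) (sdirac_mulx_mono _ mC Sx) /scomb.
move: (C j x) (mulx C j x) (n.+1%:R) => u v k.
by case: s; rewrite ?expr1 ?expr0; ring.
Qed.

Let halves (a b c d : R) : 1 * a + 1 * d =
  1 * (2^-1 * (1 * a + 1 * b) + 1 / 2 * (1 * c + 1 * d)) +
  1 * (2^-1 * (1 * a + -1 * b) + -1 / 2 * (1 * c + -1 * d)).
Proof. by field. Qed.

Let euler_step (k u v w : R) : k != 0 ->
  1 * ((k - 1) * (k^-1 * w)) + 1 * (v - u) = 1 * w + 1 * v - (1 * (k^-1 * w) + 1 * u).
Proof. by move=> k0; field. Qed.

Let ler_sqrt_abs (a b : R) : a ^+ 2 <= b ^+ 2 -> `|a| <= `|b|.
Proof. by move=> ab; rewrite -ler_sqr ?nnegrE// !real_normK ?num_real. Qed.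

Let half_le (s k t : R) : s + s <= k * (2 * t) -> s <= k * t.
Proof. by rewrite mulrCA; lra. Qed.

Let cross_pure1 (a b c : R) : 1 * (- (1 / 2) * a + 1 / 2 * b) + 1 * (- (1 / 2) * b + 1 / 2 * c) = 1 / 2 * (c - a).
Proof. by field. Qed.

Let cross_pure2 (a b c : R) : 1 * (1 / 2 * a + 1 / 2 * b) + -1 * (1 / 2 * b + 1 / 2 * c) = 1 / 2 * (a - c).
Proof. by field. Qed.

Let cross_pure3 (t a b : R) : 1 * t + 1 * (1 / 2 * (b - a)) + (1 * t + 1 * (1 / 2 * (a - b))) = 2 * t.
Proof. by field. Qed.

Variables (N : nat) (A B : nat -> sfun).
Hypotheses (mA : forall i, mono i (A i)) (mB : forall i, mono i (B i)).

(** [A + x B] is the sum of two halves built from [A + B] and from [A - B], which [eig_mono] places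
    in the eigenspaces of [-(i + 1)] and [i + 1]. Hence [|D|] acts on [U i] as [i + 1]. *)
Let Um i : sfun := scomb (2^-1) (scomb 1 (A i) 1 (B i)) ((-1) ^+ false * 2^-1) (mulx (scomb 1 (A i) 1 (B i))).
Let Up i : sfun := scomb (2^-1) (scomb 1 (A i) (-1) (B i)) ((-1) ^+ true * 2^-1) (mulx (scomb 1 (A i) (-1) (B i))).
Let U i : sfun := scomb 1 (A i) 1 (mulx (B i)).

Let UE i : U i = scomb 1 (Um i) 1 (Up i).
Proof.
apply: sfunP => j x; rewrite /U /Um /Up /scomb !mulx_comb expr0 expr1.
exact: halves.
Qed.

Let eUm i : eig (- i.+1%:R) (Um i).
Proof. by have := eig_mono (2^-1) false (mono_comb 1 1 (mA i) (mB i)); rewrite expr0 mul1r. Qed.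

Let eUp i : eig (i.+1%:R) (Up i).
Proof.
by have := eig_mono (2^-1) true (mono_comb 1 (-1) (mA i) (mB i)); rewrite expr1 mulN1r opprK.
Qed.

Let LU i : L2s (U i).
Proof. by rewrite UE; apply: L2s_comb; [exact: eig_L2s (eUm i)|exact: eig_L2s (eUp i)]. Qed.

Let U_orthogonal i k : i != k -> rin (U i) (U k) = 0.
Proof.
move=> ik; have LUm := fun i => eig_L2s (eUm i); have LUp := fun i => eig_L2s (eUp i).
have nik : i.+1%:R != k.+1%:R :> R by rewrite eqr_nat eqSS.
have pos m : 0 < m.+1%:R :> R by rewrite ltr0n.
have o1 : rin (Um i) (Um k) = 0 by apply: (eig_orthogonal (eUm i) (eUm k)); rewrite eqr_opp.
have o2 : rin (Up i) (Up k) = 0 by exact: (eig_orthogonal (eUp i) (eUp k)).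
have o3 : rin (Um i) (Up k) = 0.
  apply: (eig_orthogonal (eUm i) (eUp k)); rewrite lt_eqF//.
  by apply: (@lt_trans _ _ 0) => //; rewrite oppr_lt0.
have o4 : rin (Up i) (Um k) = 0.
  apply: (eig_orthogonal (eUp i) (eUm k)); rewrite gt_eqF//.
  by apply: (@lt_trans _ _ 0) => //; rewrite oppr_lt0.
rewrite (UE i) (rin_combl 1 1 (LUm i) (LUp i) (LU k)) (UE k).
rewrite (rin_combr 1 1 (LUm k) (LUp k) (LUm i)) (rin_combr 1 1 (LUm k) (LUp k) (LUp i)).
by rewrite o1 o2 o3 o4 !mulr0 !addr0 mulr0 addr0.
Qed.

Let hE n : Num.sqrt (Num.sqrt (n.+1%:R ^+ 2)) = Num.sqrt n.+1%:R :> R /\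
  Num.sqrt (Num.sqrt ((- n.+1%:R) ^+ 2)) = Num.sqrt n.+1%:R :> R.
Proof. by rewrite !sqrtr_sqr normrN ger0_norm. Qed.

Let rinU psi phi i : sqrt_abs_dirac psi phi ->
  rin (cmps phi) (U i) = Num.sqrt i.+1%:R * rin (cmps psi) (U i).
Proof.
move=> sq; have [Lp Lq] := calculus_L2s sq; have LUm := eig_L2s (eUm i); have LUp := eig_L2s (eUp i).
rewrite UE (rin_combr 1 1 LUm LUp Lp) (rin_combr 1 1 LUm LUp Lq) (calculus_rin sq (eUm i)) (calculus_rin sq (eUp i)).
have [-> ->] := hE i; by rewrite !mul1r mulrDr.
Qed.

Definition wsum (c : nat -> R) : sfun := ssum (index_enum 'I_N) (fun i : 'I_N => fun j x => c i * U i j x).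

Let LcU (c : nat -> R) (i : 'I_N) : L2s (fun j x => c i * U i j x).
Proof. exact: L2s_scale. Qed.

Let rin_wsumr F c : L2s F -> rin F (wsum c) = \sum_(i < N) c i * rin F (U i).
Proof.
move=> LF; rewrite /wsum (rin_ssumr _ (LcU c) LF).
by apply: eq_bigr => i _; rewrite rin_scaler.
Qed.

Lemma L2s_wsum c : L2s (wsum c).
Proof. by apply: L2s_ssum => i; exact: LcU. Qed.

Let rin_wsum c d : rin (wsum c) (wsum d) = \sum_(i < N) c i * d i * rin (U i) (U i).
Proof.
rewrite rin_wsumr; last exact: L2s_wsum.
apply: eq_bigr => i _; rewrite rinC rin_wsumr// (bigD1 i)//= big1 => [|k ki].
  by rewrite addr0; ring.
by rewrite U_orthogonal ?mulr0// eq_sym.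
Qed.

(** The test spinor [eta]; then [spectral_inv] is [theta = |D|^-1 eta], each term being divided by
    its eigenvalue [i + 1] of [|D|]. *)
Definition spectral_sum : sfun := wsum (fun=> 1).
Definition spectral_inv : sfun := wsum (fun i => i.+1%:R^-1).

(* Pairing with [sum_i U_i / sqrt (i+1)] turns the projection of [psi] into that of
   [|D|^(1/2) psi]. *)
Lemma spectral_CS psi phi : sqrt_abs_dirac psi phi ->
  rin (cmps psi) spectral_sum ^+ 2 <= rin (cmps phi) (cmps phi) * rin spectral_inv spectral_sum.
Proof.
move=> sq; have [Lp Lq] := calculus_L2s sq.
pose c (i : nat) : R := (Num.sqrt i.+1%:R)^-1.
have s0 (i : nat) : Num.sqrt i.+1%:R != 0 :> R by rewrite gt_eqF// sqrtr_gt0 ltr0n.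
have e1 : rin (cmps psi) spectral_sum = rin (cmps phi) (wsum c).
  rewrite /spectral_sum !rin_wsumr//; apply: eq_bigr => i _.
  by rewrite (rinU i sq) /c mulrA mulVf.
have e2 : rin spectral_inv spectral_sum = rin (wsum c) (wsum c).
  rewrite !rin_wsum; apply: eq_bigr => i _.
  by rewrite mulr1 /c -invfM -expr2 sqr_sqrtr.
by rewrite e1 e2; apply: rin_CS => //; exact: L2s_wsum.
Qed.

(** [theta = alpha + x beta] and [eta = alpha' + x beta'], where [alpha], [beta], [x alpha] and
    [x beta] are harmonic polynomials on R^3. *)
Let alpha := ssum (index_enum 'I_N) (fun i : 'I_N => scomb (i.+1%:R^-1) (A i) 0 szero).
Let beta := ssum (index_enum 'I_N) (fun i : 'I_N => scomb (i.+1%:R^-1) (B i) 0 szero).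
Let alpha' := ssum (index_enum 'I_N) (fun i : 'I_N => A i).
Let beta' := ssum (index_enum 'I_N) (fun i : 'I_N => B i).

Let mscale n C (c : R) : mono n C -> mono n (scomb c C 0 szero).
Proof. by move=> mC; apply: mono_comb => //; exact: mono_zero. Qed.

Let sharm_alpha : sharm alpha.
Proof. by apply: sharm_ssum => i; exact: sharm_mono (mscale _ (mA i)). Qed.

Let sharm_beta : sharm beta.
Proof. by apply: sharm_ssum => i; exact: sharm_mono (mscale _ (mB i)). Qed.

Let sharm_mulx_alpha : sharm (mulx alpha).
Proof. by rewrite mulx_ssum; apply: sharm_ssum => i; exact: sharm_mulx_mono (mscale _ (mA i)). Qed.

Let sharm_mulx_beta : sharm (mulx beta).
Proof. by rewrite mulx_ssum; apply: sharm_ssum => i; exact: sharm_mulx_mono (mscale _ (mB i)). Qed.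

(** From [i / (i + 1) = 1 - 1 / (i + 1)]. *)
Let euler_ssum (s : seq 'I_N) (C : nat -> sfun) j x : (forall i, mono i (C i)) ->
  euler (ssum s (fun i : 'I_N => scomb (i.+1%:R^-1) (C i) 0 szero) j) x =
  ssum s (fun i : 'I_N => C i) j x - ssum s (fun i : 'I_N => scomb (i.+1%:R^-1) (C i) 0 szero) j x.
Proof.
move=> mC; elim: s => [|i s ih].
  rewrite /ssum !big_nil subr0 (_ : (fun x => _) = fun=> 0); last by apply/funext => y; rewrite big_nil.
  by rewrite /euler /dotp (partial_cst 0) (partial_cst 1) (partial_cst 2) !mulr0 !addr0.
rewrite !ssum_cons.
have p1 : pol (scomb (i.+1%:R^-1) (C i) 0 szero j) := (sharm_mono (mscale _ (mC i)) j).1.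
have p2 : pol (ssum s (fun i : 'I_N => scomb (i.+1%:R^-1) (C i) 0 szero) j).
  by apply: (sharm_ssum _ _ j).1 => k; exact: sharm_mono (mscale _ (mC k)).
rewrite [in LHS]/scomb (euler_comb 1 1 ((C1_pol p1).1 x) ((C1_pol p2).1 x)) ih.
have [hC _] := mC i; rewrite scombr0 (euler_hpol x (hpolZ _ (hC j))) /scomb.
move: (ssum _ _ _ _) (ssum _ _ _ _) (C i j x) => u v w.
have i0 : i.+1%:R != 0 :> R by rewrite pnatr_eq0.
have -> : i%:R = i.+1%:R - 1 :> R by rewrite -(addn1 i) natrD addrK.
exact: euler_step.
Qed.

Let spectral_invE : spectral_inv = scomb 1 alpha 1 (mulx beta).
Proof.
rewrite /alpha /beta mulx_ssum; apply: sfunP => j x.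
rewrite /spectral_inv /wsum /scomb /ssum !mul1r -big_split; apply: eq_bigr => i _ /=.
rewrite /U /scomb /szero !mulr0.
have -> : (fun j x => i.+1%:R^-1 * B i j x + 0) = scomb (i.+1%:R^-1) (B i) 0 szero.
  by apply: sfunP => l y; rewrite scombr0 addr0.
rewrite scombr0; have := mulx_comb (B i) szero (i.+1%:R^-1) 0.
rewrite -[X in mulx X]/(scomb _ _ _ _) scombr0 => ->.
by rewrite mulx_zero /szero; ring.
Qed.

Let spectral_sumE : spectral_sum = scomb 1 alpha' 1 (mulx beta').
Proof.
rewrite /alpha' /beta' mulx_ssum; apply: sfunP => j x.
rewrite /spectral_sum /wsum /scomb /ssum !mul1r -big_split; apply: eq_bigr => i _ /=.
by rewrite /U /scomb !mul1r.
Qed.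

(** The harmonic extension of [x theta]: the polynomial [x x beta = - |x|^2 beta] need not be
    harmonic, but on the sphere it agrees with [- beta]. *)
Let dual := scomb 1 (mulx alpha) (-1) beta.

Let dualE x j : sphere x -> dual j x = mulx spectral_inv j x.
Proof.
move=> /sphere_coords Sx; rewrite spectral_invE mulx_comb /dual /scomb mulxx Sx.
by rewrite !mul1r.
Qed.

Let flux (f : E -> R) := sint (fun x => f x * (1 / 2 * f x + euler f x)).

Let flux_trace (f : E -> R) : harmonic_pol f -> 0 <= flux f /\ sint (fun x => f x ^+ 4) <= flux f ^+ 2 / pi.
Proof.
move=> [pf lf]; have cf := C1_pol pf; have cpf k := C1_pol (pol_partial k pf).
by split; [exact: trace_flux_ge0|exact: trace_sphere].
Qed.

Let sharm_inv : sharm spectral_inv.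
Proof. by rewrite spectral_invE; exact: sharm_comb. Qed.

Let sharm_dual : sharm dual.
Proof. exact: sharm_comb. Qed.

Let cpol f : pol f -> continuous (f : E -> R).
Proof. by move=> /C1_pol; exact: C1_continuous. Qed.

Let ceuler f : pol f -> continuous (fun x : E => 1 / 2 * f x + euler f x).
Proof.
move=> pf; have e : (fun x : E => 1 / 2 * f x + euler f x) = (fun x : E => 1 / 2 * f x +
    1 * (x 0 0 * partial 0 f x + x 0 1 * partial 1 f x + x 0 2 * partial 2 f x)).
  by apply/funext => x; congr (_ + _); rewrite mul1r.
rewrite e; apply: cpol; apply: (pol_comb _ _ pf (polD (polD (polM (pol_coord 0) (pol_partial 0 pf))
  (polM (pol_coord 1) (pol_partial 1 pf))) (polM (pol_coord 2) (pol_partial 2 pf)))).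
Qed.

Let Eh (F : sfun) : sfun := fun j x => 1 / 2 * F j x + euler (F j) x.

Let spol_sharm (F : sfun) : sharm F -> spol F.
Proof. by move=> sF j; exact: (sF j).1. Qed.

Let L2s_spol (F : sfun) : spol F -> L2s F.
Proof. by move=> pF; apply: L2s_continuous => j; exact: cpol. Qed.

Let flux_rin (F : sfun) : spol F -> \sum_j flux (F j) = rin F (Eh F).
Proof.
move=> pF; rewrite rin_sint//; first exact: L2s_spol.
by apply: L2s_continuous => j; exact: ceuler.
Qed.

Let spol_mulx (F : sfun) : spol F -> spol (mulx F).
Proof.
move=> pF j; have pX k l := polM (pol_coord k) (pF l).
have pN k l : pol (fun x : E => - (x 0 k * F l x)).
  have := polM (pol_cst (-1)) (pX k l); congr pol; apply/funext => x; exact: mulN1r.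
by move: j; apply: ord4P; rewrite /mulx /cliff /=; do 2![apply: polD => //].
Qed.

Let rin_mulx (F G : sfun) : spol F -> spol G -> rin (mulx F) (mulx G) = rin F G.
Proof.
move=> pF pG; apply: eq_sint.
- by move=> x /sphere_coords Sx; rewrite mulx_isometry Sx mul1r.
- by apply: sintegrable_measurable; apply: L2s_dot; apply: L2s_spol; exact: spol_mulx.
- by apply: sintegrable_measurable; apply: L2s_dot; exact: L2s_spol.
Qed.

Let e1_pure (a b a' b' : R) : 1 / 2 * (1 * a + 1 * b) + (1 * (a' - a) + 1 * (b + (b' - b))) =
  1 * (1 * a' + 1 * b') + 1 * (- (1 / 2) * a + 1 / 2 * b).
Proof. by field. Qed.

Let mulx_euler (C : nat -> sfun) (j : 'I_4) x : (forall i, mono i (C i)) ->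
  let c := ssum (index_enum 'I_N) (fun i : 'I_N => scomb (i.+1%:R^-1) (C i) 0 szero) in
  let c' := ssum (index_enum 'I_N) (fun i : 'I_N => C i) in
  mulx (fun l => euler (c l)) j x = mulx c' j x - mulx c j x.
Proof.
move=> mC c c'; have -> : (fun l => euler (c l)) = scomb 1 c' (-1) c.
  by apply: sfunP => l y; rewrite euler_ssum// /scomb mul1r mulN1r.
by rewrite mulx_comb mul1r mulN1r.
Qed.

Let spol_ssum (C : nat -> sfun) : (forall i, mono i (C i)) -> spol (ssum (index_enum 'I_N) (fun i : 'I_N => C i)).
Proof. by move=> mC; apply: spol_sharm; apply: sharm_ssum => i; exact: sharm_mono (mC i). Qed.

(** Besides [eta] and [x eta], the boundary operator produces the half terms [X] and [Y]. Their
    pairings with [theta] and [dual] are opposite, because multiplication by [x] preserves inner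
    products on the sphere. *)
Lemma flux_sum : \sum_j flux (spectral_inv j) + \sum_j flux (dual j) = 2 * rin spectral_inv spectral_sum.
Proof.
have pa := spol_sharm sharm_alpha; have pb := spol_sharm sharm_beta.
have pxa := spol_sharm sharm_mulx_alpha; have pxb := spol_sharm sharm_mulx_beta.
have pa' : spol alpha' := spol_ssum mA; have pb' : spol beta' := spol_ssum mB.
have La := L2s_spol pa; have Lb := L2s_spol pb; have Lxa := L2s_spol pxa; have Lxb := L2s_spol pxb.
have Linv := L2s_spol (spol_sharm sharm_inv); have Ldual := L2s_spol (spol_sharm sharm_dual).
have psum : spol spectral_sum.
  by rewrite spectral_sumE => j; apply: pol_comb => //; exact: spol_mulx.
have Lsum := L2s_spol psum; have Lxsum := L2s_spol (spol_mulx psum).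
have Lxinv := L2s_spol (spol_mulx (spol_sharm sharm_inv)).
pose X := scomb (- (1 / 2)) alpha (1 / 2) (mulx beta).
pose Y := scomb (1 / 2) (mulx alpha) (1 / 2) beta.
have LX : L2s X by exact: L2s_comb. have LY : L2s Y by exact: L2s_comb.
have EhE (F : sfun) : spol F -> L2s (Eh F) by move=> pF; apply: L2s_continuous => j; exact: ceuler.
have d_euler j x (F : sfun) : spol F -> differentiable (F j) x by move=> pF; exact: ((C1_pol (pF j)).1 x).
have e1 : Eh spectral_inv = scomb 1 spectral_sum 1 X.
  apply: sfunP => j x; rewrite /Eh spectral_invE spectral_sumE [in LHS]/scomb.
  rewrite (euler_comb 1 1 (d_euler j x _ pa) (d_euler j x _ pxb)) (euler_mulx _ _ pb) mulx_euler// euler_ssum//.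
  exact: e1_pure.
have e2 j x : sphere x -> Eh dual j x = scomb 1 (mulx spectral_sum) 1 Y j x.
  move=> Sx; rewrite /Eh /dual [in LHS]/scomb.
  rewrite (euler_comb 1 (-1) (d_euler j x _ pxa) (d_euler j x _ pb)) (euler_mulx _ _ pa) mulx_euler// euler_ssum//.
  rewrite spectral_sumE /scomb mulx_comb mulxx (sphere_coords x).1// -/alpha -/beta -/alpha' -/beta' /Y /scomb.
  by field.
apply: (etrans (congr2 +%R (flux_rin (spol_sharm sharm_inv)) (flux_rin (spol_sharm sharm_dual)))).
rewrite e1.
have -> : rin dual (Eh dual) = rin dual (scomb 1 (mulx spectral_sum) 1 Y).
  by apply: eq_rin => //; [exact: EhE (spol_sharm sharm_dual)|exact: L2s_comb].
rewrite (rin_combr 1 1 Lsum LX Linv) (rin_combr 1 1 Lxsum LY Ldual).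
have -> : rin dual (mulx spectral_sum) = rin spectral_inv spectral_sum.
  rewrite -(rin_mulx (spol_sharm sharm_inv) psum).
  by apply: eq_rin => // j x Sx; exact: dualE.
have -> : rin spectral_inv X = 1 / 2 * (rin beta beta - rin alpha alpha).
  rewrite spectral_invE /X (rin_combl 1 1 La Lxb LX) (rin_combr _ _ La Lxb La) (rin_combr _ _ La Lxb Lxb).
  by rewrite (rin_mulx pb pb) (rinC (mulx beta)) cross_pure1.
have -> : rin dual Y = 1 / 2 * (rin alpha alpha - rin beta beta).
  rewrite /dual /Y (rin_combl 1 (-1) Lxa Lb LY) (rin_combr _ _ Lxa Lb Lxa) (rin_combr _ _ Lxa Lb Lb).
  by rewrite (rin_mulx pa pa) (rinC beta (mulx alpha)) cross_pure2.
exact: cross_pure3.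
Qed.

Let K (w : E -> R) := Num.sqrt (sint (fun x => w x ^+ 2) / pi).

(** Cauchy-Schwarz against [f^2], then [trace_sphere]; the square root is taken using that the flux
    is nonnegative. *)
Let weight_flux (w f : E -> R) : L2 w -> harmonic_pol f -> sint (fun x => w x * f x ^+ 2) <= K w * flux f.
Proof.
move=> Lw hf; have [q0 q4] := flux_trace hf; have cf := cpol hf.1.
have Lf2 : L2 (fun x => f x ^+ 2) by apply: L2_continuous; exact: continuous_exp.
have cs := sint_CS Lw Lf2.
have e4 : sint (fun x => (f x ^+ 2) ^+ 2) = sint (fun x => f x ^+ 4).
  by congr sint; apply/funext => x; rewrite -exprM.
have K0 : 0 <= K w by exact: sqrtr_ge0.
have w0 : 0 <= sint (fun x => w x ^+ 2) / pi by rewrite divr_ge0 ?sint_sqr_ge0 ?pi_ge0.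
have : sint (fun x => w x * f x ^+ 2) ^+ 2 <= (K w * flux f) ^+ 2.
  apply: (le_trans cs); rewrite e4 exprMn /K sqr_sqrtr// mulrAC -mulrA.
  by apply: ler_wpM2l => //; exact: sint_sqr_ge0.
by move=> /ler_sqrt_abs; rewrite (ger0_norm (mulr_ge0 K0 q0)); exact: le_trans (ler_norm _).
Qed.

Let L2_pol (f : E -> R) : pol f -> L2 f.
Proof. by move=> pf; apply: L2_continuous; exact: cpol. Qed.

Let weight_sum (w : E -> R) (F : sfun) : L2 w -> sharm F ->
  sint (fun x => w x * \sum_j F j x * F j x) <= K w * \sum_j flux (F j).
Proof.
move=> Lw sF; have Lj j : sintegrable (fun x => w x * F j x ^+ 2).
  by apply: L2M => //; apply: L2_continuous; apply: continuous_exp; exact: cpol (sF j).1.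
have -> : sint (fun x => w x * \sum_j F j x * F j x) = \sum_j sint (fun x => w x * F j x ^+ 2).
  rewrite sum4E -!sintD//; do ?[apply: sintegrableD]; rewrite //.
  by congr sint; apply/funext => x; rewrite sum4E -!expr2 !mulrDr.
by rewrite mulr_sumr; apply: ler_sum => j _; exact: weight_flux.
Qed.

(** [theta] and [dual] have the same pointwise norm on the sphere, so adding their two bounds
    doubles the left side, and [flux_sum] the right one. *)
Let weight_inv (w : E -> R) : L2 w ->
  sint (fun x => w x * \sum_j spectral_inv j x * spectral_inv j x) <= K w * rin spectral_inv spectral_sum.
Proof.
move=> Lw; have h1 := weight_sum Lw sharm_inv; have h2 := weight_sum Lw sharm_dual.
have pI := spol_sharm sharm_inv; have pD := spol_sharm sharm_dual.
have mw : measurable_fun [set: E] w by have [] := Lw.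
have ms F : spol F -> measurable_fun [set: E] (fun x => w x * \sum_j F j x * F j x).
  move=> pF; apply: measurable_funM => //; apply: sintegrable_measurable.
  by apply: L2s_dot; exact: L2s_spol.
have e : sint (fun x => w x * \sum_j dual j x * dual j x) =
    sint (fun x => w x * \sum_j spectral_inv j x * spectral_inv j x).
  apply: eq_sint => [x Sx||]; [congr (_ * _)|exact: ms|exact: ms].
  transitivity (\sum_j mulx spectral_inv j x * mulx spectral_inv j x).
    by apply: eq_bigr => j _; rewrite dualE.
  by rewrite mulx_isometry (sphere_coords x).1// mul1r.
by have := lerD h1 h2; rewrite e -mulrDr flux_sum; exact: half_le.
Qed.

(** Let [T] be the pairing of [theta] with [eta], and [V] the integral of [|eta|^2 / w]. Weighted
    Cauchy-Schwarz bounds [T^2] by [V] times the integral of [w |theta|^2], which is itself at most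
    [K T]; hence [T <= K V]. The lower bound [d] keeps [1 / w] bounded. *)
Lemma spectral_weight psi phi (w : E -> R) (d : R) : sqrt_abs_dirac psi phi -> L2 w -> 0 < d ->
  (forall x, d <= w x) ->
  rin (cmps psi) spectral_sum ^+ 2 <= rin (cmps phi) (cmps phi) * K w *
    sint (fun x => (\sum_j spectral_sum j x * spectral_sum j x) / w x).
Proof.
move=> sq Lw d0 dw; have Linv := L2s_spol (spol_sharm sharm_inv).
have psum : spol spectral_sum.
  rewrite spectral_sumE => j; apply: pol_comb; first exact: (spol_ssum mA).
  by apply: spol_mulx; exact: (spol_ssum mB).
have w0 x : 0 < w x by exact: lt_le_trans (dw x).
have mw : measurable_fun [set: E] w by have [] := Lw.
have msw : measurable_fun [set: E] (fun x => Num.sqrt (w x)).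
  by apply: (measurableT_comp _ mw); apply: continuous_measurable_fun; exact: sqrt_continuous.
have misw : measurable_fun [set: E] (fun x => (Num.sqrt (w x))^-1).
  by apply: measurable_invr => // x; rewrite sqrtr_gt0.
have LF : L2s (fun j x => Num.sqrt (w x) * spectral_inv j x).
  move=> j; split.
    by apply: measurable_funM => //; have [] := Linv j.
  rewrite (_ : (fun x => _) = (fun x => w x * spectral_inv j x ^+ 2)).
    by apply: L2M => //; apply: L2_continuous; apply: continuous_exp; exact: cpol (sharm_inv j).1.
  by apply/funext => x; rewrite exprMn sqr_sqrtr// ltW.
have LG : L2s (fun j x => (Num.sqrt (w x))^-1 * spectral_sum j x).
  move=> j; apply: (@L2_bounded_mul _ _ _ (Num.sqrt d)^-1) => //; last exact: L2_pol.
  move=> x _; rewrite ger0_norm ?invr_ge0 ?sqrtr_ge0// lef_pV2 ?posrE ?sqrtr_gt0//.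
  by rewrite ler_sqrt// ltW.
have := rin_CS LF LG.
have s0 x : Num.sqrt (w x) != 0 by rewrite gt_eqF// sqrtr_gt0.
have -> : rin (fun j x => Num.sqrt (w x) * spectral_inv j x)
    (fun j x => (Num.sqrt (w x))^-1 * spectral_sum j x) = rin spectral_inv spectral_sum.
  congr sint; apply/funext => x; apply: eq_bigr => j _; rewrite mulrACA divff ?mul1r//.
have -> : rin (fun j x => Num.sqrt (w x) * spectral_inv j x) (fun j x => Num.sqrt (w x) * spectral_inv j x) =
    sint (fun x => w x * \sum_j spectral_inv j x * spectral_inv j x).
  congr sint; apply/funext => x; rewrite mulr_sumr; apply: eq_bigr => j _.
  by rewrite mulrACA -expr2 sqr_sqrtr// ltW.
have -> : rin (fun j x => (Num.sqrt (w x))^-1 * spectral_sum j x)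
    (fun j x => (Num.sqrt (w x))^-1 * spectral_sum j x) =
    sint (fun x => (\sum_j spectral_sum j x * spectral_sum j x) / w x).
  congr sint; apply/funext => x; rewrite mulr_suml; apply: eq_bigr => j _.
  by rewrite mulrACA -invfM -expr2 sqr_sqrtr ?ltW// mulrC.
have V0 : 0 <= sint (fun x => (\sum_j spectral_sum j x * spectral_sum j x) / w x).
  apply: sint_ge0 => x; rewrite divr_ge0 ?(ltW (w0 x))//.
  by apply: sumr_ge0 => j _; rewrite -expr2 sqr_ge0.
move: V0; set V := sint _ => V0 cs.
have T0 : 0 <= rin spectral_inv spectral_sum.
  rewrite -(pmulr_rge0 _ (ltr0Sn _ 1)) -flux_sum addr_ge0//; apply: sumr_ge0 => j _.
    by have [] := flux_trace (sharm_inv j).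
  by have [] := flux_trace (sharm_dual j).
have K0 : 0 <= K w by exact: sqrtr_ge0.
have TV : rin spectral_inv spectral_sum <= K w * V.
  move: cs (weight_inv Lw) T0 V0 K0.
  move: (sint _) (rin _ _) (V) (K w) => W T v k cs wW T0 v0 k0.
  have [->|Tn0] := eqVneq T 0; first exact: mulr_ge0.
  have Tp : 0 < T by rewrite lt_neqAle eq_sym Tn0.
  rewrite -(ler_pM2l Tp) -expr2; apply: (le_trans cs).
  by rewrite mulrA (mulrC T); exact: ler_wpM2r.
apply: (le_trans (spectral_CS sq)); rewrite -mulrA; apply: ler_wpM2l TV; exact: rin_ge0.
Qed.

End spectral_bound.

Section weighted_polynomials.
Context {R : realType}.
Local Notation E := 'rV[R]_3.
Local Notation spinor := 'cV[R[i]]_2.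
Local Notation sfun := ('I_4 -> E -> R).

Lemma weighted_pol (psi phi : E -> spinor) (w : E -> R) (d : R) (G : sfun) : sqrt_abs_dirac psi phi ->
  L2 w -> 0 < d -> (forall x, d <= w x) -> spol G ->
  rin (cmps psi) G ^+ 2 <= rin (cmps phi) (cmps phi) * Num.sqrt (sint (fun x => w x ^+ 2) / pi) *
    sint (fun x => (\sum_j G j x * G j x) / w x).
Proof.
move=> sq Lw d0 dw pG; have [N [A [B [mA mB GE]]]] := fischer_pol pG.
have [Lp Lq] := calculus_L2s sq; have [mw _] := Lw.
have LG : L2s G by move=> j; apply: L2_continuous; exact: C1_continuous (C1_pol (pG j)).
have LS : L2s (spectral_sum N A B) by apply: L2s_wsum.
have SG x j : sphere x -> spectral_sum N A B j x = G j x.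
  move=> Sx; rewrite GE// /spectral_sum /wsum /ssum; apply: eq_bigr => i _.
  by rewrite /scomb !mul1r.
have w0 x : 0 < w x by exact: lt_le_trans (dw x).
have miw := measurable_invr mw w0.
have mf F : L2s F -> measurable_fun [set: E] (fun x => (\sum_j F j x * F j x) / w x).
  by move=> LF; apply: measurable_funM => //; apply: sintegrable_measurable; exact: L2s_dot.
have := spectral_weight N mA mB sq Lw d0 dw.
rewrite (eq_rin (F' := cmps psi) (G' := G) _ _ Lp Lp LS LG)//; last by move=> j x; exact: SG.
have -> // : sint (fun x => (\sum_j spectral_sum N A B j x * spectral_sum N A B j x) / w x) =
    sint (fun x => (\sum_j G j x * G j x) / w x).
apply: eq_sint => [x Sx||]; [|exact: mf|exact: mf].
by congr (_ / _); apply: eq_bigr => j _; rewrite SG.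
Qed.

End weighted_polynomials.

(** * Density of polynomials *)

Section power_step.
Context {R : realType}.

Lemma bernoulli_ge (u : R) m : 0 <= u -> 1 + m%:R * u <= (1 + u) ^+ m.
Proof.
move=> u0; elim: m => [|m ih]; first by rewrite mul0r addr0 expr0.
rewrite exprS; apply: (@le_trans _ _ ((1 + u) * (1 + m%:R * u))); last by rewrite ler_wpM2l// addr_ge0.
have m0 : 0 <= m%:R * u ^+ 2 by rewrite mulr_ge0// sqr_ge0.
by rewrite -[m.+1]addn1 natrD; lra.
Qed.

Lemma bernoulli_le (u : R) m : 0 <= u <= 1 -> 1 - m%:R * u <= (1 - u) ^+ m.
Proof.
move=> /andP[u0 u1]; elim: m => [|m ih]; first by rewrite mul0r subr0 expr0.
have v0 : 0 <= 1 - u by lra.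
rewrite exprS; have [neg|pos] := ltP (1 - m%:R * u) 0.
  apply: (@le_trans _ _ 0); last by rewrite mulr_ge0// exprn_ge0.
  by rewrite -[m.+1]addn1 natrD mulrDl mul1r; lra.
apply: (@le_trans _ _ ((1 - u) * (1 - m%:R * u))); last by rewrite ler_wpM2l.
have m0 : 0 <= m%:R * u ^+ 2 by rewrite mulr_ge0// sqr_ge0.
by rewrite -[m.+1]addn1 natrD; lra.
Qed.

Lemma expr_compl_le (u : R) m : 0 <= u <= 1 -> (1 - u) ^+ m <= (1 + m%:R * u)^-1.
Proof.
move=> /andP[u0 u1]; have p : 0 < 1 + m%:R * u by rewrite ltr_wpDr// mulr_ge0.
rewrite -[leRHS]mul1r ler_pdivlMr//.
apply: (@le_trans _ _ ((1 - u) ^+ m * (1 + u) ^+ m)).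
  by rewrite ler_wpM2l ?bernoulli_ge// exprn_ge0//; lra.
by rewrite -exprMn exprn_ile1//; nra.
Qed.

Lemma cvg_natM_expr (r : R) : 0 < r < 1 -> n%:R * r ^+ n @[n --> \oo] --> (0 : R).
Proof.
move=> /andP[r0 r1]; pose q := Num.sqrt r.
have q0 : 0 < q by rewrite sqrtr_gt0.
have q2 : q ^+ 2 = r by rewrite sqr_sqrtr// ltW.
have q1 : q < 1 by rewrite -sqrtr1 ltr_sqrt.
have iq : 0 < q^-1 - 1 by rewrite subr_gt0 invf_gt1.
have bd n : n%:R * q ^+ n <= (q^-1 - 1)^-1.
  have e1 : 1 + (q^-1 - 1) = q^-1 by rewrite addrC subrK.
  have := bernoulli_ge n (ltW iq); rewrite e1 exprVn => h.
  have qn : 0 < q ^+ n by rewrite exprn_gt0.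
  rewrite -[leRHS]mul1r ler_pdivlMr// mulrAC -ler_pdivlMr// mul1r.
  by apply: le_trans h; rewrite lerDr.
have lim : (q^-1 - 1)^-1 * q ^+ n @[n --> \oo] --> (q^-1 - 1)^-1 * 0.
  by apply: cvgMr; apply: cvg_expr; rewrite ger0_norm ?ltW.
rewrite mulr0 in lim; apply: (squeeze_cvgr _ (cvg_cst (0 : R)) lim).
near=> n; apply/andP; split; first by rewrite mulr_ge0// exprn_ge0// ltW.
by rewrite -q2 -exprM mul2n -addnn exprD mulrA ler_wpM2r// exprn_ge0// ltW.
Unshelve. all: by end_near.
Qed.

(** Polynomials in [t] tending to the indicator of [t < 1/2] on the open unit interval: the outer
    exponent times [t^n] is [n (2 t)^n], which tends to 0 below 1/2; the factor [n] makes it tend to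
    infinity at 1/2 itself too. *)
Definition step (n : nat) (t : R) : R := (1 - t ^+ n) ^+ (n * 2 ^ n).

Lemma step_itv n t : 0 <= t <= 1 -> 0 <= step n t <= 1.
Proof.
move=> /andP[t0 t1]; have h : 0 <= t ^+ n <= 1 by rewrite exprn_ge0// exprn_ile1.
by rewrite exprn_ge0 ?exprn_ile1//; lra.
Qed.

Lemma cvg_step (t : R) : 0 < t < 1 -> step n t @[n --> \oo] --> ((t < 1 / 2)%R%:R : R).
Proof.
move=> /andP[t0 t1].
have t01 : 0 <= t <= 1 by rewrite !ltW.
have tn n : 0 <= t ^+ n <= 1 by rewrite exprn_ge0 ?exprn_ile1// ltW.
have e n : (n * 2 ^ n)%:R * t ^+ n = n%:R * (2 * t) ^+ n by rewrite natrM natrX exprMn mulrA.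
have [lt|ge] := ltP.
  have r01 : 0 < 2 * t < 1 by lra.
  have lim : 1 - n%:R * (2 * t) ^+ n @[n --> \oo] --> 1 - (0 : R).
    by apply: cvgB; [exact: cvg_cst|exact: cvg_natM_expr].
  rewrite subr0 in lim; apply: (squeeze_cvgr _ lim (cvg_cst (1 : R))).
  near=> n; have /andP[_ ->] := step_itv n t01.
  by rewrite andbT -e; exact: bernoulli_le.
apply: (squeeze_cvgr _ (cvg_cst (0 : R)) (@cvg_harmonic R)).
near=> n; have /andP[-> _] := step_itv n t01.
apply: (le_trans (expr_compl_le _ (tn n))); rewrite e /harmonic.
have r1 : 1 <= (2 * t) ^+ n by rewrite exprn_ege1//; lra.
have p1 : 0 < 1 + n%:R :> R by rewrite ltr_wpDr.
have p2 : 1 + n%:R <= 1 + n%:R * (2 * t) ^+ n by rewrite lerD2l ler_peMr.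
rewrite /= -[n.+1]addn1 natrD (addrC n%:R) lef_pV2 ?posrE//; exact: lt_le_trans p2.
Unshelve. all: by end_near.
Qed.

End power_step.

Import HBSimple HBNNSimple.

(** * Bounded functions as L^2 limits of polynomials *)

Section density.
Context {R : realType}.
Local Notation E := 'rV[R]_3.

(* Bounded functions in the L^2 closure of the polynomials. *)
Definition approximable (f : E -> R) : Prop :=
  [/\ measurable_fun [set: E] f, exists M, forall x, sphere x -> `|f x| <= M &
      forall e, 0 < e -> exists2 p, pol p & sint (fun x => (f x - p x) ^+ 2) <= e].

Lemma L2_of_bounded (f : E -> R) : measurable_fun [set: E] f ->
  (exists M, forall x, sphere x -> `|f x| <= M) -> L2 f.
Proof. by move=> mf [M bM]; exact: L2_bounded mf bM. Qed.

Lemma approximable_L2 f : approximable f -> L2 f.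
Proof. by case=> mf bf _; exact: L2_of_bounded. Qed.

Lemma L2_pol (f : E -> R) : pol f -> L2 f.
Proof. by move=> /continuous_pol; exact: L2_continuous. Qed.

Lemma approximable_pol f : pol f -> approximable f.
Proof.
move=> pf; have [mf _] := L2_pol pf; split=> //; first exact: sphere_bounded (continuous_pol pf).
move=> e e0; exists f => //; rewrite (_ : (fun x => _) = fun=> 0); first by rewrite sint_cst mul0r ltW.
by apply/funext => x; rewrite subrr expr0n.
Qed.

Let sqrD_le (a b c d : R) : (a * c + b * d) ^+ 2 <= 2 * a ^+ 2 * c ^+ 2 + 2 * b ^+ 2 * d ^+ 2.
Proof. by have := sqr_ge0 (a * c - b * d); lra. Qed.

Let sint_sqrD_le (a b c d : E -> R) (A B : R) : measurable_fun [set: E] a -> measurable_fun [set: E] b ->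
  (forall x, sphere x -> `|a x| <= A) -> (forall x, sphere x -> `|b x| <= B) -> L2 c -> L2 d ->
  sint (fun x => (a x * c x + b x * d x) ^+ 2) <=
  2 * A ^+ 2 * sint (fun x => c x ^+ 2) + 2 * B ^+ 2 * sint (fun x => d x ^+ 2).
Proof.
move=> ma mb aA bB Lc Ld; have [_ ic] := Lc; have [_ id] := Ld.
rewrite -(sintZ _ ic) -(sintZ _ id) -sintD; [|exact: sintegrableZ|exact: sintegrableZ].
have [_ iL] := L2D (L2_bounded_mul ma aA Lc) (L2_bounded_mul mb bB Ld).
apply: sint_le => //; first by apply: sintegrableD; exact: sintegrableZ.
move=> x Sx; apply: (le_trans (sqrD_le _ _ _ _)).
have sq (u v : R) : `|u| <= v -> u ^+ 2 <= v ^+ 2.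
  by move=> uv; rewrite -(real_normK (num_real u)) ler_sqr ?nnegrE// (le_trans _ uv).
by apply: lerD; apply: ler_wpM2r; rewrite ?sqr_ge0// ler_pM2l//; apply: sq; [exact: aA|exact: bB].
Qed.

Lemma approximable_comb a b f g : approximable f -> approximable g -> approximable (fun x => a * f x + b * g x).
Proof.
move=> cf cg; have Lf := approximable_L2 cf; have Lg := approximable_L2 cg.
have [mf [M fM] af] := cf; have [mg [N gN] ag] := cg; split.
- by apply: measurable_funD; exact: measurable_funM.
- exists (`|a| * M + `|b| * N) => x Sx; apply: (le_trans (ler_normD _ _)).
  by rewrite !normrM; apply: lerD; apply: ler_wpM2l => //; [exact: fM|exact: gN].
move=> e e0.
have pos (c : R) : 0 < 4 * c ^+ 2 + 1 by rewrite ltr_wpDl// mulr_ge0// sqr_ge0.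
have [p pp hp] := af _ (divr_gt0 e0 (pos a)); have [q pq hq] := ag _ (divr_gt0 e0 (pos b)).
exists (fun x => a * p x + b * q x); first exact: pol_comb.
have Lfp := L2B Lf (L2_pol pp); have Lgq := L2B Lg (L2_pol pq).
have := @sint_sqrD_le (fun=> a) (fun=> b) _ _ `|a| `|b| _ _ _ _ Lfp Lgq.
rewrite (_ : (fun x => (a * (f x - p x) + b * (g x - q x)) ^+ 2) =
  (fun x => (a * f x + b * g x - (a * p x + b * q x)) ^+ 2)); last by apply/funext => x; congr (_ ^+ 2); ring.
move=> /(_ _ _ _ _) h; apply: (le_trans (h _ _ _ _)) => //; rewrite !real_normK ?num_real//.
have half (c s : R) : s <= e / (4 * c ^+ 2 + 1) -> 2 * c ^+ 2 * s <= e / 2.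
  move=> hs; apply: (@le_trans _ _ (2 * c ^+ 2 * (e / (4 * c ^+ 2 + 1)))).
    by apply: ler_wpM2l hs; rewrite mulr_ge0// sqr_ge0.
  rewrite mulrA ler_pdivrMr//.
  by have := sqr_ge0 c; nra.
have -> : e = e / 2 + e / 2 by field.
by apply: lerD; exact: half.
Qed.

Lemma approximable_mul f g : approximable f -> approximable g -> approximable (fun x => f x * g x).
Proof.
move=> cf cg; have Lf := approximable_L2 cf; have Lg := approximable_L2 cg.
have [mf [M fM] af] := cf; have [mg [N gN] ag] := cg; split.
- exact: measurable_funM.
- exists (M * N) => x Sx; rewrite normrM; apply: ler_pM => //; [exact: fM|exact: gN].
move=> e e0.
have pos (c : R) : 0 < 4 * c ^+ 2 + 1 by rewrite ltr_wpDl// mulr_ge0// sqr_ge0.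
have half (c s : R) : s <= e / (4 * c ^+ 2 + 1) -> 2 * c ^+ 2 * s <= e / 2.
  move=> hs; apply: (@le_trans _ _ (2 * c ^+ 2 * (e / (4 * c ^+ 2 + 1)))).
    by apply: ler_wpM2l hs; rewrite mulr_ge0// sqr_ge0.
  rewrite mulrA ler_pdivrMr//.
  by have := sqr_ge0 c; nra.
have [p pp hp] := af _ (divr_gt0 e0 (pos N)).
have [P pP] := sphere_bounded (continuous_pol pp).
have [q pq hq] := ag _ (divr_gt0 e0 (pos P)).
exists (fun x => p x * q x); first exact: polM.
have Lfp := L2B Lf (L2_pol pp); have Lgq := L2B Lg (L2_pol pq).
have [mp _] := L2_pol pp.
have := sint_sqrD_le mg mp gN pP Lfp Lgq.
rewrite (_ : (fun x => (g x * (f x - p x) + p x * (g x - q x)) ^+ 2) =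
  (fun x => (f x * g x - p x * q x) ^+ 2)); last by apply/funext => x; congr (_ ^+ 2); ring.
move=> h; apply: (le_trans h).
have -> : e = e / 2 + e / 2 by field.
by apply: lerD; exact: half.
Qed.

Lemma approximable_cst c : approximable (fun=> c).
Proof. exact: approximable_pol (pol_cst c). Qed.

Lemma approximable_exp n f : approximable f -> approximable (fun x => f x ^+ n).
Proof.
move=> cf; elim: n => [|n ih]; first exact: approximable_cst 1.
by rewrite (_ : (fun x => _) = (fun x => f x * f x ^+ n)); [exact: approximable_mul|apply/funext => x; rewrite exprS].
Qed.

(** Bounded pointwise convergence on the sphere implies L^2 convergence; the class is thus stable
    under countable unions of sets and limits of simple functions. *)
Lemma approximable_lim (f_ : nat -> E -> R) (f : E -> R) (M : R) : (forall n, approximable (f_ n)) ->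
  (forall n x, sphere x -> `|f_ n x| <= M) -> measurable_fun [set: E] f ->
  (forall x, sphere x -> f_ n x @[n --> \oo] --> f x) -> approximable f.
Proof.
move=> cf_ bM mf lim.
have bf x : sphere x -> `|f x| <= M.
  move=> Sx; have l : `|f_ n x| @[n --> \oo] --> `|f x| by apply: cvg_norm; exact: lim.
  by apply: (ler_cvg_to l (@cvg_cst _ M _ _ _)); apply: nearW => n; exact: bM.
split=> //; first by exists M.
have mf_ n : measurable_fun [set: E] (f_ n) by case: (cf_ n).
have d0 : sint (fun x => (f_ n x - f x) ^+ 2) @[n --> \oo] --> sint (fun=> 0).
  apply: (sphere_dominated (g := fun=> (M + M) ^+ 2)) => //.
  - by move=> n; apply: measurable_funX; exact: measurable_funB.
  - exact: sintegrable_cst.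
  - move=> n x Sx; rewrite normrX ler_sqr ?nnegrE//; last first.
      by rewrite addr_ge0// (le_trans _ (bf x Sx)).
    by apply: (le_trans (ler_normB _ _)); apply: lerD; [exact: bM|exact: bf].
  - apply: aeW => x Sx; rewrite -[X in _ --> X](expr0n R 2) /= -(subrr (f x)).
    have l : f_ n x - f x @[n --> \oo] --> f x - f x by apply: cvgB; [exact: lim|exact: cvg_cst].
    by rewrite expr2; apply: (cvg_eq_seq _ (cvgM l l)) => n; rewrite expr2.
rewrite sint_cst mul0r in d0.
move=> e e0; have e4 : 0 < e / 4 by rewrite divr_gt0.
have [n hn] : exists n, sint (fun x => (f_ n x - f x) ^+ 2) < e / 4.
  have nb : \forall n \near \oo, `|sint (fun x => (f_ n x - f x) ^+ 2) - 0| < e / 4.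
    exact: (cvgr_distC_lt _ _ d0 _ e4).
  have [n] := filter_ex nb; by rewrite subr0 ger0_norm ?sint_sqr_ge0// => ?; exists n.
have [_ _ /(_ _ e4) [p pp hp]] := cf_ n.
exists p => //.
have Lf : L2 f by apply: L2_of_bounded => //; exists M.
have L1 := L2B Lf (approximable_L2 (cf_ n)); have L2' := L2B (approximable_L2 (cf_ n)) (L2_pol pp).
have := @sint_sqrD_le (fun=> 1) (fun=> 1) _ _ 1 1 _ _ _ _ L1 L2'.
rewrite (_ : (fun x => (1 * (f x - f_ n x) + 1 * (f_ n x - p x)) ^+ 2) = (fun x => (f x - p x) ^+ 2)); last first.
  by apply/funext => x; congr (_ ^+ 2); ring.
rewrite (_ : (fun x => (f x - f_ n x) ^+ 2) = (fun x => (f_ n x - f x) ^+ 2)); last first.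
  by apply/funext => x; rewrite -sqrrN opprB.
move=> h; apply: (le_trans (h _ _ _ _)) => //; try by move=> x _; rewrite normr1.
rewrite !expr1n !mulr1; have -> : e = 2 * (e / 4) + 2 * (e / 4) by field.
by apply: lerD; rewrite ler_pM2l// ltW.
Qed.

Lemma preimage_halfspace (k : 'I_3) (a : R) :
  (fun x : E => x 0 k) @^-1` `]-oo, a[%classic = [set x | x 0 k < a].
Proof. by apply/seteqP; split=> x; rewrite /= in_itv. Qed.

Lemma measurable_halfspace (k : 'I_3) (a : R) : measurable [set x : E | x 0 k < a].
Proof.
rewrite -preimage_halfspace -[X in measurable X]setTI; exact: measurable_coord.
Qed.

Lemma approximable_halfspace (k : 'I_3) (a : R) : approximable \1_[set x : E | x 0 k < a].
Proof.
(* Scaled so that [t] stays within 1/4 of 1/2 on the sphere, hence in the range where [cvg_step]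
   applies. *)
pose c := (4 * (1 + `|a|))^-1.
have a1 : 0 < 1 + `|a| by rewrite ltr_wpDr.
have c0 : 0 < c by rewrite invr_gt0 mulr_gt0.
pose t (x : E) := c * x 0 k + (1 / 2 - c * a).
have ct : approximable t.
  rewrite (_ : t = (fun x => c * x 0 k + 1 * (1 / 2 - c * a))); last by apply/funext => x; rewrite mul1r.
  by apply: approximable_comb; [exact: approximable_pol (pol_coord k)|exact: approximable_cst].
have tx x : sphere x -> 0 < t x < 1.
  move=> /sphere_coords Sx.
  have xk : `|x 0 k| <= 1.
    rewrite -(@ler_sqr _ `|x 0 k| 1) ?nnegrE// real_normK ?num_real// expr1n -Sx.
    have := sqr_ge0 (x 0 0); have := sqr_ge0 (x 0 1); have := sqr_ge0 (x 0 2).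
    by move: k {t ct}; apply: ord3P; lra.
  have : `|c * (x 0 k - a)| <= 1 / 4.
    rewrite normrM gtr0_norm//; apply: (@le_trans _ _ (c * (1 + `|a|))).
      by apply: ler_wpM2l; [exact: ltW|apply: (le_trans (ler_normB _ _)); exact: lerD].
    by rewrite /c invfM -mulrA mulVf ?gt_eqF// mulr1 mul1r.
  have -> : t x = 1 / 2 + c * (x 0 k - a) by rewrite /t; ring.
  by rewrite ler_norml => /andP[]; lra.
apply: (@approximable_lim (fun n x => step n (t x)) _ 1).
- move=> n; apply: approximable_exp.
  rewrite (_ : (fun x => _) = (fun x => 1 * 1 + -1 * t x ^+ n)); last first.
    by apply/funext => x; rewrite mulr1 mulN1r.
  by apply: approximable_comb; [exact: approximable_cst|exact: approximable_exp].
- move=> n x /tx /andP[t0 t1]; have t01 : 0 <= t x <= 1 by rewrite !ltW.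
  by have /andP[s0 s1] := step_itv n t01; rewrite ger0_norm.
- by apply: measurable_indic; exact: measurable_halfspace.
move=> x /tx h; rewrite indicE (_ : (x \in _) = (t x < 1 / 2)%R); first exact: cvg_step.
have -> : t x = 1 / 2 + c * (x 0 k - a) by rewrite /t; ring.
rewrite gtrDl pmulr_rlt0// subr_lt0.
by apply/idP/idP => [/set_mem//|?]; exact: mem_set.
Qed.

Lemma approximable_setC (A : set E) : measurable A -> approximable \1_A -> approximable \1_(~` A).
Proof.
move=> mA cA; rewrite (_ : \1_(~` A) = (fun x => 1 * 1 + -1 * \1_A x)).
  by apply: approximable_comb => //; exact: approximable_cst.
by apply/funext => x; rewrite !indicE in_setC; case: (x \in A) => /=; ring.
Qed.

Lemma approximable_setU (A B : set E) : approximable \1_A -> approximable \1_B -> approximable \1_(A `|` B).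
Proof.
move=> cA cB; have cAB := approximable_mul cA cB.
rewrite (_ : \1_(A `|` B) = (fun x => 1 * (1 * \1_A x + 1 * \1_B x) + -1 * (\1_A x * \1_B x))).
  by apply: approximable_comb => //; exact: approximable_comb.
apply/funext => x; rewrite !indicE in_setU.
by case: (x \in A); case: (x \in B) => /=; ring.
Qed.

Lemma indic_le1 (A : set E) x : `|\1_A x| <= 1 :> R.
Proof. by rewrite indicE; case: (x \in A); rewrite ?normr1 ?normr0. Qed.

Lemma approximable_bigcup (F : nat -> set E) : (forall n, measurable (F n)) -> (forall n, approximable \1_(F n)) ->
  approximable \1_(\bigcup_n F n).
Proof.
move=> mF cF; pose G n := \big[setU/set0]_(i < n) F i.
apply: (@approximable_lim (fun n => \1_(G n)) _ 1).
- move=> n; rewrite /G; elim: n => [|n ih]; last by rewrite big_ord_recr /=; exact: approximable_setU.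
  rewrite big_ord0 (_ : \1_set0 = fun=> 0); first exact: approximable_cst.
  by apply/funext => x; rewrite indicE in_set0.
- by move=> n x _; exact: indic_le1.
- by apply: measurable_indic; exact: bigcup_measurable.
move=> x _; have [[i _ Fi]|nF] := pselect ((\bigcup_n F n) x).
  apply: cvg_near_cst; near=> n; rewrite !indicE !mem_set//; first by exists i.
  rewrite /G -bigcup_mkord; exists i => //=; near: n; exact: nbhs_infty_gt.
apply: cvg_near_cst; near=> n; rewrite !indicE !memNset//.
by rewrite /G -bigcup_mkord => -[j _ Fj]; apply: nF; exists j.
Unshelve. all: by end_near.
Qed.

(** The measurable sets with approximable indicator form a sigma-algebra, since sums and products of
    approximable functions are approximable; it contains the half-spaces [x_k < a], which
    generate. *)
Lemma approximable_measurable (A : set E) : measurable A -> approximable \1_A.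
Proof.
pose D (A : set E) := measurable A /\ approximable \1_A.
have D0 : D set0.
  by split=> //; rewrite (_ : \1_set0 = fun=> 0); [exact: approximable_cst|apply/funext => x; rewrite indicE in_set0].
have half (k : 'I_3) (B : set R) : measurable B -> D ((fun x : E => x 0 k) @^-1` B).
  pose C (B : set R) := measurable B /\ D ((fun x : E => x 0 k) @^-1` B).
  move=> mB; suff [] : C B by [].
  have : (@RGenInftyO.G R).-sigma.-measurable B by rewrite -RGenInftyO.measurableE.
  apply: smallest_sub; last first.
    move=> _ [a ->]; split; first exact: measurable_itv.
    by rewrite preimage_halfspace; split; [exact: measurable_halfspace|exact: approximable_halfspace].
  split.
  - by split=> //; rewrite preimage_set0.
  - move=> S [mS [mpS cS]]; rewrite setTD; split; first exact: measurableC.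
    by rewrite preimage_setC; split; [exact: measurableC|exact: approximable_setC].
  - move=> F CF; split; first by apply: bigcup_measurable => n _; case: (CF n).
    rewrite preimage_bigcup; split; first by apply: bigcup_measurable => n _; case: (CF n) => _ [].
    by apply: approximable_bigcup => n; case: (CF n) => _ [].
move=> mA; suff [] : D A by [].
move: mA; apply: smallest_sub.
  split=> //.
  - by move=> S [mS cS]; rewrite setTD; split; [exact: measurableC|exact: approximable_setC].
  - move=> F DF; split; first by apply: bigcup_measurable => n _; case: (DF n).
    by apply: approximable_bigcup => n; case: (DF n).
move=> S; rewrite -bigcup_seq => -[k _ [B mB <-]].
by rewrite setTI; exact: half.
Qed.

Lemma approximable_bounded (f : E -> R) (M : R) : measurable_fun [set: E] f -> (forall x, 0 <= f x <= M) -> approximable f.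
Proof.
move=> mf fM; have mf' : measurable_fun [set: E] (EFin \o f) by exact/measurable_EFinP.
pose g := nnsfun_approx measurableT mf'.
have f0 x : [set: E] x -> (0 <= (EFin \o f) x)%E by rewrite /= lee_fin; have /andP[] := fM x.
have gf n x : 0 <= g n x <= f x.
  rewrite fun_ge0 /=; have := le_approx n f0 (I : [set: E] x).
  by rewrite /= lee_fin /g nnsfun_approxE.
apply: (@approximable_lim (fun n => g n) _ M) => //.
- move=> n; have : approximable (fun x => \sum_(y <- fset_set (range (g n))) y * \1_(g n @^-1` [set y]) x); last first.
    by congr approximable; apply/funext => x; rewrite [RHS]fimfunE (fsbig_finite _ _ (fimfunP (g n))).
  elim: (enum_fset _) => [|y s ih].
    by rewrite (_ : (fun x => _) = fun=> 0); [exact: approximable_cst|apply/funext => x; rewrite big_nil].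
  rewrite (_ : (fun x => _) = (fun x => y * \1_(g n @^-1` [set y]) x + 1 * \sum_(y <- s) y * \1_(g n @^-1` [set y]) x)).
    by apply: approximable_comb => //; exact: approximable_measurable.
  by apply/funext => x; rewrite big_cons mul1r.
- move=> n x _; have /andP[g0 g1] := gf n x; rewrite ger0_norm//.
  by apply: (le_trans g1); have /andP[] := fM x.
- move=> x _; have h := cvg_nnsfun_approx measurableT mf' f0 (I : [set: E] x).
  exact: (@fine_cvg _ _ _ _ (fun n => (g n x)%:E) (f x) h).
Qed.

End density.

(** * The weighted inequality for general spinors *)

Section weighted_inequality.
Context {R : realType}.
Local Notation E := 'rV[R]_3.
Local Notation spinor := 'cV[R[i]]_2.
Local Notation sfun := ('I_4 -> E -> R).
Local Notation sig := (@sphere_measure R).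

Lemma approximable_bounded_abs (f : E -> R) (M : R) : measurable_fun [set: E] f -> (forall x, `|f x| <= M) -> approximable f.
Proof.
move=> mf fM; have M0 : 0 <= M by exact: le_trans (fM 0).
have c : approximable (fun x => f x + M).
  apply: (@approximable_bounded _ _ (M + M)); first exact: measurable_funD.
  by move=> x; have := fM x; rewrite ler_norml => /andP[]; lra.
rewrite (_ : f = (fun x => 1 * (f x + M) + -1 * M)); first exact: approximable_comb c (approximable_cst M).
by apply/funext => x; ring.
Qed.

Lemma approximable_seq (f : E -> R) : approximable f -> exists2 p : nat -> E -> R, forall n, pol (p n) & L2cvg p f.
Proof.
move=> [_ _ h]; have pos n : 0 < n.+1%:R^-1 :> R by rewrite invr_gt0.
have h' n : exists p, pol p /\ sint (fun x => (f x - p x) ^+ 2) <= n.+1%:R^-1.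
  by have [p] := h _ (pos n); exists p.
have [p hp] := choice h'; exists p; first by move=> n; case: (hp n).
apply: (squeeze_cvgr _ (cvg_cst (0 : R)) (@cvg_harmonic R)).
near=> n; rewrite sint_sqr_ge0 /=; have [_] := hp n.
congr (_ <= _); congr sint; apply/funext => x; by rewrite -sqrrN opprB.
Unshelve. all: by end_near.
Qed.

Lemma rin_cvg_sqr (F_ : nat -> sfun) F : (forall n, L2s (F_ n)) -> L2s F ->
  (forall j, L2cvg (fun n => F_ n j) (F j)) -> rin (F_ n) (F_ n) @[n --> \oo] --> rin F F.
Proof.
move=> LF_ LF h; have w j := L2cvg_sqr (fun n => LF_ n j) (LF j) (h j).
have E2 (G : sfun) : L2s G -> rin G G = sint (fun x => G 0 x ^+ 2) + sint (fun x => G 1 x ^+ 2) +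
    sint (fun x => G 2 x ^+ 2) + sint (fun x => G 3 x ^+ 2).
  by move=> LG; rewrite rin_sint// sum4E; congr (_ + _ + _ + _); congr sint; apply/funext => x; rewrite expr2.
rewrite (E2 _ LF).
by apply: (cvg_eq_seq _ (cvgD (cvgD (cvgD (w 0) (w 1)) (w 2)) (w 3))) => n; rewrite E2.
Qed.

(** Both sides are continuous for L^2 convergence of [G], since [w >= d] bounds [1 / w]; so the
    inequality passes from polynomial to approximable test spinors. *)
Lemma weighted_cl (psi phi : E -> spinor) (w : E -> R) (d : R) (G : sfun) : sqrt_abs_dirac psi phi ->
  L2 w -> 0 < d -> (forall x, d <= w x) -> (forall j, approximable (G j)) ->
  rin (cmps psi) G ^+ 2 <= rin (cmps phi) (cmps phi) * Num.sqrt (sint (fun x => w x ^+ 2) / pi) *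
    sint (fun x => (\sum_j G j x * G j x) / w x).
Proof.
move=> sq Lw d0 dw cG; have [Lp Lq] := calculus_L2s sq; have [mw _] := Lw.
have h j : exists p : nat -> E -> R, (forall n, pol (p n)) /\ L2cvg p (G j).
  by have [p ? ?] := approximable_seq (cG j); exists p.
have [p hp] := choice h.
have LG : L2s G by move=> j; exact: approximable_L2.
pose P n : sfun := fun j => p j n.
have pP n : spol (P n) by move=> j; have [pj _] := hp j; exact: pj.
have LP n : L2s (P n) by move=> j; exact: L2_pol (pP n j).
have w0 x : 0 < w x by exact: lt_le_trans (dw x).
have msw : measurable_fun [set: E] (fun x => Num.sqrt (w x)).
  by apply: (measurableT_comp _ mw); apply: continuous_measurable_fun; exact: sqrt_continuous.
have sw0 x : 0 < Num.sqrt (w x) by rewrite sqrtr_gt0.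
have misw := measurable_invr msw sw0.
have bisw x : sphere x -> `|(Num.sqrt (w x))^-1| <= (Num.sqrt d)^-1.
  move=> _; rewrite ger0_norm ?invr_ge0 ?sqrtr_ge0// lef_pV2 ?posrE ?sqrtr_gt0//.
  by rewrite ler_sqrt// ltW.
pose S (F : sfun) : sfun := fun j x => (Num.sqrt (w x))^-1 * F j x.
have LS F : L2s F -> L2s (S F) by move=> LF j; exact: (L2_bounded_mul misw bisw (LF j)).
have SE F : rin (S F) (S F) = sint (fun x => (\sum_j F j x * F j x) / w x).
  congr sint; apply/funext => x; rewrite mulr_suml; apply: eq_bigr => j _.
  by rewrite mulrACA -invfM -expr2 sqr_sqrtr ?ltW// mulrC.
have cP j : L2cvg (fun n => P n j) (G j) by have [_] := hp j.
have cS j : L2cvg (fun n => S (P n) j) (S G j).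
  have lim : (Num.sqrt d)^-1 ^+ 2 * sint (fun x => (P n j x - G j x) ^+ 2) @[n --> \oo] --> (Num.sqrt d)^-1 ^+ 2 * 0.
    by apply: cvgMr; exact: cP.
  rewrite mulr0 in lim; apply: (squeeze_cvgr _ (cvg_cst (0 : R)) lim).
  near=> n; rewrite sint_sqr_ge0 /=; have [_ i1] := L2B (LP n j) (LG j).
  rewrite -(sintZ _ i1); apply: sint_le; [|exact: sintegrableZ|].
    by have [] := L2B (LS _ (LP n) j) (LS _ LG j).
  move=> x Sx; rewrite /S -mulrBr exprMn ler_wpM2r ?sqr_ge0//.
  by rewrite -(real_normK (num_real (Num.sqrt (w x))^-1)) ler_sqr ?nnegrE ?invr_ge0 ?sqrtr_ge0//; exact: bisw.
have c1 : rin (cmps psi) (P n) @[n --> \oo] --> rin (cmps psi) G.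
  by rewrite (rinC (cmps psi) G); apply: (cvg_eq_seq _ (rin_cvg LP LG Lp cP)) => n; rewrite rinC.
have c2 := rin_cvg_sqr (fun n => LS _ (LP n)) (LS _ LG) cS.
have l1 : rin (cmps psi) (P n) ^+ 2 @[n --> \oo] --> rin (cmps psi) G ^+ 2.
  by rewrite expr2; apply: (cvg_eq_seq _ (cvgM c1 c1)) => n; rewrite expr2.
pose C := rin (cmps phi) (cmps phi) * Num.sqrt (sint (fun x => w x ^+ 2) / pi).
have l2 : C * rin (S (P n)) (S (P n)) @[n --> \oo] --> C * rin (S G) (S G) by exact: cvgMr.
rewrite -SE -/C; apply: (ler_cvg_to l1 l2); apply: nearW => n.
by rewrite SE; exact: (weighted_pol sq Lw d0 dw (pP n)).
Unshelve. all: by end_near.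
Qed.

(* Test the inequality against [w psi] truncated to a set where [w] and [psi] are bounded. *)
Lemma weighted_trunc (psi phi : E -> spinor) (w : E -> R) (d : R) (n : nat) : sqrt_abs_dirac psi phi ->
  L2 w -> 0 < d -> (forall x, d <= w x) ->
  let A := [set x | w x <= n%:R /\ normsq (psi x) <= n%:R] in
  measurable A /\ sint (fun x => \1_A x * (w x * normsq (psi x))) <=
    rin (cmps phi) (cmps phi) * Num.sqrt (sint (fun x => w x ^+ 2) / pi).
Proof.
move=> sq Lw d0 dw A; have [Lp Lq] := calculus_L2s sq; have [mw _] := Lw.
have w0 x : 0 < w x by exact: lt_le_trans (dw x).
have mp j : measurable_fun [set: E] (cmps psi j) by have [] := Lp j.
have mn : measurable_fun [set: E] (fun x => normsq (psi x)).
  by rewrite normsq_sum; exact: measurable_dot4.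
have mle (f : E -> R) : measurable_fun [set: E] f -> measurable [set x | f x <= n%:R].
  move=> mf; rewrite (_ : [set x | _] = [set: E] `&` f @^-1` `]-oo, n%:R]); first by apply: mf => //.
  by apply/seteqP; split=> x /=; rewrite in_itv/=; [move=> ->|case].
have mA : measurable A by apply: measurableI; exact: mle.
split=> //.
pose G : 'I_4 -> E -> R := fun j x => \1_A x * (w x * cmps psi j x).
have cG j : approximable (G j).
  apply: (@approximable_bounded_abs _ (n%:R * (n%:R + 1))).
    by apply: measurable_funM; [exact: measurable_indic|exact: measurable_funM].
  move=> x; rewrite /G indicE; case: (boolP (x \in A)) => [/set_mem[wn pn]|_]; last first.
    by rewrite mul0r normr0 mulr_ge0// addr_ge0.
  rewrite mul1r normrM (gtr0_norm (w0 x)); apply: ler_pM => //; first exact: ltW.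
  have : cmps psi j x ^+ 2 <= n%:R.
    apply: le_trans pn; rewrite normsq_cmp; under eq_bigr do rewrite expr2.
    exact: (sqr_le_sum4 (cmp (psi x))).
  by rewrite ler_norml; have : 0 <= n%:R :> R by []; move: (cmps psi j x) (n%:R) => a b b0 ab; apply/andP; split; nra.
have := weighted_cl sq Lw d0 dw cG.
have e1 : rin (cmps psi) G = sint (fun x => \1_A x * (w x * normsq (psi x))).
  congr sint; apply/funext => x; rewrite normsq_cmp !mulr_sumr; apply: eq_bigr => j _.
  by rewrite /G /cmps expr2; ring.
have e2 : sint (fun x => (\sum_j G j x * G j x) / w x) = sint (fun x => \1_A x * (w x * normsq (psi x))).
  congr sint; apply/funext => x; rewrite normsq_cmp !mulr_sumr mulr_suml; apply: eq_bigr => j _.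
  rewrite /G /cmps; have := w0 x; move: (w x) (cmp (psi x) j) => a b a0.
  rewrite indicE; case: (x \in A) => /=; last by rewrite !mul0r.
  by field; rewrite gt_eqF.
(* For this test spinor the pairing and the weighted norm are one and the same integral [I], so the
   inequality reads [I^2 <= C * I]. *)
rewrite e1 e2.
have I0 : 0 <= sint (fun x => \1_A x * (w x * normsq (psi x))).
  apply: sint_ge0 => x; rewrite mulr_ge0 ?indicE// mulr_ge0 ?(ltW (w0 x))//.
  by rewrite normsq_cmp; apply: sumr_ge0 => j _; exact: sqr_ge0.
have C0 : 0 <= rin (cmps phi) (cmps phi) * Num.sqrt (sint (fun x => w x ^+ 2) / pi).
  by rewrite mulr_ge0 ?rin_ge0 ?sqrtr_ge0.
move: I0 C0; move: (sint (fun x => \1_A x * _)) (_ * Num.sqrt _) => I C I0 C0 h.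
have [->//|In0] := eqVneq I 0.
have Ip : 0 < I by rewrite lt_neqAle eq_sym In0.
by rewrite -(ler_pM2r Ip) -expr2.
Qed.

Lemma weighted_psi (psi phi : E -> spinor) (w : E -> R) (d : R) : sqrt_abs_dirac psi phi ->
  L2 w -> 0 < d -> (forall x, d <= w x) ->
  (\int[sig]_x (w x * normsq (psi x))%:E <=
    (rin (cmps phi) (cmps phi) * Num.sqrt (sint (fun x => w x ^+ 2) / pi))%:E)%E.
Proof.
move=> sq Lw d0 dw; have [Lp Lq] := calculus_L2s sq; have [mw _] := Lw.
have w0 x : 0 < w x by exact: lt_le_trans (dw x).
have n0 x : 0 <= normsq (psi x) by rewrite normsq_cmp; apply: sumr_ge0 => j _; exact: sqr_ge0.
have wn0 x : 0 <= w x * normsq (psi x) by rewrite mulr_ge0// ltW.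
have mn : measurable_fun [set: E] (fun x => normsq (psi x)).
  by rewrite normsq_sum; apply: measurable_dot4 => j; have [] := Lp j.
pose A n := [set x | w x <= n%:R /\ normsq (psi x) <= n%:R].
pose g n x := (\1_(A n) x * (w x * normsq (psi x)))%:E.
have mg n : measurable_fun [set: E] (g n).
  apply/measurable_EFinP; apply: measurable_funM; last exact: measurable_funM.
  by apply: measurable_indic; have [] := weighted_trunc n sq Lw d0 dw.
have g0 n x : [set: E] x -> (0 <= g n x)%E by move=> _; rewrite lee_fin mulr_ge0// indicE.
have gnd x : [set: E] x -> {homo g^~ x : n m / (n <= m)%N >-> (n <= m)%E}.
  move=> _ n m nm; rewrite lee_fin; apply: ler_wpM2r => //; rewrite !indicE.
  case: (boolP (x \in A n)) => // /set_mem[wn pn]; rewrite mem_set//.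
  by split; [apply: (le_trans wn)|apply: (le_trans pn)]; rewrite ler_nat.
have lim := @cvg_monotone_convergence _ _ _ sig setT measurableT g mg g0 gnd.
have e : (fun x => limn (g^~ x)) = (fun x => (w x * normsq (psi x))%:E).
  apply/funext => x; apply/cvg_lim => //; apply: cvg_near_cst.
  near=> n; rewrite /g indicE mem_set ?mul1r//; split; near: n; exact: nbhs_infty_ger.
rewrite e in lim; have [_ bd] := all_and2 (fun n => weighted_trunc n sq Lw d0 dw).
apply: (lee_cvg_to lim (@cvg_cst _ _ _ _ _)); apply: nearW => n.
have ig : sintegrable (fun x => \1_(A n) x * (w x * normsq (psi x))).
  apply: (@sintegrable_bounded _ _ (n%:R * n%:R)); first by apply/measurable_EFinP; exact: mg n.
  move=> x _; rewrite ger0_norm; last by rewrite mulr_ge0// indicE.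
  rewrite indicE; case: (boolP (x \in A n)) => [/set_mem[wn pn]|_]; last by rewrite mul0r mulr_ge0.
  by rewrite mul1r; apply: ler_pM => //; exact: ltW.
rewrite (sintEFin ig) lee_fin; exact: bd.
Unshelve. all: by end_near.
Qed.

(* [weighted_psi] for the weights [e^u + 1/(k+1)], as [k] tends to infinity. *)
Lemma expR_weight_psi (psi phi : E -> spinor) (u : E -> R) : sqrt_abs_dirac psi phi ->
  L2 (fun x => expR (u x)) ->
  (\int[sig]_x (expR (u x) * normsq (psi x))%:E <=
    (rin (cmps phi) (cmps phi) * Num.sqrt (sint (fun x => expR (u x) ^+ 2) / pi))%:E)%E.
Proof.
move=> sq Lu; have [mu iu] := Lu; have [Lp _] := calculus_L2s sq.
pose c (k : nat) : R := k.+1%:R^-1.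
have c0 k : 0 < c k by rewrite invr_gt0.
have n0 x : 0 <= normsq (psi x) by rewrite normsq_cmp; apply: sumr_ge0 => j _; exact: sqr_ge0.
have mn : measurable_fun [set: E] (fun x => normsq (psi x)).
  by rewrite normsq_sum; apply: measurable_dot4 => j; have [] := Lp j.
pose a := sint (fun x => expR (u x) ^+ 2); pose b := sint (fun x => expR (u x)).
have i1 : sintegrable (fun x => expR (u x)).
  have := L2M Lu (L2_cst 1); congr sintegrable; apply/funext => x; exact: mulr1.
have sE k : sint (fun x => (expR (u x) + c k) ^+ 2) = a + (2 * c k) * b + c k ^+ 2 * (4 * pi).
  rewrite /a /b -(sintZ _ i1) -sint_cst -!sintD//; do ?[exact: sintegrableZ|exact: sintegrable_cst].
    by congr sint; apply/funext => x; ring.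
  by apply: sintegrableD => //; exact: sintegrableZ.
have bd k : (\int[sig]_x (expR (u x) * normsq (psi x))%:E <=
    (rin (cmps phi) (cmps phi) * Num.sqrt ((a + (2 * c k) * b + c k ^+ 2 * (4 * pi)) / pi))%:E)%E.
  have Lw : L2 (fun x => expR (u x) + c k) by exact: L2D Lu (L2_cst _).
  have wc x : c k <= expR (u x) + c k by rewrite lerDr expR_ge0.
  have := weighted_psi sq Lw (c0 k) wc; rewrite sE; apply: le_trans.
  apply: ge0_le_integral => //.
  - by move=> x _; rewrite lee_fin mulr_ge0// expR_ge0.
  - by apply/measurable_EFinP; exact: measurable_funM.
  - by apply/measurable_EFinP; apply: measurable_funM => //; exact: measurable_funD.
  - by move=> x _; rewrite lee_fin ler_wpM2r// lerDl ltW.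
have cc : c k @[k --> \oo] --> (0 : R) by exact: cvg_harmonic.
have lim : rin (cmps phi) (cmps phi) * Num.sqrt ((a + (2 * c k) * b + c k ^+ 2 * (4 * pi)) / pi)
    @[k --> \oo] --> rin (cmps phi) (cmps phi) * Num.sqrt ((a + (2 * 0) * b + 0 * 0 * (4 * pi)) / pi).
  apply: cvgMr; apply: continuous_cvg; first exact: sqrt_continuous.
  apply: cvgMl.
  apply: cvgD; last first.
    by apply: cvgMl; apply: (cvg_eq_seq _ (cvgM cc cc)) => k; rewrite expr2.
  by apply: cvgD; [exact: cvg_cst|apply: cvgMl; exact: cvgMr].
rewrite !mulr0 !mul0r !addr0 in lim.
have ge0 : (0 <= \int[sig]_x (expR (u x) * normsq (psi x))%:E)%E.
  by apply: integral_ge0 => x _; rewrite lee_fin mulr_ge0// expR_ge0.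
(* The bound at [k = 0] excludes an infinite integral, after which the limit in [k] can be taken
   among real numbers. *)
move: ge0 bd; case: (\int[sig]_x _)%E => [r| |] // _ bd; last by have := bd 0%N; rewrite leye_eq.
rewrite lee_fin; apply: (ler_cvg_to (@cvg_cst _ r _ _ _) lim); apply: nearW => k.
by rewrite -lee_fin; exact: bd.
Qed.

End weighted_inequality.

(** * The logarithmic inequality *)

Section combination.
Context {R : realType}.

Lemma ln_le_subr1 (x : R) : 0 < x -> ln x <= x - 1.
Proof. move=> x0; have e : 1 + (x - 1) = x by rewrite addrC subrK.
by rewrite -{1}e; apply: le_ln1Dx; lra. Qed.

Let swap_factor (s d q : R) : 0 < q -> s / 2 * (d / q) = s / q * (1 / 2 * d).
Proof. by move=> q0; field; rewrite gt_eqF. Qed.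

(** The hypothesis on [b] gives [ln b <= ln En + (ln a - ln pi) / 2]. The first term is handled by
    [ln x <= x - 1] at [x = En / mu], the origin of [mu ln mu - mu]. The second raises the
    coefficient of [ln a] to [(rho + mu) / 2], and Onofri's inequality applies to the total. The
    remaining constants combine through [ln (4 pi) - ln pi = 2 ln 2]. *)
Lemma log_combination (a b rho mu D En : R) : 0 < a -> 0 < b -> 0 < rho -> 0 < mu ->
  rho + mu <= 4 * pi -> 0 <= D -> a <= 4 * pi * expR (D / (4 * pi)) ->
  b <= En * Num.sqrt (a / pi) ->
  rho / 2 * ln a + mu * ln b <= 1 / 2 * D + En + (rho / 2 * ln (4 * pi) + mu * ln (2 * mu) - mu).
Proof.
move=> a0 b0 r0 m0 rm D0 aD bE; have pi0 := pi_gt0 R.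
have q0 : 0 < Num.sqrt (a / pi) by rewrite sqrtr_gt0 divr_gt0.
have E0 : 0 < En by rewrite -(pmulr_lgt0 _ q0); exact: lt_le_trans bE.
have p4 : 0 < 4 * pi :> R by rewrite mulr_gt0.
have la : ln a <= ln (4 * pi) + D / (4 * pi).
  by rewrite -[leRHS](congr1 (+%R _) (expRK (D / (4 * pi)))) -lnM ?posrE ?expR_gt0// ler_ln ?posrE ?mulr_gt0 ?expR_gt0.
have lsq : 2 * ln (Num.sqrt (a / pi)) = ln a - ln pi.
  rewrite -ln_div ?posrE// -[in RHS](@sqr_sqrtr _ (a / pi)); last by rewrite ltW// divr_gt0.
  by rewrite lnXn// mulr_natl.
have lb : ln b <= ln En + ln (Num.sqrt (a / pi)) by rewrite -lnM ?posrE// ler_ln ?posrE ?mulr_gt0.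
have l4 : ln (4 * pi) = 2 * ln 2 + ln pi :> R.
  rewrite lnM ?posrE//; congr (_ + _).
  by rewrite (_ : 4 = 2 ^+ 2); [rewrite lnXn// mulr_natl|ring].
have lm : ln (2 * mu) = ln 2 + ln mu by rewrite lnM ?posrE.
have lE : mu * (ln En - ln mu) <= En - mu.
  have := ln_le_subr1 (divr_gt0 E0 m0); rewrite ln_div ?posrE// => h.
  have := ler_wpM2l (ltW m0) h; rewrite [leRHS]mulrBr mulr1 mulrCA divff ?mulr1// gt_eqF//.
(* Here [rho + mu <= 4 pi] is used: Onofri's inequality returns [D] with the factor
   [(rho + mu) / (8 pi)], at most 1/2. *)
have la' : (rho + mu) / 2 * ln a <= (rho + mu) / 2 * ln (4 * pi) + 1 / 2 * D.
  have h := ler_wpM2l (ltW (divr_gt0 (addr_gt0 r0 m0) (ltr0Sn R 1))) la.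
  apply: (le_trans h); rewrite mulrDr lerD2l.
  have -> : (rho + mu) / 2 * (D / (4 * pi)) = (rho + mu) / (4 * pi) * (1 / 2 * D).
    exact: swap_factor.
  by rewrite ler_piMl ?mulr_ge0// ler_pdivrMr// mul1r.
have lb' : mu * ln b <= mu * ln En + mu / 2 * (ln a - ln pi).
  have h := ler_wpM2l (ltW m0) lb; apply: (le_trans h).
  by rewrite -lsq mulrDr lerD2l -mulrA [2^-1 * _]mulrA mulVf ?mul1r.
move: la' lb' lE; rewrite lm l4 => la' lb' lE.
move: la' lb' lE; move: (ln a) (ln b) (ln En) (ln mu) (ln 2) (ln pi) => A B e m t p.
by clear -m0; move=> h1 h2 h3; lra.
Qed.

End combination.

Lemma integral_eq0_ae (R : realType) (f : 'rV[R]_3 -> R) :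
  measurable_fun [set: 'rV[R]_3] f -> (forall x, 0 <= f x) ->
  (\int[@sphere_measure R]_x (f x)%:E = 0)%E -> \forall x \ae (@sphere_measure R), f x = 0.
Proof.
move=> mf f0 i0; have mf' : measurable_fun [set: 'rV[R]_3] (EFin \o f) by exact/measurable_EFinP.
have := (@ae_eq_integral_abs _ _ _ (@sphere_measure R) setT measurableT _ mf').1.
rewrite (eq_integral (fun x => (f x)%:E)); last by move=> x _ /=; rewrite ger0_norm.
by move=> /(_ i0); apply: filterS => x /(_ I) [].
Qed.

(** Integrals and logarithms are extended, so that finiteness of the integrals is proved along with
    the inequality. A spinor is nonzero when it is not almost everywhere 0, which makes the second
    integral positive. *)
Theorem theorem6p2 (R : realType) (u : 'rV[R]_3 -> R)
    (psi : 'rV[R]_3 -> 'cV[complex R]_2) (rho mu : R) :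
  H1 u -> mean u = 0 ->
  H12 psi -> ~ (\forall x \ae (@sphere_measure R), psi x = 0) ->
  0 < rho -> 0 < mu -> rho + mu <= 4 * pi ->
  ((rho / 2)%:E * lne (\int[@sphere_measure R]_x (expR (2 * u x))%:E) +
   mu%:E * lne (\int[@sphere_measure R]_x (expR (u x) * normsq (psi x))%:E) <=
   (1 / 2 * dirichlet u + dirac_energy psi +
    (rho / 2 * ln (4 * pi) + mu * ln (2 * mu) - mu))%:E)%E.
Proof.
move=> Hu mean0 Hpsi psi0 r0 m0 rm; have pi0 := pi_gt0 R.
(* [grad] and [dirac_energy] choose some weak gradient and some value of [|D|^(1/2) psi]; the
   estimates hold for every choice. *)
have wg : weak_gradient u (grad u) := xgetPex (fun=> 0) Hu.
have sq : sqrt_abs_dirac psi (xget (fun=> 0) [set phi | sqrt_abs_dirac psi phi]) := xgetPex (fun=> 0) Hpsi.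
rewrite /dirac_energy; move: sq; set phi := xget _ _ => sq.
have [[mu_ _] _ _] := wg.
have u0 : sint u = 0.
  by move: mean0; rewrite /mean => /eqP; rewrite mulf_eq0 invr_eq0 gt_eqF ?mulr_gt0//= => /eqP.
have := onofri_H1 wg; rewrite u0 mulr0 add0r -/(dirichlet u) => on.
have e2 x : expR (2 * u x) = expR (u x) ^+ 2 by rewrite -expRM_natl.
have mexp : measurable_fun setT (fun x => expR (u x)).
  by apply: (@measurableT_comp _ _ _ _ _ _ expR).
have i2 : sintegrable (fun x => expR (u x) ^+ 2).
  apply: integral_lt_pinfty; [exact: measurable_funX|by move=> x; exact: sqr_ge0|].
  under eq_integral do rewrite -e2; exact: le_lt_trans on (ltry _).
have Lexp : L2 (fun x => expR (u x)) by [].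
have eA : (\int[@sphere_measure R]_x (expR (2 * u x))%:E)%E = (sint (fun x => expR (u x) ^+ 2))%:E.
  by under eq_integral do rewrite e2; exact: sintEFin.
move: on; rewrite eA lee_fin -[sint (fun x => dot _ _)]/(dirichlet u) => on.
have a0 : 0 < sint (fun x => expR (u x) ^+ 2).
  (* Were this integral 0, [e^(2u)] would vanish almost everywhere. As it vanishes nowhere, every
     statement would then hold almost everywhere, in particular [psi = 0], against the
     hypothesis. *)
  rewrite lt_neqAle sint_sqr_ge0 andbT; apply/eqP => a0; apply: psi0.
  have := @integral_eq0_ae R (fun x => expR (u x) ^+ 2) _ _ _.
  rewrite (sintEFin i2) -a0 => h; apply: filterS (h _ _ _) => //.
  - by move=> x /eqP; rewrite expf_eq0 /= gt_eqF ?expR_gt0.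
  - exact: measurable_funX.
have [Lp Lq] := calculus_L2s sq.
have n0 x : 0 <= normsq (psi x) by rewrite normsq_cmp; apply: sumr_ge0 => j _; exact: sqr_ge0.
have mn : measurable_fun [set: 'rV[R]_3] (fun x => normsq (psi x)).
  by rewrite normsq_sum; apply: measurable_dot4 => j; have [] := Lp j.
have mf : measurable_fun [set: 'rV[R]_3] (fun x => expR (u x) * normsq (psi x)) by exact: measurable_funM.
have f0 x : 0 <= expR (u x) * normsq (psi x) by rewrite mulr_ge0// expR_ge0.
have := expR_weight_psi sq Lexp.
have : (0 <= \int[@sphere_measure R]_x (expR (u x) * normsq (psi x))%:E)%E.
  by apply: integral_ge0 => x _; rewrite lee_fin.
have : (\int[@sphere_measure R]_x (expR (u x) * normsq (psi x))%:E)%E <> 0%E.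
  move=> /(integral_eq0_ae mf f0) h; apply: psi0; apply: filterS h => x.
  move=> /eqP; rewrite mulf_eq0 gt_eqF ?expR_gt0//= normsq_cmp => /eqP s0.
  apply: cmp_inj => j; rewrite cmp_zero; apply/eqP; rewrite -sqrf_eq0; apply/eqP.
  apply: le_anti; rewrite sqr_ge0 andbT -s0 [leRHS](eq_bigr (fun i => cmp (psi x) i * cmp (psi x) i)).
    exact: (sqr_le_sum4 (cmp (psi x))).
  by move=> i _; rewrite expr2.
case: (\int[@sphere_measure R]_x (expR (u x) * normsq (psi x))%:E)%E => [b| |] //.
rewrite !lee_fin -sint_normsq => b0 b0' bE.
have bp : 0 < b by rewrite lt_neqAle b0' andbT; apply/eqP => b00; apply: b0; rewrite -b00.
rewrite !lne_EFin// -!EFinM -EFinD lee_fin.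
apply: log_combination => //; apply: sint_ge0 => x.
by apply: sumr_ge0 => k _; rewrite -expr2 sqr_ge0.
Qed.
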